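(* As $N\to\infty$, $$\frac{1}{N}\sum_{n=1}^N L(1/2,\chi^{4n-3})=\frac{2\pi}{\sqrt{7}}+O\left(\frac{\log N}{\sqrt{N}}\right).$$
   Context: Let $\eta=\frac{1+\sqrt{-7}}{2}$ with $\sqrt{-7}=i\sqrt 7$; the ring of integers of $\mathbb{Q}(\sqrt{-7})$ is $\{a+b\eta: a,b\in\mathbb{Z}\}$, and $N(a+b\eta)=a^2+ab+2b^2$. For integers $a,b$ set $\epsilon_{a,b}=\left(\frac{a^3-2a^2b-ab^2+b^3}{7}\right)$ (Legendre symbol, equal to $0$ when $7$ divides the numerator). The Hecke Grössencharacter $\chi$ is defined on ideals by $\chi((a+b\eta))=\epsilon_{a,b}(a+b\eta)$ (so it is $0$ if $a+b\eta$ is not coprime to $\sqrt{-7}$). For each integer $n\ge 1$, $L(s,\chi^{4n-3})$ is the $L$-function (normalized so that its central point is $s=1/2$) defined for $\Re s>1$ by the absolutely convergent series $$L(s,\chi^{4n-3})=\frac12\sum_{(a,b)\in\mathbb{Z}^2\setminus\{(0,0)\}}\frac{\epsilon_{a,b}\,(a+b\eta)^{4n-3}}{(a^2+ab+2b^2)^{s+2n-3/2}},$$ and elsewhere by analytic continuation; it is entire, and $\left(\frac{7}{2\pi}\right)^s\Gamma(s+2n-3/2)L(s,\chi^{4n-3})$ is invariant under $s\mapsto 1-s$. *)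

(* Defs.v *)
From Stdlib Require Import Reals ZArith List.
From Coquelicot Require Import Coquelicot.

Open Scope R_scope.

(** Legendre symbol [(a / p)], for an odd prime [p]. *)
Definition legendre (a p : Z) : Z :=
  if (a mod p =? 0)%Z then 0%Z
  else if existsb (fun x : nat => ((Z.of_nat x ^ 2 - a) mod p =? 0)%Z)
                  (seq 0 (Z.to_nat p))
  then 1%Z else (-1)%Z.

Definition eps (a b : Z) : Z :=
  legendre (a ^ 3 - 2 * a ^ 2 * b - a * b ^ 2 + b ^ 3) 7.

Definition eta : C := (1 / 2, sqrt 7 / 2).

Definition elt (a b : Z) : C := (RtoC (IZR a) + RtoC (IZR b) * eta)%C.

Definition normZ (a b : Z) : Z := (a ^ 2 + a * b + 2 * b ^ 2)%Z.

(** [t ^ s = exp (s * ln t)], for a real [t > 0] and a complex [s]. *)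
Definition Rcpow (t : R) (s : C) : C :=
  (exp (Re s * ln t) * cos (Im s * ln t),
   exp (Re s * ln t) * sin (Im s * ln t)).

Definition list_sum {A : Type} (f : A -> C) (l : list A) : C :=
  fold_right Cplus (RtoC 0) (map f l).

(** Unordered summation of [f] over [{x | P x}], as the limit along the directed
    family of finite subsets. For complex values the existence of this sum is
    equivalent to absolute convergence. *)
Definition has_sum {A : Type} (P : A -> Prop) (f : A -> C) (S : C) : Prop :=
  forall e : R, 0 < e ->
    exists F0 : list A, List.Forall P F0 /\
      forall F : list A, NoDup F -> List.Forall P F -> incl F0 F ->
        Cmod (list_sum f F - S)%C < e.

(** Here [4 * n - 3] is a natural number subtraction; it is used for [n >= 1]. *)
Definition hecke_term (n : nat) (s : C) (ab : Z * Z) : C :=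
  let (a, b) := ab in
  (RtoC (IZR (eps a b)) * Cpow (elt a b) (4 * n - 3)
   / Rcpow (IZR (normZ a b)) (s + RtoC (2 * INR n - 3 / 2)))%C.

Definition entire (f : C -> C) : Prop :=
  forall z : C, @ex_derive C_AbsRing C_NormedModule f z.

(** [L] is the function [s |-> L(s, chi^(4n-3))]: the analytic continuation to
    the whole plane of half the sum of [hecke_term n s] over the nonzero pairs.
    By the identity theorem at most one function satisfies this. *)
Definition is_hecke_L (n : nat) (L : C -> C) : Prop :=
  entire L /\
  forall s : C, 1 < Re s ->
    exists S : C,
      has_sum (fun ab : Z * Z => ab <> (0%Z, 0%Z)) (hecke_term n s) S /\
      L s = (RtoC (1 / 2) * S)%C.

(* Main.v *)
Require Import Defs.
From Stdlib Require Import Reals ZArith List Permutation Lra Lia ClassicalEpsilon.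
From Coquelicot Require Import Coquelicot.
(* [List.list_sum] would otherwise shadow [Defs.list_sum]. *)
Import Defs.
Open Scope R_scope.

(** Poisson summation over the lattice gives the functional equation of the theta series
    [sum chi(2 a + b) z ^ (4 n - 3) exp (- 2 pi t |z| ^ 2 / 7)], with [z = a + b eta]. Its Mellin
    transform shows that [L(1/2, chi ^ (4 n - 3))] is the lattice sum of
    [chi(2 a + b) (z / |z|) ^ (4 n - 4) * z / |z| ^ 2] against the weight
    [Gamma(m, 2 pi |z| ^ 2 / 7) / Gamma(m)], [m = 2 n - 1], which cuts the sum off at [|z| ^ 2] of
    order [n].

    The points [b = 0] contribute [2 L(1, (./7)) = 2 pi / sqrt 7] up to [O(1 / sqrt n)]. For the
    other points the sum over [n <= N] is essentially geometric with ratio [(z / |z|) ^ 4], and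
    since the weights increase with [n] summation by parts bounds it by
    [O(1 / |b| + 1 / |2 a + b|)]; only [|z| ^ 2 = O(N)] matters, which makes the total
    [O(sqrt N * log N)]. The points with [2 a + b = 0], where the ratio is [1] as well, do not
    occur because the character vanishes there. *)

(** * Unordered sums *)

(** The exponents $4n-3$ are $1$ modulo $4$, which makes the root number $+1$ ([root_number]); the
    two halves of the Mellin integral then agree at the centre instead of cancelling. The proof
    shifts the index by one: [coef n] and [central_term n] belong to the exponent $4n+1$.

    The hypothesis ties [L] to its series only for $\Re s>1$, while the value wanted is at $1/2$.
    The bridge is a uniqueness statement for a half-plane: a function that is differentiable on $\Re
    p\ge0$ and zero for large $\Re p$ vanishes at $0$. It rests on Goursat's theorem for rectangles
    and a Gaussian factor, and all functions involved are integrals that converge on that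
    half-plane.

    Two-dimensional inversion comes from Jacobi's formula used in one coordinate after the other.
    This works directly for a factor $e^{wz}$ but not for $z^k$, so powers are extracted afterwards
    by finite differences in $w$.

    On the real axis the series for $L(1,(\cdot/7))$ converges only conditionally; the effect of the
    cutoff is therefore measured by the total variation of the weight against the bounded partial
    sums of the character. *)

Definition rsum {A : Type} (g : A -> R) (l : list A) : R :=
  fold_right Rplus 0 (map g l).

Definition sums_to {A : Type} (f : A -> C) (S : C) : Prop :=
  forall e : R, 0 < e ->
    exists F0 : list A,
      forall F : list A, NoDup F -> incl F0 F -> Cmod (list_sum f F - S)%C < e.

Definition summable {A : Type} (g : A -> R) : Prop :=
  (forall x, 0 <= g x) /\ exists B, forall F, NoDup F -> rsum g F <= B.

(** Makes [nodup] and [in_dec] available over arbitrary index types. *)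
Lemma classic_eq_dec {A : Type} (x y : A) : {x = y} + {x <> y}.
Proof. apply excluded_middle_informative. Qed.

Lemma list_sum_cons {A} (f : A -> C) a l : list_sum f (a :: l) = (f a + list_sum f l)%C.
Proof. reflexivity. Qed.

Lemma rsum_cons {A} (f : A -> R) a l : rsum f (a :: l) = f a + rsum f l.
Proof. reflexivity. Qed.

Lemma list_sum_app {A} (f : A -> C) l l' :
  list_sum f (l ++ l') = (list_sum f l + list_sum f l')%C.
Proof.
induction l as [|a l IH]; simpl app.
- unfold list_sum at 2; simpl. ring.
- rewrite !list_sum_cons, IH. ring.
Qed.

Lemma rsum_app {A} (f : A -> R) l l' : rsum f (l ++ l') = rsum f l + rsum f l'.
Proof.
induction l as [|a l IH]; simpl app.
- unfold rsum at 2; simpl. ring.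
- rewrite !rsum_cons, IH. ring.
Qed.

Lemma list_sum_ext {A} (f g : A -> C) l :
  (forall x, In x l -> f x = g x) -> list_sum f l = list_sum g l.
Proof.
intros H; induction l as [|a l IH]; [reflexivity|].
rewrite !list_sum_cons, IH, H; auto using in_eq, in_cons.
Qed.

Lemma rsum_le {A} (f g : A -> R) l :
  (forall x, In x l -> f x <= g x) -> rsum f l <= rsum g l.
Proof.
intros H; induction l as [|a l IH]; [apply Rle_refl|].
rewrite !rsum_cons. apply Rplus_le_compat; auto using in_eq, in_cons.
Qed.

Lemma rsum_ext {A} (f g : A -> R) l :
  (forall x, In x l -> f x = g x) -> rsum f l = rsum g l.
Proof.
intros H; apply Rle_antisym; apply rsum_le; intros x Hx; rewrite (H x Hx); lra.
Qed.

Lemma rsum_ge0 {A} (g : A -> R) l : (forall x, In x l -> 0 <= g x) -> 0 <= rsum g l.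
Proof.
intros H; induction l as [|a l IH]; [apply Rle_refl|].
rewrite rsum_cons. apply Rplus_le_le_0_compat; auto using in_eq, in_cons.
Qed.

Lemma rsum_plus {A} (f g : A -> R) l : rsum (fun x => f x + g x) l = rsum f l + rsum g l.
Proof.
induction l as [|a l IH]; [unfold rsum; simpl; ring|]. rewrite !rsum_cons, IH; ring.
Qed.

Lemma rsum_scal {A} c (g : A -> R) l : rsum (fun x => c * g x) l = c * rsum g l.
Proof.
induction l as [|a l IH]; [unfold rsum; simpl; ring|]. rewrite !rsum_cons, IH; ring.
Qed.

Lemma list_sum_plus {A} (f g : A -> C) l :
  list_sum (fun x => f x + g x)%C l = (list_sum f l + list_sum g l)%C.
Proof.
induction l as [|a l IH]; [unfold list_sum; simpl; ring|]. rewrite !list_sum_cons, IH; ring.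
Qed.

Lemma list_sum_scal {A} c (f : A -> C) l :
  list_sum (fun x => c * f x)%C l = (c * list_sum f l)%C.
Proof.
induction l as [|a l IH]; [unfold list_sum; simpl; ring|]. rewrite !list_sum_cons, IH; ring.
Qed.

Lemma list_sum_RtoC {A} (g : A -> R) l : list_sum (fun x => RtoC (g x)) l = RtoC (rsum g l).
Proof.
induction l as [|a l IH]; [reflexivity|]. rewrite list_sum_cons, IH, rsum_cons, RtoC_plus; ring.
Qed.

Lemma list_sum_map {A B} (f : B -> C) (h : A -> B) l :
  list_sum f (map h l) = list_sum (fun x => f (h x)) l.
Proof. unfold list_sum. now rewrite map_map. Qed.

Lemma rsum_map {A B} (f : B -> R) (h : A -> B) l :
  rsum f (map h l) = rsum (fun x => f (h x)) l.
Proof. unfold rsum. now rewrite map_map. Qed.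

Lemma Cmod_list_sum_le {A} (f : A -> C) (g : A -> R) l :
  (forall x, In x l -> Cmod (f x) <= g x) -> Cmod (list_sum f l) <= rsum g l.
Proof.
intros H; induction l as [|a l IH].
- unfold list_sum, rsum; simpl. rewrite Cmod_0. lra.
- rewrite list_sum_cons, rsum_cons. eapply Rle_trans; [apply Cmod_triangle|].
  apply Rplus_le_compat; auto using in_eq, in_cons.
Qed.

Lemma list_sum_perm {A} (f : A -> C) l l' :
  Permutation l l' -> list_sum f l = list_sum f l'.
Proof.
induction 1; rewrite ?list_sum_cons; try congruence. ring.
Qed.

Lemma rsum_perm {A} (f : A -> R) l l' : Permutation l l' -> rsum f l = rsum f l'.
Proof.
induction 1; rewrite ?rsum_cons; try congruence. ring.
Qed.

Lemma NoDup_incl_split {A} (F0 F : list A) :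
  NoDup F0 -> NoDup F -> incl F0 F ->
  exists F1, Permutation F (F0 ++ F1) /\ NoDup F1 /\ (forall x, In x F1 -> In x F /\ ~ In x F0).
Proof.
intros H0 H HI.
exists (filter (fun x => if in_dec classic_eq_dec x F0 then false else true) F).
assert (HF : forall x, In x (filter (fun x => if in_dec classic_eq_dec x F0 then false else true) F)
                 <-> In x F /\ ~ In x F0).
{ intros x. rewrite filter_In. destruct (in_dec classic_eq_dec x F0); intuition congruence. }
assert (HN : NoDup (filter (fun x => if in_dec classic_eq_dec x F0 then false else true) F))
  by now apply NoDup_filter.
repeat split; try tauto; try (now apply HF).
apply NoDup_Permutation; [easy| |].
- apply NoDup_app; auto. intros x Hx Hx'. now apply HF in Hx'.
- intros x. rewrite in_app_iff, HF.
  destruct (in_dec classic_eq_dec x F0); intuition.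
Qed.

Definition union {A} (F G : list A) : list A := nodup classic_eq_dec (F ++ G).

Lemma union_spec {A} (F G : list A) :
  NoDup (union F G) /\ incl F (union F G) /\ incl G (union F G).
Proof.
repeat split.
- apply NoDup_nodup.
- intros x Hx. apply nodup_In, in_app_iff. now left.
- intros x Hx. apply nodup_In, in_app_iff. now right.
Qed.

Lemma sums_to_unique {A} (f : A -> C) S S' : sums_to f S -> sums_to f S' -> S = S'.
Proof.
intros H H'.
destruct (Req_dec (Cmod (S' - S)%C) 0) as [E|E].
- apply Cmod_eq_0 in E. replace S' with (S' - S + S)%C by ring. rewrite E. ring.
- pose proof (Cmod_ge_0 (S' - S)%C) as Hge.
  destruct (H (Cmod (S' - S)%C / 2)) as [F0 H0]; [lra|].
  destruct (H' (Cmod (S' - S)%C / 2)) as [F1 H1]; [lra|].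
  destruct (union_spec F0 F1) as (N & I0 & I1).
  specialize (H0 _ N I0); specialize (H1 _ N I1).
  pose proof (Cmod_triangle (list_sum f (union F0 F1) - S) (- (list_sum f (union F0 F1) - S')))%C as T.
  rewrite Cmod_opp in T.
  replace (list_sum f (union F0 F1) - S + - (list_sum f (union F0 F1) - S'))%C with (S' - S)%C in T by ring.
  lra.
Qed.

Lemma sums_to_ext {A} (f g : A -> C) S : (forall x, f x = g x) -> sums_to f S -> sums_to g S.
Proof.
intros E H e He. destruct (H e He) as [F0 HF0]. exists F0. intros F N I.
rewrite <- (list_sum_ext f g); auto.
Qed.

Lemma sums_to_plus {A} (f g : A -> C) S T :
  sums_to f S -> sums_to g T -> sums_to (fun x => f x + g x)%C (S + T)%C.
Proof.
intros Hf Hg e He.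
destruct (Hf (e/2)) as [F0 H0]; [lra|]. destruct (Hg (e/2)) as [F1 H1]; [lra|].
exists (F0 ++ F1). intros F N I.
assert (I0 : incl F0 F) by (intros x Hx; apply I, in_app_iff; auto).
assert (I1 : incl F1 F) by (intros x Hx; apply I, in_app_iff; auto).
specialize (H0 F N I0); specialize (H1 F N I1).
rewrite list_sum_plus.
pose proof (Cmod_triangle (list_sum f F - S) (list_sum g F - T))%C as Tr.
replace (list_sum f F + list_sum g F - (S + T))%C with (list_sum f F - S + (list_sum g F - T))%C by ring.
lra.
Qed.

Lemma sums_to_scal {A} c (f : A -> C) S :
  sums_to f S -> sums_to (fun x => c * f x)%C (c * S)%C.
Proof.
intros Hf e He. pose proof (Cmod_ge_0 c) as Hc.
destruct (Hf (e / (Cmod c + 1))) as [F0 H0]; [apply Rdiv_lt_0_compat; lra|].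
exists F0. intros F N I. specialize (H0 F N I).
rewrite list_sum_scal. replace (c * list_sum f F - c * S)%C with (c * (list_sum f F - S))%C by ring.
rewrite Cmod_mult.
apply Rle_lt_trans with (Cmod c * (e / (Cmod c + 1))).
- apply Rmult_le_compat_l; lra.
- apply Rmult_lt_reg_r with (Cmod c + 1); [lra|]. field_simplify; [|lra]. nra.
Qed.

Lemma sums_to_finite {A} (f : A -> C) F0 :
  NoDup F0 -> (forall x, ~ In x F0 -> f x = RtoC 0) -> sums_to f (list_sum f F0).
Proof.
intros N0 Hf e He. exists F0. intros F N I.
destruct (NoDup_incl_split F0 F N0 N I) as (F1 & P & N1 & H1).
rewrite (list_sum_perm f _ _ P), list_sum_app, (list_sum_ext f (fun _ => RtoC 0 * RtoC 0)%C F1).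
- rewrite list_sum_scal.
  replace (list_sum f F0 + 0 * list_sum (fun _ : A => RtoC 0) F1 - list_sum f F0)%C with (RtoC 0) by ring.
  rewrite Cmod_0; lra.
- intros x Hx. rewrite Hf; [ring|]. now apply H1.
Qed.

Lemma sums_to_zero {A} : sums_to (fun _ : A => RtoC 0) (RtoC 0).
Proof. apply (sums_to_finite (fun _ : A => RtoC 0) nil); [constructor|auto]. Qed.

Lemma summable_le {A} (f g : A -> R) :
  (forall x, 0 <= f x <= g x) -> summable g -> summable f.
Proof.
intros H [_ [B HB]]. split; [intros; apply H|]. exists B. intros F N.
eapply Rle_trans; [apply rsum_le|apply HB, N]. intros; apply H.
Qed.

Lemma summable_scal {A} c (g : A -> R) : 0 <= c -> summable g -> summable (fun x => c * g x).
Proof.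
intros Hc [H0 [B HB]]. split.
- intros x. apply Rmult_le_pos; auto.
- exists (c * B). intros F N. rewrite rsum_scal. apply Rmult_le_compat_l; auto.
Qed.

(** If the sum over [F0] is within [e] of the supremum of all finite sums, a finite set disjoint
    from [F0] can add at most [e]. *)
Lemma summable_tail {A} (g : A -> R) : summable g -> forall e, 0 < e ->
  exists F0, NoDup F0 /\ forall F, NoDup F -> (forall x, In x F -> ~ In x F0) -> rsum g F <= e.
Proof.
intros [H0 [B HB]] e He.
destruct (completeness (fun v => exists F, NoDup F /\ v = rsum g F)) as [s [Hub Hlub]].
- exists B. intros v (F & N & ->). now apply HB.
- exists 0, nil. split; [constructor|reflexivity].
- assert (Hex : exists F, NoDup F /\ s - e < rsum g F).
  { destruct (classic (exists F, NoDup F /\ s - e < rsum g F)) as [|Hn]; [easy|].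
    exfalso. assert (s <= s - e); [|lra]. apply Hlub. intros v (F & N & ->).
    destruct (Rle_dec (rsum g F) (s - e)); [easy|]. exfalso; apply Hn. exists F. split; [easy|lra]. }
  destruct Hex as (F0 & N0 & HF0). exists F0. split; [easy|]. intros F N Hd.
  assert (rsum g (F0 ++ F) <= s).
  { apply Hub. exists (F0 ++ F). split; [|easy]. apply NoDup_app; auto. intros x Hx Hx'. now apply (Hd x). }
  rewrite rsum_app in H. lra.
Qed.

Lemma sums_to_nonneg_ex {A} (g : A -> R) :
  summable g -> exists s, sums_to (fun x => RtoC (g x)) (RtoC s).
Proof.
intros Hs. destruct (Hs) as [H0 [B HB]].
destruct (completeness (fun v => exists F, NoDup F /\ v = rsum g F)) as [s [Hub Hlub]].
- exists B. intros v (F & N & ->). now apply HB.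
- exists 0, nil. split; [constructor|reflexivity].
- exists s. intros e He.
  destruct (summable_tail g Hs (e/2)) as (F0 & N0 & HF0); [lra|].
  exists F0. intros F N I. rewrite list_sum_RtoC, <- RtoC_minus, Cmod_R.
  assert (rsum g F <= s) by (apply Hub; exists F; auto).
  assert (s <= rsum g F + e/2).
  { apply Hlub. intros v (G & NG & ->).
    destruct (union_spec F G) as (NU & IF & IG).
    destruct (NoDup_incl_split F _ N NU IF) as (F1 & P1 & N1 & D1).
    destruct (NoDup_incl_split G _ NG NU IG) as (F2 & P2 & N2 & D2).
    pose proof (rsum_perm g _ _ P1) as E1. pose proof (rsum_perm g _ _ P2) as E2.
    rewrite rsum_app in E1, E2.
    assert (0 <= rsum g F2) by (apply rsum_ge0; auto).
    assert (rsum g F1 <= e/2) by (apply HF0; auto; intros x Hx Hx'; apply (D1 x Hx); auto).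
    lra. }
  unfold Rabs; destruct (Rcase_abs _); lra.
Qed.

(** Real and imaginary parts are treated separately, each as a difference of the nonnegative
    functions $(|h|+h)/2$ and $(|h|-h)/2$, whose sums are suprema. *)
Lemma sums_to_ex {A} (f : A -> C) (g : A -> R) :
  summable g -> (forall x, Cmod (f x) <= g x) -> exists S, sums_to f S.
Proof.
intros Hg Hf.
assert (HR : forall h : A -> R, (forall x, Rabs (h x) <= g x) -> exists s, sums_to (fun x => RtoC (h x)) (RtoC s)).
{ intros h Hh.
  destruct (sums_to_nonneg_ex (fun x => (Rabs (h x) + h x) / 2)) as [s1 H1].
  - apply summable_le with g; auto. intros x. specialize (Hh x).
    revert Hh; unfold Rabs; destruct (Rcase_abs _); intros; lra.
  - destruct (sums_to_nonneg_ex (fun x => (Rabs (h x) - h x) / 2)) as [s2 H2].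
    + apply summable_le with g; auto. intros x. specialize (Hh x).
      revert Hh; unfold Rabs; destruct (Rcase_abs _); intros; lra.
    + exists (s1 + -1 * s2).
      eapply sums_to_ext; [|rewrite RtoC_plus, RtoC_mult; apply sums_to_plus; [apply H1|apply sums_to_scal, H2]].
      intros x; simpl. rewrite <- RtoC_mult, <- RtoC_plus. f_equal. field. }
destruct (HR (fun x => Re (f x))) as [s1 H1].
{ intros x. eapply Rle_trans; [apply re_le_Cmod|apply Hf]. }
destruct (HR (fun x => Im (f x))) as [s2 H2].
{ intros x. eapply Rle_trans; [|apply Hf]. eapply Rle_trans; [apply Rmax_r|apply Rmax_Cmod]. }
exists (RtoC s1 + Ci * RtoC s2)%C.
eapply sums_to_ext; [|apply sums_to_plus; [apply H1|apply sums_to_scal, H2]].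
intros x. simpl. apply injective_projections; simpl; unfold Re, Im; ring.
Qed.

Lemma sums_to_bound {A} (f : A -> C) S B :
  sums_to f S -> (forall F, NoDup F -> Cmod (list_sum f F) <= B) -> Cmod S <= B.
Proof.
intros H HB. apply le_epsilon. intros e He.
destruct (H e He) as [F0 HF0].
destruct (union_spec F0 nil) as (N & I & _).
specialize (HF0 _ N I). specialize (HB _ N).
pose proof (Cmod_triangle (list_sum f (union F0 nil)) (- (list_sum f (union F0 nil) - S)))%C as T.
rewrite Cmod_opp in T.
replace (list_sum f (union F0 nil) + - (list_sum f (union F0 nil) - S))%C with S in T by ring.
lra.
Qed.

(** * Limits of complex sequences and dominated convergence *)

Definition Cseq_lim (u : nat -> C) (l : C) : Prop :=
  forall e, 0 < e -> exists N, forall n, (N <= n)%nat -> Cmod (u n - l)%C < e.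

Lemma Cseq_lim_unique u l l' : Cseq_lim u l -> Cseq_lim u l' -> l = l'.
Proof.
intros H H'.
destruct (Req_dec (Cmod (l' - l)%C) 0) as [E|E].
- apply Cmod_eq_0 in E. replace l' with (l' - l + l)%C by ring. rewrite E. ring.
- pose proof (Cmod_ge_0 (l' - l)%C) as Hge.
  destruct (H (Cmod (l' - l)%C / 2)) as [N0 H0]; [lra|].
  destruct (H' (Cmod (l' - l)%C / 2)) as [N1 H1]; [lra|].
  specialize (H0 (N0 + N1)%nat ltac:(lia)); specialize (H1 (N0 + N1)%nat ltac:(lia)).
  pose proof (Cmod_triangle (u (N0 + N1)%nat - l) (- (u (N0 + N1)%nat - l')))%C as T.
  rewrite Cmod_opp in T.
  replace (u (N0 + N1)%nat - l + - (u (N0 + N1)%nat - l'))%C with (l' - l)%C in T by ring.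
  lra.
Qed.

Lemma Cseq_lim_list_sum {A} (u : nat -> A -> C) (v : A -> C) F :
  (forall x, Cseq_lim (fun n => u n x) (v x)) ->
  Cseq_lim (fun n => list_sum (u n) F) (list_sum v F).
Proof.
intros H. induction F as [|a F IH].
- intros e He. exists 0%nat. intros. unfold list_sum; simpl.
  replace (0 - 0)%C with (RtoC 0) by ring. now rewrite Cmod_0.
- intros e He. destruct (H a (e/2)) as [N1 H1]; [lra|]. destruct (IH (e/2)) as [N2 H2]; [lra|].
  exists (N1 + N2)%nat. intros n Hn. specialize (H1 n ltac:(lia)); specialize (H2 n ltac:(lia)).
  rewrite !list_sum_cons.
  replace (u n a + list_sum (u n) F - (v a + list_sum v F))%C
    with (u n a - v a + (list_sum (u n) F - list_sum v F))%C by ring.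
  eapply Rle_lt_trans; [apply Cmod_triangle|]. lra.
Qed.

Lemma dominated_tail {A} (f : A -> C) (g : A -> R) S F0 e :
  sums_to f S -> (forall x, Cmod (f x) <= g x) -> NoDup F0 ->
  (forall F, NoDup F -> (forall x, In x F -> ~ In x F0) -> rsum g F <= e) ->
  Cmod (list_sum f F0 - S)%C <= e.
Proof.
intros H Hg N0 Ht. apply le_epsilon. intros d Hd.
destruct (H d Hd) as [F1 H1].
destruct (union_spec F0 F1) as (N & I0 & I1). specialize (H1 _ N I1).
destruct (NoDup_incl_split F0 _ N0 N I0) as (F2 & P & N2 & D).
rewrite (list_sum_perm f _ _ P), list_sum_app in H1.
assert (Cmod (list_sum f F2) <= e).
{ eapply Rle_trans; [apply Cmod_list_sum_le; intros; apply Hg|]. apply Ht; auto. intros x Hx; apply D, Hx. }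
pose proof (Cmod_triangle (list_sum f F0 + list_sum f F2 - S) (- list_sum f F2))%C as T.
rewrite Cmod_opp in T.
replace (list_sum f F0 + list_sum f F2 - S + - list_sum f F2)%C with (list_sum f F0 - S)%C in T by ring.
lra.
Qed.

(** Tannery's theorem. One finite set [F0] leaves a tail of at most [e / 4] for every [f n] with
    [n0 <= n] and for the limit [h], which inherits the majorant; on [F0] only finitely many limits
    are involved. *)
Lemma sums_to_dominated {A} (f : nat -> A -> C) (h : A -> C) (g : A -> R) (S : nat -> C) T n0 :
  summable g -> (forall n x, (n0 <= n)%nat -> Cmod (f n x) <= g x) ->
  (forall x, Cseq_lim (fun n => f n x) (h x)) ->
  (forall n, sums_to (f n) (S n)) -> sums_to h T -> Cseq_lim S T.
Proof.
intros Hg Hd Hl Hs HT e He.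
assert (Hh : forall x, Cmod (h x) <= g x).
{ intros x. apply le_epsilon. intros d Hdd. destruct (Hl x d Hdd) as [N HN].
  specialize (HN (N + n0)%nat ltac:(lia)). specialize (Hd (N + n0)%nat x ltac:(lia)).
  pose proof (Cmod_triangle (f (N + n0)%nat x) (- (f (N + n0)%nat x - h x)))%C as Tr.
  rewrite Cmod_opp in Tr.
  replace (f (N + n0)%nat x + - (f (N + n0)%nat x - h x))%C with (h x) in Tr by ring. lra. }
destruct (summable_tail g Hg (e/4)) as (F0 & N0 & HF0); [lra|].
destruct (Cseq_lim_list_sum f h F0 Hl (e/4)) as [N HN]; [lra|].
exists (N + n0)%nat. intros n Hn. specialize (HN n ltac:(lia)).
pose proof (dominated_tail (f n) g (S n) F0 (e/4) (Hs n) (fun x => Hd n x ltac:(lia)) N0 HF0) as T1.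
pose proof (dominated_tail h g T F0 (e/4) HT Hh N0 HF0) as T2.
replace (S n - T)%C with (- (list_sum (f n) F0 - S n) + ((list_sum (f n) F0 - list_sum h F0) + (list_sum h F0 - T)))%C by ring.
eapply Rle_lt_trans; [apply Cmod_triangle|]. rewrite Cmod_opp.
pose proof (Cmod_triangle (list_sum (f n) F0 - list_sum h F0) (list_sum h F0 - T))%C. lra.
Qed.

(** * Double sums, Fubini and reindexing *)

Lemma list_sum_prod {A B} (f : A * B -> C) (F : list A) (G : list B) :
  list_sum f (list_prod F G) = list_sum (fun a => list_sum (fun b => f (a, b)) G) F.
Proof.
induction F as [|a F IH]; [reflexivity|].
simpl list_prod. rewrite list_sum_app, list_sum_cons, IH, list_sum_map. reflexivity.
Qed.

Lemma rsum_prod {A B} (f : A -> R) (g : B -> R) (F : list A) (G : list B) :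
  rsum (fun p => f (fst p) * g (snd p)) (list_prod F G) = rsum f F * rsum g G.
Proof.
induction F as [|a F IH]; [unfold rsum; simpl; ring|].
simpl list_prod. rewrite rsum_app, rsum_cons, IH, rsum_map. simpl. rewrite rsum_scal. ring.
Qed.

Lemma NoDup_list_prod {A B} (F : list A) (G : list B) :
  NoDup F -> NoDup G -> NoDup (list_prod F G).
Proof.
intros HF HG. induction F as [|a F IH]; [constructor|].
inversion HF as [|? ? Ha HF']; subst. simpl. apply NoDup_app.
- apply FinFun.Injective_map_NoDup; [|easy]. intros x y E. congruence.
- auto.
- intros [x y] H1 H2. apply in_map_iff in H1 as (b & E & _). apply in_prod_iff in H2 as [H2 _].
  inversion E; subst. auto.
Qed.

Lemma rsum_incl {A} (g : A -> R) F G :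
  (forall x, 0 <= g x) -> NoDup F -> NoDup G -> incl F G -> rsum g F <= rsum g G.
Proof.
intros H0 NF NG I. destruct (NoDup_incl_split F G NF NG I) as (F1 & P & _ & _).
rewrite (rsum_perm g _ _ P), rsum_app. pose proof (rsum_ge0 g F1 ltac:(auto)). lra.
Qed.

Lemma rsum_prod_le {A B} (f : A -> R) (g : B -> R) (Bf Bg : R) :
  (forall x, 0 <= f x) -> (forall x, 0 <= g x) ->
  (forall F, NoDup F -> rsum f F <= Bf) -> (forall F, NoDup F -> rsum g F <= Bg) ->
  forall F, NoDup F -> rsum (fun p => f (fst p) * g (snd p)) F <= Bf * Bg.
Proof.
intros Hf Hg HBf HBg F N.
apply Rle_trans with (rsum (fun p => f (fst p) * g (snd p))
  (list_prod (nodup classic_eq_dec (map fst F)) (nodup classic_eq_dec (map snd F)))).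
- apply rsum_incl; auto using NoDup_list_prod, NoDup_nodup.
  + intros; apply Rmult_le_pos; auto.
  + intros [a b] Hab. apply in_prod; apply nodup_In, in_map_iff; exists (a, b); auto.
- rewrite rsum_prod. apply Rmult_le_compat; auto using NoDup_nodup, rsum_ge0.
Qed.

Lemma summable_prod {A B} (f : A -> R) (g : B -> R) :
  summable f -> summable g -> summable (fun p => f (fst p) * g (snd p)).
Proof.
intros [Hf [Bf HBf]] [Hg [Bg HBg]]. split.
- intros; apply Rmult_le_pos; auto.
- exists (Bf * Bg). now apply rsum_prod_le.
Qed.

Lemma Cmod_list_sum_const {A} (f : A -> C) e F :
  (forall x, In x F -> Cmod (f x) <= e) -> Cmod (list_sum f F) <= INR (length F) * e.
Proof.
intros H. eapply Rle_trans; [apply (Cmod_list_sum_le f (fun _ => e) F H)|].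
clear H. induction F as [|a F IH]; [unfold rsum; simpl; lra|].
rewrite rsum_cons. simpl length. rewrite S_INR. lra.
Qed.

Lemma sums_to_common {A B} (f : A -> B -> C) (r : A -> C) e F :
  0 < e -> (forall a, sums_to (f a) (r a)) ->
  exists G0, forall G, NoDup G -> incl G0 G -> forall a, In a F -> Cmod (list_sum (f a) G - r a)%C < e.
Proof.
intros He H. induction F as [|a F [G0 IH]].
- exists nil. intros G _ _ a [].
- destruct (H a e He) as [G1 H1]. exists (G1 ++ G0). intros G N I b [<-|Hb].
  + apply H1; auto. intros x Hx; apply I, in_app_iff; auto.
  + apply IH; auto. intros x Hx; apply I, in_app_iff; auto.
Qed.

(** For the finitely many rows in [F] one finite set [G] serves all row sums at once, with an error
    divided by the number of rows; adding the columns of [F0] to [G] makes [list_prod F G] contain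
    [F0]. *)
Lemma sums_to_fubini {A B} (f : A * B -> C) (r : A -> C) S :
  sums_to f S -> (forall a, sums_to (fun b => f (a, b)) (r a)) -> sums_to r S.
Proof.
intros HS Hr e He. destruct (HS (e/2)) as [F0 HF0]; [lra|].
exists (map fst F0). intros F N I.
assert (Hl : 0 <= INR (length F)) by apply pos_INR.
assert (He' : 0 < e / (2 * (INR (length F) + 1))) by (apply Rdiv_lt_0_compat; lra).
destruct (sums_to_common (fun a b => f (a, b)) r (e / (2 * (INR (length F) + 1))) F) as [G0 HG0]; auto.
set (G := union G0 (map snd F0)).
destruct (union_spec G0 (map snd F0)) as (NG & I0 & I1). fold G in NG, I0, I1.
specialize (HG0 G NG I0).
assert (Cmod (list_sum f (list_prod F G) - S)%C < e/2).
{ apply HF0; auto using NoDup_list_prod. intros [a b] Hab. apply in_prod.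
  - apply I, in_map_iff. exists (a, b); auto.
  - apply I1, in_map_iff. exists (a, b); auto. }
rewrite list_sum_prod in H.
assert (H2 : Cmod (list_sum (fun a => r a + (-1) * list_sum (fun b => f (a, b)) G)%C F) <= e/2).
{ eapply Rle_trans; [apply (Cmod_list_sum_const _ (e / (2 * (INR (length F) + 1))))|].
  - intros a Ha. specialize (HG0 a Ha). rewrite <- Cmod_opp.
    replace (- (r a + (-1) * list_sum (fun b : B => f (a, b)) G))%C with (list_sum (fun b : B => f (a, b)) G - r a)%C by ring.
    lra.
  - apply Rmult_le_reg_r with (2 * (INR (length F) + 1)); [lra|]. field_simplify; lra. }
rewrite list_sum_plus, list_sum_scal in H2.
set (X := list_sum r F) in *. set (Y := list_sum _ F) in *.
replace (X - S)%C with (X + (-1) * Y + (Y - S))%C by ring.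
eapply Rle_lt_trans; [apply Cmod_triangle|]. lra.
Qed.

Lemma preimage_list {A B} (f : B -> C) (phi : A -> B) :
  (forall x y, phi x = phi y -> x = y) ->
  (forall y, (forall x, phi x <> y) -> f y = RtoC 0) ->
  forall F, NoDup F -> exists G, NoDup G /\ (forall x, In x G <-> In (phi x) F) /\
    list_sum (fun x => f (phi x)) G = list_sum f F.
Proof.
intros Hinj H0 F. induction F as [|b F IH]; intros N.
- exists nil. repeat split; auto. constructor.
- inversion N as [|? ? Hb N']; subst. destruct (IH N') as (G & NG & HG & E).
  destruct (classic (exists x, phi x = b)) as [[x Hx]|Hn].
  + exists (x :: G). split; [|split].
    * constructor; auto. intros Hx'. apply HG in Hx'. congruence.
    * intros y. simpl. rewrite HG, <- Hx. split; intros [Hy|Hy]; auto. subst; auto.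
    * rewrite !list_sum_cons, E, Hx. reflexivity.
  + exists G. split; [easy|split].
    * intros y. simpl. rewrite HG. split; auto. intros [Hy|Hy]; auto. exfalso; eauto.
    * rewrite list_sum_cons, E, H0; [ring|]. intros x Hx. eauto.
Qed.

(** Extension by zero along an injection; [sums_to_pull] is the converse. *)
Lemma sums_to_push {A B} (f : B -> C) (phi : A -> B) S :
  (forall x y, phi x = phi y -> x = y) ->
  (forall y, (forall x, phi x <> y) -> f y = RtoC 0) ->
  sums_to (fun x => f (phi x)) S -> sums_to f S.
Proof.
intros Hinj H0 H e He. destruct (H e He) as [F0 HF0]. exists (map phi F0). intros F N I.
destruct (preimage_list f phi Hinj H0 F N) as (G & NG & HG & E). rewrite <- E.
apply HF0; auto. intros x Hx. apply HG, I, in_map, Hx.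
Qed.

Lemma sums_to_bij {A B} (f : B -> C) (phi : A -> B) (psi : B -> A) S :
  (forall x, psi (phi x) = x) -> (forall y, phi (psi y) = y) ->
  sums_to f S -> sums_to (fun x => f (phi x)) S.
Proof.
intros H1 H2 H. apply (sums_to_push (fun x => f (phi x)) psi).
- intros x y E. rewrite <- (H2 x), <- (H2 y). congruence.
- intros y Hy. exfalso. apply (Hy (phi y)). apply H1.
- eapply sums_to_ext; [|apply H]. intros x. simpl. now rewrite H2.
Qed.

Lemma sums_to_swap {A B} (f : A * B -> C) S :
  sums_to f S -> sums_to (fun p : B * A => f (snd p, fst p)) S.
Proof.
intros H. apply (sums_to_bij f (fun p : B * A => (snd p, fst p)) (fun p => (snd p, fst p)) S); auto;
intros [a b]; reflexivity.
Qed.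

Lemma sums_to_pull {A B} (f : B -> C) (phi : A -> B) S :
  (forall x y, phi x = phi y -> x = y) ->
  (forall y, (forall x, phi x <> y) -> f y = RtoC 0) ->
  sums_to f S -> sums_to (fun x => f (phi x)) S.
Proof.
intros Hinj H0 H e He. destruct (H e He) as [F0 HF0].
destruct (preimage_list f phi Hinj H0 (nodup classic_eq_dec F0) (NoDup_nodup _ _)) as (G & _ & HG & _).
exists G. intros F N I.
assert (NM : NoDup (map phi F)) by (apply FinFun.Injective_map_NoDup; auto; intros x y; apply Hinj).
destruct (union_spec (map phi F) F0) as (NU & I1 & I0).
specialize (HF0 _ NU I0).
destruct (NoDup_incl_split _ _ NM NU I1) as (F1 & P & _ & HF1).
rewrite (list_sum_perm f _ _ P), list_sum_app, list_sum_map in HF0.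
rewrite (list_sum_ext f (fun _ => RtoC 0 * RtoC 0)%C F1), list_sum_scal in HF0.
- now replace (list_sum (fun x : A => f (phi x)) F + 0 * list_sum (fun _ : B => RtoC 0) F1 - S)%C
   with (list_sum (fun x : A => f (phi x)) F - S)%C in HF0 by ring.
- intros y Hy. rewrite H0; [ring|]. intros x <-. destruct (HF1 _ Hy) as [Hu Hn]. apply Hn, in_map, I, HG.
  apply nodup_In in Hu. apply in_app_iff in Hu as [Hu|Hu]; [contradiction|]. now apply nodup_In.
Qed.

Lemma sums_to_list_sum {A J} (f : J -> A -> C) (s : J -> C) (l : list J) :
  (forall j, sums_to (f j) (s j)) ->
  sums_to (fun x => list_sum (fun j => f j x) l) (list_sum s l).
Proof.
intros H. induction l as [|j l IH].
- apply sums_to_zero.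
- eapply sums_to_ext; [|rewrite list_sum_cons; apply sums_to_plus; [apply H|apply IH]].
  reflexivity.
Qed.

(** The integers from [- M] to [M - 1], written as [k] and [- k - 1] with [k] natural, so that a sum
    over [Z] is bounded by two sums over [nat]. *)
Definition zlist (M : nat) : list Z :=
  map Z.of_nat (seq 0 M) ++ map (fun k => (- Z.of_nat k - 1)%Z) (seq 0 M).

Lemma NoDup_zlist M : NoDup (zlist M).
Proof.
apply NoDup_app.
- apply FinFun.Injective_map_NoDup; [|apply seq_NoDup]. intros x y; lia.
- apply FinFun.Injective_map_NoDup; [|apply seq_NoDup]. intros x y; lia.
- intros z H1 H2. apply in_map_iff in H1 as (a & <- & _). apply in_map_iff in H2 as (b & E & _). lia.
Qed.

Lemma in_zlist M z : (- Z.of_nat M <= z < Z.of_nat M)%Z -> In z (zlist M).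
Proof.
intros H. apply in_app_iff. destruct (Z_lt_le_dec z 0).
- right. apply in_map_iff. exists (Z.to_nat (- z - 1)). split; [lia|]. apply in_seq. lia.
- left. apply in_map_iff. exists (Z.to_nat z). split; [lia|]. apply in_seq. lia.
Qed.

Lemma incl_zlist (F : list Z) : exists M, incl F (zlist M).
Proof.
assert (exists M, forall z, In z F -> (- Z.of_nat M <= z < Z.of_nat M)%Z) as [M HM].
{ induction F as [|a F [M HM]].
  - exists 0%nat. intros z [].
  - exists (M + Z.to_nat (Z.abs a) + 1)%nat. intros z [<-|Hz]; [lia|]. specialize (HM z Hz). lia. }
exists M. intros z Hz. apply in_zlist. auto.
Qed.

Lemma rsum_Z_le (g : Z -> R) (h1 h2 : nat -> R) (B1 B2 : R) :
  (forall z, 0 <= g z) ->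
  (forall k, g (Z.of_nat k) <= h1 k) -> (forall k, g (- Z.of_nat k - 1)%Z <= h2 k) ->
  (forall M, rsum h1 (seq 0 M) <= B1) -> (forall M, rsum h2 (seq 0 M) <= B2) ->
  forall F, NoDup F -> rsum g F <= B1 + B2.
Proof.
intros H0 H1 H2 HB1 HB2 F N. destruct (incl_zlist F) as [M HM].
apply Rle_trans with (rsum g (zlist M)); [apply rsum_incl; auto using NoDup_zlist|].
unfold zlist. rewrite rsum_app, !rsum_map.
apply Rplus_le_compat; (eapply Rle_trans; [|apply HB1 || apply HB2]); apply rsum_le; auto.
Qed.

Lemma rsum_seq_S (h : nat -> R) M : rsum h (seq 0 (S M)) = rsum h (seq 0 M) + h M.
Proof. rewrite seq_S, rsum_app. simpl. unfold rsum at 2; simpl. ring. Qed.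

(** The standard summable majorant: every use of [sums_to_dominated] below compares with a multiple
    of it, or of a product of two of them. *)
Definition pz (n : Z) : R := / (1 + IZR n ^ 2).

Lemma pz_ge0 n : 0 < pz n.
Proof. apply Rinv_0_lt_compat. pose proof (pow2_ge_0 (IZR n)). lra. Qed.

(** Induction against a telescoping bound: $1+q^2\ge q(q+1)/2$ gives $1/(1+q^2)\le 2/q-2/(q+1)$. *)
Lemma rsum_inv_sq M : rsum (fun k => / (1 + INR k ^ 2)) (seq 0 (S M)) <= 3 - 2 / INR (S M).
Proof.
induction M as [|M IH].
- unfold rsum; simpl. lra.
- rewrite rsum_seq_S. eapply Rle_trans; [apply Rplus_le_compat_r, IH|].
  assert (Hq : 1 <= INR (S M)) by (rewrite S_INR; pose proof (pos_INR M); lra).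
  rewrite (S_INR (S M)). set (q := INR (S M)) in *.
  assert (/ (1 + q ^ 2) <= 2 / q - 2 / (q + 1)).
  { replace (2 / q - 2 / (q + 1)) with (/ (q * (q + 1) / 2)) by (field; lra).
    apply Rinv_le_contravar; nra. }
  lra.
Qed.

Lemma summable_pz : summable pz.
Proof.
split; [intros; apply Rlt_le, pz_ge0|].
exists (3 + 3).
assert (HB : forall M, rsum (fun k => / (1 + INR k ^ 2)) (seq 0 M) <= 3).
{ intros [|M]; [unfold rsum; simpl; lra|]. eapply Rle_trans; [apply rsum_inv_sq|].
  assert (0 < 2 / INR (S M)) by (apply Rdiv_lt_0_compat; [lra|apply lt_0_INR; lia]). lra. }
apply rsum_Z_le with (fun k => / (1 + INR k ^ 2)) (fun k => / (1 + INR k ^ 2)); auto.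
- intros; apply Rlt_le, pz_ge0.
- intros k. unfold pz. rewrite <- INR_IZR_INZ. lra.
- intros k. unfold pz. rewrite minus_IZR, opp_IZR, <- INR_IZR_INZ.
  pose proof (pos_INR k). apply Rinv_le_contravar; nra.
Qed.

Lemma summable_pz2 : summable (fun p : Z * Z => pz (fst p) * pz (snd p)).
Proof. apply summable_prod; apply summable_pz. Qed.

Lemma exp_neg_le y : 0 <= y -> exp (- y) <= / (1 + y).
Proof.
intros Hy. rewrite exp_Ropp. apply Rinv_le_contravar; [lra|].
pose proof (exp_ineq1_le y). lra.
Qed.

Lemma gauss_le_pz k n : 0 < k -> exp (- (k * IZR n ^ 2)) <= (1 + / k) * pz n.
Proof.
intros Hk. pose proof (pow2_ge_0 (IZR n)) as H2.
eapply Rle_trans; [apply exp_neg_le; nra|]. unfold pz.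
set (y := IZR n ^ 2) in *.
apply Rmult_le_reg_r with ((1 + k * y) * (1 + y)); [nra|].
assert (0 < / k) by now apply Rinv_0_lt_compat.
field_simplify; try nra.
apply Rmult_le_reg_r with k; auto. field_simplify; nra.
Qed.

(** * Jacobi's inversion formula *)

Definition E (t : R) : C := (cos t, sin t).

Lemma E_plus a b : E (a + b) = (E a * E b)%C.
Proof. unfold E, Cmult; simpl. rewrite cos_plus, sin_plus. apply injective_projections; simpl; ring. Qed.

Lemma E_0 : E 0 = RtoC 1.
Proof. unfold E. rewrite cos_0, sin_0. reflexivity. Qed.

Lemma Cmod_E t : Cmod (E t) = 1.
Proof.
unfold Cmod, E; simpl. rewrite !Rmult_1_r, Rplus_comm. pose proof (sin2_cos2 t) as H; unfold Rsqr in H.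
rewrite H. apply sqrt_1.
Qed.

Lemma E_periodic_nat t k : E (t + 2 * INR k * PI) = E t.
Proof. unfold E. now rewrite cos_period, sin_period. Qed.

Lemma E_periodic t (k : Z) : E (t + 2 * PI * IZR k) = E t.
Proof.
destruct (Z_lt_le_dec k 0) as [H|H].
- rewrite <- (E_periodic_nat _ (Z.to_nat (- k))), INR_IZR_INZ, Z2Nat.id, opp_IZR by lia. f_equal; ring.
- rewrite <- (E_periodic_nat t (Z.to_nat k)), INR_IZR_INZ, Z2Nat.id by lia. f_equal; ring.
Qed.

Lemma E_2PI_Z (k : Z) : E (2 * PI * IZR k) = RtoC 1.
Proof. rewrite <- (Rplus_0_l (2 * PI * IZR k)), E_periodic. apply E_0. Qed.

Lemma E_double t : (E (2 * t) - 1 = 2 * sin t * Ci * E t)%C.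
Proof.
unfold E. rewrite cos_2a_sin, sin_2a. apply injective_projections; simpl; ring.
Qed.

(** The symmetric residue system modulo the odd number [2 L + 1]. For $|x|\le1/2$ it keeps $|x+j|$
    at most half the modulus, hence the arguments of the cosines in [finite_poisson] within $\pi/2$
    of zero. *)
Definition sym_range (L : nat) : list Z :=
  map (fun i => (Z.of_nat i - Z.of_nat L)%Z) (seq 0 (2 * L + 1)).

Lemma NoDup_sym_range L : NoDup (sym_range L).
Proof. apply FinFun.Injective_map_NoDup; [intros x y; lia|apply seq_NoDup]. Qed.

Lemma in_sym_range L j : In j (sym_range L) <-> (Z.abs j <= Z.of_nat L)%Z.
Proof.
unfold sym_range. rewrite in_map_iff. split.
- intros (i & <- & Hi). apply in_seq in Hi. lia.
- intros H. exists (Z.to_nat (j + Z.of_nat L)). split; [lia|]. apply in_seq. lia.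
Qed.

Lemma E_geometric t a n :
  (list_sum (fun i => E (t * IZR (Z.of_nat i - a))) (seq 0 n) * (E t - 1) =
   E (t * IZR (Z.of_nat n - a)) - E (t * IZR (- a)))%C.
Proof.
induction n as [|n IH].
- unfold list_sum; simpl. ring.
- rewrite seq_S, list_sum_app, Cmult_plus_distr_r, IH, list_sum_cons. simpl Nat.add.
  unfold list_sum; simpl fold_right.
  replace (t * IZR (Z.of_nat (S n) - a)) with (t * IZR (Z.of_nat n - a) + t).
  + rewrite E_plus. ring.
  + rewrite Nat2Z.inj_succ, !minus_IZR, succ_IZR. ring.
Qed.

(** For [r] not divisible by the modulus, the sum times [E t - 1] telescopes to a difference of two
    values of [E] whose arguments differ by $2\pi r$, hence to zero; and [E t] is not [1], because
    by [E_double] the difference is a nonzero multiple of a sine at a point strictly between $0$ and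
    $\pi$. *)
Lemma sym_range_orthogonality L (r : Z) :
  list_sum (fun j => E (2 * PI * (IZR r / INR (2 * L + 1)) * IZR j)) (sym_range L) =
  if (r mod Z.of_nat (2 * L + 1) =? 0)%Z then RtoC (INR (2 * L + 1)) else RtoC 0.
Proof.
set (l := (2 * L + 1)%nat).
assert (Hl : 0 < INR l) by (apply lt_0_INR; unfold l; lia).
assert (HlZ : IZR (Z.of_nat l) = INR l) by (symmetry; apply INR_IZR_INZ).
destruct (Z.eqb_spec (r mod Z.of_nat l) 0) as [H|H].
- apply Z.mod_divide in H; [|unfold l; lia]. destruct H as [q ->].
  rewrite (list_sum_ext _ (fun _ => RtoC 1 * RtoC 1)%C).
  + rewrite list_sum_scal, Cmult_1_l.
    change (fun _ : Z => RtoC 1) with (fun _ : Z => RtoC ((fun _ => 1) 0)).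
    rewrite list_sum_RtoC. f_equal. unfold sym_range. rewrite rsum_map. fold l.
    generalize 0%nat. induction l; intros s; [reflexivity|]. simpl seq. rewrite rsum_cons, S_INR.
    destruct l; [unfold rsum; simpl; ring|]. rewrite IHl; try lra; try (apply lt_0_INR; lia).
    symmetry; apply INR_IZR_INZ.
  + intros j _. rewrite mult_IZR, HlZ.
    replace (2 * PI * (IZR q * INR l / INR l) * IZR j) with (2 * PI * IZR (q * j)) by (rewrite mult_IZR; field; lra).
    rewrite E_2PI_Z. ring.
- unfold sym_range. rewrite list_sum_map. fold l.
  pose proof (E_geometric (2 * PI * (IZR r / INR l)) (Z.of_nat L) l) as G.
  replace (E (2 * PI * (IZR r / INR l) * IZR (Z.of_nat l - Z.of_nat L)))
    with (E (2 * PI * (IZR r / INR l) * IZR (- Z.of_nat L))) in G.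
  2:{ rewrite <- (E_periodic _ r). f_equal. rewrite minus_IZR, opp_IZR, HlZ. field. lra. }
  match type of G with (?X * ?Y = _)%C => set (s := X) in *; set (d := Y) in * end.
  assert (Hd : d <> RtoC 0).
  { unfold d.
    assert (Hr : 2 * PI * (IZR r / INR l) = 2 * (PI * (IZR (r mod Z.of_nat l) / INR l)) + 2 * PI * IZR (r / Z.of_nat l)).
    { rewrite (Z.div_mod r (Z.of_nat l)) at 1 by (unfold l; lia).
      rewrite plus_IZR, mult_IZR, HlZ. field. lra. }
    rewrite Hr, E_periodic, E_double.
    assert (Hm : (0 < r mod Z.of_nat l < Z.of_nat l)%Z).
    { pose proof (Z.mod_pos_bound r (Z.of_nat l)). unfold l in *; lia. }
    assert (Hs : 0 < sin (PI * (IZR (r mod Z.of_nat l) / INR l))).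
    { destruct Hm as [Hm1 Hm2]. apply IZR_lt in Hm1, Hm2. rewrite HlZ in Hm2.
      pose proof PI_RGT_0.
      assert (0 < IZR (r mod Z.of_nat l) / INR l) by (apply Rdiv_lt_0_compat; lra).
      assert (IZR (r mod Z.of_nat l) / INR l < 1) by (apply Rmult_lt_reg_r with (INR l); auto; unfold Rdiv; rewrite Rmult_assoc, Rinv_l; lra).
      apply sin_gt_0; nra. }
    intros E0. apply (f_equal Cmod) in E0.
    rewrite !Cmod_mult, Cmod_E, Cmod_Ci, !Cmod_R, Rabs_R0, (Rabs_pos_eq 2) in E0 by lra.
    rewrite Rabs_pos_eq in E0 by lra. lra. }
  replace s with (s * d / d)%C by (field; auto). rewrite G. field. auto.
Qed.

(** Reciprocal factorial, extended by [0] to the negative integers so that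
    [rfact_pred] holds on all of [Z]. *)
Definition rfact (n : Z) : R := if (n <? 0)%Z then 0 else / INR (fact (Z.to_nat n)).

Lemma rfact_pred n : rfact (n - 1) = IZR n * rfact n.
Proof.
unfold rfact. destruct (Z.ltb_spec (n - 1) 0), (Z.ltb_spec n 0); try lia.
- ring.
- assert (n = 0%Z) as -> by lia. ring.
- replace (Z.to_nat n) with (S (Z.to_nat (n - 1))) by lia.
  rewrite fact_simpl, mult_INR.
  replace (IZR n) with (INR (S (Z.to_nat (n - 1)))) by (rewrite INR_IZR_INZ; f_equal; lia).
  pose proof (INR_fact_neq_0 (Z.to_nat (n - 1))). field. split; auto. apply not_0_INR; lia.
Qed.

(** This is $\binom{2m}{m-r}/4^m$, the coefficient of $e^{2iry}$ in $\cos^{2m}y$, and zero for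
    $|r|>m$. *)
Definition bin_weight (m : nat) (r : Z) : R :=
  INR (fact (2 * m)) / 4 ^ m * rfact (Z.of_nat m - r) * rfact (Z.of_nat m + r).

(** Pascal's rule applied twice. With [rfact_pred] all terms become multiples of
    [rfact p * rfact q], so the ends of the range need no separate treatment. *)
Lemma bin_weight_S m r :
  bin_weight (S m) r = / 4 * (bin_weight m (r - 1) + 2 * bin_weight m r + bin_weight m (r + 1)).
Proof.
unfold bin_weight. set (p := (Z.of_nat (S m) - r)%Z). set (q := (Z.of_nat (S m) + r)%Z).
assert (Hpq : IZR p + IZR q = 2 * (INR m + 1)).
{ rewrite INR_IZR_INZ, <- plus_IZR, <- plus_IZR, <- mult_IZR. f_equal. unfold p, q; lia. }
replace (Z.of_nat m - (r - 1))%Z with p by (unfold p; lia).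
replace (Z.of_nat m + (r - 1))%Z with (q - 1 - 1)%Z by (unfold q; lia).
replace (Z.of_nat m - r)%Z with (p - 1)%Z by (unfold p; lia).
replace (Z.of_nat m + r)%Z with (q - 1)%Z by (unfold q; lia).
replace (Z.of_nat m - (r + 1))%Z with (p - 1 - 1)%Z by (unfold p; lia).
replace (Z.of_nat m + (r + 1))%Z with q by (unfold q; lia).
rewrite !rfact_pred, !minus_IZR.
replace (2 * S m)%nat with (S (S (2 * m))) by lia.
rewrite !fact_simpl, !mult_INR, !S_INR, mult_INR. simpl (INR 2). simpl pow.
replace (IZR q) with (2 * (INR m + 1) - IZR p) by lra.
field. apply pow_nonzero; lra.
Qed.

Lemma bin_weight_0 r : bin_weight 0 r = if (r =? 0)%Z then 1 else 0.
Proof.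
unfold bin_weight, rfact. destruct (Z.eqb_spec r 0) as [->|H].
- simpl. field.
- destruct (Z.ltb_spec (Z.of_nat 0 - r) 0), (Z.ltb_spec (Z.of_nat 0 + r) 0); try lia; ring.
Qed.

Lemma bin_weight_out m r : (Z.of_nat m < Z.abs r)%Z -> bin_weight m r = 0.
Proof.
intros H. unfold bin_weight, rfact.
destruct (Z.ltb_spec (Z.of_nat m - r) 0), (Z.ltb_spec (Z.of_nat m + r) 0); try lia; ring.
Qed.

Lemma bin_weight_sym m r : bin_weight m (- r) = bin_weight m r.
Proof.
unfold bin_weight. replace (Z.of_nat m - - r)%Z with (Z.of_nat m + r)%Z by lia.
replace (Z.of_nat m + - r)%Z with (Z.of_nat m - r)%Z by lia. ring.
Qed.

(** Induction through $\cos^2y=(e^{2iy}+e^{-2iy}+2)/4$: multiplication by it shifts frequencies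
    exactly as [bin_weight_S] prescribes. *)
Lemma cos_pow_expansion m y :
  sums_to (fun r => bin_weight m r * E (2 * y * IZR r))%C (RtoC (cos y ^ (2 * m))).
Proof.
induction m as [|m IH].
- replace (RtoC (cos y ^ (2 * 0))) with (list_sum (fun r => bin_weight 0 r * E (2 * y * IZR r))%C (0%Z :: nil)).
  + apply sums_to_finite; [repeat constructor; simpl; tauto|].
    intros r Hr. rewrite bin_weight_0. destruct (Z.eqb_spec r 0); [subst; exfalso; apply Hr; now left|ring].
  + unfold list_sum; simpl. rewrite bin_weight_0. simpl. rewrite Rmult_0_r, E_0. ring.
- assert (Hc : RtoC (cos y ^ (2 * S m)) = (/ 4 * (E (2 * y) + E (- (2 * y)) + 2) * RtoC (cos y ^ (2 * m)))%C).
  { replace (2 * S m)%nat with (2 * m + 2)%nat by lia. rewrite pow_add.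
    unfold E. rewrite cos_neg, sin_neg, cos_2a_cos.
    apply injective_projections; simpl; field. }
  rewrite Hc.
  pose proof (sums_to_bij _ (fun r => (r - 1)%Z) (fun r => (r + 1)%Z) _ ltac:(intros; simpl; lia) ltac:(intros; simpl; lia) IH) as H1.
  pose proof (sums_to_bij _ (fun r => (r + 1)%Z) (fun r => (r - 1)%Z) _ ltac:(intros; simpl; lia) ltac:(intros; simpl; lia) IH) as H2.
  apply (sums_to_scal (/4 * E (2 * y))%C) in H1. apply (sums_to_scal (/4 * E (- (2 * y)))%C) in H2.
  pose proof (sums_to_plus _ _ _ _ (sums_to_plus _ _ _ _ H1 H2) (sums_to_scal (/4 * 2)%C _ _ IH)) as H3.
  replace (/ 4 * (E (2 * y) + E (- (2 * y)) + 2) * RtoC (cos y ^ (2 * m)))%C with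
   (/ 4 * E (2 * y) * RtoC (cos y ^ (2 * m)) + / 4 * E (- (2 * y)) * RtoC (cos y ^ (2 * m)) + / 4 * 2 * RtoC (cos y ^ (2 * m)))%C by ring.
  revert H3. apply sums_to_ext. intros r.
  rewrite bin_weight_S, minus_IZR, plus_IZR, !RtoC_mult, !RtoC_plus, RtoC_mult, RtoC_inv by lra.
  replace (2 * y * IZR r) with (2 * y * (IZR r - 1) + 2 * y) by ring.
  replace (2 * y * (IZR r + 1)) with (2 * y * (IZR r - 1) + 2 * y + 2 * y) by ring.
  rewrite !E_plus.
  assert (HE : (E (2 * y) * E (- (2 * y)) = 1)%C) by (rewrite <- E_plus, Rplus_opp_r; apply E_0).
  set (u := E (2 * y)) in *. set (v := E (- (2 * y))) in *. set (w := E _).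
  transitivity (/ 4 * (bin_weight m (r - 1) * w * u) + / 4 * (bin_weight m (r + 1) * w * u * (u * v)) + / 4 * 2 * (bin_weight m r * w * u))%C; [ring|].
  rewrite HE. ring.
Qed.

(** Expanding each power of the cosine and summing over the residues [j] keeps, by orthogonality,
    only the frequencies [r = (2 L + 1) v]. *)
Lemma finite_poisson L m x :
  sums_to (fun v => INR (2 * L + 1) * bin_weight m (Z.of_nat (2 * L + 1) * v) * E (2 * PI * IZR v * x))%C
    (list_sum (fun j => RtoC (cos (PI * (x + IZR j) / INR (2 * L + 1)) ^ (2 * m))) (sym_range L)).
Proof.
set (l := (2 * L + 1)%nat).
assert (Hl : 0 < INR l) by (apply lt_0_INR; unfold l; lia).
assert (HlZ : IZR (Z.of_nat l) = INR l) by (symmetry; apply INR_IZR_INZ).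
pose proof (sums_to_list_sum _ _ (sym_range L) (fun j => cos_pow_expansion m (PI * (x + IZR j) / INR l))) as H.
apply (sums_to_ext _ (fun r => bin_weight m r * E (2 * PI * (IZR r / INR l) * x) *
  if (r mod Z.of_nat l =? 0)%Z then RtoC (INR l) else RtoC 0)%C) in H.
2:{ intros r. unfold l. rewrite <- sym_range_orthogonality, <- list_sum_scal.
    apply list_sum_ext. intros j _. rewrite <- Cmult_assoc, <- E_plus. f_equal. f_equal. fold l. field. lra. }
apply (sums_to_pull _ (fun v => (Z.of_nat l * v)%Z)) in H.
- revert H. apply sums_to_ext. intros v.
  rewrite Z.mul_comm at 3. rewrite Z.mod_mul by (unfold l; lia). simpl (0 =? 0)%Z. cbv iota.
  rewrite mult_IZR, HlZ. replace (2 * PI * (INR l * IZR v / INR l) * x) with (2 * PI * IZR v * x) by (field; lra).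
  ring.
- intros a b Hab. unfold l in Hab. nia.
- intros r Hr. destruct (Z.eqb_spec (r mod Z.of_nat l) 0) as [E0|]; [|ring].
  apply Z.mod_divide in E0; [|unfold l; lia]. destruct E0 as [q ->].
  exfalso. apply (Hr q). ring.
Qed.

Lemma rfact_nat n : rfact (Z.of_nat n) = / INR (fact n).
Proof. unfold rfact. destruct (Z.ltb_spec (Z.of_nat n) 0); [lia|]. now rewrite Nat2Z.id. Qed.

Lemma bin_weight_ratio_eq n k :
  bin_weight (n + k) (Z.of_nat k) = bin_weight (n + k) 0 *
    (INR (fact (n + k)) * INR (fact (n + k)) / (INR (fact n) * INR (fact (n + k + k)))).
Proof.
unfold bin_weight.
replace (Z.of_nat (n + k) - Z.of_nat k)%Z with (Z.of_nat n) by lia.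
replace (Z.of_nat (n + k) + Z.of_nat k)%Z with (Z.of_nat (n + k + k)) by lia.
rewrite Z.sub_0_r, Z.add_0_r, !rfact_nat.
pose proof (INR_fact_neq_0 (n + k)); pose proof (INR_fact_neq_0 n); pose proof (INR_fact_neq_0 (n + k + k)).
field. repeat split; auto. apply pow_nonzero; lra.
Qed.

Lemma bin_weight_0_pos m : 0 < bin_weight m 0.
Proof.
unfold bin_weight. rewrite Z.sub_0_r, Z.add_0_r, !rfact_nat.
pose proof (INR_fact_lt_0 m). pose proof (INR_fact_lt_0 (2 * m)).
repeat apply Rmult_lt_0_compat; auto using Rinv_0_lt_compat.
apply Rinv_0_lt_compat, pow_lt; lra.
Qed.

(** The quotient is the product of $(n+i)/(n+k+i)$ for $1\le i\le j$. These factors increase with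
    $i$ and, as $j\le k$, lie between $n/(n+k)$ and $(n+k)/(n+2k)$. *)
Lemma fact_ratio_bounds n k j : (j <= k)%nat -> (0 < n + k)%nat ->
  (INR n / INR (n + k)) ^ j <= INR (fact (n + j)) * INR (fact (n + k)) / (INR (fact n) * INR (fact (n + k + j)))
   <= (INR (n + k) / INR (n + k + k)) ^ j.
Proof.
intros Hj Hp. induction j as [|j IH].
- rewrite !Nat.add_0_r. pose proof (INR_fact_neq_0 (n + k)); pose proof (INR_fact_neq_0 n).
  simpl. split; apply Req_le; field; auto.
- specialize (IH ltac:(lia)).
  rewrite !Nat.add_succ_r, !fact_simpl, !mult_INR.
  pose proof (INR_fact_neq_0 (n + k)); pose proof (INR_fact_neq_0 n); pose proof (INR_fact_neq_0 (n + k + j)).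
  set (P := INR (fact (n + j)) * INR (fact (n + k)) / (INR (fact n) * INR (fact (n + k + j)))) in *.
  replace (INR (S (n + j)) * INR (fact (n + j)) * INR (fact (n + k)) / (INR (fact n) * (INR (S (n + k + j)) * INR (fact (n + k + j))))) with (INR (S (n + j)) / INR (S (n + k + j)) * P).
  2:{ unfold P. field. repeat split; auto. apply not_0_INR; lia. }
  assert (Hq0 : 0 <= INR n / INR (n + k)) by (apply Rdiv_le_0_compat; [apply pos_INR|apply lt_0_INR; lia]).
  assert (Hn : 0 <= INR n) by apply pos_INR.
  assert (Hk : 0 <= INR k) by apply pos_INR.
  assert (Hjj : 0 <= INR j) by apply pos_INR.
  assert (Hjk : INR j + 1 <= INR k) by (rewrite <- S_INR; apply le_INR; lia).
  assert (A1 : INR n / INR (n + k) <= INR (S (n + j)) / INR (S (n + k + j))).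
  { rewrite !S_INR, !plus_INR. apply Rle_div_l; [lra|].
    replace ((INR n + INR j + 1) / (INR n + INR k + INR j + 1) * (INR n + INR k)) with
     ((INR n + INR j + 1) * (INR n + INR k) / (INR n + INR k + INR j + 1)) by (field; lra).
    apply Rle_div_r; nra. }
  assert (A2 : INR (S (n + j)) / INR (S (n + k + j)) <= INR (n + k) / INR (n + k + k)).
  { rewrite !S_INR, !plus_INR. apply Rle_div_l; [lra|].
    replace ((INR n + INR k) / (INR n + INR k + INR k) * (INR n + INR k + INR j + 1)) with
     ((INR n + INR k) * (INR n + INR k + INR j + 1) / (INR n + INR k + INR k)) by (field; lra).
    apply Rle_div_r; nra. }
  assert (0 <= (INR n / INR (n + k)) ^ j) by now apply pow_le.
  simpl pow. split; apply Rmult_le_compat; try lra.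
Qed.

(** A local de Moivre-Laplace estimate: both bounds behave like $e^{-k^2/m}$ when $k^2/m$ stays
    bounded and $m$ grows. *)
Lemma bin_weight_ratio_bounds m k : (k <= m)%nat -> (0 < m)%nat ->
  bin_weight m 0 * (1 - INR k / INR m) ^ k <= bin_weight m (Z.of_nat k)
   <= bin_weight m 0 * (1 - INR k / (INR m + INR k)) ^ k.
Proof.
intros Hk Hm. replace m with ((m - k) + k)%nat by lia. set (n := (m - k)%nat).
rewrite bin_weight_ratio_eq.
destruct (fact_ratio_bounds n k k (le_n k) ltac:(lia)) as [H1 H2].
replace (1 - INR k / INR (n + k)) with (INR n / INR (n + k)).
2:{ rewrite plus_INR. field. rewrite <- plus_INR. apply not_0_INR; lia. }
replace (1 - INR k / (INR (n + k) + INR k)) with (INR (n + k) / INR (n + k + k)).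
2:{ rewrite (plus_INR (n + k)). field. rewrite <- plus_INR. apply not_0_INR; lia. }
pose proof (bin_weight_0_pos (n + k)).
split; apply Rmult_le_compat_l; lra.
Qed.

Lemma pow_exp_bounds u k : 0 <= u <= / 2 ->
  exp (- (INR k * u + 2 * (INR k * u) * u)) <= (1 - u) ^ k <= exp (- (INR k * u)).
Proof.
(* As $e^x\ge1+x$, this follows from $(1-u)(1+u+2u^2)=1+u^2(1-2u)\ge1$. *)
intros Hu. assert (H1 : exp (- (u + 2 * u * u)) <= 1 - u).
{ rewrite exp_Ropp. pose proof (exp_ineq1_le (u + 2 * u * u)).
  apply Rmult_le_reg_l with (exp (u + 2 * u * u)); [apply exp_pos|]. rewrite Rinv_r by (pose proof (exp_pos (u + 2 * u * u)); lra).
  nra. }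
assert (H2 : 1 - u <= exp (- u)) by (pose proof (exp_ineq1_le (- u)); lra).
induction k as [|k IH].
- simpl. replace (- (0 * u + 2 * (0 * u) * u)) with 0 by ring. replace (- (0 * u)) with 0 by ring. rewrite exp_0; lra.
- rewrite S_INR. simpl pow.
  replace (- ((INR k + 1) * u + 2 * ((INR k + 1) * u) * u)) with (- (u + 2 * u * u) + - (INR k * u + 2 * (INR k * u) * u)) by ring.
  replace (- ((INR k + 1) * u)) with (- u + - (INR k * u)) by ring.
  rewrite !exp_plus. pose proof (exp_pos (- (u + 2 * u * u))). pose proof (exp_pos (- (INR k * u + 2 * (INR k * u) * u))).
  pose proof (pow_le (1 - u) k ltac:(lra)).
  split; apply Rmult_le_compat; lra.
Qed.

Lemma is_lim_seq_exp_neg u (A : R) : is_lim_seq u (Finite A) -> is_lim_seq (fun n => exp (- u n)) (exp (- A)).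
Proof.
intros H. apply (is_lim_seq_continuous (fun y => exp (- y))); [|easy].
apply derivable_continuous_pt. reg.
Qed.

Lemma is_lim_seq_pow_exp (u : nat -> R) (k : nat -> nat) (A : R) :
  (forall n, 0 <= u n) -> is_lim_seq u 0 -> is_lim_seq (fun n => INR (k n) * u n) A ->
  is_lim_seq (fun n => (1 - u n) ^ k n) (exp (- A)).
Proof.
intros H0 Hu Hk.
apply is_lim_seq_le_le_loc with (fun n => exp (- (INR (k n) * u n + 2 * (INR (k n) * u n) * u n)))
  (fun n => exp (- (INR (k n) * u n))).
- apply is_lim_seq_spec in Hu. specialize (Hu (mkposreal (/2) ltac:(lra))). destruct Hu as [N HN].
  exists N. intros n Hn. apply pow_exp_bounds. specialize (HN n Hn). simpl in HN.
  specialize (H0 n). rewrite Rabs_pos_eq in HN; lra.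
- apply is_lim_seq_exp_neg. replace A with (A + 2 * A * 0) by ring.
  apply is_lim_seq_plus'; auto. apply is_lim_seq_mult'; auto. apply is_lim_seq_mult'; auto. apply is_lim_seq_const.
- now apply is_lim_seq_exp_neg.
Qed.

Lemma increasing_from_derivative (f df : R -> R) a x :
  a <= x -> (forall t, a <= t <= x -> is_derive f t (df t)) -> (forall t, a <= t <= x -> 0 <= df t) -> f a <= f x.
Proof.
intros Hx Hd Hp.
destruct (MVT_gen f a x df) as (c & Hc & E0).
- intros t Ht. rewrite Rmin_left, Rmax_right in Ht by lra. apply Hd; lra.
- intros t Ht. rewrite Rmin_left, Rmax_right in Ht by lra.
  apply continuity_pt_filterlim. apply (ex_derive_continuous (K := R_AbsRing) (V := R_NormedModule) f t). exists (df t). apply Hd; lra.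
- rewrite Rmin_left, Rmax_right in Hc by lra. specialize (Hp c Hc). nra.
Qed.

Lemma abs_sin_le y : Rabs (sin y) <= Rabs y.
Proof.
assert (Hs : forall z, 0 <= z -> Rabs (sin z) <= z).
{ intros z Hz. destruct (Req_dec z 0) as [->|]; [rewrite sin_0, Rabs_R0; lra|].
  destruct (Rle_dec z 1).
  - rewrite Rabs_pos_eq; [apply Rlt_le, sin_lt_x; lra|]. apply sin_ge_0; [lra|]. pose proof PI2_1. lra.
  - pose proof (SIN_bound z). unfold Rabs; destruct (Rcase_abs _); lra. }
destruct (Rle_dec 0 y).
- rewrite (Rabs_pos_eq y); auto.
- rewrite <- Rabs_Ropp, <- sin_neg, <- (Rabs_Ropp y), (Rabs_pos_eq (- y)) by lra. apply Hs; lra.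
Qed.

Lemma sin_cube_lower y : 0 <= y -> y - y ^ 3 / 6 <= sin y.
Proof.
intros Hy. pose proof (increasing_from_derivative (fun t => sin t - (t - t ^ 3 / 6)) (fun t => cos t - (1 - t ^ 2 / 2)) 0 y Hy) as H.
cbv beta in H; rewrite sin_0 in H. cut (0 - (0 - 0 ^ 3 / 6) <= sin y - (y - y ^ 3 / 6)); [intros; lra|]. apply H.
- intros t _. auto_derive; auto. field.
- intros t _. replace (cos t) with (1 - 2 * sin (t / 2) * sin (t / 2)) by (rewrite <- cos_2a_sin; f_equal; field).
  pose proof (abs_sin_le (t / 2)) as H0.
  apply Rsqr_le_abs_1 in H0. unfold Rsqr in H0. nra.
Qed.

Lemma sin_sqr_le y : sin y ^ 2 <= y ^ 2.
Proof. pose proof (Rsqr_le_abs_1 _ _ (abs_sin_le y)) as H. unfold Rsqr in H. nra. Qed.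

(** Both bounds come from $\sin z\ge z(1-z^2/6)\ge z/3$. The first is exact to second order and
    gives the limit in [polya_space_lim]; the second stays proportional to $y^2$ up to $|y|=2$ and
    gives the majorant in [polya_space_dominated]. *)
Lemma sin_sqr_ge y : y ^ 2 <= 4 -> y ^ 2 - y ^ 4 / 3 <= sin y ^ 2 /\ y ^ 2 / 9 <= sin y ^ 2.
Proof.
intros Hy. assert (H : forall z, 0 <= z -> z ^ 2 <= 4 -> z ^ 2 - z ^ 4 / 3 <= sin z ^ 2 /\ z ^ 2 / 9 <= sin z ^ 2).
{ intros z Hz H4. pose proof (sin_cube_lower z Hz) as H.
  assert (E1 : z - z ^ 3 / 6 = z * (1 - z ^ 2 / 6)) by field. rewrite E1 in H.
  assert (H0 : z * (1 / 3) <= z * (1 - z ^ 2 / 6)) by (apply Rmult_le_compat_l; lra).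
  assert (H1 : (z * (1 - z ^ 2 / 6)) ^ 2 <= sin z ^ 2) by (apply pow_incr; split; [nra|lra]).
  assert (H2 : (z * (1 / 3)) ^ 2 <= (z * (1 - z ^ 2 / 6)) ^ 2) by (apply pow_incr; split; [nra|lra]).
  split; [|nra].
  replace ((z * (1 - z ^ 2 / 6)) ^ 2) with (z ^ 2 - z ^ 4 / 3 + (z ^ 3) ^ 2 / 36) in H1 by field.
  pose proof (pow2_ge_0 (z ^ 3)). lra. }
destruct (Rle_dec 0 y); [now apply H|].
replace (y ^ 2) with ((- y) ^ 2) by ring. replace (y ^ 4) with ((- y) ^ 4) by ring.
replace (sin y ^ 2) with (sin (- y) ^ 2) by (rewrite sin_neg; ring).
apply H; [lra|]. now replace ((- y) ^ 2) with (y ^ 2) by ring.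
Qed.

Lemma exp_le a b : a <= b -> exp a <= exp b.
Proof. intros [H|H]; [apply Rlt_le, exp_increasing, H|rewrite H; lra]. Qed.

Lemma RtoC_neq a b : a <> b -> RtoC a <> RtoC b.
Proof. intros H E0. apply H. now inversion E0. Qed.

Lemma exp_pow_INR x n : exp x ^ n = exp (INR n * x).
Proof.
induction n as [|n IH]; [simpl; rewrite Rmult_0_l, exp_0; easy|].
rewrite S_INR. simpl pow. rewrite IH, <- exp_plus. f_equal; ring.
Qed.

Lemma Cseq_lim_RtoC u (l : R) : is_lim_seq u l -> Cseq_lim (fun n => RtoC (u n)) (RtoC l).
Proof.
intros H e He. apply is_lim_seq_spec in H. destruct (H (mkposreal e He)) as [N HN].
exists N. intros n Hn. rewrite <- RtoC_minus, Cmod_R. now apply HN.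
Qed.

Lemma Cseq_lim_to_R u (l : C) : Cseq_lim (fun n => RtoC (u n)) l -> is_lim_seq u (Re l).
Proof.
intros H. apply is_lim_seq_spec. intros e. destruct (H e (cond_pos e)) as [N HN].
exists N. intros n Hn. eapply Rle_lt_trans; [|apply (HN n Hn)].
eapply Rle_trans; [|apply re_le_Cmod]. apply Req_le. f_equal.
Qed.

Lemma Cseq_lim_ext u v l : (forall n, u n = v n) -> Cseq_lim u l -> Cseq_lim v l.
Proof. intros E0 H e He. destruct (H e He) as [N HN]. exists N. intros n Hn. rewrite <- E0. auto. Qed.

Lemma Cseq_lim_scal c u l : Cseq_lim u l -> Cseq_lim (fun n => c * u n)%C (c * l)%C.
Proof.
intros Hf e He. pose proof (Cmod_ge_0 c) as Hc.
destruct (Hf (e / (Cmod c + 1))) as [N H0]; [apply Rdiv_lt_0_compat; lra|].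
exists N. intros n Hn. specialize (H0 n Hn).
replace (c * u n - c * l)%C with (c * (u n - l))%C by ring. rewrite Cmod_mult.
apply Rle_lt_trans with (Cmod c * (e / (Cmod c + 1))).
- apply Rmult_le_compat_l; lra.
- apply Rmult_lt_reg_r with (Cmod c + 1); [lra|]. field_simplify; [|lra]. nra.
Qed.

Lemma Cseq_lim_mult u v a b : Cseq_lim u a -> Cseq_lim v b -> Cseq_lim (fun n => u n * v n)%C (a * b)%C.
Proof.
intros Hu Hv e He.
pose proof (Cmod_ge_0 a). pose proof (Cmod_ge_0 b).
destruct (Hu (Rmin 1 (e / (2 * (Cmod b + 2))))) as [N1 H1]; [apply Rmin_pos; [lra|apply Rdiv_lt_0_compat; lra]|].
destruct (Hv (Rmin 1 (e / (2 * (Cmod a + 2))))) as [N2 H2]; [apply Rmin_pos; [lra|apply Rdiv_lt_0_compat; lra]|].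
exists (N1 + N2)%nat. intros n Hn. specialize (H1 n ltac:(lia)); specialize (H2 n ltac:(lia)).
assert (Hb : Cmod (v n) <= Cmod b + 1).
{ pose proof (Cmod_triangle (v n - b) b) as T. replace (v n - b + b)%C with (v n) in T by ring.
  pose proof (Rmin_l 1 (e / (2 * (Cmod a + 2)))). lra. }
replace (u n * v n - a * b)%C with ((u n - a) * v n + a * (v n - b))%C by ring.
eapply Rle_lt_trans; [apply Cmod_triangle|]. rewrite !Cmod_mult.
pose proof (Rmin_r 1 (e / (2 * (Cmod a + 2)))) as M1. pose proof (Rmin_r 1 (e / (2 * (Cmod b + 2)))) as M2.
pose proof (Cmod_ge_0 (u n - a)) as G1. pose proof (Cmod_ge_0 (v n - b)) as G2.
assert (K1 : Cmod (u n - a) * Cmod (v n) <= e / (2 * (Cmod b + 2)) * (Cmod b + 1)).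
{ apply Rmult_le_compat; try lra. apply Cmod_ge_0. }
assert (K2 : Cmod a * Cmod (v n - b) <= Cmod a * (e / (2 * (Cmod a + 2)))).
{ apply Rmult_le_compat_l; lra. }
assert (K3 : e / (2 * (Cmod b + 2)) * (Cmod b + 1) < e / 2).
{ apply Rmult_lt_reg_r with (2 * (Cmod b + 2)); [lra|]. field_simplify; nra. }
assert (K4 : Cmod a * (e / (2 * (Cmod a + 2))) < e / 2).
{ apply Rmult_lt_reg_r with (2 * (Cmod a + 2)); [lra|]. field_simplify; nra. }
lra.
Qed.

(** [theta_space] and [theta_freq] are the summands of the two sides of $\sum_n e^{-\pi
    t(x+n)^2}=t^{-1/2}\sum_v e^{-\pi v^2/t}e^{2\pi ivx}$, without the factor $t^{-1/2}$. *)
Definition theta_space (t x : R) (n : Z) : C := RtoC (exp (- (PI * t * (x + IZR n) ^ 2))).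

Definition theta_freq (t x : R) (v : Z) : C :=
  (exp (- (PI / t * IZR v ^ 2)) * E (2 * PI * IZR v * x))%C.

Lemma Cmod_exp a : Cmod (RtoC (exp a)) = exp a.
Proof. rewrite Cmod_R. apply Rabs_pos_eq, Rlt_le, exp_pos. Qed.

Lemma gauss_shift_le k x n : 0 < k ->
  exp (- (k * (x + IZR n) ^ 2)) <= exp (k * x ^ 2) * (1 + / (k / 2)) * pz n.
Proof.
intros Hk. rewrite Rmult_assoc.
apply Rle_trans with (exp (k * x ^ 2) * exp (- (k / 2 * IZR n ^ 2))).
- rewrite <- exp_plus. apply exp_le. pose proof (pow2_ge_0 (2 * x + IZR n)). nra.
- apply Rmult_le_compat_l; [apply Rlt_le, exp_pos|]. apply gauss_le_pz. lra.
Qed.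

Lemma gauss_const_pos k x : 0 < k -> 0 <= exp (k * x ^ 2) * (1 + / (k / 2)).
Proof.
intros Hk. pose proof (exp_pos (k * x ^ 2)). assert (0 < / (k / 2)) by (apply Rinv_0_lt_compat; lra). nra.
Qed.

Lemma theta_space_ex t x : 0 < t -> exists S, sums_to (theta_space t x) S.
Proof.
intros Ht. pose proof PI_RGT_0.
apply (sums_to_ex _ (fun n => exp (PI * t * x ^ 2) * (1 + / (PI * t / 2)) * pz n)).
- apply summable_scal; [apply gauss_const_pos; nra|apply summable_pz].
- intros n. unfold theta_space. rewrite Cmod_exp. apply gauss_shift_le. nra.
Qed.

Lemma Cmod_theta_freq t x v : Cmod (theta_freq t x v) = exp (- (PI / t * IZR v ^ 2)).
Proof. unfold theta_freq. rewrite Cmod_mult, Cmod_E, Cmod_exp. ring. Qed.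

Lemma theta_freq_ex t x : 0 < t -> exists S, sums_to (theta_freq t x) S.
Proof.
intros Ht. pose proof PI_RGT_0.
assert (0 < PI / t) by now apply Rdiv_lt_0_compat.
apply (sums_to_ex _ (fun n => (1 + / (PI / t)) * pz n)).
- apply summable_scal; [|apply summable_pz]. assert (0 < / (PI / t)) by now apply Rinv_0_lt_compat. lra.
- intros n. rewrite Cmod_theta_freq. now apply gauss_le_pz.
Qed.

(** Polya's proof: in [finite_poisson] take [m ~ tau * (2 * L + 1) ^ 2] and let [L] tend to
    infinity. The powers of cosines tend to Gaussians, and so do the binomial weights
    relative to the central one. *)
Definition polya_exponent (tau : R) (L : nat) : nat :=
  match Rle_dec 0 (tau * INR (2 * L + 1) ^ 2) with
  | left H => nfloor (tau * INR (2 * L + 1) ^ 2) H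
  | right _ => 0%nat
  end.

Section Polya.

Variable tau : R.
Hypothesis tau_pos : 0 < tau.

Let l (L : nat) := INR (2 * L + 1).
Let m := polya_exponent tau.

Lemma polya_l_pos L : 1 <= l L.
Proof. unfold l. rewrite plus_INR. simpl. pose proof (pos_INR (L + (L + 0))). lra. Qed.

Lemma polya_l_lim : is_lim_seq l p_infty.
Proof.
apply is_lim_seq_le_p_loc with INR; [|apply is_lim_seq_INR].
exists 0%nat. intros n _. apply le_INR. lia.
Qed.

Lemma polya_inv_l_lim : is_lim_seq (fun L => / l L) 0.
Proof. apply (is_lim_seq_inv l p_infty); [apply polya_l_lim|discriminate]. Qed.

Lemma polya_m_spec L : INR (m L) <= tau * l L ^ 2 < INR (m L) + 1.
Proof.
unfold m, polya_exponent. fold (l L). destruct (Rle_dec 0 (tau * l L ^ 2)) as [H|H].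
- unfold nfloor. destruct (nfloor_ex (tau * l L ^ 2) H) as [n Hn]. exact Hn.
- exfalso. apply H. pose proof (pow2_ge_0 (l L)). nra.
Qed.

Lemma polya_m_ratio_lim : is_lim_seq (fun L => INR (m L) / l L ^ 2) tau.
Proof.
apply is_lim_seq_le_le with (fun L => tau - / l L * / l L) (fun _ => tau).
- intros L. pose proof (polya_m_spec L). pose proof (polya_l_pos L).
  assert (0 < l L ^ 2) by nra.
  split.
  + apply Rle_div_r; [nra|]. replace ((tau - / l L * / l L) * l L ^ 2) with (tau * l L ^ 2 - 1) by (field; lra). lra.
  + apply Rle_div_l; lra.
- replace (Finite tau) with (Finite (tau - 0 * 0)) by (f_equal; ring).
  apply is_lim_seq_minus'; [apply is_lim_seq_const|]. apply is_lim_seq_mult'; apply polya_inv_l_lim.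
- apply is_lim_seq_const.
Qed.

Lemma polya_m_ratio_eventually : exists N, forall L, (N <= L)%nat -> tau / 2 <= INR (m L) / l L ^ 2.
Proof.
pose proof polya_m_ratio_lim as H. apply is_lim_seq_spec in H.
destruct (H (mkposreal (tau / 2) ltac:(lra))) as [N HN]. exists N. intros L HL. specialize (HN L HL). simpl in HN.
apply Rabs_lt_between in HN. simpl. lra.
Qed.

Lemma polya_m_pos L : tau / 2 <= INR (m L) / l L ^ 2 -> 0 < INR (m L).
Proof.
intros H. pose proof (polya_l_pos L). apply Rle_div_r in H; [|nra]. assert (0 < tau / 2 * l L ^ 2) by (apply Rmult_lt_0_compat; nra). lra.
Qed.

Lemma polya_m_le_lim K : exists N, forall L, (N <= L)%nat -> K <= INR (m L).
Proof.
destruct polya_m_ratio_eventually as [N HN].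
pose proof polya_l_lim as Hl. apply is_lim_seq_spec in Hl. destruct (Hl (2 * (Rabs K) / tau)) as [N2 HN2].
exists (N + N2)%nat. intros L HL. specialize (HN L ltac:(lia)). specialize (HN2 L ltac:(lia)).
pose proof (polya_l_pos L). apply Rle_div_r in HN; [|nra]. apply Rlt_div_l in HN2; [|lra].
pose proof (Rle_abs K). assert (l L <= l L ^ 2) by nra. nra.
Qed.

(** Extended by zero outside the window, so that the sums for all [L] run over the same set and
    dominated convergence applies. *)
Definition polya_space x L (j : Z) : C :=
  if in_dec Z.eq_dec j (sym_range L) then RtoC (cos (PI * (x + IZR j) / l L) ^ (2 * m L)) else RtoC 0.

(** The power of the cosine is $(1-\sin^2y)^m$. Since $m\sin^2y$ and $my^2$ have the same limit
    $\pi^2\tau(x+j)^2$, the Gaussian of parameter $t=\pi\tau$ appears. *)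
Lemma polya_space_lim x j :
  Cseq_lim (fun L => polya_space x L j) (theta_space (PI * tau) x j).
Proof.
set (y := fun L => PI * (x + IZR j) / l L).
assert (Hy : is_lim_seq y 0).
{ replace 0 with (PI * (x + IZR j) * 0) by ring. apply is_lim_seq_mult'; [apply is_lim_seq_const|apply polya_inv_l_lim]. }
assert (Hmy : is_lim_seq (fun L => INR (m L) * y L ^ 2) (PI * (PI * tau) * (x + IZR j) ^ 2)).
{ apply is_lim_seq_ext with (fun L => INR (m L) / l L ^ 2 * (PI * (x + IZR j)) ^ 2).
  - intros L. unfold y. pose proof (polya_l_pos L). field. lra.
  - replace (PI * (PI * tau) * (x + IZR j) ^ 2) with (tau * (PI * (x + IZR j)) ^ 2) by ring.
    apply is_lim_seq_mult'; [apply polya_m_ratio_lim|apply is_lim_seq_const]. }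
assert (Hy2 : is_lim_seq (fun L => y L ^ 2) 0).
{ replace 0 with (0 * 0) by ring. apply is_lim_seq_ext with (fun L => y L * y L); [intros; ring|]. now apply is_lim_seq_mult'. }
assert (Hc : is_lim_seq (fun L => cos (y L) ^ (2 * m L)) (exp (- (PI * (PI * tau) * (x + IZR j) ^ 2)))).
{ apply is_lim_seq_ext with (fun L => (1 - sin (y L) ^ 2) ^ m L).
  - intros L. rewrite pow_mult. f_equal. pose proof (sin2_cos2 (y L)) as H. unfold Rsqr in H. simpl. lra.
  - assert (He : eventually (fun L => y L ^ 2 <= 4)).
    { apply is_lim_seq_spec in Hy2. destruct (Hy2 (mkposreal 4 ltac:(lra))) as [N HN]. exists N. intros L HL.
      specialize (HN L HL). cbv [pos] in HN. apply Rabs_lt_between in HN. lra. }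
    apply is_lim_seq_pow_exp.
    + intros; apply pow2_ge_0.
    + apply is_lim_seq_le_le with (fun _ => 0) (fun L => y L ^ 2); [|apply is_lim_seq_const|apply Hy2].
      intros L. split; [apply pow2_ge_0|apply sin_sqr_le].
    + apply is_lim_seq_le_le_loc with (fun L => INR (m L) * y L ^ 2 - INR (m L) * y L ^ 2 * (y L ^ 2 * / 3)) (fun L => INR (m L) * y L ^ 2).
      * apply filter_imp with (2 := He). intros L HL. pose proof (pos_INR (m L)). split.
        -- destruct (sin_sqr_ge (y L) HL) as [H1 _].
           replace (INR (m L) * y L ^ 2 - INR (m L) * y L ^ 2 * (y L ^ 2 * / 3)) with (INR (m L) * (y L ^ 2 - y L ^ 4 / 3)) by field.
           now apply Rmult_le_compat_l.
        -- apply Rmult_le_compat_l; [easy|apply sin_sqr_le].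
      * set (A := PI * (PI * tau) * (x + IZR j) ^ 2) in *.
        replace (Finite A) with (Finite (A - A * (0 * / 3))) by (f_equal; ring).
        apply is_lim_seq_minus'; [easy|]. apply is_lim_seq_mult'; [easy|]. apply is_lim_seq_mult'; [easy|apply is_lim_seq_const].
      * easy. }
intros e He. destruct (Cseq_lim_RtoC _ _ Hc e He) as [N HN].
exists (N + Z.to_nat (Z.abs j))%nat. intros L HL. unfold polya_space.
destruct (in_dec Z.eq_dec j (sym_range L)) as [_|Hn]; [apply HN; lia|].
exfalso. apply Hn, in_sym_range. lia.
Qed.

Lemma polya_decay_pos : 0 < PI ^ 2 * tau / 18.
Proof. apply Rdiv_lt_0_compat; [|lra]. apply Rmult_lt_0_compat; [|easy]. apply pow_lt, PI_RGT_0. Qed.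

(** On the window $|y|\le\pi/2\le2$, thanks to $|x|\le1/2$, so $\cos^{2m}y\le e^{-my^2/9}$; with
    $m/l^2\ge\tau/2$ this yields the exponent $\pi^2\tau/18$. *)
Lemma polya_space_dominated x : Rabs x <= / 2 -> exists n0, forall L j, (n0 <= L)%nat ->
  Cmod (polya_space x L j) <= exp (PI ^ 2 * tau / 18 * x ^ 2) * (1 + / (PI ^ 2 * tau / 18 / 2)) * pz j.
Proof.
intros Hx. destruct polya_m_ratio_eventually as [N HN]. exists N. intros L j HL. specialize (HN L HL).
pose proof PI_RGT_0 as HPI. pose proof (polya_l_pos L) as Hl.
unfold polya_space. destruct (in_dec Z.eq_dec j (sym_range L)) as [Hj|_].
2:{ rewrite Cmod_0. apply Rmult_le_pos; [|apply Rlt_le, pz_ge0]. apply gauss_const_pos, polya_decay_pos. }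
eapply Rle_trans; [|apply gauss_shift_le, polya_decay_pos].
apply in_sym_range in Hj. set (y := PI * (x + IZR j) / l L).
assert (Hy : y ^ 2 <= 4).
{ assert (H : Rabs (x + IZR j) <= l L / 2).
  { eapply Rle_trans; [apply Rabs_triang|]. rewrite <- abs_IZR. apply IZR_le in Hj. rewrite <- INR_IZR_INZ in Hj.
    unfold l. rewrite plus_INR, mult_INR. simpl (INR 2); simpl (INR 1). lra. }
  assert (Rabs y <= 2).
  { unfold y, Rdiv. rewrite !Rabs_mult, (Rabs_pos_eq PI), (Rabs_pos_eq (/ l L)) by (try apply Rlt_le, Rinv_0_lt_compat; lra).
    apply Rle_div_l; [lra|]. pose proof PI_4. pose proof (Rabs_pos (x + IZR j)). nra. }
  apply Rabs_le_between in H0. nra. }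
rewrite Cmod_R, <- RPow_abs. rewrite pow_mult, pow2_abs.
replace (cos y ^ 2) with (1 - sin y ^ 2) by (pose proof (sin2_cos2 y) as H; unfold Rsqr in H; simpl; lra).
destruct (sin_sqr_ge y Hy) as [_ H9].
assert (0 <= 1 - sin y ^ 2) by (pose proof (COS_bound y); pose proof (sin2_cos2 y) as H1; unfold Rsqr in H1; nra).
apply Rle_trans with (exp (- sin y ^ 2) ^ m L).
{ apply pow_incr. split; [easy|]. pose proof (exp_ineq1_le (- sin y ^ 2)). lra. }
rewrite exp_pow_INR. apply exp_le.
apply Rle_trans with (INR (m L) * - (y ^ 2 / 9)).
- pose proof (pos_INR (m L)). nra.
- replace (INR (m L) * - (y ^ 2 / 9)) with (- (PI ^ 2 * (x + IZR j) ^ 2 / 9 * (INR (m L) / l L ^ 2))) by (unfold y; field; lra).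
  apply Ropp_le_contravar.
  replace (PI ^ 2 * tau / 18 * (x + IZR j) ^ 2) with (PI ^ 2 * (x + IZR j) ^ 2 / 9 * (tau / 2)) by field.
  apply Rmult_le_compat_l; [|easy]. pose proof (pow2_ge_0 (PI * (x + IZR j))). nra.
Qed.

Definition polya_freq x L (v : Z) : C :=
  (RtoC (bin_weight (m L) (Z.of_nat (2 * L + 1) * v) / bin_weight (m L) 0) * E (2 * PI * IZR v * x))%C.

Lemma bin_ratio_abs L v : bin_weight (m L) (Z.of_nat (2 * L + 1) * v) = bin_weight (m L) (Z.of_nat ((2 * L + 1) * Z.abs_nat v)).
Proof.
rewrite Nat2Z.inj_mul. destruct (Z_lt_le_dec v 0).
- rewrite <- bin_weight_sym. f_equal. lia.
- f_equal. lia.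
Qed.

Lemma INR_abs_nat v : INR (Z.abs_nat v) = Rabs (IZR v).
Proof. now rewrite INR_IZR_INZ, Zabs2Nat.id_abs, abs_IZR. Qed.

(** For $k=l|v|$ both bounds of [bin_weight_ratio_bounds] have the form $(1-u)^k$ with $u\to0$ and
    $ku\to v^2/\tau$, which is $\pi v^2/t$ for $t=\pi\tau$. *)
Lemma polya_freq_lim x v : Cseq_lim (fun L => polya_freq x L v) (theta_freq (PI * tau) x v).
Proof.
pose proof PI_RGT_0 as HPI.
unfold polya_freq, theta_freq. apply Cseq_lim_mult; [|intros e He; exists 0%nat; intros; replace (_ - _)%C with (RtoC 0) by ring; now rewrite Cmod_0].
apply Cseq_lim_RtoC.
replace (PI / (PI * tau) * IZR v ^ 2) with (Rabs (IZR v) ^ 2 / tau) by (rewrite pow2_abs; field; lra).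
set (k := fun L => ((2 * L + 1) * Z.abs_nat v)%nat).
assert (Hk : forall L, INR (k L) = l L * Rabs (IZR v)) by (intros; unfold k; rewrite mult_INR, INR_abs_nat; reflexivity).
destruct polya_m_ratio_eventually as [N1 HN1].
assert (Hlm : is_lim_seq (fun L => / l L / (INR (m L) / l L ^ 2)) 0).
{ replace 0 with (0 / tau) by (field; lra). apply is_lim_seq_div'; [apply polya_inv_l_lim|apply polya_m_ratio_lim|lra]. }
assert (Hq : is_lim_seq (fun L => / (INR (m L) / l L ^ 2)) (/ tau)).
{ apply (is_lim_seq_inv _ tau); [apply polya_m_ratio_lim|]. intros H; inversion H; lra. }
assert (Hkm : is_lim_seq (fun L => INR (k L) / INR (m L)) 0).
{ apply is_lim_seq_ext_loc with (fun L => / l L / (INR (m L) / l L ^ 2) * Rabs (IZR v)).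
  - exists N1. intros L HL. pose proof (polya_m_pos L (HN1 L HL)). pose proof (polya_l_pos L). rewrite Hk. field. lra.
  - replace 0 with (0 * Rabs (IZR v)) by ring. apply is_lim_seq_mult'; [easy|apply is_lim_seq_const]. }
assert (Hkkm : is_lim_seq (fun L => INR (k L) * (INR (k L) / INR (m L))) (Rabs (IZR v) ^ 2 / tau)).
{ apply is_lim_seq_ext_loc with (fun L => Rabs (IZR v) ^ 2 * / (INR (m L) / l L ^ 2)).
  - exists N1. intros L HL. pose proof (polya_m_pos L (HN1 L HL)). pose proof (polya_l_pos L). rewrite Hk. field. lra.
  - apply is_lim_seq_mult'; [apply is_lim_seq_const|easy]. }
assert (Hev : eventually (fun L => (k L <= m L)%nat /\ (0 < m L)%nat)).
{ pose proof Hkm as H. apply is_lim_seq_spec in H. destruct (H (mkposreal 1 ltac:(lra))) as [N2 HN2].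
  exists (N1 + N2)%nat. intros L HL. pose proof (polya_m_pos L (HN1 L ltac:(lia))) as Hm.
  specialize (HN2 L ltac:(lia)). simpl in HN2. rewrite Rminus_0_r in HN2. apply Rabs_lt_between in HN2 as [_ HN2].
  apply Rlt_div_l in HN2; [|lra]. split; [apply INR_le; lra|]. apply INR_lt; simpl; lra. }
assert (Hpos : forall a b : nat, 0 <= INR a / (INR b)).
{ intros a [|b]; [unfold Rdiv; simpl; rewrite Rinv_0; lra|]. apply Rdiv_le_0_compat; [apply pos_INR|apply lt_0_INR; lia]. }
apply is_lim_seq_le_le_loc with (fun L => (1 - INR (k L) / INR (m L)) ^ k L) (fun L => (1 - INR (k L) / INR (m L + k L)) ^ k L).
- apply filter_imp with (2 := Hev). intros L [H1 H2].
  rewrite bin_ratio_abs. fold (k L). destruct (bin_weight_ratio_bounds (m L) (k L) H1 H2) as [B1 B2].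
  pose proof (bin_weight_0_pos (m L)) as Hb. rewrite plus_INR.
  split; [apply Rle_div_r; lra|apply Rle_div_l; lra].
- apply is_lim_seq_pow_exp; auto.
- apply is_lim_seq_pow_exp; auto.
  + apply is_lim_seq_le_le_loc with (fun _ => 0) (fun L => INR (k L) / INR (m L)); [|apply is_lim_seq_const|easy].
    apply filter_imp with (2 := Hev). intros L [H1 H2]. split; auto.
    apply Rmult_le_compat_l; [apply pos_INR|]. apply Rinv_le_contravar; [now apply lt_0_INR|apply le_INR; lia].
  + apply is_lim_seq_ext_loc with (fun L => INR (k L) * (INR (k L) / INR (m L)) / (1 + INR (k L) / INR (m L))).
    * apply filter_imp with (2 := Hev). intros L [H1 H2]. rewrite plus_INR. apply lt_0_INR in H2. pose proof (pos_INR (k L)). field. lra.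
    * replace (Finite (Rabs (IZR v) ^ 2 / tau)) with (Finite (Rabs (IZR v) ^ 2 / tau / (1 + 0))) by (f_equal; field; lra).
      apply is_lim_seq_div'; [easy| |lra]. apply is_lim_seq_plus'; [apply is_lim_seq_const|easy].
Qed.

(** For $k=l|v|\le m$ one has $k^2/(m+k)\ge k^2/(2m)\ge v^2/(2\tau)$, because $m\le\tau l^2$; for
    $k>m$ the weight is zero. *)
Lemma polya_freq_dominated x : exists n0, forall L v, (n0 <= L)%nat ->
  Cmod (polya_freq x L v) <= (1 + / (/ (2 * tau))) * pz v.
Proof.
destruct polya_m_ratio_eventually as [N HN]. exists N. intros L v HL. specialize (HN L HL).
pose proof (polya_m_pos L HN) as Hm. pose proof (polya_l_pos L) as Hl. pose proof (polya_m_spec L) as [Hs _].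
unfold polya_freq. rewrite Cmod_mult, Cmod_E, Rmult_1_r, Cmod_R.
eapply Rle_trans; [|apply gauss_le_pz; apply Rinv_0_lt_compat; lra].
rewrite bin_ratio_abs. set (k := ((2 * L + 1) * Z.abs_nat v)%nat).
assert (Hk : INR k = l L * Rabs (IZR v)) by (unfold k; rewrite mult_INR, INR_abs_nat; reflexivity).
pose proof (bin_weight_0_pos (m L)) as Hb.
assert (Hm0 : (0 < m L)%nat) by (apply INR_lt; simpl; lra).
destruct (le_lt_dec k (m L)) as [Hkm|Hkm].
- destruct (bin_weight_ratio_bounds (m L) k Hkm Hm0) as [B1 B2].
  assert (Hk0 : 0 <= INR k) by apply pos_INR.
  assert (Hkm' : INR k <= INR (m L)) by now apply le_INR.
  assert (0 <= (1 - INR k / INR (m L)) ^ k).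
  { apply pow_le. assert (INR k / INR (m L) <= 1) by (apply Rle_div_l; lra). lra. }
  rewrite Rabs_pos_eq by (apply Rdiv_le_0_compat; [|easy]; eapply Rle_trans; [|apply B1]; nra).
  apply Rle_div_l; [easy|]. rewrite Rmult_comm. eapply Rle_trans; [apply B2|]. apply Rmult_le_compat_l; [lra|].
  apply Rle_trans with (exp (- (INR k / (INR (m L) + INR k))) ^ k).
  { apply pow_incr. assert (INR k / (INR (m L) + INR k) <= 1) by (apply Rle_div_l; lra).
    pose proof (exp_ineq1_le (- (INR k / (INR (m L) + INR k)))). lra. }
  rewrite exp_pow_INR. apply exp_le.
  assert (/ (2 * tau) * IZR v ^ 2 <= INR k * (INR k / (INR (m L) + INR k))); [|lra].
  replace (INR k * (INR k / (INR (m L) + INR k))) with (l L ^ 2 * IZR v ^ 2 / (INR (m L) + INR k)).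
  2:{ rewrite <- (pow2_abs (IZR v)). replace (l L ^ 2 * Rabs (IZR v) ^ 2) with (INR k * INR k) by (rewrite Hk; ring). field; lra. }
  apply (proj1 (Rle_div_r _ _ (INR (m L) + INR k) ltac:(lra))). apply Rle_trans with (/ (2 * tau) * IZR v ^ 2 * (2 * tau * l L ^ 2)).
  + apply Rmult_le_compat_l; [|lra]. apply Rmult_le_pos; [apply Rlt_le, Rinv_0_lt_compat; lra|apply pow2_ge_0].
  + apply Req_le. field. lra.
- rewrite bin_weight_out by lia. unfold Rdiv. rewrite Rmult_0_l, Rabs_R0. apply Rlt_le, exp_pos.
Qed.

Lemma polya_freq_sums x L :
  sums_to (polya_freq x L) (/ RtoC (l L * bin_weight (m L) 0) * list_sum (polya_space x L) (sym_range L))%C.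
Proof.
pose proof (polya_l_pos L). pose proof (bin_weight_0_pos (m L)).
pose proof (finite_poisson L (m L) x) as H1. apply (sums_to_scal (/ RtoC (l L * bin_weight (m L) 0))%C) in H1.
assert (HC1 : RtoC (l L) <> RtoC 0) by (apply RtoC_neq; lra).
assert (HC2 : RtoC (bin_weight (m L) 0) <> RtoC 0) by (apply RtoC_neq; lra).
rewrite (list_sum_ext (polya_space x L) (fun j => RtoC (cos (PI * (x + IZR j) / INR (2 * L + 1)) ^ (2 * m L)))).
- revert H1. apply sums_to_ext. intros v. unfold polya_freq. fold (l L). rewrite RtoC_div by lra.
  rewrite RtoC_mult. field. auto.
- intros j Hj. unfold polya_space. now destruct (in_dec Z.eq_dec j (sym_range L)).
Qed.

Lemma polya_space_sums x L : sums_to (polya_space x L) (list_sum (polya_space x L) (sym_range L)).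
Proof.
apply sums_to_finite; [apply NoDup_sym_range|]. intros j Hj. unfold polya_space.
now destruct (in_dec Z.eq_dec j (sym_range L)).
Qed.

(** After division by $l$ times the central weight, both sides of [finite_poisson] converge to theta
    sums. At $x=0$ these are positive reals, so the divisor itself converges; its limit [kappa] then
    serves every [x]. *)
Lemma theta_up_to_constant :
  exists kappa : R, is_lim_seq (fun L => l L * bin_weight (m L) 0) kappa /\
    forall x A B, Rabs x <= / 2 -> sums_to (theta_space (PI * tau) x) A -> sums_to (theta_freq (PI * tau) x) B ->
      A = (kappa * B)%C.
Proof.
pose proof PI_RGT_0 as HPI.
assert (Hpt : 0 < PI * tau) by nra.
assert (HS : forall x A, Rabs x <= / 2 -> sums_to (theta_space (PI * tau) x) A ->
   Cseq_lim (fun L => list_sum (polya_space x L) (sym_range L)) A).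
{ intros x A Hx HA. destruct (polya_space_dominated x Hx) as [n0 Hd].
  apply (sums_to_dominated (polya_space x) (theta_space (PI * tau) x) _ _ A n0
    (summable_scal _ _ (gauss_const_pos (PI ^ 2 * tau / 18) x polya_decay_pos) summable_pz) Hd); auto using polya_space_lim, polya_space_sums. }
assert (HF : forall x B, sums_to (theta_freq (PI * tau) x) B ->
   Cseq_lim (fun L => / RtoC (l L * bin_weight (m L) 0) * list_sum (polya_space x L) (sym_range L))%C B).
{ intros x B HB. destruct (polya_freq_dominated x) as [n0 Hd].
  assert (Hc : 0 <= 1 + / (/ (2 * tau))) by (rewrite Rinv_inv; lra).
  apply (sums_to_dominated (polya_freq x) (theta_freq (PI * tau) x) _ _ B n0
    (summable_scal _ _ Hc summable_pz) Hd); auto using polya_freq_lim, polya_freq_sums. }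
assert (Hne : forall L, RtoC (l L * bin_weight (m L) 0) <> RtoC 0).
{ intros L. apply RtoC_neq. pose proof (polya_l_pos L). pose proof (bin_weight_0_pos (m L)). nra. }
destruct (theta_space_ex (PI * tau) 0 Hpt) as [A0 HA0]. destruct (theta_freq_ex (PI * tau) 0 Hpt) as [B0 HB0].
assert (Hx0 : Rabs 0 <= / 2) by (rewrite Rabs_R0; lra).
assert (HA0c : Cseq_lim (fun L => list_sum (polya_space 0 L) (sym_range L)) A0) by now apply HS.
assert (HAn : 1 / 2 * exp (- (PI * (PI * tau) * 0 ^ 2)) <= Re A0).
{ destruct (HA0 (1/2) ltac:(lra)) as [F0 H0]. destruct (union_spec (0%Z :: nil) F0) as (NU & I0 & I1).
  specialize (H0 _ NU I1). unfold theta_space in H0. rewrite list_sum_RtoC in H0.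
  pose proof (rsum_incl (fun x => exp (- (PI * (PI * tau) * (0 + IZR x) ^ 2))) (0%Z :: nil) _ ltac:(intros; apply Rlt_le, exp_pos)
    ltac:(repeat constructor; simpl; tauto) NU I0) as H1.
  rewrite rsum_cons in H1. unfold rsum at 1 in H1; simpl in H1. rewrite !Rplus_0_r, !Rmult_0_l, !Rmult_0_r, Ropp_0, exp_0 in H1.
  set (s := rsum _ _) in *. pose proof (re_le_Cmod (RtoC s - A0)%C) as H2. apply Rle_lt_trans with (1 := H2) in H0.
  simpl in H0. apply Rabs_lt_between in H0. replace (PI * (PI * tau) * 0 ^ 2) with 0 by ring. rewrite Ropp_0, exp_0. unfold Re. lra. }
replace (PI * (PI * tau) * 0 ^ 2) with 0 in HAn by ring. rewrite Ropp_0, exp_0 in HAn.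
assert (HA0n : A0 <> RtoC 0) by (intros ->; simpl in HAn; lra).
assert (Hinv : Cseq_lim (fun L => RtoC (/ (l L * bin_weight (m L) 0)) * list_sum (polya_space 0 L) (sym_range L))%C B0).
{ generalize (HF 0 B0 HB0). apply Cseq_lim_ext. intros L. rewrite RtoC_inv; [easy|]. pose proof (polya_l_pos L). pose proof (bin_weight_0_pos (m L)). nra. }
(* [A0] and [B0] are real, and [A0] is the limit of the product of [l * w] with the sequence tending to [B0]. *)
assert (HrA : exists u, (forall L, list_sum (polya_space 0 L) (sym_range L) = RtoC (u L))).
{ exists (fun L => rsum (fun j => if in_dec Z.eq_dec j (sym_range L) then cos (PI * (0 + IZR j) / l L) ^ (2 * m L) else 0) (sym_range L)).
  intros L. rewrite <- list_sum_RtoC. apply list_sum_ext. intros j _. unfold polya_space. now destruct (in_dec Z.eq_dec j (sym_range L)). }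
destruct HrA as [u Hu].
assert (HuA : is_lim_seq u (Re A0)).
{ apply Cseq_lim_to_R. revert HA0c. apply Cseq_lim_ext. apply Hu. }
assert (HuB : is_lim_seq (fun L => / (l L * bin_weight (m L) 0) * u L) (Re B0)).
{ apply Cseq_lim_to_R. revert Hinv. apply Cseq_lim_ext. intros L. now rewrite Hu, RtoC_mult. }
assert (HB0n : 0 < Re B0).
{ destruct (HB0 (1/2) ltac:(lra)) as [F0 H0]. destruct (union_spec (0%Z :: nil) F0) as (NU & I0 & I1).
  specialize (H0 _ NU I1).
  rewrite (list_sum_ext _ (fun v => RtoC (exp (- (PI / (PI * tau) * IZR v ^ 2))))) in H0.
  2:{ intros v _. unfold theta_freq. rewrite Rmult_0_r, E_0. ring. }
  rewrite list_sum_RtoC in H0.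
  pose proof (rsum_incl (fun v => exp (- (PI / (PI * tau) * IZR v ^ 2))) (0%Z :: nil) _ ltac:(intros; apply Rlt_le, exp_pos)
    ltac:(repeat constructor; simpl; tauto) NU I0) as H1.
  rewrite rsum_cons in H1. unfold rsum at 1 in H1; simpl in H1. rewrite !Rplus_0_r, !Rmult_0_l, !Rmult_0_r, Ropp_0, exp_0 in H1.
  set (s := rsum _ _) in *. pose proof (re_le_Cmod (RtoC s - B0)%C) as H2. apply Rle_lt_trans with (1 := H2) in H0.
  simpl in H0. apply Rabs_lt_between in H0. unfold Re. lra. }
exists (Re A0 / Re B0).
assert (Hk : is_lim_seq (fun L => l L * bin_weight (m L) 0) (Re A0 / Re B0)).
{ apply is_lim_seq_ext_loc with (fun L => u L / (/ (l L * bin_weight (m L) 0) * u L)).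
  - apply is_lim_seq_spec in HuA. destruct (HuA (mkposreal (1/2) ltac:(lra))) as [N HN]. exists N. intros L HL.
    specialize (HN L HL). simpl in HN. apply Rabs_lt_between in HN. pose proof (polya_l_pos L). pose proof (bin_weight_0_pos (m L)).
    field. repeat split; lra.
  - apply is_lim_seq_div'; auto. lra. }
split; [easy|].
intros x A B Hx HA HB. specialize (HS x A Hx HA). specialize (HF x B HB).
apply (Cseq_lim_unique _ _ _ HS).
pose proof (Cseq_lim_mult _ _ _ _ (Cseq_lim_RtoC _ _ Hk) HF) as H.
revert H. apply Cseq_lim_ext. intros L. field. apply Hne.
Qed.

End Polya.

Lemma bin_weight_0_S m : bin_weight (S m) 0 = bin_weight m 0 * ((2 * INR m + 1) / (2 * INR m + 2)).
Proof.
unfold bin_weight. rewrite !Z.sub_0_r, !Z.add_0_r, !rfact_nat.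
replace (2 * S m)%nat with (S (S (2 * m))) by lia.
rewrite !fact_simpl, !mult_INR, !S_INR, mult_INR. simpl (INR 2). simpl pow.
pose proof (INR_fact_neq_0 m). pose proof (pos_INR m). field.
repeat split; auto; try lra. apply pow_nonzero; lra.
Qed.

(** For $n\ge1$ the ratio of the values at $n+1$ and $n$ is $(2n+1)^2/(4n(n+1))>1$. *)
Lemma central_weight_increasing m n : (m <= n)%nat ->
  INR m * bin_weight m 0 ^ 2 <= INR n * bin_weight n 0 ^ 2.
Proof.
induction 1 as [|n Hn IH]; [lra|]. eapply Rle_trans; [apply IH|].
rewrite bin_weight_0_S, S_INR. pose proof (pos_INR n) as Hp.
set (q := INR n) in *. set (w := bin_weight n 0).
replace ((q + 1) * (w * ((2 * q + 1) / (2 * q + 2))) ^ 2) with (w ^ 2 * ((2 * q + 1) ^ 2 / (4 * (q + 1)))) by (field; lra).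
rewrite Rmult_comm. apply Rmult_le_compat_l; [apply pow2_ge_0|]. apply Rle_div_r; nra.
Qed.

(** Along the exponents for [tau], $m$ times the squared central weight tends to $\tau k^2$, since
    $m\sim\tau l^2$. By monotonicity each such value is eventually reached or exceeded along the
    exponents for [tau']. Used in both directions, this makes $\tau k^2$ independent of $\tau$. *)
Lemma central_weight_le_limit tau tau' k k' : 0 < tau -> 0 < tau' ->
  is_lim_seq (fun L => INR (2 * L + 1) * bin_weight (polya_exponent tau L) 0) (Finite k) ->
  is_lim_seq (fun L => INR (2 * L + 1) * bin_weight (polya_exponent tau' L) 0) (Finite k') ->
  tau * k ^ 2 <= tau' * k' ^ 2.
Proof.
assert (HL : forall tau k, 0 < tau ->
  is_lim_seq (fun L => INR (2 * L + 1) * bin_weight (polya_exponent tau L) 0) (Finite k) ->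
  is_lim_seq (fun L => INR (polya_exponent tau L) * bin_weight (polya_exponent tau L) 0 ^ 2) (Finite (tau * k ^ 2))).
{ intros t a Ht Ha. apply is_lim_seq_ext with (fun L => INR (polya_exponent t L) / INR (2 * L + 1) ^ 2 *
    ((INR (2 * L + 1) * bin_weight (polya_exponent t L) 0) * (INR (2 * L + 1) * bin_weight (polya_exponent t L) 0))).
  - intros L. pose proof (polya_l_pos L). field. lra.
  - apply is_lim_seq_mult'; [now apply polya_m_ratio_lim|].
    replace (Finite (a ^ 2)) with (Finite (a * a)) by (f_equal; ring). now apply is_lim_seq_mult'. }
intros Ht Ht' Hk Hk'. apply HL in Hk; auto. apply HL in Hk'; auto.
apply (is_lim_seq_le (fun L => INR (polya_exponent tau L) * bin_weight (polya_exponent tau L) 0 ^ 2) (fun _ => tau' * k' ^ 2) (Finite (tau * k ^ 2)) (Finite (tau' * k' ^ 2))); auto using is_lim_seq_const.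
intros L.
apply (is_lim_seq_le_loc (fun _ => INR (polya_exponent tau L) * bin_weight (polya_exponent tau L) 0 ^ 2)
   (fun L' => INR (polya_exponent tau' L') * bin_weight (polya_exponent tau' L') 0 ^ 2)
   (Finite (INR (polya_exponent tau L) * bin_weight (polya_exponent tau L) 0 ^ 2)) (Finite (tau' * k' ^ 2))); auto using is_lim_seq_const.
destruct (polya_m_le_lim tau' Ht' (INR (polya_exponent tau L))) as [N HN]. exists N. intros n Hn.
apply central_weight_increasing, INR_le. auto.
Qed.

(** The limit constant is [c / sqrt t] with [c] independent of [t], because [m * bin_weight m 0 ^ 2]
    is monotone in [m]; the self-dual case [t = 1], [x = 0] gives [c = 1]. *)
Lemma theta_inversion_half t x A B : 0 < t -> Rabs x <= / 2 ->
  sums_to (theta_space t x) A -> sums_to (theta_freq t x) B -> A = (RtoC (/ sqrt t) * B)%C.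
Proof.
intros Ht Hx. pose proof PI_RGT_0 as HPI.
assert (Hi : 0 < 1 / PI) by (apply Rdiv_lt_0_compat; lra).
destruct (theta_up_to_constant (1 / PI) Hi) as (k1 & Hk1 & H1).
assert (Hti : 0 < t / PI) by (apply Rdiv_lt_0_compat; lra).
destruct (theta_up_to_constant (t / PI) Hti) as (k & Hk & H).
assert (E1 : PI * (1 / PI) = 1) by (field; lra). assert (Et : PI * (t / PI) = t) by (field; lra).
rewrite E1 in H1. rewrite Et in H.
assert (Hk1' : k1 = 1).
{ destruct (theta_space_ex 1 0 ltac:(lra)) as [A0 HA0].
  assert (HB0 : sums_to (theta_freq 1 0) A0).
  { revert HA0. apply sums_to_ext. intros v. unfold theta_space, theta_freq.
    rewrite Rmult_0_r, E_0, Cmult_1_r, Rplus_0_l. do 3 f_equal. field. }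
  pose proof (H1 0 A0 A0 ltac:(rewrite Rabs_R0; lra) HA0 HB0) as E0.
  assert (HA0n : A0 <> RtoC 0).
  { intros ->. destruct (HA0 1 ltac:(lra)) as [F0 H0]. destruct (union_spec (0%Z :: nil) F0) as (NU & I0 & I1).
    specialize (H0 _ NU I1). unfold theta_space in H0. rewrite list_sum_RtoC, <- RtoC_minus, Cmod_R in H0.
    pose proof (rsum_incl (fun x => exp (- (PI * 1 * (0 + IZR x) ^ 2))) (0%Z :: nil) _ ltac:(intros; apply Rlt_le, exp_pos)
      ltac:(repeat constructor; simpl; tauto) NU I0) as H2.
    rewrite rsum_cons in H2. unfold rsum at 1 in H2; simpl in H2. rewrite !Rplus_0_r, !Rmult_0_l, !Rmult_0_r, Ropp_0, exp_0 in H2.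
    apply Rabs_lt_between in H0. simpl in H0. lra. }
  assert (E2 : RtoC k1 = RtoC 1).
  { replace (RtoC k1) with (k1 * A0 / A0)%C by (field; auto). rewrite <- E0. field; auto. }
  now inversion E2. }
subst k1.
assert (Hkt : k = / sqrt t).
{ pose proof (central_weight_le_limit _ _ _ _ Hi Hti Hk1 Hk) as L1.
  pose proof (central_weight_le_limit _ _ _ _ Hti Hi Hk Hk1) as L2.
  assert (Hk2 : k ^ 2 = / t).
  { apply Rmult_eq_reg_l with (t / PI); [|lra]. replace (t / PI * / t) with (1 / PI * 1 ^ 2) by (field; lra). lra. }
  assert (0 <= k).
  { apply (is_lim_seq_le (fun _ => 0) _ (Finite 0) (Finite k)) with (2 := is_lim_seq_const 0) (3 := Hk).
    intros L. apply Rmult_le_pos; [apply pos_INR|apply Rlt_le, bin_weight_0_pos]. }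
  rewrite <- sqrt_inv, <- Hk2. symmetry. now apply sqrt_pow2. }
subst k. intros HA HB. now apply (H x).
Qed.

(** Both sides have period one in [x], so [x] can be moved into $[-1/2,1/2]$; subtracting
    [up (x - / 2)] does this. *)
Lemma theta_inversion t x B : 0 < t ->
  sums_to (theta_freq t x) B -> sums_to (theta_space t x) (RtoC (/ sqrt t) * B)%C.
Proof.
intros Ht HB.
destruct (archimed (x - / 2)) as [U1 U2]. set (n := up (x - / 2)) in *.
assert (Hx : Rabs (x - IZR n) <= / 2) by (apply Rabs_le; lra).
assert (HB' : sums_to (theta_freq t (x - IZR n)) B).
{ revert HB. apply sums_to_ext. intros v. unfold theta_freq. f_equal.
  rewrite <- (E_periodic _ (- (v * n))). f_equal. rewrite opp_IZR, mult_IZR. ring. }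
destruct (theta_space_ex t (x - IZR n) Ht) as [A HA].
rewrite <- (theta_inversion_half t (x - IZR n) A B Ht Hx HA HB').
pose proof (sums_to_bij _ (fun j => (j + n)%Z) (fun j => (j - n)%Z) _ ltac:(intros; simpl; lia) ltac:(intros; simpl; lia) HA) as H.
revert H. apply sums_to_ext. intros j. unfold theta_space. rewrite plus_IZR. do 4 f_equal. f_equal. ring.
Qed.

(** * The complex exponential, the character and its Gauss sum *)

Definition cexp (z : C) : C := (exp (Re z) * E (Im z))%C.

Lemma cexp_plus a b : cexp (a + b)%C = (cexp a * cexp b)%C.
Proof.
unfold cexp. destruct a as [a1 a2], b as [b1 b2]; simpl. rewrite E_plus, exp_plus, RtoC_mult. ring.
Qed.

Lemma cexp_0 : cexp 0 = RtoC 1.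
Proof. unfold cexp; simpl. rewrite exp_0, E_0. ring. Qed.

Lemma Cmod_cexp z : Cmod (cexp z) = exp (Re z).
Proof. unfold cexp. rewrite Cmod_mult, Cmod_E, Cmod_exp. ring. Qed.

Lemma cexp_RtoC x : cexp (RtoC x) = RtoC (exp x).
Proof. unfold cexp; simpl. rewrite E_0. ring. Qed.

Lemma cexp_neq_0 z : cexp z <> RtoC 0.
Proof. intros H. apply (f_equal Cmod) in H. rewrite Cmod_cexp, Cmod_0 in H. pose proof (exp_pos (Re z)). lra. Qed.

Lemma Rcpow_cexp t s : Rcpow t s = cexp (s * RtoC (ln t))%C.
Proof.
unfold Rcpow, cexp, E. destruct s as [x y]. apply injective_projections; simpl.
- rewrite !Rmult_0_r, !Rmult_0_l, !Rminus_0_r, Rplus_0_l. easy.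
- rewrite !Rmult_0_r, !Rmult_0_l, !Rminus_0_r, Rplus_0_r, Rplus_0_l. easy.
Qed.

Lemma im_le_Cmod z : Rabs (Im z) <= Cmod z.
Proof. eapply Rle_trans; [apply Rmax_r|apply Rmax_Cmod]. Qed.

Lemma Cmod_E_minus_1 y : Cmod (E y - 1)%C <= Rabs y.
Proof.
replace y with (2 * (y / 2)) at 1 by field. rewrite E_double, !Cmod_mult, Cmod_E, Cmod_Ci, !Cmod_R, (Rabs_pos_eq 2) by lra.
pose proof (abs_sin_le (y / 2)) as H. unfold Rdiv in H at 2. rewrite Rabs_mult, (Rabs_pos_eq (/ 2)) in H by lra. lra.
Qed.

Lemma exp_minus_1_abs x : Rabs (exp x - 1) <= Rabs x * exp (Rabs x).
Proof.
pose proof (exp_ineq1_le x). pose proof (exp_ineq1_le (- x)). pose proof (exp_pos x).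
assert (exp x * exp (- x) = 1) by (rewrite <- exp_plus, Rplus_opp_r; apply exp_0).
destruct (Rle_dec 0 x).
- rewrite (Rabs_pos_eq x), Rabs_pos_eq by lra. nra.
- rewrite (Rabs_left x), Rabs_left1 by nra. pose proof (exp_ineq1_le (- x)). nra.
Qed.

Lemma exp_taylor2_abs x : Rabs (exp x - 1 - x) <= x ^ 2 * exp (Rabs x).
Proof.
pose proof (exp_ineq1_le x). pose proof (exp_ineq1_le (- x)). pose proof (exp_pos x).
assert (exp x * exp (- x) = 1) by (rewrite <- exp_plus, Rplus_opp_r; apply exp_0).
assert (exp x - 1 <= x * exp x) by nra.
rewrite Rabs_pos_eq by lra.
destruct (Rle_dec 0 x).
- rewrite Rabs_pos_eq by lra. nra.
- rewrite Rabs_left by lra. nra.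
Qed.

Lemma Cmod_E_taylor2 y : Cmod (E y - 1 - Ci * RtoC y)%C <= 3 * y ^ 2.
Proof.
replace (E y - 1 - Ci * RtoC y)%C with (RtoC (cos y - 1) + Ci * RtoC (sin y - y))%C.
2:{ unfold E. apply injective_projections; simpl; ring. }
eapply Rle_trans; [apply Cmod_triangle|]. rewrite Cmod_mult, Cmod_Ci, !Cmod_R, Rmult_1_l.
assert (H1 : Rabs (cos y - 1) <= y ^ 2 / 2).
{ replace (cos y) with (1 - 2 * sin (y / 2) * sin (y / 2)) by (rewrite <- cos_2a_sin; f_equal; field).
  pose proof (sin_sqr_le (y / 2)). apply Rabs_le. nra. }
assert (H2 : Rabs (sin y - y) <= 2 * y ^ 2).
{ assert (Hp : forall z, 0 <= z -> Rabs (sin z - z) <= 2 * z ^ 2).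
  { intros z Hz. destruct (Rle_dec z 1).
    - pose proof (sin_cube_lower z Hz). pose proof (abs_sin_le z) as A. rewrite (Rabs_pos_eq z) in A by lra.
      apply Rabs_le_between in A. apply Rabs_le. nra.
    - pose proof (SIN_bound z). apply Rabs_le. nra. }
  destruct (Rle_dec 0 y); [now apply Hp|].
  replace (sin y - y) with (- (sin (- y) - - y)) by (rewrite sin_neg; ring).
  rewrite Rabs_Ropp. replace (y ^ 2) with ((- y) ^ 2) by ring. apply Hp. lra. }
pose proof (pow2_ge_0 y). lra.
Qed.

Lemma Cmod_cexp_minus_1 u : Cmod (cexp u - 1)%C <= 2 * Cmod u * exp (Cmod u).
Proof.
destruct u as [x y]. set (u := (x, y)). pose proof (re_le_Cmod u) as H1. pose proof (im_le_Cmod u) as H2. simpl in H1, H2.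
replace (cexp u - 1)%C with (RtoC (exp x - 1) * E y + (E y - 1))%C.
2:{ unfold cexp; simpl. rewrite RtoC_minus. ring. }
eapply Rle_trans; [apply Cmod_triangle|]. rewrite Cmod_mult, Cmod_E, Cmod_R.
pose proof (exp_minus_1_abs x) as A. pose proof (Cmod_E_minus_1 y) as B.
pose proof (exp_le _ _ H1) as H3. pose proof (Rabs_pos x). pose proof (exp_pos (Rabs x)).
assert (1 <= exp (Cmod u)) by (pose proof (exp_ineq1_le (Cmod u)); pose proof (Cmod_ge_0 u); lra).
assert (Rabs x * exp (Rabs x) <= Cmod u * exp (Cmod u)) by (apply Rmult_le_compat; lra).
assert (Rabs y * 1 <= Cmod u * exp (Cmod u)) by (apply Rmult_le_compat; try lra; apply Rabs_pos).
lra.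
Qed.

Lemma Cmod_cexp_taylor2 u : Cmod (cexp u - 1 - u)%C <= 5 * Cmod u ^ 2 * exp (Cmod u).
Proof.
destruct u as [x y]. set (u := (x, y)). pose proof (re_le_Cmod u) as H1. pose proof (im_le_Cmod u) as H2. simpl in H1, H2.
replace (cexp u - 1 - u)%C with (RtoC (exp x - 1 - x) + RtoC (exp x - 1) * (E y - 1) + (E y - 1 - Ci * RtoC y))%C.
2:{ unfold cexp, u, E; simpl. apply injective_projections; simpl; ring. }
eapply Rle_trans; [apply Cmod_triangle|]. eapply Rle_trans; [apply Rplus_le_compat_r, Cmod_triangle|].
rewrite Cmod_mult, !Cmod_R.
pose proof (exp_taylor2_abs x) as A. pose proof (exp_minus_1_abs x) as A'. pose proof (Cmod_E_minus_1 y) as B. pose proof (Cmod_E_taylor2 y) as D.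
pose proof (exp_le _ _ H1) as H3. pose proof (Rabs_pos x). pose proof (Rabs_pos y). pose proof (exp_pos (Rabs x)). pose proof (Cmod_ge_0 u).
assert (1 <= exp (Cmod u)) by (pose proof (exp_ineq1_le (Cmod u)); lra).
assert (X2 : x ^ 2 <= Cmod u ^ 2) by (rewrite <- pow2_abs; apply pow_incr; lra).
assert (Y2 : y ^ 2 <= Cmod u ^ 2) by (rewrite <- pow2_abs; apply pow_incr; lra).
assert (T1 : x ^ 2 * exp (Rabs x) <= Cmod u ^ 2 * exp (Cmod u)) by (apply Rmult_le_compat; try lra; apply pow2_ge_0).
assert (T2 : Rabs (exp x - 1) * Cmod (E y - 1) <= (Cmod u * exp (Cmod u)) * Cmod u).
{ apply Rmult_le_compat; try apply Rabs_pos; try apply Cmod_ge_0; [|lra]. eapply Rle_trans; [apply A'|]. apply Rmult_le_compat; lra. }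
assert (T3 : y ^ 2 * 1 <= Cmod u ^ 2 * exp (Cmod u)) by (apply Rmult_le_compat; try lra; apply pow2_ge_0).
replace ((Cmod u * exp (Cmod u)) * Cmod u) with (Cmod u ^ 2 * exp (Cmod u)) in T2 by ring.
lra.
Qed.

(** * The quadratic character modulo 7 and its Gauss sum *)

Definition chi (c : Z) : Z := legendre c 7.

Lemma existsb_congr {A} (f g : A -> bool) l : (forall x, f x = g x) -> existsb f l = existsb g l.
Proof. intros H. induction l as [|a l IH]; simpl; [easy|]. now rewrite H, IH. Qed.

Lemma legendre7_mod a b : (a mod 7 = b mod 7)%Z -> legendre a 7 = legendre b 7.
Proof.
intros H. unfold legendre. rewrite H. destruct (b mod 7 =? 0)%Z; [easy|].
rewrite (existsb_congr _ (fun x : nat => ((Z.of_nat x ^ 2 - b) mod 7 =? 0)%Z)); [easy|].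
intros x. f_equal. rewrite <- Zminus_mod_idemp_r, H, Zminus_mod_idemp_r. easy.
Qed.

Lemma chi_mod a b : (a mod 7 = b mod 7)%Z -> chi a = chi b.
Proof. apply legendre7_mod. Qed.

Lemma mod7_cases (P : Z -> Prop) :
  P 0%Z -> P 1%Z -> P 2%Z -> P 3%Z -> P 4%Z -> P 5%Z -> P 6%Z -> forall a, P (a mod 7)%Z.
Proof.
intros. pose proof (Z.mod_pos_bound a 7 ltac:(lia)).
assert (D : (a mod 7 = 0 \/ a mod 7 = 1 \/ a mod 7 = 2 \/ a mod 7 = 3 \/ a mod 7 = 4 \/ a mod 7 = 5 \/ a mod 7 = 6)%Z) by lia.
destruct D as [->|[->|[->|[->|[->|[->| ->]]]]]]; easy.
Qed.

Lemma chi_bound a : (Z.abs (chi a) <= 1)%Z.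
Proof.
unfold chi, legendre. destruct (a mod 7 =? 0)%Z; [lia|]. destruct (existsb _ _); lia.
Qed.

Lemma chi_2 a : chi (2 * a) = chi a.
Proof.
rewrite (chi_mod (2 * a) (2 * (a mod 7))), (chi_mod a (a mod 7)).
- pattern (a mod 7)%Z. apply mod7_cases; reflexivity.
- now rewrite Zmod_mod.
- now rewrite Zmult_mod_idemp_r.
Qed.

Lemma chi_opp a : chi (- a) = (- chi a)%Z.
Proof.
rewrite (chi_mod (- a) (0 - (a mod 7))), (chi_mod a (a mod 7)).
- pattern (a mod 7)%Z. apply mod7_cases; reflexivity.
- now rewrite Zmod_mod.
- now rewrite Zminus_mod_idemp_r.
Qed.

(** Modulo 7 the cubic form is $(2a+b)^3$, and the Legendre symbol of a cube is that of its base.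
    The proof reduces to residues and checks the 49 cases. *)
Lemma eps_chi a b : eps a b = chi (2 * a + b).
Proof.
transitivity (eps (a mod 7) (b mod 7)).
- apply legendre7_mod.
  rewrite (Z.div_mod a 7) at 1 2 3 by lia. rewrite (Z.div_mod b 7) at 1 2 3 by lia.
  set (q := (a / 7)%Z). set (r := (a mod 7)%Z). set (q' := (b / 7)%Z). set (r' := (b mod 7)%Z).
  match goal with |- (?A mod 7 = ?B mod 7)%Z =>
    assert (D : exists k, A = (B + k * 7)%Z) end.
  { exists (49 * q ^ 3 + 21 * q ^ 2 * r + 3 * q * r ^ 2 - 2 * (49 * q ^ 2 * q' + 7 * q ^ 2 * r' + 14 * q * r * q' + 2 * q * r * r' + r ^ 2 * q')
       - (49 * q * q' ^ 2 + 14 * q * q' * r' + q * r' ^ 2 + 7 * r * q' ^ 2 + 2 * r * q' * r') + 49 * q' ^ 3 + 21 * q' ^ 2 * r' + 3 * q' * r' ^ 2)%Z. ring. }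
  destruct D as [k ->]. now rewrite Z_mod_plus_full.
- rewrite (chi_mod (2 * a + b) (2 * (a mod 7) + b mod 7)).
  + pattern (b mod 7)%Z. apply mod7_cases; pattern (a mod 7)%Z; apply mod7_cases; reflexivity.
  + pose proof (Z.div_mod a 7 ltac:(lia)). pose proof (Z.div_mod b 7 ltac:(lia)).
    replace (2 * a + b)%Z with (2 * (a mod 7) + b mod 7 + (2 * (a / 7) + b / 7) * 7)%Z by lia.
    now rewrite Z_mod_plus_full.
Qed.

Definition residues7 : list Z := (0 :: 1 :: 2 :: 3 :: 4 :: 5 :: 6 :: nil)%Z.

Lemma list_sum_residues7_shift (h : Z -> C) s :
  (forall a b, (a mod 7 = b mod 7)%Z -> h a = h b) ->
  list_sum (fun r => h (r + s)%Z) residues7 = list_sum h residues7.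
Proof.
intros Hh. transitivity (list_sum (fun r => h ((r + s mod 7) mod 7)%Z) residues7).
- apply list_sum_ext. intros r _. apply Hh. now rewrite Zmod_mod, Zplus_mod_idemp_r.
- pattern (s mod 7)%Z. apply mod7_cases; cbv -[Cplus RtoC IZR C]; ring.
Qed.

Lemma sqrt7_sqr : sqrt 7 * sqrt 7 = 7.
Proof. apply sqrt_def; lra. Qed.

Lemma E_pow t n : Cpow (E t) n = E (INR n * t).
Proof.
induction n as [|n IH].
- simpl. now rewrite Rmult_0_l, E_0.
- rewrite Cpow_S, IH, <- E_plus, S_INR. f_equal. ring.
Qed.

Definition zeta7 : C := E (2 * PI / 7).

Lemma zeta7_pow7 : Cpow zeta7 7 = RtoC 1.
Proof.
unfold zeta7. rewrite E_pow. replace (INR 7 * (2 * PI / 7)) with (2 * PI * IZR 1) by (simpl; field). apply E_2PI_Z.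
Qed.

(** Decides the sign of the Gauss sum, which its square leaves open. *)
Lemma sin_PI_7_pos : 0 < sin (2 * PI / 7) + sin (4 * PI / 7) + sin (8 * PI / 7).
Proof.
pose proof PI_RGT_0.
replace (8 * PI / 7) with (PI / 7 + PI) by field. rewrite neg_sin.
assert (0 < sin (4 * PI / 7)) by (apply sin_gt_0; lra).
assert (sin (PI / 7) < sin (2 * PI / 7)) by (apply sin_increasing_1; lra).
lra.
Qed.

Lemma zeta7_sum : (1 + zeta7 + zeta7 ^ 2 + zeta7 ^ 3 + zeta7 ^ 4 + zeta7 ^ 5 + zeta7 ^ 6)%C = RtoC 0.
Proof.
pose proof zeta7_pow7 as H7.
assert (Hn : (zeta7 - 1)%C <> RtoC 0).
{ unfold zeta7, E. intros H0. apply (f_equal snd) in H0. simpl in H0.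
  assert (0 < sin (2 * PI / 7)) by (pose proof PI_RGT_0; apply sin_gt_0; lra). lra. }
assert (H : ((zeta7 - 1) * (1 + zeta7 + zeta7 ^ 2 + zeta7 ^ 3 + zeta7 ^ 4 + zeta7 ^ 5 + zeta7 ^ 6))%C = RtoC 0).
{ transitivity (Cpow zeta7 7 - 1)%C; [|rewrite H7; ring]. simpl. ring. }
destruct (classic ((1 + zeta7 + zeta7 ^ 2 + zeta7 ^ 3 + zeta7 ^ 4 + zeta7 ^ 5 + zeta7 ^ 6)%C = RtoC 0)) as [|Hc]; [easy|].
exfalso. now apply (Cmult_neq_0 _ _ Hn Hc).
Qed.

(** Pairing conjugate powers shows that the sum is $i$ times a real number $2S$; its square is $-7$,
    and $S>0$. *)
Lemma gauss_sum_1 : (zeta7 + zeta7 ^ 2 - zeta7 ^ 3 + zeta7 ^ 4 - zeta7 ^ 5 - zeta7 ^ 6)%C = (Ci * sqrt 7)%C.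
Proof.
set (G := (zeta7 + zeta7 ^ 2 - zeta7 ^ 3 + zeta7 ^ 4 - zeta7 ^ 5 - zeta7 ^ 6)%C).
set (S := sin (2 * PI / 7) + sin (4 * PI / 7) + sin (8 * PI / 7)).
assert (HG : G = (Ci * RtoC (2 * S))%C).
{ assert (H1 : (zeta7 ^ 6)%C = Cconj zeta7 /\ (zeta7 ^ 5)%C = Cconj (zeta7 ^ 2) /\ (zeta7 ^ 3)%C = Cconj (zeta7 ^ 4)).
  { assert (HC : forall j k, (j + k = 7)%nat -> (zeta7 ^ j)%C = Cconj (zeta7 ^ k)).
    { intros j k Hjk. unfold zeta7. rewrite !E_pow. unfold E, Cconj; cbn [fst snd].
      assert (Hj : INR j = 7 - INR k) by (replace 7 with (INR 7) by (simpl; lra); rewrite <- Hjk, plus_INR; lra).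
      rewrite Hj. replace ((7 - INR k) * (2 * PI / 7)) with (- (INR k * (2 * PI / 7)) + 2 * INR 1 * PI) by (simpl; field).
      rewrite cos_period, sin_period. rewrite cos_neg, sin_neg; easy. }
    split; [|split]; [rewrite (HC 6 1)%nat by easy; now rewrite Cpow_1_r|now apply HC|now apply HC]. }
  destruct H1 as (E6 & E5 & E3). unfold G. rewrite E6, E5, E3. unfold zeta7. rewrite !E_pow. unfold E, S.
  replace (INR 2 * (2 * PI / 7)) with (4 * PI / 7) by (simpl; field).
  replace (INR 4 * (2 * PI / 7)) with (8 * PI / 7) by (simpl; field).
  apply injective_projections; simpl; ring. }
assert (HS : (2 * S) * (2 * S) = 7).
{ assert (H2 : (G * G)%C = RtoC (-7)).
  { pose proof zeta7_sum as Z0. pose proof zeta7_pow7 as Z7.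
    set (z := zeta7) in *.
    assert (Hz6 : (z ^ 6)%C = (- (1 + z + z ^ 2 + z ^ 3 + z ^ 4 + z ^ 5))%C).
    { replace (z ^ 6)%C with ((1 + z + z ^ 2 + z ^ 3 + z ^ 4 + z ^ 5 + z ^ 6) - (1 + z + z ^ 2 + z ^ 3 + z ^ 4 + z ^ 5))%C by ring.
      rewrite Z0. ring. }
    (* Modulo $z^7-1$ the square of the sum is $-7+(1+z+\dots+z^6)$; the long factor is the quotient
       of this polynomial division. *)
    transitivity (-7 + (z ^ 7 - 1) * (z^5 + 2 * z^4 - z^3 + z - 6) + (1 + z + z ^ 2 + z ^ 3 + z ^ 4 + z ^ 5 + z ^ 6))%C.
    - unfold G. ring.
    - rewrite Z7, Z0. ring. }
  rewrite HG in H2. apply (f_equal fst) in H2. simpl in H2. lra. }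
pose proof sin_PI_7_pos as Hp. fold S in Hp.
rewrite HG. do 2 f_equal. rewrite <- HS. symmetry. apply sqrt_square. lra.
Qed.

Lemma E_zeta7 nu r : E (2 * PI * IZR nu * IZR r / 7) = Cpow zeta7 (Z.to_nat (((nu mod 7) * r) mod 7)).
Proof.
unfold zeta7. rewrite E_pow, INR_IZR_INZ, Z2Nat.id by (apply Z.mod_pos_bound; lia).
rewrite <- (E_periodic (IZR _ * _) ((nu / 7) * r + ((nu mod 7) * r) / 7)). f_equal.
rewrite plus_IZR, mult_IZR.
assert (H1 : IZR nu = 7 * IZR (nu / 7) + IZR (nu mod 7)) by (rewrite <- mult_IZR, <- plus_IZR; f_equal; apply Z.div_mod; lia).
assert (H2 : IZR (nu mod 7) * IZR r = 7 * IZR (((nu mod 7) * r) / 7) + IZR (((nu mod 7) * r) mod 7))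
  by (rewrite <- !mult_IZR, <- plus_IZR; f_equal; apply Z.div_mod; lia).
rewrite H1. replace (2 * PI * (7 * IZR (nu / 7) + IZR (nu mod 7)) * IZR r / 7) with
 (2 * PI * IZR (nu / 7) * IZR r + 2 * PI / 7 * (IZR (nu mod 7) * IZR r)) by field.
rewrite H2. field.
Qed.

(** For each residue of [nu] the exponents are permuted with total sign [chi nu], which reduces to
    [gauss_sum_1]; when 7 divides [nu] they all become zero and the values of [chi] cancel. *)
Lemma gauss_sum nu :
  list_sum (fun r => IZR (chi r) * E (2 * PI * IZR nu * IZR r / 7))%C residues7 = (Ci * sqrt 7 * IZR (chi nu))%C.
Proof.
rewrite (list_sum_ext _ (fun r => IZR (chi r) * Cpow zeta7 (Z.to_nat (((nu mod 7) * r) mod 7)))%C)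
  by (intros; now rewrite E_zeta7).
rewrite (chi_mod nu (nu mod 7)) by now rewrite Zmod_mod.
rewrite <- gauss_sum_1. unfold residues7. rewrite !list_sum_cons. unfold list_sum, map, fold_right.
change (chi 0) with 0%Z. change (chi 1) with 1%Z. change (chi 2) with 1%Z. change (chi 3) with (-1)%Z.
change (chi 4) with 1%Z. change (chi 5) with (-1)%Z. change (chi 6) with (-1)%Z.
pattern (nu mod 7)%Z. apply mod7_cases;
 repeat match goal with |- context [Z.to_nat ?x] => let y := eval vm_compute in (Z.to_nat x) in change (Z.to_nat x) with y end;
 repeat match goal with |- context [chi ?x] => let y := eval vm_compute in (chi x) in change (chi x) with y end;
 try rewrite !opp_IZR; simpl Cpow; try ring.
Qed.

(** * Gaussian sums over the lattice and their majorants *)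

Lemma elt_parts a b : elt a b = (IZR a + IZR b / 2, IZR b * sqrt 7 / 2).
Proof. unfold elt, eta. apply injective_projections; simpl; field. Qed.

Lemma normZ_IZR a b : IZR (normZ a b) = IZR a ^ 2 + IZR a * IZR b + 2 * IZR b ^ 2.
Proof. unfold normZ. rewrite !Z.pow_2_r, !plus_IZR, !mult_IZR. ring. Qed.

Lemma Cmod_elt_sqr a b : Cmod (elt a b) ^ 2 = IZR (normZ a b).
Proof.
rewrite normZ_IZR, elt_parts, Cmod2_alt. simpl Re; simpl Im. pose proof sqrt7_sqr as H7.
replace ((IZR b * sqrt 7 / 2) ^ 2) with (IZR b ^ 2 / 4 * (sqrt 7 * sqrt 7)) by field. rewrite H7. field.
Qed.

Definition lat_gauss (t : R) (p : Z * Z) : R :=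
  IZR (chi (2 * fst p + snd p)) * exp (- (2 * PI / 7 * t * IZR (normZ (fst p) (snd p)))).

Lemma chi_abs_le c : Rabs (IZR (chi c)) <= 1.
Proof. rewrite <- abs_IZR. apply IZR_le, chi_bound. Qed.

(** Completing the square in each coordinate: half of the Gaussian absorbs the linear term, at the
    price of a factor $e^{M^2/(2k)}$ per coordinate. *)
Lemma quad_dom k M : 0 < k -> exists K, 0 <= K /\ forall a b,
  exp (- (k * (IZR a ^ 2 + IZR b ^ 2)) + M * (Rabs (IZR a) + Rabs (IZR b))) <= K * (pz a * pz b).
Proof.
intros Hk. set (K1 := exp (M ^ 2 / (2 * k)) * (1 + / (k / 2))).
assert (HK1 : 0 <= K1).
{ apply Rmult_le_pos; [apply Rlt_le, exp_pos|]. assert (0 < / (k / 2)) by (apply Rinv_0_lt_compat; lra). lra. }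
assert (H1 : forall a, exp (- (k * IZR a ^ 2) + M * Rabs (IZR a)) <= K1 * pz a).
{ intros a. unfold K1. rewrite Rmult_assoc.
  apply Rle_trans with (exp (M ^ 2 / (2 * k)) * exp (- (k / 2 * IZR a ^ 2))).
  - rewrite <- exp_plus. apply exp_le. rewrite <- (pow2_abs (IZR a)). set (y := Rabs (IZR a)).
    assert (0 <= (M - k * y) ^ 2 / (2 * k)) by (apply Rdiv_le_0_compat; [apply pow2_ge_0|lra]).
    replace ((M - k * y) ^ 2 / (2 * k)) with (M ^ 2 / (2 * k) - M * y + k / 2 * y ^ 2) in H by (field; lra). lra.
  - apply Rmult_le_compat_l; [apply Rlt_le, exp_pos|]. apply gauss_le_pz. lra. }
exists (K1 * K1). split; [now apply Rmult_le_pos|]. intros a b.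
replace (- (k * (IZR a ^ 2 + IZR b ^ 2)) + M * (Rabs (IZR a) + Rabs (IZR b)))
 with ((- (k * IZR a ^ 2) + M * Rabs (IZR a)) + (- (k * IZR b ^ 2) + M * Rabs (IZR b))) by ring.
rewrite exp_plus. replace (K1 * K1 * (pz a * pz b)) with ((K1 * pz a) * (K1 * pz b)) by ring.
apply Rmult_le_compat; auto using Rlt_le, exp_pos.
Qed.

Lemma normZ_lower a b : / 2 * (IZR a ^ 2 + IZR b ^ 2) <= IZR (normZ a b).
Proof. rewrite normZ_IZR. pose proof (pow2_ge_0 (IZR a + IZR b)). pose proof (pow2_ge_0 (IZR b)). nra. Qed.

Lemma Cmod_elt_le a b : Cmod (elt a b) <= 2 * (Rabs (IZR a) + Rabs (IZR b)).
Proof.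
apply Rsqr_incr_0_var; [|pose proof (Rabs_pos (IZR a)); pose proof (Rabs_pos (IZR b)); lra].
rewrite !Rsqr_pow2, Cmod_elt_sqr, normZ_IZR, <- (pow2_abs (IZR a)), <- (pow2_abs (IZR b)).
pose proof (Rabs_pos (IZR a)). pose proof (Rabs_pos (IZR b)).
assert (IZR a * IZR b <= Rabs (IZR a) * Rabs (IZR b)) by (rewrite <- Rabs_mult; apply Rle_abs).
nra.
Qed.

Lemma lat_gauss_dom t M : 0 < t -> exists K, 0 <= K /\ forall p,
  Rabs (lat_gauss t p) * exp (M * Cmod (elt (fst p) (snd p))) <= K * (pz (fst p) * pz (snd p)).
Proof.
intros Ht. pose proof PI_RGT_0. set (k := 2 * PI / 7 * t / 2).
assert (Hk : 0 < k) by (unfold k; pose proof (Rmult_lt_0_compat _ _ H Ht); lra).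
destruct (quad_dom k (2 * Rabs M) Hk) as (K & HK & HB). exists K. split; [easy|]. intros [a b]. simpl fst; simpl snd.
eapply Rle_trans; [|apply HB]. unfold lat_gauss; simpl fst; simpl snd.
rewrite Rabs_mult, (Rabs_pos_eq (exp _)) by apply Rlt_le, exp_pos.
apply Rle_trans with (1 * exp (- (2 * PI / 7 * t * IZR (normZ a b))) * exp (M * Cmod (elt a b))).
- apply Rmult_le_compat_r; [apply Rlt_le, exp_pos|]. apply Rmult_le_compat_r; [apply Rlt_le, exp_pos|apply chi_abs_le].
- rewrite Rmult_1_l, <- exp_plus. apply exp_le. apply Rplus_le_compat.
  + apply Ropp_le_contravar. replace (k * (IZR a ^ 2 + IZR b ^ 2)) with (2 * PI / 7 * t * (/ 2 * (IZR a ^ 2 + IZR b ^ 2))) by (unfold k; field).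
    apply Rmult_le_compat_l; [unfold k in Hk; lra|apply normZ_lower].
  + pose proof (Cmod_elt_le a b). pose proof (Cmod_ge_0 (elt a b)). pose proof (Rle_abs M). pose proof (Rabs_pos M).
    apply Rle_trans with (Rabs M * Cmod (elt a b)); nra.
Qed.

Lemma Cmod_cexp_le z : Cmod (cexp z) <= exp (Cmod z).
Proof. rewrite Cmod_cexp. apply exp_le. eapply Rle_trans; [apply Rle_abs|apply re_le_Cmod]. Qed.

Lemma lat_gauss_cexp_ex t c : 0 < t ->
  exists S, sums_to (fun p => lat_gauss t p * cexp (c * elt (fst p) (snd p)))%C S.
Proof.
intros Ht. destruct (lat_gauss_dom t (Cmod c) Ht) as (K & HK & HB).
apply (sums_to_ex _ (fun p => K * (pz (fst p) * pz (snd p)))).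
- apply summable_scal; [easy|apply summable_pz2].
- intros p. eapply Rle_trans; [|apply HB]. rewrite Cmod_mult, Cmod_R. apply Rmult_le_compat_l; [apply Rabs_pos|].
  rewrite <- Cmod_mult. apply Cmod_cexp_le.
Qed.

(** * Functional equation of the theta series *)

Lemma choice_fun {A B} (P : A -> B -> Prop) : (forall a, exists b, P a b) -> exists f, forall a, P a (f a).
Proof.
intros H. exists (fun a => proj1_sig (constructive_indefinite_description _ (H a))).
intros a. apply proj2_sig.
Qed.

Section LatticeInversion.

Variables t w : R.
Hypothesis t_pos : 0 < t.

(** Left over from completing the square in the first coordinate. The second coordinate produces the
    inverse factor, since the linear form $z$ is isotropic for the norm form; the final identity
    thus contains no exponential of $w^2$. *)
Let shift_factor := exp (7 * w ^ 2 / (8 * PI * t)).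

(** The value of the lattice sum after inversion in the first coordinate only. *)
Definition half_dual (p : Z * Z) : C :=
  (RtoC (shift_factor * / sqrt (14 * t) * exp (- (PI / (14 * t) * IZR (snd p) ^ 2)) * exp (- (PI / (2 / t) * IZR (fst p) ^ 2)))
   * (Ci * sqrt 7 * IZR (chi (snd p))) * E (- (IZR (snd p) * w / (2 * t))) * E (PI * IZR (snd p) * IZR (fst p))
   * E (sqrt 7 * IZR (fst p) * w / 2))%C.

Definition lat_term (p : Z * Z) : C := (lat_gauss t p * cexp (RtoC w * elt (fst p) (snd p)))%C.

Definition dual_term (p : Z * Z) : C :=
  (Ci / t * (lat_gauss (/ t) p * cexp (- Ci * RtoC (w / t) * elt (fst p) (snd p))))%C.

Lemma half_dual_ex : exists S, sums_to half_dual S.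
Proof.
pose proof PI_RGT_0 as HPI.
assert (H1 : 0 < PI / (14 * t)) by (apply Rdiv_lt_0_compat; lra).
assert (H2 : 0 < PI / (2 / t)) by (apply Rdiv_lt_0_compat; [lra|apply Rdiv_lt_0_compat; lra]).
set (K := shift_factor * / sqrt (14 * t) * sqrt 7 * (1 + / (PI / (2 / t))) * (1 + / (PI / (14 * t)))).
assert (Hs : 0 < shift_factor * / sqrt (14 * t)).
{ apply Rmult_lt_0_compat; [apply exp_pos|]. apply Rinv_0_lt_compat, sqrt_lt_R0. lra. }
pose proof (sqrt_pos 7). pose proof (Rinv_0_lt_compat _ H1). pose proof (Rinv_0_lt_compat _ H2).
apply (sums_to_ex _ (fun p => K * (pz (fst p) * pz (snd p)))).
- apply summable_scal; [|apply summable_pz2]. unfold K. repeat apply Rmult_le_pos; try (lra || apply Rlt_le, exp_pos).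
  apply Rlt_le, Rinv_0_lt_compat, sqrt_lt_R0. lra.
- intros [b nu]. unfold half_dual. cbn [fst snd]. rewrite !Cmod_mult, !Cmod_E, Cmod_Ci, !Cmod_R.
  rewrite !Rmult_1_r, Rmult_1_l, (Rabs_pos_eq (sqrt 7)) by easy.
  pose proof (exp_pos (- (PI / (14 * t) * IZR nu ^ 2))). pose proof (exp_pos (- (PI / (2 / t) * IZR b ^ 2))).
  rewrite Rabs_pos_eq by (apply Rmult_le_pos; [apply Rmult_le_pos|]; lra).
  pose proof (gauss_le_pz _ nu H1) as G1. pose proof (gauss_le_pz _ b H2) as G2.
  apply Rle_trans with (shift_factor * / sqrt (14 * t) * ((1 + / (PI / (14 * t))) * pz nu) * ((1 + / (PI / (2 / t))) * pz b) * (sqrt 7 * 1)).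
  2:{ apply Req_le. unfold K. ring. }
  pose proof (chi_abs_le nu). pose proof (Rabs_pos (IZR (chi nu))).
  apply Rmult_le_compat.
  + repeat apply Rmult_le_pos; try (lra || apply Rlt_le, exp_pos). apply Rlt_le, Rinv_0_lt_compat, sqrt_lt_R0. lra.
  + apply Rmult_le_pos; lra.
  + apply Rmult_le_compat; try lra; [apply Rmult_le_pos; lra|]. apply Rmult_le_compat_l; lra.
  + apply Rmult_le_compat_l; lra.
Qed.

Let xr (r b : Z) := (IZR r + IZR b / 2) / 7 - w / (4 * PI * t).

Let row_const (b r : Z) : C :=
  (RtoC (IZR (chi (2 * r + b)) * shift_factor * exp (- (PI / (2 / t) * IZR b ^ 2))) * E (sqrt 7 * IZR b * w / 2))%C.

(** Completing the square in [n] for [a = 7 n + r]: each residue class in a row is a Jacobi theta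
    series of parameter $14t$, whose shift [xr] carries both the residue and [w]. *)
Lemma lat_term_residue b r n :
  lat_term (7 * n + r, b)%Z = (row_const b r * theta_space (14 * t) (xr r b) n)%C.
Proof.
pose proof PI_RGT_0 as HPI.
unfold lat_term, row_const, theta_space, lat_gauss, cexp. cbn [fst snd].
rewrite (chi_mod (2 * (7 * n + r) + b) (2 * r + b)).
2:{ replace (2 * (7 * n + r) + b)%Z with (2 * r + b + (2 * n) * 7)%Z by ring. apply Z_mod_plus_full. }
rewrite elt_parts.
replace (Im (RtoC w * ((IZR (7 * n + r) + IZR b / 2)%R, (IZR b * sqrt 7 / 2)%R))%C) with (sqrt 7 * IZR b * w / 2) by (simpl; field).
replace (Re (RtoC w * ((IZR (7 * n + r) + IZR b / 2)%R, (IZR b * sqrt 7 / 2)%R))%C) with (w * (IZR (7 * n + r) + IZR b / 2)) by (simpl; field).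
assert (He : exp (- (2 * PI / 7 * t * IZR (normZ (7 * n + r) b))) * exp (w * (IZR (7 * n + r) + IZR b / 2)) =
  shift_factor * exp (- (PI / (2 / t) * IZR b ^ 2)) * exp (- (PI * (14 * t) * (xr r b + IZR n) ^ 2))).
{ unfold shift_factor. rewrite <- !exp_plus. f_equal. unfold xr. rewrite normZ_IZR, plus_IZR, mult_IZR. field. lra. }
transitivity (RtoC (IZR (chi (2 * r + b)) * (exp (- (2 * PI / 7 * t * IZR (normZ (7 * n + r) b))) * exp (w * (IZR (7 * n + r) + IZR b / 2)))) * E (sqrt 7 * IZR b * w / 2))%C.
- rewrite !RtoC_mult. ring.
- rewrite He, !RtoC_mult. ring.
Qed.

(** Along a row the character depends only on [a] modulo 7, so the row splits into seven
    progressions to which [theta_inversion] applies; on the dual side the sum over the residues is a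
    Gauss sum, which produces [chi nu]. *)
Lemma lat_term_rows b : exists S, sums_to (fun a => lat_term (a, b)) S /\ sums_to (fun nu => half_dual (b, nu)) S.
Proof.
pose proof PI_RGT_0 as HPI.
assert (H14 : 0 < 14 * t) by lra.
destruct (choice_fun _ (fun r => theta_freq_ex (14 * t) (xr r b) H14)) as [B HB].
exists (list_sum (fun r => row_const b r * (RtoC (/ sqrt (14 * t)) * B r))%C residues7). split.
- pose proof (sums_to_list_sum (fun r a => if (a mod 7 =? r mod 7)%Z then lat_term (a, b) else RtoC 0)
    (fun r => row_const b r * (RtoC (/ sqrt (14 * t)) * B r))%C residues7) as H.
  eapply sums_to_ext; [|apply H].
  + intros a. simpl. unfold residues7. rewrite !list_sum_cons. unfold list_sum, map, fold_right.
    pattern (a mod 7)%Z. apply mod7_cases; simpl; ring.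
  + intros r. apply sums_to_push with (fun n => 7 * n + r)%Z.
    * intros x y Hxy. lia.
    * intros a Ha. destruct (Z.eqb_spec (a mod 7) (r mod 7)) as [E0|]; [|easy]. exfalso. apply (Ha ((a - r) / 7)%Z).
      assert (Hd : ((a - r) mod 7 = 0)%Z) by (rewrite Zminus_mod, E0, Z.sub_diag; reflexivity).
      pose proof (Z.div_mod (a - r) 7). lia.
    * pose proof (theta_inversion _ _ _ H14 (HB r)) as Hi. apply (sums_to_scal (row_const b r)) in Hi.
      revert Hi. apply sums_to_ext. intros n.
      replace ((7 * n + r) mod 7)%Z with (r mod 7)%Z by (rewrite Z.add_comm, Z.mul_comm, Z_mod_plus_full; easy).
      rewrite Z.eqb_refl. symmetry. apply lat_term_residue.
- pose proof (sums_to_list_sum (fun r nu => row_const b r * (RtoC (/ sqrt (14 * t)) * theta_freq (14 * t) (xr r b) nu))%C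
    (fun r => row_const b r * (RtoC (/ sqrt (14 * t)) * B r))%C residues7
    (fun r => sums_to_scal _ _ _ (sums_to_scal _ _ _ (HB r)))) as H.
  revert H. apply sums_to_ext. intros nu.
  set (X := (RtoC (shift_factor * / sqrt (14 * t) * exp (- (PI / (14 * t) * IZR nu ^ 2)) * exp (- (PI / (2 / t) * IZR b ^ 2)))
     * E (- (IZR nu * w / (2 * t))) * E (PI * IZR nu * IZR b) * E (sqrt 7 * IZR b * w / 2))%C).
  set (h := fun s => (IZR (chi s) * E (2 * PI * IZR nu * IZR s / 7))%C).
  transitivity (X * list_sum (fun r => h (r + 4 * b)%Z) residues7)%C.
  + rewrite <- list_sum_scal. apply list_sum_ext. intros r _. unfold h, X, row_const, theta_freq.
    (* $8\equiv1$ modulo 7 and 2 is a square there, so the character sees only [r + 4 b]; the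
       matching change of the phase is a whole number of turns. *)
    rewrite (chi_mod (2 * r + b) (2 * (r + 4 * b))), chi_2.
    2:{ replace (2 * (r + 4 * b))%Z with (2 * r + b + b * 7)%Z by ring. now rewrite Z_mod_plus_full. }
    replace (E (2 * PI * IZR nu * xr r b)) with (E (- (IZR nu * w / (2 * t))) * E (PI * IZR nu * IZR b) * E (2 * PI * IZR nu * IZR (r + 4 * b) / 7))%C.
    2:{ rewrite <- !E_plus, <- (E_periodic (2 * PI * IZR nu * xr r b) (nu * b)). f_equal.
        unfold xr. rewrite plus_IZR, !mult_IZR. field. lra. }
    rewrite !RtoC_mult. ring.
  + rewrite list_sum_residues7_shift; [unfold h; rewrite gauss_sum|].
    * unfold X, half_dual. cbn [fst snd]. ring.
    * intros a a' Ha. unfold h. rewrite (chi_mod _ _ Ha). f_equal.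
      assert (Hk : a = (a' + 7 * (a / 7 - a' / 7))%Z).
      { pose proof (Z.div_mod a 7 ltac:(lia)). pose proof (Z.div_mod a' 7 ltac:(lia)). lia. }
      set (k := (a / 7 - a' / 7)%Z) in Hk. rewrite Hk, <- (E_periodic (2 * PI * IZR nu * IZR a' / 7) (nu * k)). f_equal.
      rewrite plus_IZR, !mult_IZR. field.
Qed.

Let col_const (nu : Z) : C :=
  (RtoC (shift_factor * / sqrt (14 * t) * exp (- (PI / (14 * t) * IZR nu ^ 2)))
   * (Ci * sqrt 7 * IZR (chi nu)) * E (- (IZR nu * w / (2 * t))))%C.

(** The lattice points with [2 a + b = nu] have real part $\nu/2$ and imaginary part
    $-\sqrt7(\nu+2\mu)/2$; along this column the dual summand is a theta series in [mu]. *)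
Lemma dual_term_column nu mu :
  dual_term (nu + mu, - (nu + 2 * mu))%Z =
  (col_const nu * (RtoC (sqrt (2 / t)) * theta_space (2 / t) (sqrt 7 * w / (4 * PI) + IZR nu / 2) mu))%C.
Proof.
pose proof PI_RGT_0 as HPI. pose proof sqrt7_sqr as H7.
(* The three constants that meet here: $1/\sqrt{14t}$ from the first inversion, $\sqrt7$ from the
   Gauss sum, $\sqrt{2/t}$ from the second inversion. *)
assert (Hc : / sqrt (14 * t) * sqrt 7 * sqrt (2 / t) = / t).
{ assert (0 < sqrt (14 * t)) by (apply sqrt_lt_R0; lra).
  assert (0 < 2 / t) by (apply Rdiv_lt_0_compat; lra).
  apply Rmult_eq_reg_l with (sqrt (14 * t)); [|lra]. rewrite <- !Rmult_assoc, Rinv_r, Rmult_1_l, <- sqrt_mult by lra.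
  replace (7 * (2 / t)) with (14 * t * (/ t * / t)) by (field; lra).
  assert (0 < / t) by (now apply Rinv_0_lt_compat).
  rewrite sqrt_mult, sqrt_square by nra. ring. }
unfold dual_term, col_const, theta_space, lat_gauss, cexp. cbn [fst snd].
replace (2 * (nu + mu) + - (nu + 2 * mu))%Z with nu by ring.
rewrite elt_parts. set (a := (nu + mu)%Z). set (b := (- (nu + 2 * mu))%Z).
replace (Im (- Ci * RtoC (w / t) * ((IZR a + IZR b / 2)%R, (IZR b * sqrt 7 / 2)%R))%C) with (- (IZR nu * w / (2 * t))).
2:{ simpl. unfold a, b. rewrite !opp_IZR, !plus_IZR, mult_IZR. field. lra. }
replace (Re (- Ci * RtoC (w / t) * ((IZR a + IZR b / 2)%R, (IZR b * sqrt 7 / 2)%R))%C) with (IZR b * sqrt 7 / 2 * (w / t)) by (simpl; field; lra).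
assert (He : exp (- (2 * PI / 7 * / t * IZR (normZ a b))) * exp (IZR b * sqrt 7 / 2 * (w / t)) =
  shift_factor * exp (- (PI / (14 * t) * IZR nu ^ 2)) * exp (- (PI * (2 / t) * (sqrt 7 * w / (4 * PI) + IZR nu / 2 + IZR mu) ^ 2))).
{ unfold shift_factor. rewrite <- !exp_plus. f_equal.
  replace ((sqrt 7 * w / (4 * PI) + IZR nu / 2 + IZR mu) ^ 2) with
   ((sqrt 7 * sqrt 7) * w ^ 2 / (16 * PI ^ 2) + 2 * (sqrt 7 * w / (4 * PI)) * (IZR nu / 2 + IZR mu) + (IZR nu / 2 + IZR mu) ^ 2) by (field; lra).
  rewrite H7. unfold a, b. rewrite normZ_IZR, !opp_IZR, !plus_IZR, mult_IZR. field. lra. }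
transitivity (Ci * RtoC (/ t) * RtoC (IZR (chi nu) * (exp (- (2 * PI / 7 * / t * IZR (normZ a b))) * exp (IZR b * sqrt 7 / 2 * (w / t)))) * E (- (IZR nu * w / (2 * t))))%C.
- rewrite !RtoC_mult, RtoC_inv by lra. unfold Cdiv. ring.
- rewrite He, <- Hc, !RtoC_mult. ring.
Qed.

Lemma half_dual_columns nu : exists S, sums_to (fun b => half_dual (b, nu)) S /\
  sums_to (fun mu => dual_term (nu + mu, - (nu + 2 * mu))%Z) S.
Proof.
pose proof PI_RGT_0 as HPI.
assert (H2 : 0 < 2 / t) by (apply Rdiv_lt_0_compat; lra).
destruct (theta_freq_ex (2 / t) (sqrt 7 * w / (4 * PI) + IZR nu / 2) H2) as [B HB].
exists (col_const nu * B)%C. split.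
- apply (sums_to_scal (col_const nu)) in HB. revert HB. apply sums_to_ext. intros b.
  unfold col_const, theta_freq, half_dual. cbn [fst snd].
  replace (2 * PI * IZR b * (sqrt 7 * w / (4 * PI) + IZR nu / 2)) with (sqrt 7 * IZR b * w / 2 + PI * IZR nu * IZR b) by (field; lra).
  rewrite E_plus, !RtoC_mult. ring.
- apply (theta_inversion _ _ _ H2) in HB. apply (sums_to_scal (RtoC (sqrt (2 / t)))), (sums_to_scal (col_const nu)) in HB.
  pose proof (sqrt_lt_R0 _ H2).
  replace (col_const nu * B)%C with (col_const nu * (RtoC (sqrt (2 / t)) * (RtoC (/ sqrt (2 / t)) * B)))%C.
  + revert HB. apply sums_to_ext. intros mu. symmetry. apply dual_term_column.
  + rewrite RtoC_inv by lra. field. apply RtoC_neq. lra.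
Qed.

(** The array [half_dual] is absolutely summable; its sum by rows is the original lattice sum and
    its sum by columns is the dual one. *)
Lemma lattice_inversion : exists S, sums_to lat_term S /\ sums_to dual_term S.
Proof.
destruct (lat_gauss_cexp_ex t (RtoC w) t_pos) as [S HS]. fold lat_term in HS.
destruct (lat_gauss_cexp_ex (/ t) (- Ci * RtoC (w / t))%C (Rinv_0_lt_compat _ t_pos)) as [S' HS'].
apply (sums_to_scal (Ci / t)%C) in HS'.
destruct half_dual_ex as [T HT].
destruct (choice_fun _ lat_term_rows) as [rw Hrw]. destruct (choice_fun _ half_dual_columns) as [cl Hcl].
exists S. split; [exact HS|].
assert (E1 : S = T).
{ apply (sums_to_unique rw).
  - apply (sums_to_fubini _ rw) in HT; [|intros b; exact (proj2 (Hrw b))].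
    apply (fun f => sums_to_fubini (fun p : Z * Z => lat_term (snd p, fst p)) rw S f).
    + now apply sums_to_swap in HS.
    + intros b. exact (proj1 (Hrw b)).
  - apply (sums_to_fubini half_dual); auto. intros b. exact (proj2 (Hrw b)). }
assert (E2 : (Ci / t * S')%C = T).
{ apply (sums_to_unique cl).
  - apply (sums_to_fubini (fun p : Z * Z => dual_term (fst p + snd p, - (fst p + 2 * snd p))%Z)).
    (* The coordinate change has determinant $-1$, hence an integral inverse. *)
    + apply (sums_to_bij dual_term (fun p : Z * Z => (fst p + snd p, - (fst p + 2 * snd p))%Z) (fun p => (2 * fst p + snd p, - fst p - snd p)%Z)).
      * intros [x y]. cbn [fst snd]. f_equal; lia.
      * intros [x y]. cbn [fst snd]. f_equal; lia.
      * exact HS'.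
    + intros nu. exact (proj2 (Hcl nu)).
  - apply (sums_to_fubini (fun p : Z * Z => half_dual (snd p, fst p))).
    + now apply sums_to_swap in HT.
    + intros nu. exact (proj1 (Hcl nu)). }
rewrite E1, <- E2. exact HS'.
Qed.

End LatticeInversion.

Definition zelt (p : Z * Z) : C := elt (fst p) (snd p).

(** Differences in [w] of [lattice_inversion] replace the exponential by
    [(cexp (w * z) - 1) ^ k]; letting [w] tend to [0] turns this into [z ^ k]. *)
Lemma lattice_inversion_diff t w k : 0 < t -> forall w0, exists S,
  sums_to (fun p => lat_gauss t p * (cexp (RtoC w0 * zelt p) * Cpow (cexp (RtoC w * zelt p) - 1) k))%C S /\
  sums_to (fun p => Ci / t * (lat_gauss (/ t) p *
     (cexp (- Ci / t * RtoC w0 * zelt p) * Cpow (cexp (- Ci / t * RtoC w * zelt p) - 1) k)))%C S.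
Proof.
intros Ht. induction k as [|k IH]; intros w0.
- destruct (lattice_inversion t w0 Ht) as (S & H1 & H2). exists S. split.
  + revert H1. apply sums_to_ext. intros p. unfold lat_term, zelt. simpl. ring.
  + revert H2. apply sums_to_ext. intros p. unfold dual_term, zelt. simpl Cpow. rewrite RtoC_div by lra.
    replace (- Ci / t * w0 * elt (fst p) (snd p))%C with (- Ci * (w0 / t) * elt (fst p) (snd p))%C
      by (field; apply RtoC_neq; lra). ring.
- destruct (IH (w0 + w)) as (S1 & A1 & B1). destruct (IH w0) as (S2 & A2 & B2).
  exists (S1 + (-1) * S2)%C. split.
  + generalize (sums_to_plus _ _ _ _ A1 (sums_to_scal (-1)%C _ _ A2)). apply sums_to_ext. intros p.
    rewrite Cpow_S, RtoC_plus, Cmult_plus_distr_r, cexp_plus. ring.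
  + generalize (sums_to_plus _ _ _ _ B1 (sums_to_scal (-1)%C _ _ B2)). apply sums_to_ext. intros p.
    rewrite Cpow_S, RtoC_plus, Cmult_plus_distr_l, Cmult_plus_distr_r, cexp_plus. ring.
Qed.

Definition diff_quot (u : C) (j : nat) : C := (RtoC (INR (S j)) * (cexp (u * RtoC (/ INR (S j))) - 1))%C.

(** Uniform in [j] and only exponential in $|u|$, so that powers of it are still dominated through
    [lat_gauss_dom]. *)
Lemma Cmod_diff_quot_le u j : Cmod (diff_quot u j) <= 2 * exp (2 * Cmod u).
Proof.
assert (H1 : 1 <= INR (S j)) by (rewrite S_INR; pose proof (pos_INR j); lra).
set (q := INR (S j)) in *. unfold diff_quot. fold q.
rewrite Cmod_mult, Cmod_R, Rabs_pos_eq by lra.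
assert (Hq : 0 < / q <= 1) by (split; [apply Rinv_0_lt_compat; lra|rewrite <- Rinv_1; apply Rinv_le_contravar; lra]).
assert (Hu : Cmod (u * RtoC (/ q)) = Cmod u * / q) by (rewrite Cmod_mult, Cmod_R, Rabs_pos_eq; lra).
pose proof (Cmod_ge_0 u) as Hu0.
pose proof (Cmod_cexp_minus_1 (u * RtoC (/ q))) as H. rewrite Hu in H.
assert (He : exp (Cmod u * / q) <= exp (Cmod u)) by (apply exp_le; nra).
pose proof (exp_pos (Cmod u * / q)). pose proof (exp_pos (Cmod u)).
apply Rle_trans with (q * (2 * (Cmod u * / q) * exp (Cmod u))).
- apply Rmult_le_compat_l; [lra|]. eapply Rle_trans; [apply H|]. apply Rmult_le_compat_l; [|easy]. nra.
- replace (q * (2 * (Cmod u * / q) * exp (Cmod u))) with (2 * (Cmod u * exp (Cmod u))) by (field; lra).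
  replace (2 * Cmod u) with (Cmod u + Cmod u) by ring. rewrite exp_plus.
  pose proof (exp_ineq1_le (Cmod u)). apply Rmult_le_compat_l; [lra|]. apply Rmult_le_compat_r; lra.
Qed.

Lemma diff_quot_lim u : Cseq_lim (diff_quot u) u.
Proof.
intros e He. pose proof (Cmod_ge_0 u) as Hu0.
set (K := 5 * Cmod u ^ 2 * exp (Cmod u)). assert (HK : 0 <= K).
{ unfold K. pose proof (exp_pos (Cmod u)). pose proof (pow2_ge_0 (Cmod u)). nra. }
destruct (nfloor_ex (K / e)) as [N [_ HN]]; [apply Rdiv_le_0_compat; lra|].
exists N. intros j Hj. apply le_INR in Hj.
assert (H1 : 1 <= INR (S j)) by (rewrite S_INR; pose proof (pos_INR j); lra).
assert (HKe : K / e < INR (S j)) by (rewrite S_INR; lra).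
set (q := INR (S j)) in *. unfold diff_quot. fold q.
assert (Hq : 0 < / q <= 1) by (split; [apply Rinv_0_lt_compat; lra|rewrite <- Rinv_1; apply Rinv_le_contravar; lra]).
replace (q * (cexp (u * RtoC (/ q)) - 1) - u)%C with (q * (cexp (u * RtoC (/ q)) - 1 - u * RtoC (/ q)))%C.
2:{ rewrite RtoC_inv by lra. field. apply RtoC_neq; lra. }
rewrite Cmod_mult, Cmod_R, Rabs_pos_eq by lra.
assert (Hu : Cmod (u * RtoC (/ q)) = Cmod u * / q) by (rewrite Cmod_mult, Cmod_R, Rabs_pos_eq; lra).
pose proof (Cmod_cexp_taylor2 (u * RtoC (/ q))) as H. rewrite Hu in H.
assert (He' : exp (Cmod u * / q) <= exp (Cmod u)) by (apply exp_le; nra).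
apply Rle_lt_trans with (q * (5 * (Cmod u * / q) ^ 2 * exp (Cmod u))).
- apply Rmult_le_compat_l; [lra|]. eapply Rle_trans; [apply H|]. apply Rmult_le_compat_l; [|easy].
  pose proof (pow2_ge_0 (Cmod u * / q)). lra.
- replace (q * (5 * (Cmod u * / q) ^ 2 * exp (Cmod u))) with (K / q) by (unfold K; field; lra).
  apply Rlt_div_l; [lra|]. apply Rlt_div_l in HKe; lra.
Qed.

Lemma Cseq_lim_pow u l k : Cseq_lim u l -> Cseq_lim (fun n => Cpow (u n) k) (Cpow l k).
Proof.
intros H. induction k as [|k IH].
- intros e He. exists 0%nat. intros. simpl. replace (1 - 1)%C with (RtoC 0) by ring. now rewrite Cmod_0.
- apply (Cseq_lim_ext (fun n => u n * Cpow (u n) k)%C); [intros; now rewrite Cpow_S|].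
  rewrite Cpow_S. now apply Cseq_lim_mult.
Qed.

Lemma diff_quot_sums_lim t c k S T : 0 < t ->
  (forall j, sums_to (fun p => lat_gauss t p * Cpow (diff_quot (c * zelt p) j) k)%C (S j)) ->
  sums_to (fun p => lat_gauss t p * Cpow (c * zelt p) k)%C T -> Cseq_lim S T.
Proof.
intros Ht HS HT.
destruct (lat_gauss_dom t (INR k * (2 * Cmod c)) Ht) as (K & HK & HB).
apply (sums_to_dominated (fun j p => lat_gauss t p * Cpow (diff_quot (c * zelt p) j) k)%C
  (fun p => lat_gauss t p * Cpow (c * zelt p) k)%C (fun p => 2 ^ k * (K * (pz (fst p) * pz (snd p)))) S T 0); auto.
- apply summable_scal; [apply pow_le; lra|]. apply summable_scal; [easy|apply summable_pz2].
- intros j p _. rewrite Cmod_mult, Cmod_R, Cmod_pow.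
  apply Rle_trans with (Rabs (lat_gauss t p) * (2 * exp (2 * Cmod (c * zelt p))) ^ k).
  + apply Rmult_le_compat_l; [apply Rabs_pos|]. apply pow_incr. split; [apply Cmod_ge_0|apply Cmod_diff_quot_le].
  + rewrite Rpow_mult_distr, exp_pow_INR, Cmod_mult.
    replace (INR k * (2 * (Cmod c * Cmod (zelt p)))) with (INR k * (2 * Cmod c) * Cmod (zelt p)) by ring.
    rewrite Rmult_comm, Rmult_assoc. apply Rmult_le_compat_l; [apply pow_le; lra|]. rewrite Rmult_comm. apply HB.
- intros p. apply Cseq_lim_scal, Cseq_lim_pow, diff_quot_lim.
Qed.

Lemma lat_gauss_pow_ex t c k : 0 < t -> exists S, sums_to (fun p => lat_gauss t p * Cpow (c * zelt p) k)%C S.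
Proof.
intros Ht.
destruct (lat_gauss_dom t (INR k * Cmod c) Ht) as (K & HK & HB).
apply (sums_to_ex _ (fun p => K * (pz (fst p) * pz (snd p)))).
- apply summable_scal; [easy|apply summable_pz2].
- intros p. eapply Rle_trans; [|apply HB]. rewrite Cmod_mult, Cmod_R, Cmod_pow, Cmod_mult.
  apply Rmult_le_compat_l; [apply Rabs_pos|].
  rewrite Rmult_assoc, <- exp_pow_INR. apply pow_incr.
  assert (0 <= Cmod c * Cmod (zelt p)) by (apply Rmult_le_pos; apply Cmod_ge_0).
  split; [easy|]. pose proof (exp_ineq1_le (Cmod c * Cmod (zelt p))). unfold zelt in *. lra.
Qed.

(** In [lattice_inversion_diff] the step $w=1/(j+1)$, after multiplication by $(j+1)^k$, gives
    $k$-th powers of difference quotients, which tend to $z^k$ on one side and to $(-iz/t)^k$ on the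
    other. *)
Lemma theta_pow_inversion t k S : 0 < t ->
  sums_to (fun p => lat_gauss t p * Cpow (zelt p) k)%C S ->
  sums_to (fun p => Ci / t * (lat_gauss (/ t) p * Cpow (- Ci / t * zelt p) k))%C S.
Proof.
intros Ht HS. pose proof (Rinv_0_lt_compat _ Ht) as Hit.
destruct (lat_gauss_pow_ex (/ t) (- Ci / t)%C k Hit) as [T HT].
destruct (choice_fun _ (fun j => lattice_inversion_diff t (/ INR (Datatypes.S j)) k Ht 0)) as [U HU].
assert (HC : forall j, RtoC (INR (Datatypes.S j)) <> RtoC 0) by (intros; apply RtoC_neq, not_0_INR; lia).
assert (L1 : Cseq_lim (fun j => Cpow (RtoC (INR (Datatypes.S j))) k * U j)%C S).
{ apply (diff_quot_sums_lim t 1 k); auto.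
  - intros j. destruct (HU j) as [H _]. apply (sums_to_scal (Cpow (RtoC (INR (Datatypes.S j))) k)) in H.
    revert H. apply sums_to_ext. intros p. unfold diff_quot. rewrite Cpow_mult_l.
    replace (RtoC 0 * zelt p)%C with (RtoC 0) by ring. rewrite cexp_0.
    replace (RtoC (/ INR (Datatypes.S j)) * zelt p)%C with (1 * zelt p * RtoC (/ INR (Datatypes.S j)))%C by ring. ring.
  - revert HS. apply sums_to_ext. intros p. now rewrite Cmult_1_l. }
assert (HCt : (Ci / t)%C <> RtoC 0).
{ unfold Cdiv. apply Cmult_neq_0; [apply Ci_nz|]. rewrite <- RtoC_inv by lra. apply RtoC_neq. lra. }
assert (L2 : Cseq_lim (fun j => Ci / t * (/ (Ci / t) * (Cpow (RtoC (INR (Datatypes.S j))) k * U j)))%C (Ci / t * T)%C).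
{ apply Cseq_lim_scal. apply (diff_quot_sums_lim (/ t) (- Ci / t)%C k); auto.
  intros j. destruct (HU j) as [_ H]. apply (sums_to_scal (/ (Ci / t) * Cpow (RtoC (INR (Datatypes.S j))) k)%C) in H.
  replace (/ (Ci / t) * (Cpow (RtoC (INR (Datatypes.S j))) k * U j))%C with (/ (Ci / t) * Cpow (RtoC (INR (Datatypes.S j))) k * U j)%C by ring.
  revert H. apply sums_to_ext. intros p. unfold diff_quot. rewrite Cpow_mult_l.
  replace (- Ci / t * RtoC 0 * zelt p)%C with (RtoC 0) by (unfold Cdiv; ring). rewrite cexp_0.
  replace (- Ci / t * RtoC (/ INR (Datatypes.S j)) * zelt p)%C with (- Ci / t * zelt p * RtoC (/ INR (Datatypes.S j)))%C by (unfold Cdiv; ring).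
  set (q := (Ci / t)%C) in *. set (A := Cpow (RtoC _) k). set (B := Cpow (cexp _ - 1) k).
  transitivity (/ q * q * (lat_gauss (/ t) p * (A * B)))%C; [ring|]. rewrite Cinv_l; auto. ring. }
assert (E0 : S = (Ci / t * T)%C).
{ apply (Cseq_lim_unique _ _ _ L1). revert L2. apply Cseq_lim_ext. intros j. field.
  split; (apply Ci_nz || apply RtoC_neq; lra). }
rewrite E0. apply sums_to_scal. exact HT.
Qed.

(** The sign is $i(-i)^{4n+1}=1$, because the exponent is 1 modulo 4; an exponent 3 modulo 4 would
    give $-1$. *)
Lemma root_number t n : 0 < t -> (Ci / t * Cpow (- Ci / t) (4 * n + 1))%C = RtoC (/ t ^ (4 * n + 2)).
Proof.
intros Ht. pose proof (Rinv_0_lt_compat _ Ht).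
replace (- Ci / t)%C with (- Ci * RtoC (/ t))%C by (rewrite RtoC_inv by lra; reflexivity).
replace (Ci / t)%C with (Ci * RtoC (/ t))%C by (rewrite RtoC_inv by lra; reflexivity).
rewrite Cpow_mult_l, <- RtoC_pow, Cpow_add_r, Cpow_mult_r.
replace (Cpow (- Ci) 4) with (RtoC 1) by (unfold Ci; apply injective_projections; simpl; ring).
rewrite Cpow_1_l, Cpow_1_r.
transitivity (- (Ci * Ci) * (RtoC (/ t) * RtoC ((/ t) ^ (4 * n + 1))))%C; [ring|].
rewrite <- RtoC_mult, <- pow_inv. replace (4 * n + 2)%nat with (S (4 * n + 1)) by lia. simpl ((/ t) ^ S _).
unfold Ci. apply injective_projections; simpl; ring.
Qed.

Lemma theta_functional_equation t n S : 0 < t ->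
  sums_to (fun p => lat_gauss t p * Cpow (zelt p) (4 * n + 1))%C S ->
  sums_to (fun p => lat_gauss (/ t) p * Cpow (zelt p) (4 * n + 1))%C (RtoC (t ^ (4 * n + 2)) * S)%C.
Proof.
intros Ht HS. apply theta_pow_inversion in HS; auto.
apply (sums_to_scal (RtoC (t ^ (4 * n + 2)))) in HS. revert HS. apply sums_to_ext. intros p.
rewrite Cpow_mult_l.
transitivity (RtoC (t ^ (4 * n + 2)) * (Ci / t * Cpow (- Ci / t) (4 * n + 1)) * (lat_gauss (/ t) p * Cpow (zelt p) (4 * n + 1)))%C; [ring|].
rewrite root_number by easy. rewrite <- RtoC_mult, Rinv_r; [ring|]. apply pow_nonzero. lra.
Qed.

(** * Complex integration and Goursat's theorem *)

Definition ccont (f : R -> C) (x : R) : Prop :=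
  continuous (fun t => Re (f t)) x /\ continuous (fun t => Im (f t)) x.

Lemma continuous_eps (g : R -> R) x : continuous g x <->
  forall e, 0 < e -> exists d, 0 < d /\ forall y, Rabs (y - x) < d -> Rabs (g y - g x) < e.
Proof.
split.
- intros H e He. apply filterlim_locally with (eps := mkposreal e He) in H. destruct H as [d Hd].
  exists d. split; [apply cond_pos|]. intros y Hy. apply (Hd y). exact Hy.
- intros H. apply filterlim_locally. intros e. destruct (H e (cond_pos e)) as (d & Hd & Hy).
  exists (mkposreal d Hd). intros y Hyd. apply Hy. exact Hyd.
Qed.

Lemma Cmod_le_parts z : Cmod z <= Rabs (Re z) + Rabs (Im z).
Proof.
destruct z as [a b]. replace (a, b) with (RtoC a + Ci * RtoC b)%C by (apply injective_projections; simpl; ring).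
eapply Rle_trans; [apply Cmod_triangle|]. rewrite Cmod_mult, Cmod_Ci, !Cmod_R. simpl.
rewrite Rmult_1_l. apply Req_le. f_equal; f_equal; ring.
Qed.

Lemma ccont_eps f x : ccont f x <->
  forall e, 0 < e -> exists d, 0 < d /\ forall y, Rabs (y - x) < d -> Cmod (f y - f x)%C < e.
Proof.
split.
- intros [H1 H2] e He. rewrite continuous_eps in H1, H2.
  destruct (H1 (e / 2)) as (d1 & Hd1 & K1); [lra|]. destruct (H2 (e / 2)) as (d2 & Hd2 & K2); [lra|].
  exists (Rmin d1 d2). split; [now apply Rmin_pos|]. intros y Hy.
  pose proof (Rmin_l d1 d2). pose proof (Rmin_r d1 d2).
  specialize (K1 y ltac:(lra)). specialize (K2 y ltac:(lra)).
  eapply Rle_lt_trans; [apply Cmod_le_parts|]. unfold Re, Im in *. simpl. unfold Rminus in *. lra.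
- intros H. split; apply continuous_eps; intros e He; destruct (H e He) as (d & Hd & K); exists d; split; auto;
  intros y Hy; specialize (K y Hy); (eapply Rle_lt_trans; [|apply K]).
  + pose proof (re_le_Cmod (f y - f x)%C) as T. exact T.
  + pose proof (im_le_Cmod (f y - f x)%C) as T. exact T.
Qed.

Lemma ccont_const c x : ccont (fun _ => c) x.
Proof. split; apply continuous_const. Qed.

Lemma ccont_plus f g x : ccont f x -> ccont g x -> ccont (fun t => f t + g t)%C x.
Proof. intros [F1 F2] [G1 G2]. split; simpl; apply (continuous_plus (V := R_NormedModule)); auto. Qed.

Lemma ccont_mult f g x : ccont f x -> ccont g x -> ccont (fun t => f t * g t)%C x.
Proof.
intros [F1 F2] [G1 G2]. split; simpl.
- apply (continuous_minus (V := R_NormedModule)); apply (continuous_mult (K := R_AbsRing)); auto.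
- apply (continuous_plus (V := R_NormedModule)); apply (continuous_mult (K := R_AbsRing)); auto.
Qed.

Lemma ccont_RtoC g x : continuous g x -> ccont (fun t => RtoC (g t)) x.
Proof. intros H. split; simpl; auto. apply continuous_const. Qed.

Definition cintegrable (f : R -> C) (a b : R) : Prop :=
  ex_RInt (fun t => Re (f t)) a b /\ ex_RInt (fun t => Im (f t)) a b.

Definition CInt (f : R -> C) (a b : R) : C :=
  (RInt (fun t => Re (f t)) a b, RInt (fun t => Im (f t)) a b).

Lemma cintegrable_continuous f a b : a <= b -> (forall x, a <= x <= b -> ccont f x) -> cintegrable f a b.
Proof.
intros Hab H. split; apply (ex_RInt_continuous (V := R_CompleteNormedModule)); intros z Hz;
rewrite Rmin_left, Rmax_right in Hz by lra; now apply H.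
Qed.

Lemma CInt_ext f g a b : a <= b -> (forall x, a <= x <= b -> f x = g x) -> CInt f a b = CInt g a b.
Proof.
intros Hab H. unfold CInt. f_equal; apply RInt_ext; intros x Hx; rewrite Rmin_left, Rmax_right in Hx by lra;
rewrite H; auto; lra.
Qed.

Lemma CInt_plus f g a b : cintegrable f a b -> cintegrable g a b ->
  CInt (fun t => f t + g t)%C a b = (CInt f a b + CInt g a b)%C.
Proof.
intros [F1 F2] [G1 G2]. unfold CInt. apply injective_projections; simpl.
- apply (RInt_plus (V := R_CompleteNormedModule)); auto.
- apply (RInt_plus (V := R_CompleteNormedModule)); auto.
Qed.

Lemma CInt_scal c f a b : cintegrable f a b -> CInt (fun t => c * f t)%C a b = (c * CInt f a b)%C.
Proof.
intros [F1 F2]. unfold CInt. destruct c as [c1 c2]. apply injective_projections; simpl.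
- transitivity (RInt (fun t => minus (scal c1 (Re (f t))) (scal c2 (Im (f t)))) a b); [reflexivity|].
  rewrite (RInt_minus (V := R_CompleteNormedModule)).
  + rewrite !(RInt_scal (V := R_CompleteNormedModule)); auto.
  + now apply (ex_RInt_scal (V := R_CompleteNormedModule)).
  + now apply (ex_RInt_scal (V := R_CompleteNormedModule)).
- transitivity (RInt (fun t => plus (scal c1 (Im (f t))) (scal c2 (Re (f t)))) a b); [reflexivity|].
  rewrite (RInt_plus (V := R_CompleteNormedModule)).
  + rewrite !(RInt_scal (V := R_CompleteNormedModule)); auto.
  + now apply (ex_RInt_scal (V := R_CompleteNormedModule)).
  + now apply (ex_RInt_scal (V := R_CompleteNormedModule)).
Qed.

Lemma cintegrable_scal c f a b : cintegrable f a b -> cintegrable (fun t => c * f t)%C a b.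
Proof.
intros [F1 F2]. destruct c as [c1 c2]. split; simpl.
- apply (ex_RInt_minus (V := R_CompleteNormedModule) (fun t => scal c1 (Re (f t))) (fun t => scal c2 (Im (f t))));
  now apply (ex_RInt_scal (V := R_CompleteNormedModule)).
- apply (ex_RInt_plus (V := R_CompleteNormedModule) (fun t => scal c1 (Im (f t))) (fun t => scal c2 (Re (f t))));
  now apply (ex_RInt_scal (V := R_CompleteNormedModule)).
Qed.

Lemma CInt_Chasles f a b c : cintegrable f a b -> cintegrable f b c -> (CInt f a b + CInt f b c)%C = CInt f a c.
Proof.
intros [F1 F2] [G1 G2]. unfold CInt. apply injective_projections; simpl;
apply (RInt_Chasles (V := R_CompleteNormedModule)); auto.
Qed.

Lemma CInt_const c a b : CInt (fun _ => c) a b = (RtoC (b - a) * c)%C.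
Proof.
unfold CInt. rewrite !RInt_const. destruct c. apply injective_projections; simpl; unfold scal; simpl; unfold mult; simpl; ring.
Qed.

Lemma cintegrable_const c a b : cintegrable (fun _ => c) a b.
Proof. split; apply ex_RInt_const. Qed.

(** Multiplying by the conjugate of the integral reduces this to the real part. *)
Lemma Cmod_CInt_le f g a b : a <= b -> cintegrable f a b -> ex_RInt g a b ->
  (forall x, a <= x <= b -> Cmod (f x) <= g x) -> Cmod (CInt f a b) <= RInt g a b.
Proof.
intros Hab Hf Hg H.
destruct (Req_dec (Cmod (CInt f a b)) 0) as [E0|Hn].
- rewrite E0. replace 0 with (RInt (fun _ => 0) a b) by (rewrite RInt_const; unfold scal; simpl; unfold mult; simpl; ring).
  apply RInt_le; auto; [apply ex_RInt_const|]. intros x Hx. eapply Rle_trans; [apply Cmod_ge_0|apply H; lra].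
- pose proof (Cmod_ge_0 (CInt f a b)) as Hv. set (v := CInt f a b) in *.
  apply Rmult_le_reg_l with (Cmod v); [lra|].
  assert (E1 : Cmod v * Cmod v = Re (CInt (fun t => Cconj v * f t)%C a b)).
  { rewrite CInt_scal by auto. fold v. replace (Cmod v * Cmod v) with (Cmod v ^ 2) by ring. rewrite Cmod2_alt.
    destruct v; simpl; ring. }
  rewrite E1. unfold CInt; simpl Re.
  replace (Cmod v * RInt g a b) with (RInt (fun t => scal (Cmod v) (g t)) a b) by (now apply (RInt_scal (V := R_CompleteNormedModule))).
  apply RInt_le; auto.
  + apply (cintegrable_scal (Cconj v) f); auto.
  + now apply (ex_RInt_scal (V := R_CompleteNormedModule)).
  + intros x Hx. change (Re (Cconj v * f x)%C <= Cmod v * g x).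
    eapply Rle_trans; [apply Rle_abs|]. eapply Rle_trans; [apply re_le_Cmod|].
    rewrite Cmod_mult, Cmod_conj. apply Rmult_le_compat_l; [easy|]. apply H; lra.
Qed.

Lemma Cmod_CInt_le_const f M a b : a <= b -> cintegrable f a b ->
  (forall x, a <= x <= b -> Cmod (f x) <= M) -> Cmod (CInt f a b) <= (b - a) * M.
Proof.
intros Hab Hf H. replace ((b - a) * M) with (RInt (fun _ => M) a b) by (rewrite RInt_const; reflexivity).
apply Cmod_CInt_le; auto. apply ex_RInt_const.
Qed.

(** Stated with [<=], so that [h = 0] is included and no quotient is formed. *)
Definition cdiff_at (f : C -> C) (z l : C) : Prop :=
  forall e, 0 < e -> exists d, 0 < d /\ forall h, Cmod h < d -> Cmod (f (z + h) - f z - l * h)%C <= e * Cmod h.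

Definition cdiff (f : C -> C) (z : C) : Prop := exists l, cdiff_at f z l.

Lemma cdiff_of_ex_derive f z : @ex_derive C_AbsRing C_NormedModule f z -> cdiff f z.
Proof.
intros [l [_ H]]. exists l. intros e He.
assert (Hz : is_filter_lim (locally (T := AbsRing_UniformSpace C_AbsRing) z) z) by (intros P HP; exact HP).
destruct (H z Hz (mkposreal e He)) as [d Hd]. exists d. split; [apply cond_pos|].
intros h Hh. specialize (Hd (z + h)%C).
assert (Hb : Cmod (z + h - z)%C < d) by (replace (z + h - z)%C with h by ring; exact Hh).
specialize (Hd Hb).
change (Cmod ((f (z + h) - f z) - (z + h - z) * l)%C <= e * Cmod (z + h - z)%C) in Hd.
replace (z + h - z)%C with h in Hd by ring. now replace (f (z + h) - f z - l * h)%C with (f (z + h) - f z - h * l)%C by ring.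
Qed.

Lemma cdiff_at_cont f z l : cdiff_at f z l ->
  forall e, 0 < e -> exists d, 0 < d /\ forall h, Cmod h < d -> Cmod (f (z + h) - f z)%C < e.
Proof.
intros H e He. destruct (H 1 ltac:(lra)) as (d & Hd & K). pose proof (Cmod_ge_0 l) as Hl.
exists (Rmin d (e / (Cmod l + 2))). split; [apply Rmin_pos; auto; apply Rdiv_lt_0_compat; lra|].
intros h Hh. pose proof (Rmin_l d (e / (Cmod l + 2))). pose proof (Rmin_r d (e / (Cmod l + 2))).
specialize (K h ltac:(lra)).
replace (f (z + h) - f z)%C with ((f (z + h) - f z - l * h) + l * h)%C by ring.
eapply Rle_lt_trans; [apply Cmod_triangle|]. rewrite Cmod_mult.
assert (Hh2 : Cmod h < e / (Cmod l + 2)) by lra. apply Rlt_div_r in Hh2; [|lra].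
pose proof (Cmod_ge_0 h). nra.
Qed.

Lemma cdiff_const c z : cdiff (fun _ => c) z.
Proof.
exists 0. intros e He. exists 1. split; [lra|]. intros h _. replace (c - c - 0 * h)%C with (RtoC 0) by ring.
rewrite Cmod_0. pose proof (Cmod_ge_0 h). nra.
Qed.

Lemma cdiff_id z : cdiff (fun s => s) z.
Proof.
exists 1. intros e He. exists 1. split; [lra|]. intros h _. replace (z + h - z - 1 * h)%C with (RtoC 0) by ring.
rewrite Cmod_0. pose proof (Cmod_ge_0 h). nra.
Qed.

Lemma cdiff_plus f g z : cdiff f z -> cdiff g z -> cdiff (fun s => f s + g s)%C z.
Proof.
intros [l Hf] [m Hg]. exists (l + m)%C. intros e He.
destruct (Hf (e / 2)) as (d1 & Hd1 & K1); [lra|]. destruct (Hg (e / 2)) as (d2 & Hd2 & K2); [lra|].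
exists (Rmin d1 d2). split; [now apply Rmin_pos|]. intros h Hh.
pose proof (Rmin_l d1 d2). pose proof (Rmin_r d1 d2). specialize (K1 h ltac:(lra)). specialize (K2 h ltac:(lra)).
replace (f (z + h) + g (z + h) - (f z + g z) - (l + m) * h)%C with
  ((f (z + h) - f z - l * h) + (g (z + h) - g z - m * h))%C by ring.
eapply Rle_trans; [apply Cmod_triangle|]. lra.
Qed.

Lemma cdiff_mult f g z : cdiff f z -> cdiff g z -> cdiff (fun s => f s * g s)%C z.
Proof.
intros [l Hf] [m Hg]. exists (l * g z + f z * m)%C. intros e He.
pose proof (Cmod_ge_0 l) as Hl. pose proof (Cmod_ge_0 (f z)) as Hfz. pose proof (Cmod_ge_0 (g z)) as Hgz.
destruct (Hf (Rmin 1 (e / (3 * (Cmod (g z) + 1))))) as (d1 & Hd1 & K1); [apply Rmin_pos; [lra|apply Rdiv_lt_0_compat; lra]|].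
destruct (Hg (e / (3 * (Cmod (f z) + 1)))) as (d2 & Hd2 & K2); [apply Rdiv_lt_0_compat; lra|].
destruct (cdiff_at_cont g z m Hg (e / (3 * (Cmod l + 2)))) as (d3 & Hd3 & K3); [apply Rdiv_lt_0_compat; lra|].
exists (Rmin d1 (Rmin d2 d3)). split; [repeat apply Rmin_pos; auto|]. intros h Hh.
pose proof (Rmin_l d1 (Rmin d2 d3)). pose proof (Rmin_r d1 (Rmin d2 d3)). pose proof (Rmin_l d2 d3). pose proof (Rmin_r d2 d3).
specialize (K1 h ltac:(lra)). specialize (K2 h ltac:(lra)). specialize (K3 h ltac:(lra)).
set (F := (f (z + h) - f z - l * h)%C) in *. set (G := (g (z + h) - g z - m * h)%C) in *. set (D := (g (z + h) - g z)%C) in *.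
replace (f (z + h) * g (z + h) - f z * g z - (l * g z + f z * m) * h)%C with
  (F * g z + f z * G + (F + l * h) * D)%C by (unfold F, G, D; ring).
pose proof (Cmod_ge_0 h) as Hh0.
assert (T1 : Cmod (F * g z) <= e / 3 * Cmod h).
{ rewrite Cmod_mult. apply Rle_trans with (e / (3 * (Cmod (g z) + 1)) * Cmod h * Cmod (g z)).
  - apply Rmult_le_compat_r; [easy|]. eapply Rle_trans; [apply K1|]. apply Rmult_le_compat_r; [easy|apply Rmin_r].
  - apply Rmult_le_reg_r with (3 * (Cmod (g z) + 1)); [lra|]. field_simplify; [|lra]. assert (0 <= e * Cmod h) by nra. nra. }
assert (T2 : Cmod (f z * G) <= e / 3 * Cmod h).
{ rewrite Cmod_mult. apply Rle_trans with (Cmod (f z) * (e / (3 * (Cmod (f z) + 1)) * Cmod h)).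
  - apply Rmult_le_compat_l; easy.
  - apply Rmult_le_reg_r with (3 * (Cmod (f z) + 1)); [lra|]. field_simplify; [|lra]. assert (0 <= e * Cmod h) by nra. nra. }
assert (T3 : Cmod ((F + l * h) * D) <= e / 3 * Cmod h).
{ rewrite Cmod_mult. apply Rle_trans with ((Cmod l + 1) * Cmod h * (e / (3 * (Cmod l + 2)))).
  - apply Rmult_le_compat; try apply Cmod_ge_0; [|lra].
    eapply Rle_trans; [apply Cmod_triangle|]. rewrite Cmod_mult. pose proof (Rmin_l 1 (e / (3 * (Cmod (g z) + 1)))).
    assert (Rmin 1 (e / (3 * (Cmod (g z) + 1))) * Cmod h <= 1 * Cmod h) by (apply Rmult_le_compat_r; lra). lra.
  - apply Rmult_le_reg_r with (3 * (Cmod l + 2)); [lra|]. field_simplify; [|lra]. assert (0 <= e * Cmod h) by nra. nra. }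
eapply Rle_trans; [apply Cmod_triangle|]. eapply Rle_trans; [apply Rplus_le_compat_r, Cmod_triangle|]. lra.
Qed.

Lemma cdiff_comp f g z : cdiff g z -> cdiff f (g z) -> cdiff (fun s => f (g s)) z.
Proof.
intros [m Hg] [l Hf]. exists (l * m)%C. intros e He.
pose proof (Cmod_ge_0 l) as Hl. pose proof (Cmod_ge_0 m) as Hm.
destruct (Hf (e / (2 * (Cmod m + 1)))) as (d1 & Hd1 & K1); [apply Rdiv_lt_0_compat; lra|].
destruct (Hg (Rmin 1 (e / (2 * (Cmod l + 1))))) as (d2 & Hd2 & K2); [apply Rmin_pos; [lra|apply Rdiv_lt_0_compat; lra]|].
destruct (cdiff_at_cont g z m Hg d1 Hd1) as (d3 & Hd3 & K3).
exists (Rmin d2 d3). split; [now apply Rmin_pos|]. intros h Hh.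
pose proof (Rmin_l d2 d3). pose proof (Rmin_r d2 d3). specialize (K2 h ltac:(lra)). specialize (K3 h ltac:(lra)).
set (k := (g (z + h) - g z)%C) in *. specialize (K1 k K3). replace (g z + k)%C with (g (z + h))%C in K1 by (unfold k; ring).
set (G := (k - m * h)%C) in *.
replace (f (g (z + h)) - f (g z) - l * m * h)%C with ((f (g (z + h)) - f (g z) - l * k) + l * G)%C by (unfold G, k; ring).
pose proof (Cmod_ge_0 h) as Hh0.
assert (Hk : Cmod k <= (Cmod m + 1) * Cmod h).
{ replace k with (G + m * h)%C by (unfold G; ring). eapply Rle_trans; [apply Cmod_triangle|]. rewrite Cmod_mult.
  pose proof (Rmin_l 1 (e / (2 * (Cmod l + 1)))).
  assert (Rmin 1 (e / (2 * (Cmod l + 1))) * Cmod h <= 1 * Cmod h) by (apply Rmult_le_compat_r; lra). lra. }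
eapply Rle_trans; [apply Cmod_triangle|]. rewrite Cmod_mult.
assert (T1 : e / (2 * (Cmod m + 1)) * Cmod k <= e / 2 * Cmod h).
{ apply Rle_trans with (e / (2 * (Cmod m + 1)) * ((Cmod m + 1) * Cmod h)).
  - apply Rmult_le_compat_l; [apply Rlt_le, Rdiv_lt_0_compat; lra|easy].
  - apply Req_le. field. lra. }
assert (T2 : Cmod l * Cmod G <= e / 2 * Cmod h).
{ apply Rle_trans with (Cmod l * (e / (2 * (Cmod l + 1)) * Cmod h)).
  - apply Rmult_le_compat_l; [easy|]. eapply Rle_trans; [apply K2|]. apply Rmult_le_compat_r; [easy|apply Rmin_r].
  - apply Rmult_le_reg_r with (2 * (Cmod l + 1)); [lra|]. field_simplify; [|lra]. assert (0 <= e * Cmod h) by nra. nra. }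
lra.
Qed.

Lemma cdiff_cexp z : cdiff cexp z.
Proof.
exists (cexp z). intros e He. pose proof (Cmod_ge_0 (cexp z)) as Hz.
set (K := 5 * Cmod (cexp z) * exp 1 + 1). assert (HK : 0 < K) by (unfold K; pose proof (exp_pos 1); nra).
exists (Rmin 1 (e / K)). split; [apply Rmin_pos; [lra|now apply Rdiv_lt_0_compat]|]. intros h Hh.
pose proof (Rmin_l 1 (e / K)). pose proof (Rmin_r 1 (e / K)). pose proof (Cmod_ge_0 h).
replace (cexp (z + h) - cexp z - cexp z * h)%C with (cexp z * (cexp h - 1 - h))%C by (rewrite cexp_plus; ring).
rewrite Cmod_mult. pose proof (Cmod_cexp_taylor2 h) as T.
assert (exp (Cmod h) <= exp 1) by (apply exp_le; lra).
apply Rle_trans with (Cmod (cexp z) * (5 * Cmod h ^ 2 * exp 1)).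
- apply Rmult_le_compat_l; [easy|]. eapply Rle_trans; [apply T|]. apply Rmult_le_compat_l; [|easy]. nra.
- replace (Cmod (cexp z) * (5 * Cmod h ^ 2 * exp 1)) with ((5 * Cmod (cexp z) * exp 1) * Cmod h * Cmod h) by ring.
  apply Rmult_le_compat_r; [easy|]. assert (Hh2 : Cmod h < e / K) by lra. apply Rlt_div_r in Hh2; [|easy]. unfold K in Hh2. nra.
Qed.

Lemma cdiff_ext f g z : (forall s, f s = g s) -> cdiff f z -> cdiff g z.
Proof.
intros E0 [l H]. exists l. intros e He. destruct (H e He) as (d & Hd & K). exists d. split; auto.
intros h Hh. rewrite <- !E0. auto.
Qed.

Lemma cdiff_ccont_line f (x y u v : R) t :
  cdiff f (x + u * t, y + v * t) -> ccont (fun s => f (x + u * s, y + v * s)) t.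
Proof.
intros [l H]. apply ccont_eps. intros e He. destruct (cdiff_at_cont _ _ _ H e He) as (d & Hd & K).
pose proof (Rabs_pos u). pose proof (Rabs_pos v).
exists (d / (Rabs u + Rabs v + 1)). split; [apply Rdiv_lt_0_compat; lra|]. intros s Hs.
specialize (K (u * (s - t), v * (s - t))).
replace (Cplus (x + u * t, y + v * t) (u * (s - t), v * (s - t))) with (x + u * s, y + v * s) in K
  by (apply injective_projections; simpl; ring).
apply K. eapply Rle_lt_trans; [apply Cmod_le_parts|]. simpl. rewrite !Rabs_mult.
apply Rlt_div_r in Hs; [|lra]. pose proof (Rabs_pos (s - t)). nra.
Qed.

Lemma cdiff_ccont_h f x y : cdiff f (x, y) -> ccont (fun s => f (s, y)) x.
Proof.
intros H. pose proof (cdiff_ccont_line f 0 y 1 0 x) as K.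
replace (0 + 1 * x, y + 0 * x) with (x, y) in K by (f_equal; ring). specialize (K H).
revert K. unfold ccont. intros [K1 K2].
split; eapply continuous_ext; [|exact K1| |exact K2]; intros s; simpl; f_equal; f_equal; f_equal; ring.
Qed.

Lemma cdiff_ccont_v f x y : cdiff f (x, y) -> ccont (fun s => f (x, s)) y.
Proof.
intros H. pose proof (cdiff_ccont_line f x 0 0 1 y) as K.
replace (x + 0 * y, 0 + 1 * y) with (x, y) in K by (f_equal; ring). specialize (K H).
revert K. unfold ccont. intros [K1 K2].
split; eapply continuous_ext; [|exact K1| |exact K2]; intros s; simpl; f_equal; f_equal; f_equal; ring.
Qed.

(** The counterclockwise boundary integral: bottom minus top, plus $i$ times right minus left. *)
Definition rect_int (f : C -> C) (x0 x1 y0 y1 : R) : C :=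
  (CInt (fun x => f (x, y0)) x0 x1 - CInt (fun x => f (x, y1)) x0 x1
   + Ci * (CInt (fun y => f (x1, y)) y0 y1 - CInt (fun y => f (x0, y)) y0 y1))%C.

Definition cdiff_on (f : C -> C) (x0 x1 y0 y1 : R) : Prop :=
  forall x y, x0 <= x <= x1 -> y0 <= y <= y1 -> cdiff f (x, y).

Lemma cdiff_on_int_h f x0 x1 y0 y1 a b y : cdiff_on f x0 x1 y0 y1 ->
  x0 <= a -> a <= b -> b <= x1 -> y0 <= y <= y1 -> cintegrable (fun x => f (x, y)) a b.
Proof. intros H H1 H2 H3 Hy. apply cintegrable_continuous; auto. intros x Hx. apply cdiff_ccont_h, H; lra. Qed.

Lemma cdiff_on_int_v f x0 x1 y0 y1 a b x : cdiff_on f x0 x1 y0 y1 ->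
  y0 <= a -> a <= b -> b <= y1 -> x0 <= x <= x1 -> cintegrable (fun y => f (x, y)) a b.
Proof. intros H H1 H2 H3 Hy. apply cintegrable_continuous; auto. intros y Hx. apply cdiff_ccont_v, H; lra. Qed.

Lemma rect_int_split_x f x0 xm x1 y0 y1 : x0 <= xm <= x1 -> y0 <= y1 -> cdiff_on f x0 x1 y0 y1 ->
  rect_int f x0 x1 y0 y1 = (rect_int f x0 xm y0 y1 + rect_int f xm x1 y0 y1)%C.
Proof.
intros Hx Hy H. unfold rect_int.
rewrite <- (CInt_Chasles (fun x => f (x, y0)) x0 xm x1), <- (CInt_Chasles (fun x => f (x, y1)) x0 xm x1);
  try (apply (cdiff_on_int_h f x0 x1 y0 y1); auto; lra).
ring.
Qed.

Lemma rect_int_split_y f x0 x1 y0 ym y1 : x0 <= x1 -> y0 <= ym <= y1 -> cdiff_on f x0 x1 y0 y1 ->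
  rect_int f x0 x1 y0 y1 = (rect_int f x0 x1 y0 ym + rect_int f x0 x1 ym y1)%C.
Proof.
intros Hx Hy H. unfold rect_int.
rewrite <- (CInt_Chasles (fun y => f (x0, y)) y0 ym y1), <- (CInt_Chasles (fun y => f (x1, y)) y0 ym y1);
  try (apply (cdiff_on_int_v f x0 x1 y0 y1); auto; lra).
ring.
Qed.

Lemma cdiff_on_sub f x0 x1 y0 y1 x0' x1' y0' y1' : cdiff_on f x0 x1 y0 y1 ->
  x0 <= x0' -> x1' <= x1 -> y0 <= y0' -> y1' <= y1 -> cdiff_on f x0' x1' y0' y1'.
Proof. intros H ? ? ? ? x y Hx Hy. apply H; lra. Qed.

Lemma Cmod_half (a b c : C) : a = (b + c)%C -> Cmod a / 2 <= Cmod b \/ Cmod a / 2 <= Cmod c.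
Proof. intros ->. pose proof (Cmod_triangle b c). destruct (Rle_dec (Cmod (b + c) / 2) (Cmod b)); [now left|right; lra]. Qed.

Definition rect : Type := (R * R) * (R * R).

Definition rect_valid (f : C -> C) (r : rect) : Prop :=
  let '((x0, x1), (y0, y1)) := r in x0 <= x1 /\ y0 <= y1 /\ cdiff_on f x0 x1 y0 y1.

Definition rect_quarter (f : C -> C) (r r' : rect) : Prop :=
  let '((x0, x1), (y0, y1)) := r in
  let '((x0', x1'), (y0', y1')) := r' in
  x0 <= x0' /\ x1' <= x1 /\ y0 <= y0' /\ y1' <= y1 /\
  x1' - x0' = (x1 - x0) / 2 /\ y1' - y0' = (y1 - y0) / 2 /\
  Cmod (rect_int f x0 x1 y0 y1) / 4 <= Cmod (rect_int f x0' x1' y0' y1').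

(** Halving first in [x] and then in [y], each time keeping a half that carries at least half of the
    modulus. The validity hypothesis stands under the existential so that [choice_fun] gives a total
    map, which can be iterated. *)
Lemma rect_quarter_ex f r : exists r', rect_valid f r -> rect_quarter f r r'.
Proof.
destruct r as [[x0 x1] [y0 y1]].
destruct (classic (rect_valid f ((x0, x1), (y0, y1)))) as [Hv|]; [|now exists ((0,0),(0,0))].
destruct Hv as (Hx & Hy & Hd).
assert (H1 : exists a b, x0 <= a /\ b <= x1 /\ b - a = (x1 - x0) / 2 /\
   Cmod (rect_int f x0 x1 y0 y1) / 2 <= Cmod (rect_int f a b y0 y1)).
{ destruct (Cmod_half _ _ _ (rect_int_split_x f x0 ((x0 + x1) / 2) x1 y0 y1 ltac:(lra) Hy Hd)).
  - exists x0, ((x0 + x1) / 2). repeat split; lra.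
  - exists ((x0 + x1) / 2), x1. repeat split; lra. }
destruct H1 as (a & b & Ha & Hb & Hab & HI).
assert (Hd' : cdiff_on f a b y0 y1) by (apply (cdiff_on_sub f x0 x1 y0 y1); auto; lra).
destruct (Cmod_half _ _ _ (rect_int_split_y f a b y0 ((y0 + y1) / 2) y1 ltac:(lra) ltac:(lra) Hd')).
- exists ((a, b), (y0, (y0 + y1) / 2)). intros _. repeat split; lra.
- exists ((a, b), ((y0 + y1) / 2, y1)). intros _. repeat split; lra.
Qed.

(** On opposite sides the integrand differs by the constants $il(y_1-y_0)$ and $l(x_1-x_0)$, whose
    contributions cancel. *)
Lemma rect_int_affine (a l : C) x0 x1 y0 y1 : x0 <= x1 -> y0 <= y1 ->
  rect_int (fun z => a + l * z)%C x0 x1 y0 y1 = RtoC 0.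
Proof.
intros Hx Hy. set (f := fun z => (a + l * z)%C).
assert (Hd : cdiff_on f x0 x1 y0 y1).
{ intros x y _ _. apply cdiff_plus; [apply cdiff_const|apply cdiff_mult; [apply cdiff_const|apply cdiff_id]]. }
assert (E1 : CInt (fun x => f (x, y1)) x0 x1 = (CInt (fun x => f (x, y0)) x0 x1 + RtoC (x1 - x0) * (l * (Ci * RtoC (y1 - y0))))%C).
{ rewrite <- CInt_const, <- CInt_plus.
  - apply CInt_ext; auto. intros x _. unfold f. apply injective_projections; simpl; ring.
  - apply (cdiff_on_int_h f x0 x1 y0 y1); auto; lra.
  - apply cintegrable_const. }
assert (E2 : CInt (fun y => f (x1, y)) y0 y1 = (CInt (fun y => f (x0, y)) y0 y1 + RtoC (y1 - y0) * (l * RtoC (x1 - x0)))%C).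
{ rewrite <- CInt_const, <- CInt_plus.
  - apply CInt_ext; auto. intros x _. unfold f. apply injective_projections; simpl; ring.
  - apply (cdiff_on_int_v f x0 x1 y0 y1); auto; lra.
  - apply cintegrable_const. }
unfold rect_int. rewrite E1, E2. ring.
Qed.

Lemma rect_int_minus_affine f a l x0 x1 y0 y1 : x0 <= x1 -> y0 <= y1 -> cdiff_on f x0 x1 y0 y1 ->
  rect_int (fun z => f z - (a + l * z))%C x0 x1 y0 y1 = rect_int f x0 x1 y0 y1.
Proof.
intros Hx Hy Hd. set (g := fun z => (a + l * z)%C).
assert (Hg : cdiff_on g x0 x1 y0 y1).
{ intros x y _ _. apply cdiff_plus; [apply cdiff_const|apply cdiff_mult; [apply cdiff_const|apply cdiff_id]]. }
assert (HP : forall h1 h2 u v, u <= v -> cintegrable h1 u v -> cintegrable h2 u v ->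
  CInt (fun t => h1 t - h2 t)%C u v = (CInt h1 u v - CInt h2 u v)%C).
{ intros h1 h2 u v Huv I1 I2. rewrite (CInt_ext _ (fun t => h1 t + (-1) * h2 t)%C) by (auto; intros; ring).
  rewrite CInt_plus, CInt_scal; auto using cintegrable_scal. ring. }
transitivity (rect_int f x0 x1 y0 y1 - rect_int g x0 x1 y0 y1)%C.
- assert (Eh : forall y, y0 <= y <= y1 -> CInt (fun x => f (x, y) - g (x, y))%C x0 x1 =
    (CInt (fun x => f (x, y)) x0 x1 - CInt (fun x => g (x, y)) x0 x1)%C).
  { intros y Hy'. apply (HP (fun x => f (x, y)) (fun x => g (x, y)) x0 x1 Hx).
    - exact (cdiff_on_int_h f x0 x1 y0 y1 x0 x1 y Hd (Rle_refl _) Hx (Rle_refl _) Hy').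
    - exact (cdiff_on_int_h g x0 x1 y0 y1 x0 x1 y Hg (Rle_refl _) Hx (Rle_refl _) Hy'). }
  assert (Ev : forall x, x0 <= x <= x1 -> CInt (fun y => f (x, y) - g (x, y))%C y0 y1 =
    (CInt (fun y => f (x, y)) y0 y1 - CInt (fun y => g (x, y)) y0 y1)%C).
  { intros x Hx'. apply (HP (fun y => f (x, y)) (fun y => g (x, y)) y0 y1 Hy).
    - exact (cdiff_on_int_v f x0 x1 y0 y1 y0 y1 x Hd (Rle_refl _) Hy (Rle_refl _) Hx').
    - exact (cdiff_on_int_v g x0 x1 y0 y1 y0 y1 x Hg (Rle_refl _) Hy (Rle_refl _) Hx'). }
  unfold rect_int. fold g.
  change (fun z : C => (f z - (a + l * z))%C) with (fun z : C => (f z - g z)%C). cbv beta.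
  rewrite !Eh, !Ev by lra. ring.
- unfold g. rewrite rect_int_affine by auto. ring.
Qed.

Lemma Cmod_rect_int_le f x0 x1 y0 y1 M : x0 <= x1 -> y0 <= y1 -> cdiff_on f x0 x1 y0 y1 ->
  (forall x y, x0 <= x <= x1 -> y0 <= y <= y1 -> Cmod (f (x, y)) <= M) ->
  Cmod (rect_int f x0 x1 y0 y1) <= 2 * ((x1 - x0) + (y1 - y0)) * M.
Proof.
intros Hx Hy Hd HM.
assert (HH : forall y, y0 <= y <= y1 -> Cmod (CInt (fun x => f (x, y)) x0 x1) <= (x1 - x0) * M).
{ intros y Hy'. apply Cmod_CInt_le_const; auto. apply (cdiff_on_int_h f x0 x1 y0 y1); auto; lra. }
assert (HV : forall x, x0 <= x <= x1 -> Cmod (CInt (fun y => f (x, y)) y0 y1) <= (y1 - y0) * M).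
{ intros x Hx'. apply Cmod_CInt_le_const; auto. apply (cdiff_on_int_v f x0 x1 y0 y1); auto; lra. }
unfold rect_int, Cminus.
eapply Rle_trans; [apply Cmod_triangle|]. rewrite Cmod_mult, Cmod_Ci.
pose proof (Cmod_triangle (CInt (fun x => f (x, y0)) x0 x1) (- CInt (fun x => f (x, y1)) x0 x1)) as T1.
pose proof (Cmod_triangle (CInt (fun y => f (x1, y)) y0 y1) (- CInt (fun y => f (x0, y)) y0 y1)) as T2.
rewrite Cmod_opp in T1, T2.
pose proof (HH y0 ltac:(lra)). pose proof (HH y1 ltac:(lra)). pose proof (HV x0 ltac:(lra)). pose proof (HV x1 ltac:(lra)).
lra.
Qed.

Lemma nested_intervals (a b : nat -> R) :
  (forall k, a k <= a (S k)) -> (forall k, b (S k) <= b k) -> (forall k, a k <= b k) ->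
  exists x, forall k, a k <= x <= b k.
Proof.
intros Ha Hb Hab.
assert (Ham : forall k j, a k <= a (k + j)%nat).
{ intros k j. induction j; [rewrite Nat.add_0_r; lra|]. rewrite Nat.add_succ_r. specialize (Ha (k + j)%nat). lra. }
assert (Hbm : forall k j, b (k + j)%nat <= b k).
{ intros k j. induction j; [rewrite Nat.add_0_r; lra|]. rewrite Nat.add_succ_r. specialize (Hb (k + j)%nat). lra. }
assert (Hc : forall k j, a k <= b j).
{ intros k j. pose proof (Ham k j). pose proof (Hbm j k). rewrite Nat.add_comm in H0. specialize (Hab (k + j)%nat). lra. }
destruct (completeness (fun v => exists k, v = a k)) as [s [H1 H2]].
- exists (b 0%nat). intros v [k ->]. apply Hc.
- exists (a 0%nat). now exists 0%nat.
- exists s. intros k. split; [apply H1; now exists k|]. apply H2. intros v [j ->]. apply Hc.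
Qed.

(** If the modulus $M$ were positive, nested quarters would carry at least $M/4^k$. After
    subtraction of the affine part at their common point, the integrand is at most $e\,2^{-k}(w+h)$
    on a boundary of length $2\cdot2^{-k}(w+h)$. *)
Lemma goursat f x0 x1 y0 y1 : x0 <= x1 -> y0 <= y1 -> cdiff_on f x0 x1 y0 y1 ->
  rect_int f x0 x1 y0 y1 = RtoC 0.
Proof.
intros Hx Hy Hd.
destruct (Req_dec (Cmod (rect_int f x0 x1 y0 y1)) 0) as [E0|Hn]; [now apply Cmod_eq_0|]. exfalso.
set (M := Cmod (rect_int f x0 x1 y0 y1)) in *.
assert (HM : 0 < M) by (pose proof (Cmod_ge_0 (rect_int f x0 x1 y0 y1)); fold M in H; lra).
destruct (choice_fun _ (rect_quarter_ex f)) as [q Hq].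
set (r := fix r k := match k with O => ((x0, x1), (y0, y1)) | S k => q (r k) end).
set (w := x1 - x0). set (h := y1 - y0).
assert (Hr : forall k, rect_valid f (r k) /\ let '((a, b), (c, d)) := r k in
   x0 <= a /\ b <= x1 /\ y0 <= c /\ d <= y1 /\ b - a = w / 2 ^ k /\ d - c = h / 2 ^ k /\ M / 4 ^ k <= Cmod (rect_int f a b c d)).
{ induction k as [|k [IHv IH]].
  - simpl. repeat split; auto; try lra; unfold w, h, M; lra.
  - specialize (Hq (r k) IHv). change (r (S k)) with (q (r k)).
    destruct (r k) as [[a b] [c d]]. destruct (q ((a, b), (c, d))) as [[a' b'] [c' d']].
    destruct Hq as (Q1 & Q2 & Q3 & Q4 & Q5 & Q6 & Q7). destruct IHv as (V1 & V2 & V3).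
    destruct IH as (I1 & I2 & I3 & I4 & I5 & I6 & I7). split.
    + repeat split; try lra. apply (cdiff_on_sub f a b c d); auto.
    + assert (H2k : 0 < 2 ^ k) by (apply pow_lt; lra). assert (H4k : 0 < 4 ^ k) by (apply pow_lt; lra).
      repeat split; try lra.
      * rewrite Q5, I5. simpl. field. lra.
      * rewrite Q6, I6. simpl. field. lra.
      * eapply Rle_trans; [|apply Q7]. replace (M / 4 ^ S k) with (M / 4 ^ k / 4) by (simpl; field; lra). lra. }
set (A := fun k => fst (fst (r k))). set (B := fun k => snd (fst (r k))).
set (Cc := fun k => fst (snd (r k))). set (D := fun k => snd (snd (r k))).
assert (HS : forall k, A k <= A (S k) /\ B (S k) <= B k /\ Cc k <= Cc (S k) /\ D (S k) <= D k /\ A k <= B k /\ Cc k <= D k).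
{ intros k. destruct (Hr k) as [Hv _]. specialize (Hq (r k) Hv). unfold A, B, Cc, D. change (r (S k)) with (q (r k)).
  destruct (r k) as [[a b] [c d]]. destruct (q ((a, b), (c, d))) as [[a' b'] [c' d']]. simpl.
  destruct Hq as (Q1 & Q2 & Q3 & Q4 & _). destruct Hv as (V1 & V2 & _). lra. }
destruct (nested_intervals A B) as [xs Hxs]; try (intros; apply HS).
destruct (nested_intervals Cc D) as [ys Hys]; try (intros; apply HS).
assert (Hz : cdiff f (xs, ys)).
{ pose proof (Hxs 0%nat) as X. pose proof (Hys 0%nat) as Y. change (x0 <= xs <= x1) in X. change (y0 <= ys <= y1) in Y. now apply Hd. }
destruct Hz as [l Hl].
assert (Hw : 0 <= w /\ 0 <= h) by (unfold w, h; lra).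
(* Small enough that the resulting bound $M\le2e(w+h)^2$ is absurd; the summand 1 covers degenerate
   rectangles. *)
set (e := M / (4 * (w + h) ^ 2 + 1)).
assert (Hp : 0 <= (w + h) ^ 2) by apply pow2_ge_0.
assert (He : 0 < e) by (apply Rdiv_lt_0_compat; lra).
destruct (Hl e He) as (d & Hd0 & K).
destruct (nfloor_ex ((w + h) / d)) as [k [_ Hk]]; [apply Rdiv_le_0_compat; lra|].
assert (H2k : 0 < 2 ^ k) by (apply pow_lt; lra).
assert (Hk2 : INR k + 1 <= 2 ^ k).
{ clear. induction k; [simpl; lra|]. rewrite S_INR. simpl. pose proof (pos_INR k). lra. }
assert (Hkd : (w + h) / 2 ^ k < d).
{ apply Rlt_div_l; [easy|]. apply Rlt_div_l in Hk; [|easy]. nra. }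
destruct (Hr k) as [Hv HI]. specialize (Hxs k). specialize (Hys k). unfold A, B, Cc, D in Hxs, Hys.
destruct (r k) as [[a b] [c dd]]. simpl in Hxs, Hys. destruct Hv as (V1 & V2 & V3).
destruct HI as (I1 & I2 & I3 & I4 & I5 & I6 & I7).
rewrite <- (rect_int_minus_affine f (f (xs, ys) - l * (xs, ys))%C l) in I7 by auto.
assert (HB : Cmod (rect_int (fun z => f z - (f (xs, ys) - l * (xs, ys) + l * z))%C a b c dd) <=
  2 * ((b - a) + (dd - c)) * (e * ((w + h) / 2 ^ k))).
{ apply Cmod_rect_int_le; auto.
  - intros x y Hxx Hyy. unfold Cminus. apply cdiff_plus; [apply V3; auto|].
    apply (cdiff_ext (fun z => (-1) * (f (xs, ys) + - (l * (xs, ys)) + l * z))%C); [intros; ring|].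
    apply cdiff_mult; [apply cdiff_const|]. apply cdiff_plus; [apply cdiff_const|apply cdiff_mult; [apply cdiff_const|apply cdiff_id]].
  - intros x y Hxx Hyy. set (hh := (x - xs, y - ys) : C).
    assert (Hh : Cmod hh <= (w + h) / 2 ^ k).
    { eapply Rle_trans; [apply Cmod_le_parts|]. simpl.
      assert (Rabs (x - xs) <= b - a) by (apply Rabs_le; lra). assert (Rabs (y - ys) <= dd - c) by (apply Rabs_le; lra).
      replace ((w + h) / 2 ^ k) with (w / 2 ^ k + h / 2 ^ k) by (field; lra). lra. }
    specialize (K hh ltac:(lra)). replace (Cplus (xs, ys) hh) with ((x, y) : C) in K by (unfold hh; apply injective_projections; simpl; ring).
    replace (f (x, y) - (f (xs, ys) - l * (xs, ys) + l * (x, y)))%C with (f (x, y) - f (xs, ys) - l * hh)%C.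
    2:{ replace hh with (Cplus (x, y) (Copp (xs, ys))) by (unfold hh; apply injective_projections; simpl; ring). ring. }
    eapply Rle_trans; [apply K|]. apply Rmult_le_compat_l; lra. }
rewrite I5, I6 in HB.
assert (HF : M / 4 ^ k <= 2 * e * (w + h) ^ 2 / 4 ^ k).
{ eapply Rle_trans; [apply I7|]. eapply Rle_trans; [apply HB|]. apply Req_le.
  replace (4 ^ k) with (2 ^ k * 2 ^ k) by (rewrite <- Rpow_mult_distr; f_equal; lra). field. lra. }
assert (H4k : 0 < 4 ^ k) by (apply pow_lt; lra).
apply Rmult_le_compat_r with (r := 4 ^ k) in HF; [|lra].
replace (M / 4 ^ k * 4 ^ k) with M in HF by (field; lra).
replace (2 * e * (w + h) ^ 2 / 4 ^ k * 4 ^ k) with (2 * e * (w + h) ^ 2) in HF by (field; lra).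
assert (He2 : e * (4 * (w + h) ^ 2 + 1) = M) by (unfold e; field; lra).
nra.
Qed.

(** * Gaussian localization at a boundary point *)

Lemma Cmod_minus_le a b : Rabs (Cmod a - Cmod b) <= Cmod (a - b)%C.
Proof.
pose proof (Cmod_triangle (a - b) b) as H1. replace (a - b + b)%C with a in H1 by ring.
pose proof (Cmod_triangle (b - a) a) as H2. replace (b - a + a)%C with b in H2 by ring.
rewrite <- (Cmod_opp (b - a)) in H2. replace (- (b - a))%C with (a - b)%C in H2 by ring.
apply Rabs_le. lra.
Qed.

Lemma ccont_bounded f a b : a <= b -> (forall x, a <= x <= b -> ccont f x) ->
  exists M, 0 <= M /\ forall x, a <= x <= b -> Cmod (f x) <= M.
Proof.
intros Hab H. destruct (continuity_ab_maj (fun x => Cmod (f x)) a b Hab) as (m & Hm & _).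
- intros c Hc. apply continuity_pt_filterlim. apply continuous_eps. intros e He.
  pose proof (H c Hc) as Hcc. rewrite ccont_eps in Hcc. destruct (Hcc e He) as (d & Hd & K).
  exists d. split; auto. intros y Hy. eapply Rle_lt_trans; [apply Cmod_minus_le|auto].
- exists (Cmod (f m)). split; [apply Cmod_ge_0|auto].
Qed.

Lemma RInt_ge_const (g : R -> R) a b m : a <= b -> ex_RInt g a b ->
  (forall x, a <= x <= b -> m <= g x) -> (b - a) * m <= RInt g a b.
Proof.
intros Hab Hg H. replace ((b - a) * m) with (RInt (fun _ => m) a b) by (rewrite RInt_const; reflexivity).
apply RInt_le; auto; [apply ex_RInt_const|]. intros x Hx. apply H. lra.
Qed.

Lemma Ci_Ci : (Ci * Ci = -1)%C.
Proof. apply injective_projections; simpl; ring. Qed.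

Section GaussianLocalization.

Variables (D : C -> C) (X : R).
Hypothesis X_pos : 0 < X.
Hypothesis D_diff : forall p, 0 <= Re p -> cdiff D p.
Hypothesis D_vanishes : forall p, X <= Re p -> D p = RtoC 0.

Let B := X + 1.

Let tilted (q : R) (p : C) : C := (D p * cexp (RtoC (q ^ 2) * (p * p)))%C.

Lemma tilted_diff q p : 0 <= Re p -> cdiff (tilted q) p.
Proof.
intros Hp. apply cdiff_mult; [auto|]. apply (cdiff_comp cexp).
- apply cdiff_mult; [apply cdiff_const|]. apply cdiff_mult; apply cdiff_id.
- apply cdiff_cexp.
Qed.

Lemma Cmod_tilted q x y : Cmod (tilted q (x, y)) = Cmod (D (x, y)) * exp (q ^ 2 * (x ^ 2 - y ^ 2)).
Proof. unfold tilted. rewrite Cmod_mult, Cmod_cexp. do 2 f_equal. simpl. ring. Qed.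

Lemma tilted_axis q y : tilted q (0, y) = (RtoC (exp (- (q ^ 2 * y ^ 2))) * D (0, y))%C.
Proof.
unfold tilted. rewrite Cmult_comm. f_equal.
rewrite <- cexp_RtoC. f_equal. apply injective_projections; simpl; ring.
Qed.

(** Goursat's theorem on $[0,X]\times[-B,B]$: on the right side [D] is zero, and on the horizontal
    sides the factor has modulus $e^{q^2(x^2-B^2)}\le e^{-q^2}$, because $B=X+1$. *)
Lemma tilted_axis_integral_small : exists M, 0 <= M /\ forall q,
  Cmod (CInt (fun y => tilted q (0, y)) (- B) B) <= M * exp (- q ^ 2).
Proof.
assert (Hb : forall y, exists M, 0 <= M /\ forall x, 0 <= x <= X -> Cmod (D (x, y)) <= M).
{ intros y. apply (ccont_bounded (fun x => D (x, y))); [lra|]. intros x Hx. apply cdiff_ccont_h, D_diff. simpl; lra. }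
destruct (Hb (- B)) as (M1 & HM1 & K1). destruct (Hb B) as (M2 & HM2 & K2).
exists (X * M1 + X * M2). split; [nra|]. intros q.
assert (Hd : cdiff_on (tilted q) 0 X (- B) B) by (intros x y Hx Hy; apply tilted_diff; simpl; lra).
assert (HB : - B <= B) by (unfold B; lra). assert (HX : 0 <= X) by lra.
pose proof (goursat (tilted q) 0 X (- B) B HX HB Hd) as G. unfold rect_int in G.
rewrite (CInt_ext (fun y => tilted q (X, y)) (fun _ => RtoC 0)) in G.
2: exact HB.
2:{ intros y _. unfold tilted. rewrite D_vanishes by (simpl; lra). ring. }
rewrite CInt_const in G.
assert (HS : forall y M, - B <= y <= B -> y ^ 2 = B ^ 2 -> 0 <= M -> (forall x, 0 <= x <= X -> Cmod (D (x, y)) <= M) ->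
   Cmod (CInt (fun x => tilted q (x, y)) 0 X) <= X * M * exp (- q ^ 2)).
{ intros y M Hy Hy2 HM HMx. replace (X * M * exp (- q ^ 2)) with ((X - 0) * (M * exp (- q ^ 2))) by ring.
  apply Cmod_CInt_le_const; auto.
  - exact (cdiff_on_int_h (tilted q) 0 X (- B) B 0 X y Hd (Rle_refl _) HX (Rle_refl _) Hy).
  - intros x Hx. rewrite Cmod_tilted. apply Rmult_le_compat; auto using Cmod_ge_0, Rlt_le, exp_pos.
    apply exp_le. rewrite Hy2. assert (x ^ 2 - B ^ 2 <= -1) by (unfold B; nra). pose proof (pow2_ge_0 q). nra. }
pose proof (HS (- B) M1 ltac:(lra) ltac:(ring) HM1 K1) as S1. pose proof (HS B M2 ltac:(lra) ltac:(ring) HM2 K2) as S2.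
set (I1 := CInt (fun x => tilted q (x, - B)) 0 X) in *. set (I2 := CInt (fun x => tilted q (x, B)) 0 X) in *.
set (I3 := CInt (fun y => tilted q (0, y)) (- B) B) in *.
assert (E0 : I3 = (- Ci * (I1 + - I2))%C).
{ transitivity (- Ci * (I1 - I2 + Ci * (RtoC (B - - B) * 0 - I3) + Ci * I3))%C.
  - transitivity (- (Ci * Ci) * I3)%C; [rewrite Ci_Ci; ring|]. rewrite G. ring.
  - ring. }
rewrite E0, Cmod_mult, Cmod_opp, Cmod_Ci, Rmult_1_l.
eapply Rle_trans; [apply Cmod_triangle|]. rewrite Cmod_opp. lra.
Qed.

(** The Gaussian weight concentrates the integral over the imaginary axis at
    the origin, while shifting the contour to the right shows that it is tiny. *)
Lemma vanishing_at_origin : D (RtoC 0) = RtoC 0.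
Proof.
destruct (Req_dec (Cmod (D (RtoC 0))) 0) as [E0|Hn]; [now apply Cmod_eq_0|]. exfalso.
change (RtoC 0) with ((0, 0) : C) in Hn. set (d := D (0, 0)) in *.
assert (Hd : 0 < Cmod d) by (pose proof (Cmod_ge_0 d); lra).
destruct tilted_axis_integral_small as (M & HM & HI).
assert (Hcy : forall y, ccont (fun y => D (0, y)) y) by (intros y; apply cdiff_ccont_v, D_diff; simpl; lra).
destruct (ccont_bounded (fun y => D (0, y)) (- B) B ltac:(unfold B; lra) ltac:(auto)) as (M' & HM' & KM').
pose proof (Hcy 0) as H0. rewrite ccont_eps in H0. destruct (H0 (Cmod d / 2)) as (dl0 & Hdl0 & K); [lra|].
set (dl := Rmin dl0 1). assert (Hdl : 0 < dl <= 1) by (unfold dl; split; [apply Rmin_pos; lra|apply Rmin_r]).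
assert (Hdl' : dl <= dl0) by apply Rmin_l.
assert (HB : 1 < B) by (unfold B; lra).
(* The final estimate will force [q <= T], while [q] is chosen above [T + / dl + 1]. *)
set (T := (M + 2 * B * M') * exp 1 / (Cmod d * dl ^ 2)).
destruct (nfloor_ex (T + / dl + 1)) as [N [_ HN]].
{ assert (0 <= T). { apply Rdiv_le_0_compat; [|apply Rmult_lt_0_compat; [lra|apply pow_lt; lra]]. apply Rmult_le_pos; [nra|apply Rlt_le, exp_pos]. }
  assert (0 < / dl) by (apply Rinv_0_lt_compat; lra). lra. }
set (q := INR N + 1) in *.
assert (HT : 0 <= T). { apply Rdiv_le_0_compat; [|apply Rmult_lt_0_compat; [lra|apply pow_lt; lra]]. apply Rmult_le_pos; [nra|apply Rlt_le, exp_pos]. }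
assert (Hidl : 0 < / dl) by (apply Rinv_0_lt_compat; lra).
assert (Hq : 1 < q) by lra.
assert (Hqdl : / q < dl).
{ rewrite <- (Rinv_inv dl). apply Rinv_lt_contravar; [nra|lra]. }
assert (Hiq : 0 < / q) by (apply Rinv_0_lt_compat; lra).
(* Multiplication by the conjugate of [d] turns the value at the origin into the positive number
   $|d|^2$, so that the real part has a positive lower bound nearby. *)
set (G := fun y => Re (Cconj d * tilted q (0, y))%C).
assert (HGe : forall y, G y = exp (- (q ^ 2 * y ^ 2)) * Re (Cconj d * D (0, y))%C).
{ intros y. unfold G. rewrite tilted_axis. replace (Cconj d * (RtoC (exp (- (q ^ 2 * y ^ 2))) * D (0, y)))%C with (RtoC (exp (- (q ^ 2 * y ^ 2))) * (Cconj d * D (0, y)))%C by ring.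
  apply re_scal_l. }
assert (Hint : forall a b, a <= b -> cintegrable (fun y => tilted q (0, y)) a b).
{ intros a b Hab. apply cintegrable_continuous; auto. intros y _. apply cdiff_ccont_v, tilted_diff. simpl; lra. }
assert (HGint : forall a b, a <= b -> ex_RInt G a b).
{ intros a b Hab. apply (cintegrable_scal (Cconj d) (fun y => tilted q (0, y))). auto. }
assert (HGI : RInt G (- B) B <= Cmod d * (M * exp (- q ^ 2))).
{ replace (RInt G (- B) B) with (Re (Cconj d * CInt (fun y => tilted q (0, y)) (- B) B)%C).
  - eapply Rle_trans; [apply Rle_abs|]. eapply Rle_trans; [apply re_le_Cmod|]. rewrite Cmod_mult, Cmod_conj.
    apply Rmult_le_compat_l; [lra|apply HI].
  - rewrite <- CInt_scal by (apply Hint; lra). reflexivity. }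
assert (Hnear : forall y, Rabs y <= dl -> Rabs y < dl0 -> Cmod d ^ 2 / 2 <= Re (Cconj d * D (0, y))%C).
{ intros y _ Hy. specialize (K y). rewrite Rminus_0_r in K. specialize (K Hy). fold d in K.
  replace (Re (Cconj d * D (0, y))%C) with (Cmod d ^ 2 + Re (Cconj d * (D (0, y) - d))%C).
  - pose proof (re_le_Cmod (Cconj d * (D (0, y) - d))%C) as R1. rewrite Cmod_mult, Cmod_conj in R1.
    apply Rabs_le_between in R1. assert (Cmod d * Cmod (D (0, y) - d)%C <= Cmod d * (Cmod d / 2)) by (apply Rmult_le_compat_l; lra). nra.
  - rewrite Cmod2_alt. destruct d, (D (0, y)). simpl. ring. }
set (m := - (Cmod d * M' * exp (- (q ^ 2 * dl ^ 2)))).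
assert (Hm : m <= 0).
{ unfold m. pose proof (exp_pos (- (q ^ 2 * dl ^ 2))). assert (0 <= Cmod d * M') by nra. nra. }
assert (Hout : forall y, - B <= y <= B -> m <= G y).
{ intros y Hy. rewrite HGe. pose proof (exp_pos (- (q ^ 2 * y ^ 2))) as Hexp.
  destruct (Rlt_dec (Rabs y) dl) as [Hlt|Hge].
  - pose proof (Hnear y ltac:(lra) ltac:(lra)). assert (0 <= Cmod d ^ 2) by apply pow2_ge_0.
    assert (0 <= exp (- (q ^ 2 * y ^ 2)) * Re (Cconj d * D (0, y))%C) by (apply Rmult_le_pos; lra). lra.
  - assert (Hy2 : dl ^ 2 <= y ^ 2) by (rewrite <- (pow2_abs y); apply pow_incr; lra).
    assert (HE : exp (- (q ^ 2 * y ^ 2)) <= exp (- (q ^ 2 * dl ^ 2))) by (apply exp_le; nra).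
    pose proof (re_le_Cmod (Cconj d * D (0, y))%C) as R1. rewrite Cmod_mult, Cmod_conj in R1.
    assert (Cmod d * Cmod (D (0, y)) <= Cmod d * M') by (apply Rmult_le_compat_l; [lra|auto]).
    apply Rabs_le_between in R1. unfold m.
    assert (exp (- (q ^ 2 * y ^ 2)) * (Cmod d * M') <= exp (- (q ^ 2 * dl ^ 2)) * (Cmod d * M')) by (apply Rmult_le_compat_r; nra).
    assert (exp (- (q ^ 2 * y ^ 2)) * (- (Cmod d * M')) <= exp (- (q ^ 2 * y ^ 2)) * Re (Cconj d * D (0, y))%C) by (apply Rmult_le_compat_l; lra).
    lra. }
assert (Hin : forall y, - / q <= y <= / q -> exp (-1) * (Cmod d ^ 2 / 2) <= G y).
{ intros y Hy. rewrite HGe. assert (Rabs y <= / q) by (apply Rabs_le; lra).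
  apply Rmult_le_compat; [apply Rlt_le, exp_pos| |apply exp_le|apply Hnear; lra].
  - pose proof (pow2_ge_0 (Cmod d)). lra.
  - assert (Hy2 : y ^ 2 <= (/ q) ^ 2) by (rewrite <- (pow2_abs y); apply pow_incr; split; [apply Rabs_pos|easy]).
    assert (q ^ 2 * y ^ 2 <= q ^ 2 * (/ q) ^ 2) by (apply Rmult_le_compat_l; [apply pow2_ge_0|easy]).
    replace (q ^ 2 * (/ q) ^ 2) with 1 in H1 by (field; lra). lra. }
assert (HqB : / q < B) by lra.
(* The middle interval contributes a multiple of $1/q$, the rest at worst a multiple of
   $e^{-q^2dl^2}<1/(q\,dl)^2$; for large [q] this conflicts with the upper bound [HGI]. *)
assert (Hlow : 2 * / q * (exp (-1) * (Cmod d ^ 2 / 2)) + 2 * B * m <= RInt G (- B) B).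
{ pose proof (RInt_ge_const G (- B) (- / q) m ltac:(lra) (HGint (- B) (- / q) ltac:(lra)) ltac:(intros; apply Hout; lra)) as J1.
  pose proof (RInt_ge_const G (- / q) (/ q) _ ltac:(lra) (HGint (- / q) (/ q) ltac:(lra)) Hin) as J2.
  pose proof (RInt_ge_const G (/ q) B m ltac:(lra) (HGint (/ q) B ltac:(lra)) ltac:(intros; apply Hout; lra)) as J3.
  pose proof (RInt_Chasles (V := R_CompleteNormedModule) G (- B) (- / q) (/ q) (HGint (- B) (- / q) ltac:(lra)) (HGint (- / q) (/ q) ltac:(lra))) as C1.
  pose proof (RInt_Chasles (V := R_CompleteNormedModule) G (- B) (/ q) B (HGint (- B) (/ q) ltac:(lra)) (HGint (/ q) B ltac:(lra))) as C2.
  unfold plus in C1, C2; simpl in C1, C2. rewrite <- C2, <- C1. nra. }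
assert (Hexp1 : exp (- q ^ 2) <= exp (- (q ^ 2 * dl ^ 2))).
{ apply exp_le. assert (dl ^ 2 <= 1) by nra. pose proof (pow2_ge_0 q). nra. }
assert (Hexp2 : exp (- (q ^ 2 * dl ^ 2)) < / (q ^ 2 * dl ^ 2)).
{ assert (0 < q ^ 2 * dl ^ 2) by (apply Rmult_lt_0_compat; apply pow_lt; lra).
  eapply Rle_lt_trans; [apply exp_neg_le; lra|]. apply Rinv_lt_contravar; nra. }
assert (Hfin : / q * (exp (-1) * Cmod d) <= (M + 2 * B * M') * exp (- (q ^ 2 * dl ^ 2))).
{ apply Rmult_le_reg_l with (Cmod d); [easy|]. unfold m in Hlow.
  assert (Cmod d * (M * exp (- q ^ 2)) <= Cmod d * (M * exp (- (q ^ 2 * dl ^ 2)))).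
  { apply Rmult_le_compat_l; [lra|]. apply Rmult_le_compat_l; lra. }
  nra. }
assert (Hfin2 : / q * (exp (-1) * Cmod d) <= (M + 2 * B * M') * / (q ^ 2 * dl ^ 2)).
{ eapply Rle_trans; [apply Hfin|]. apply Rmult_le_compat_l; [nra|lra]. }
assert (He1 : exp (-1) * exp 1 = 1) by (rewrite <- exp_plus; replace (-1 + 1) with 0 by ring; apply exp_0).
assert (HqT : q <= T).
{ assert (0 < dl ^ 2) by (apply pow_lt; lra). assert (0 < q ^ 2) by (apply pow_lt; lra).
  apply Rmult_le_compat_l with (r := q ^ 2 * exp 1 / Cmod d) in Hfin2.
  2:{ pose proof (exp_pos 1). apply Rdiv_le_0_compat; [nra|easy]. }
  replace (q ^ 2 * exp 1 / Cmod d * (/ q * (exp (-1) * Cmod d))) with (q * (exp (-1) * exp 1)) in Hfin2 by (field; lra).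
  rewrite He1 in Hfin2. unfold T.
  replace (q ^ 2 * exp 1 / Cmod d * ((M + 2 * B * M') * / (q ^ 2 * dl ^ 2))) with ((M + 2 * B * M') * exp 1 / (Cmod d * dl ^ 2)) in Hfin2 by (field; lra).
  lra. }
lra.
Qed.

End GaussianLocalization.

(** * Incomplete Gamma functions and Mellin transforms *)

Fixpoint exp_trunc (m : nat) (y : R) : R :=
  match m with O => 0 | S k => exp_trunc k y + y ^ k / INR (fact k) end.

(** The regularized incomplete Gamma function [Gamma(m, y) / Gamma(m)]; it is also the
    probability that a Poisson variable of mean [y] is less than [m], whence the Markov
    and Chernoff bounds below. *)
Definition gamma_tail (m : nat) (y : R) : R := exp (- y) * exp_trunc m y.

Lemma exp_trunc_ge0 m y : 0 <= y -> 0 <= exp_trunc m y.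
Proof.
intros Hy. induction m as [|m IH]; simpl; [lra|].
assert (0 <= y ^ m / INR (fact m)) by (apply Rdiv_le_0_compat; [now apply pow_le|apply INR_fact_lt_0]). lra.
Qed.

Lemma exp_trunc_derive m y : is_derive (exp_trunc (S m)) y (exp_trunc m y).
Proof.
induction m as [|m IH].
- apply (is_derive_ext (fun _ => 1)); [intros t; simpl; field|]. apply (is_derive_const (K := R_AbsRing) (V := R_NormedModule)).
- apply (is_derive_plus (K := R_AbsRing) (V := R_NormedModule) (exp_trunc (S m)) (fun y => y ^ S m / INR (fact (S m))) y); [exact IH|].
  assert (Ec : INR (fact (S m)) = INR (S m) * INR (fact m)) by (now rewrite fact_simpl, mult_INR).
  pose proof (INR_fact_neq_0 m). pose proof (INR_fact_neq_0 (S m)) as Hc.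
  set (c := INR (fact (S m))) in *.
  assert (HS : INR (S m) <> 0) by (apply not_0_INR; lia).
  replace (y ^ m / INR (fact m)) with (INR (S m) * y ^ m / c) by (rewrite Ec; field; auto).
  auto_derive; auto. change (pred (S m)) with m. change (1 * (INR (S m) * y ^ m) * / c = INR (S m) * y ^ m / c). field. auto.
Qed.

Lemma exp_trunc_0 m : exp_trunc (S m) 0 = 1.
Proof.
induction m as [|m IH]; [simpl; field|].
change (exp_trunc (S (S m)) 0) with (exp_trunc (S m) 0 + 0 ^ S m / INR (fact (S m))).
rewrite IH. simpl pow. field. apply INR_fact_neq_0.
Qed.

Lemma gamma_tail_derive m y : is_derive (gamma_tail (S m)) y (- (exp (- y) * y ^ m / INR (fact m))).
Proof.
replace (- (exp (- y) * y ^ m / INR (fact m))) with (- exp (- y) * exp_trunc (S m) y + exp (- y) * exp_trunc m y)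
  by (simpl; field; apply INR_fact_neq_0).
apply (is_derive_mult (K := R_AbsRing) (fun y => exp (- y)) (exp_trunc (S m)) y); [|apply exp_trunc_derive|intros; apply Rmult_comm].
auto_derive; auto. ring.
Qed.

Lemma gamma_tail_0 m : gamma_tail (S m) 0 = 1.
Proof. unfold gamma_tail. rewrite exp_trunc_0, Ropp_0, exp_0. ring. Qed.

Lemma gamma_tail_ge0 m y : 0 <= y -> 0 <= gamma_tail m y.
Proof. intros Hy. apply Rmult_le_pos; [apply Rlt_le, exp_pos|now apply exp_trunc_ge0]. Qed.

Lemma gamma_tail_decreasing m x y : 0 <= x <= y -> gamma_tail (S m) y <= gamma_tail (S m) x.
Proof.
intros [Hx Hxy].
pose proof (increasing_from_derivative (fun y => - gamma_tail (S m) y) (fun y => exp (- y) * y ^ m / INR (fact m)) x y Hxy) as H.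
cut (- gamma_tail (S m) x <= - gamma_tail (S m) y); [lra|]. apply H.
- intros t Ht. replace (exp (- t) * t ^ m / INR (fact m)) with (- - (exp (- t) * t ^ m / INR (fact m))) by ring.
  apply (is_derive_opp (K := R_AbsRing) (V := R_NormedModule)), gamma_tail_derive.
- intros t Ht. apply Rdiv_le_0_compat; [|apply INR_fact_lt_0]. apply Rmult_le_pos; [apply Rlt_le, exp_pos|apply pow_le; lra].
Qed.

Lemma gamma_tail_le1 m y : 0 <= y -> gamma_tail m y <= 1.
Proof.
intros Hy. destruct m as [|m].
- unfold gamma_tail; simpl. lra.
- rewrite <- (gamma_tail_0 m). apply gamma_tail_decreasing. lra.
Qed.

Lemma gamma_tail_le_S m y : 0 <= y -> gamma_tail m y <= gamma_tail (S m) y.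
Proof.
intros Hy. apply Rmult_le_compat_l; [apply Rlt_le, exp_pos|]. simpl.
assert (0 <= y ^ m / INR (fact m)) by (apply Rdiv_le_0_compat; [now apply pow_le|apply INR_fact_lt_0]). lra.
Qed.

Lemma gamma_tail_le m n y : (m <= n)%nat -> 0 <= y -> gamma_tail m y <= gamma_tail n y.
Proof. intros H Hy. induction H; [lra|]. eapply Rle_trans; [eassumption|now apply gamma_tail_le_S]. Qed.

Lemma exp_trunc_le_exp m y : 0 <= y -> exp_trunc m y <= exp y.
Proof.
intros Hy. pose proof (gamma_tail_le1 m y Hy) as H. unfold gamma_tail in H.
assert (He : exp y * exp (- y) = 1) by (rewrite <- exp_plus, Rplus_opp_r; apply exp_0).
apply Rmult_le_compat_l with (r := exp y) in H; [|apply Rlt_le, exp_pos]. rewrite <- Rmult_assoc, He in H. lra.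
Qed.

(** Induction on [m]: with $T_m$ the truncated exponential, $te^t-(m+1)(e^t-T_{m+1})$ is zero at $0$
    and has the derivative $(t+1)e^t-(m+1)(e^t-T_m)$, nonnegative by the induction hypothesis. *)
Lemma gamma_tail_markov m y : 0 <= y -> INR m * (1 - gamma_tail m y) <= y.
Proof.
intros Hy0.
assert (H : INR m * (exp y - exp_trunc m y) <= y * exp y).
{ revert y Hy0. induction m as [|m IH]; intros y Hy.
  - simpl. pose proof (exp_pos y). nra.
  - pose proof (increasing_from_derivative (fun t => t * exp t - INR (S m) * (exp t - exp_trunc (S m) t))
     (fun t => (t + 1) * exp t - INR (S m) * (exp t - exp_trunc m t)) 0 y Hy) as H.
    cut (0 * exp 0 - INR (S m) * (exp 0 - exp_trunc (S m) 0) <= y * exp y - INR (S m) * (exp y - exp_trunc (S m) y)).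
    + rewrite exp_trunc_0, exp_0. lra.
    + apply H.
      * intros t _. apply (is_derive_minus (K := R_AbsRing) (V := R_NormedModule) (fun t => t * exp t) (fun t => INR (S m) * (exp t - exp_trunc (S m) t))).
        -- auto_derive; auto. ring.
        -- apply (is_derive_scal (fun t => exp t - exp_trunc (S m) t)).
           apply (is_derive_minus (K := R_AbsRing) (V := R_NormedModule) exp (exp_trunc (S m))); [auto_derive; auto; ring|apply exp_trunc_derive].
      * intros t Ht. specialize (IH t ltac:(lra)). pose proof (exp_trunc_ge0 m t ltac:(lra)). rewrite S_INR. lra. }
unfold gamma_tail. assert (He : exp y * exp (- y) = 1) by (rewrite <- exp_plus, Rplus_opp_r; apply exp_0).
apply Rmult_le_reg_l with (exp y); [apply exp_pos|].
replace (exp y * (INR m * (1 - exp (- y) * exp_trunc m y))) with (INR m * (exp y - exp y * exp (- y) * exp_trunc m y)) by ring.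
rewrite He. lra.
Qed.

(** Termwise $r^m\le r^k$ for $k<m$, so the truncated exponential satisfies $T_m(y)r^m\le T_m(ry)\le
    e^{ry}$. *)
Lemma gamma_tail_chernoff m y r : 0 <= y -> 0 < r <= 1 -> gamma_tail m y * r ^ m <= exp (- ((1 - r) * y)).
Proof.
intros Hy Hr. unfold gamma_tail.
assert (H : exp_trunc m y * r ^ m <= exp_trunc m (r * y)).
{ assert (Hg : forall k, (k <= m)%nat -> exp_trunc k y * r ^ m <= exp_trunc k (r * y)).
  { induction k as [|k IH]; intros Hk; simpl; [lra|]. specialize (IH ltac:(lia)).
    assert (y ^ k / INR (fact k) * r ^ m <= (r * y) ^ k / INR (fact k)); [|lra].
    rewrite Rpow_mult_distr. replace m with (k + (m - k))%nat by lia. rewrite pow_add.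
    assert (r ^ (m - k) <= 1) by (rewrite <- (pow1 (m - k)); apply pow_incr; lra).
    assert (0 <= y ^ k / INR (fact k)) by (apply Rdiv_le_0_compat; [now apply pow_le|apply INR_fact_lt_0]).
    assert (0 <= r ^ k) by (apply pow_le; lra).
    replace (r ^ k * y ^ k / INR (fact k)) with (y ^ k / INR (fact k) * (r ^ k * 1)) by (unfold Rdiv; ring).
    apply Rmult_le_compat_l; [easy|]. now apply Rmult_le_compat_l. }
  now apply Hg. }
pose proof (exp_trunc_le_exp m (r * y) ltac:(nra)) as H2.
rewrite Rmult_assoc. apply Rle_trans with (exp (- y) * exp (r * y)).
- apply Rmult_le_compat_l; [apply Rlt_le, exp_pos|lra].
- rewrite <- exp_plus. apply Req_le. f_equal. ring.
Qed.

(** The Chernoff bound with $r=1-1/m$, for which $r^m\ge e^{-2}$ as soon as $m\ge2$. *)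
Lemma gamma_tail_exp_bound m y : (2 <= m)%nat -> 0 <= y -> gamma_tail m y <= exp 2 * exp (- (y / INR m)).
Proof.
intros Hm Hy. assert (Hm2 : 2 <= INR m) by (apply (le_INR 2); easy).
assert (Hi : 0 < / INR m <= / 2) by (split; [apply Rinv_0_lt_compat; lra|apply Rinv_le_contravar; lra]).
pose proof (gamma_tail_chernoff m y (1 - / INR m) Hy ltac:(lra)) as H.
replace (1 - (1 - / INR m)) with (/ INR m) in H by ring.
replace (y / INR m) with (/ INR m * y) by (unfold Rdiv; ring).
destruct (pow_exp_bounds (/ INR m) m ltac:(lra)) as [Hr _].
rewrite Rinv_r, Rmult_1_r in Hr by lra.
assert (Hr2 : exp (- 2) <= (1 - / INR m) ^ m) by (eapply Rle_trans; [apply exp_le|apply Hr]; lra).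
assert (He : exp 2 * exp (- 2) = 1) by (rewrite <- exp_plus, Rplus_opp_r; apply exp_0).
pose proof (gamma_tail_ge0 m y Hy) as H0. pose proof (exp_pos 2).
apply Rle_trans with (exp 2 * (gamma_tail m y * (1 - / INR m) ^ m)); [|apply Rmult_le_compat_l; lra].
replace (exp 2 * (gamma_tail m y * (1 - / INR m) ^ m)) with (gamma_tail m y * (exp 2 * (1 - / INR m) ^ m)) by ring.
rewrite <- (Rmult_1_r (gamma_tail m y)) at 1. apply Rmult_le_compat_l; [easy|]. apply Rle_trans with (exp 2 * exp (- 2)); [lra|apply Rmult_le_compat_l; lra].
Qed.

Definition Lint (f : R -> C) (I : C) : Prop :=
  forall e, 0 < e -> exists T0, forall T, T0 <= T -> Cmod (CInt f 0 T - I)%C < e.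

Definition Rccont (f : R -> C) : Prop := forall u, ccont f u.

Lemma Rccont_int f a b : Rccont f -> a <= b -> cintegrable f a b.
Proof. intros H Hab. apply cintegrable_continuous; auto. Qed.

Lemma exp_decay_RInt A d a b : 0 < d -> a <= b ->
  ex_RInt (fun u => A * exp (- (d * u))) a b /\
  RInt (fun u => A * exp (- (d * u))) a b = A / d * (exp (- (d * a)) - exp (- (d * b))).
Proof.
intros Hd Hab.
assert (H : is_RInt (fun u => A * exp (- (d * u))) a b (minus (- A / d * exp (- (d * b))) (- A / d * exp (- (d * a))))).
{ apply (is_RInt_derive (fun u => - A / d * exp (- (d * u)))).
  - intros x _. auto_derive; auto. field. lra.
  - intros x _. apply (ex_derive_continuous (K := R_AbsRing) (V := R_NormedModule)). auto_derive. auto. }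
split; [eexists; exact H|]. rewrite (is_RInt_unique _ _ _ _ H). unfold minus, plus, opp; simpl. field. lra.
Qed.

Lemma Cmod_CInt_decay f A d a b : 0 < d -> a <= b -> Rccont f ->
  (forall u, a <= u -> Cmod (f u) <= A * exp (- (d * u))) -> Cmod (CInt f a b) <= A / d * exp (- (d * a)).
Proof.
intros Hd Hab Hf HA. destruct (exp_decay_RInt A d a b Hd Hab) as [H1 H2].
assert (HA0 : 0 <= A).
{ pose proof (HA a ltac:(lra)). pose proof (Cmod_ge_0 (f a)). pose proof (exp_pos (- (d * a))). nra. }
eapply Rle_trans; [apply (Cmod_CInt_le f _ a b Hab (Rccont_int _ _ _ Hf Hab) H1)|].
- intros x Hx. apply HA. lra.
- rewrite H2. apply Rmult_le_compat_l; [apply Rdiv_le_0_compat; lra|]. pose proof (exp_pos (- (d * b))). lra.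
Qed.

Lemma exp_decay_small d e : 0 < d -> 0 < e -> exists T0, 0 <= T0 /\ forall T, T0 <= T -> exp (- (d * T)) < e.
Proof.
intros Hd He. exists (/ (d * e)).
assert (Hde : 0 < / (d * e)) by (apply Rinv_0_lt_compat; nra).
split; [lra|]. intros T HT.
assert (0 < T) by lra. assert (Hp : 0 < d * T) by nra.
eapply Rle_lt_trans; [apply exp_neg_le; lra|].
rewrite <- (Rinv_inv e). apply Rinv_lt_contravar; [apply Rmult_lt_0_compat; [apply Rinv_0_lt_compat|]; lra|].
apply Rmult_le_compat_l with (r := d) in HT; [|lra]. replace (d * / (d * e)) with (/ e) in HT by (field; lra). lra.
Qed.

Lemma Lint_ex f A d : 0 < d -> Rccont f -> (forall u, 0 <= u -> Cmod (f u) <= A * exp (- (d * u))) ->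
  exists I, Lint f I.
Proof.
intros Hd Hf HA.
assert (HA0 : 0 <= A).
{ pose proof (HA 0 ltac:(lra)). pose proof (Cmod_ge_0 (f 0)). pose proof (exp_pos (- (d * 0))). nra. }
assert (Hc : forall e, 0 < e -> exists T0, 0 <= T0 /\ forall S T, T0 <= S -> T0 <= T -> Cmod (CInt f 0 T - CInt f 0 S)%C < e).
{ intros e He. destruct (exp_decay_small d (e / (A / d + 1))) as (T0 & HT0 & K); auto.
  { apply Rdiv_lt_0_compat; auto. assert (0 <= A / d) by (apply Rdiv_le_0_compat; lra). lra. }
  assert (HAd : 0 <= A / d) by (apply Rdiv_le_0_compat; lra).
  assert (Hle : forall S T, T0 <= S -> S <= T -> Cmod (CInt f 0 T - CInt f 0 S)%C < e).
  { intros S T HS HST. rewrite <- (CInt_Chasles f 0 S T) by (apply Rccont_int; auto; lra).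
    replace (CInt f 0 S + CInt f S T - CInt f 0 S)%C with (CInt f S T) by ring.
    eapply Rle_lt_trans; [apply (Cmod_CInt_decay f A d); auto; intros; apply HA; lra|].
    specialize (K S HS). apply Rlt_div_r in K; [|lra]. pose proof (exp_pos (- (d * S))). nra. }
  exists T0. split; auto. intros S T HS HT. destruct (Rle_dec S T); [auto|].
  rewrite <- Cmod_opp. replace (- (CInt f 0 T - CInt f 0 S))%C with (CInt f 0 S - CInt f 0 T)%C by ring. apply Hle; lra. }
assert (HL : forall (P : C -> R), (forall a b, Rabs (P a - P b) <= Cmod (a - b)%C) ->
   exists l, is_lim_seq (fun n => P (CInt f 0 (INR n))) (Finite l)).
{ intros P HP. apply ex_lim_seq_cauchy_corr. intros e. destruct (Hc e (cond_pos e)) as (T0 & HT0 & K).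
  destruct (nfloor_ex T0 HT0) as [N [_ HN]]. exists (S N). intros n m Hn Hm.
  apply le_INR in Hn, Hm. rewrite S_INR in Hn, Hm.
  eapply Rle_lt_trans; [apply HP|]. apply K; lra. }
destruct (HL Re) as [l1 H1].
{ intros a b. pose proof (re_le_Cmod (a - b)%C) as H. destruct a, b. exact H. }
destruct (HL Im) as [l2 H2].
{ intros a b. pose proof (im_le_Cmod (a - b)%C) as H. destruct a, b. exact H. }
exists (l1, l2). intros e He.
destruct (Hc (e / 2)) as (T0 & HT0 & K); [lra|].
apply is_lim_seq_spec in H1. apply is_lim_seq_spec in H2.
destruct (H1 (mkposreal (e / 4) ltac:(lra))) as [N1 K1]. destruct (H2 (mkposreal (e / 4) ltac:(lra))) as [N2 K2].
destruct (nfloor_ex T0 HT0) as [N [_ HN]].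
exists T0. intros T HT. set (n := (S N + N1 + N2)%nat).
assert (Hn : T0 <= INR n) by (unfold n; rewrite !plus_INR, S_INR; pose proof (pos_INR N1); pose proof (pos_INR N2); lra).
specialize (K1 n ltac:(lia)). specialize (K2 n ltac:(lia)). cbn [pos] in K1, K2.
specialize (K (INR n) T Hn HT).
replace (CInt f 0 T - (l1, l2))%C with ((CInt f 0 T - CInt f 0 (INR n)) + (CInt f 0 (INR n) - (l1, l2)))%C by ring.
eapply Rle_lt_trans; [apply Cmod_triangle|].
pose proof (Cmod_le_parts (CInt f 0 (INR n) - (l1, l2))%C) as HQ.
change (Re (CInt f 0 (INR n) - (l1, l2))%C) with (Re (CInt f 0 (INR n)) - l1) in HQ.
change (Im (CInt f 0 (INR n) - (l1, l2))%C) with (Im (CInt f 0 (INR n)) - l2) in HQ. lra.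
Qed.

Lemma Lint_unique f I J : Lint f I -> Lint f J -> I = J.
Proof.
intros H1 H2. apply (Cseq_lim_unique (fun n => CInt f 0 (INR n))).
- intros e He. destruct (H1 e He) as [T0 K]. destruct (nfloor_ex (Rabs T0) (Rabs_pos _)) as [N [_ HN]].
  exists (S N). intros n Hn. apply K. apply le_INR in Hn. rewrite S_INR in Hn. pose proof (Rle_abs T0). lra.
- intros e He. destruct (H2 e He) as [T0 K]. destruct (nfloor_ex (Rabs T0) (Rabs_pos _)) as [N [_ HN]].
  exists (S N). intros n Hn. apply K. apply le_INR in Hn. rewrite S_INR in Hn. pose proof (Rle_abs T0). lra.
Qed.

Lemma Lint_ext f g I : (forall u, 0 <= u -> f u = g u) -> Lint f I -> Lint g I.
Proof.
intros E0 H e He. destruct (H e He) as [T0 K]. exists (Rmax T0 0). intros T HT.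
pose proof (Rmax_l T0 0). pose proof (Rmax_r T0 0).
rewrite <- (CInt_ext f g) by (try lra; intros; apply E0; lra). apply K. lra.
Qed.

Lemma Lint_plus f g I J : Rccont f -> Rccont g -> Lint f I -> Lint g J -> Lint (fun u => f u + g u)%C (I + J)%C.
Proof.
intros Cf Cg Hf Hg e He. destruct (Hf (e / 2)) as [T0 K0]; [lra|]. destruct (Hg (e / 2)) as [T1 K1]; [lra|].
exists (Rmax 0 (Rmax T0 T1)). intros T HT.
pose proof (Rmax_l 0 (Rmax T0 T1)). pose proof (Rmax_r 0 (Rmax T0 T1)). pose proof (Rmax_l T0 T1). pose proof (Rmax_r T0 T1).
specialize (K0 T ltac:(lra)). specialize (K1 T ltac:(lra)).
rewrite CInt_plus by (apply Rccont_int; auto; lra).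
replace (CInt f 0 T + CInt g 0 T - (I + J))%C with ((CInt f 0 T - I) + (CInt g 0 T - J))%C by ring.
eapply Rle_lt_trans; [apply Cmod_triangle|]. lra.
Qed.

Lemma Lint_scal c f I : Rccont f -> Lint f I -> Lint (fun u => c * f u)%C (c * I)%C.
Proof.
intros Cf Hf e He. pose proof (Cmod_ge_0 c).
destruct (Hf (e / (Cmod c + 1))) as [T0 K]; [apply Rdiv_lt_0_compat; lra|].
exists (Rmax 0 T0). intros T HT. pose proof (Rmax_l 0 T0). pose proof (Rmax_r 0 T0). specialize (K T ltac:(lra)).
rewrite CInt_scal by (apply Rccont_int; auto; lra).
replace (c * CInt f 0 T - c * I)%C with (c * (CInt f 0 T - I))%C by ring. rewrite Cmod_mult.
apply Rlt_div_r in K; [|lra]. pose proof (Cmod_ge_0 (CInt f 0 T - I)). nra.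
Qed.

Lemma Lint_bound f I A d : 0 < d -> Rccont f -> (forall u, 0 <= u -> Cmod (f u) <= A * exp (- (d * u))) ->
  Lint f I -> Cmod I <= A / d.
Proof.
intros Hd Hf HA H. apply le_epsilon. intros e He. destruct (H e He) as [T0 K].
pose proof (Rmax_l 0 T0). pose proof (Rmax_r 0 T0). specialize (K (Rmax 0 T0) ltac:(lra)).
pose proof (Cmod_CInt_decay f A d 0 (Rmax 0 T0) Hd ltac:(lra) Hf HA) as HB.
rewrite Rmult_0_r, Ropp_0, exp_0, Rmult_1_r in HB.
pose proof (Cmod_triangle (CInt f 0 (Rmax 0 T0)) (- (CInt f 0 (Rmax 0 T0) - I))) as T.
rewrite Cmod_opp in T. replace (CInt f 0 (Rmax 0 T0) + - (CInt f 0 (Rmax 0 T0) - I))%C with I in T by ring. lra.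
Qed.

Lemma Rccont_plus f g : Rccont f -> Rccont g -> Rccont (fun u => f u + g u)%C.
Proof. intros Hf Hg u. now apply ccont_plus. Qed.

Lemma Rccont_mult f g : Rccont f -> Rccont g -> Rccont (fun u => f u * g u)%C.
Proof. intros Hf Hg u. now apply ccont_mult. Qed.

Lemma Rccont_const c : Rccont (fun _ => c).
Proof. intros u. apply ccont_const. Qed.

Lemma Rccont_ext f g : (forall u, f u = g u) -> Rccont f -> Rccont g.
Proof.
intros E0 H u. apply ccont_eps. intros e He. pose proof (H u) as Hu. rewrite ccont_eps in Hu.
destruct (Hu e He) as (d & Hd & K). exists d. split; auto. intros y Hy. rewrite <- !E0. auto.
Qed.

Lemma Rccont_RtoC_derive g : (forall u, ex_derive g u) -> Rccont (fun u => RtoC (g u)).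
Proof. intros H u. apply ccont_RtoC. apply (ex_derive_continuous (K := R_AbsRing) (V := R_NormedModule)). apply H. Qed.

Lemma Rccont_cexp s : Rccont (fun u => cexp (s * RtoC u)%C).
Proof.
intros u. destruct s as [a b].
apply (Rccont_ext (fun u => cexp (0 + a * u, 0 + b * u))).
- intros v. f_equal. apply injective_projections; simpl; ring.
- intros v. apply (cdiff_ccont_line cexp 0 0 a b v). apply cdiff_cexp.
Qed.

Lemma Cmod_cexp_RtoC s u : Cmod (cexp (s * RtoC u)%C) = exp (Re s * u).
Proof. rewrite Cmod_cexp. f_equal. destruct s. simpl. ring. Qed.
(** Differentiation of a Laplace integral: the derivative is the integral with an additional factor
    $u$, and the remainder is controlled by [Cmod_cexp_taylor2]. *)
Lemma Lint_cdiff g A sigma h : Rccont g -> (forall u, 0 <= u -> Cmod (g u) <= A * exp (- (sigma * u))) ->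
  (forall s, Re s < sigma -> Lint (fun u => g u * cexp (s * RtoC u))%C (h s)) ->
  forall s, Re s < sigma -> cdiff h s.
Proof.
intros Cg HA Hh s Hs.
assert (HA0 : 0 <= A).
{ pose proof (HA 0 ltac:(lra)). pose proof (Cmod_ge_0 (g 0)). pose proof (exp_pos (- (sigma * 0))). nra. }
(* A quarter of the room between [Re s] and [sigma]: one quarter pays for the factor $u^2$, one for
   $e^{|k|u}$, and what is left is decay for the last integral. *)
set (dl := (sigma - Re s) / 4). assert (Hdl : 0 < dl) by (unfold dl; lra).
assert (Hu2 : forall u, 0 <= u -> u ^ 2 <= 2 / dl ^ 2 * exp (dl * u)).
{ intros u Hu. pose proof (increasing_from_derivative (fun t => exp t - t ^ 2 / 2) (fun t => exp t - t) 0 (dl * u) ltac:(nra)) as H.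
  cut (exp 0 - 0 ^ 2 / 2 <= exp (dl * u) - (dl * u) ^ 2 / 2).
  - rewrite exp_0. intros H1. apply Rmult_le_reg_l with (dl ^ 2 / 2); [pose proof (pow_lt dl 2 Hdl); lra|].
    replace (dl ^ 2 / 2 * (2 / dl ^ 2 * exp (dl * u))) with (exp (dl * u)) by (field; lra). lra.
  - apply H.
    + intros t _. auto_derive; auto. field.
    + intros t _. pose proof (exp_ineq1_le t). lra. }
assert (Hu1 : forall u, 0 <= u -> u <= / dl * exp (dl * u)).
{ intros u Hu. pose proof (exp_ineq1_le (dl * u)). apply Rmult_le_reg_l with dl; auto. rewrite <- Rmult_assoc, Rinv_r by lra. lra. }
set (g1 := fun u => (RtoC u * (g u * cexp (s * RtoC u)))%C).
assert (Cid : Rccont (fun u => RtoC u)).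
{ apply Rccont_RtoC_derive. intros u. auto_derive. auto. }
assert (Cg1 : Rccont g1).
{ apply Rccont_mult; auto. apply Rccont_mult; auto. apply Rccont_cexp. }
assert (Hg1 : forall u, 0 <= u -> Cmod (g1 u) <= A / dl * exp (- (3 * dl * u))).
{ intros u Hu. unfold g1. rewrite !Cmod_mult, Cmod_cexp_RtoC, Cmod_R, Rabs_pos_eq by easy.
  apply Rle_trans with (/ dl * exp (dl * u) * (A * exp (- (sigma * u)) * exp (Re s * u))).
  - apply Rmult_le_compat; auto.
    + apply Rmult_le_pos; [apply Cmod_ge_0|apply Rlt_le, exp_pos].
    + apply Rmult_le_compat_r; [apply Rlt_le, exp_pos|auto].
  - replace (- (3 * dl * u)) with (dl * u + (- (sigma * u) + Re s * u)) by (unfold dl; field). rewrite !exp_plus.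
    apply Req_le. unfold Rdiv. ring. }
destruct (Lint_ex g1 (A / dl) (3 * dl) ltac:(lra) Cg1 Hg1) as [l Hl].
exists l. intros e He.
set (K := 10 * A / dl ^ 2 / dl).
assert (HK : 0 <= K). { unfold K. repeat apply Rdiv_le_0_compat; auto; try nra; try (apply pow_lt; auto). }
exists (Rmin dl (e / (K + 1))). split; [apply Rmin_pos; auto; apply Rdiv_lt_0_compat; lra|].
intros k Hk. pose proof (Rmin_l dl (e / (K + 1))). pose proof (Rmin_r dl (e / (K + 1))). pose proof (Cmod_ge_0 k) as Hk0.
assert (Hsk : Re (s + k)%C < sigma).
{ pose proof (re_le_Cmod k) as Rk. apply Rabs_le_between in Rk. change (Re (s + k)%C) with (Re s + Re k). unfold dl in *. lra. }
assert (Cs : forall s, Rccont (fun u => g u * cexp (s * RtoC u))%C) by (intros; apply Rccont_mult; auto; apply Rccont_cexp).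
pose proof (Lint_plus _ _ _ _ (Cs (s + k)%C) (Rccont_mult _ _ (Rccont_const (-1)%C) (Cs s)) (Hh _ Hsk) (Lint_scal (-1)%C _ _ (Cs s) (Hh _ Hs))) as L1.
pose proof (Lint_plus _ _ _ _ (Rccont_plus _ _ (Cs (s + k)%C) (Rccont_mult _ _ (Rccont_const (-1)%C) (Cs s)))
   (Rccont_mult _ _ (Rccont_const (- k)%C) Cg1) L1 (Lint_scal (- k)%C _ _ Cg1 Hl)) as L2.
assert (HB : Cmod (h (s + k) + -1 * h s + - k * l)%C <= (10 * A / dl ^ 2 * Cmod k ^ 2) / dl).
{ refine (Lint_bound _ _ _ dl Hdl _ _ L2).
  - apply Rccont_plus; [apply Rccont_plus; [apply Cs|apply Rccont_mult; [apply Rccont_const|apply Cs]]|].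
    apply Rccont_mult; [apply Rccont_const|exact Cg1].
  - intros u Hu. unfold g1.
    replace (g u * cexp ((s + k) * u) + -1 * (g u * cexp (s * u)) + - k * (u * (g u * cexp (s * u))))%C
      with (g u * cexp (s * u) * (cexp (k * u) - 1 - k * u))%C.
    2:{ replace ((s + k) * u)%C with (s * u + k * u)%C by ring. rewrite cexp_plus. ring. }
    rewrite !Cmod_mult, Cmod_cexp_RtoC.
    pose proof (Cmod_cexp_taylor2 (k * u)%C) as T. rewrite Cmod_mult, Cmod_R, Rabs_pos_eq in T by easy.
    assert (HE : exp (Cmod k * u) <= exp (dl * u)) by (apply exp_le; apply Rmult_le_compat_r; lra).
    apply Rle_trans with (A * exp (- (sigma * u)) * exp (Re s * u) * (5 * (Cmod k ^ 2 * (2 / dl ^ 2 * exp (dl * u))) * exp (dl * u))).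
    + apply Rmult_le_compat.
      * apply Rmult_le_pos; [apply Cmod_ge_0|apply Rlt_le, exp_pos].
      * apply Cmod_ge_0.
      * apply Rmult_le_compat_r; [apply Rlt_le, exp_pos|auto].
      * eapply Rle_trans; [apply T|]. rewrite Rpow_mult_distr.
        apply Rmult_le_compat; [pose proof (pow2_ge_0 (Cmod k)); pose proof (pow2_ge_0 u); nra|apply Rlt_le, exp_pos| |exact HE].
        apply Rmult_le_compat_l; [lra|]. apply Rmult_le_compat_l; [apply pow2_ge_0|auto].
    + replace (- (dl * u)) with (- (2 * dl * u) + dl * u) by ring.
      apply Rle_trans with (10 * A / dl ^ 2 * Cmod k ^ 2 * (exp (- (sigma * u)) * exp (Re s * u) * exp (dl * u) * exp (dl * u))).
      * apply Req_le. field. lra.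
      * apply Rmult_le_compat_l.
        -- apply Rmult_le_pos; [|apply pow2_ge_0]. apply Rdiv_le_0_compat; [lra|now apply pow_lt].
        -- rewrite <- !exp_plus. apply exp_le. unfold dl. nra. }
replace (h (s + k) - h s - l * k)%C with (h (s + k) + -1 * h s + - k * l)%C by ring.
eapply Rle_trans; [apply HB|].
replace (10 * A / dl ^ 2 * Cmod k ^ 2 / dl) with (K * Cmod k * Cmod k) by (unfold K; field; lra).
apply Rmult_le_compat_r; [easy|]. assert (Hke : Cmod k < e / (K + 1)) by lra. apply Rlt_div_r in Hke; [|lra]. nra.
Qed.

Section SumExchange.

Variables (A : Type) (f : A -> R -> C) (a : A -> R) (d : R) (g : R -> C).
Hypothesis f_cont : forall p, Rccont (f p).
Hypothesis f_bound : forall p u, Cmod (f p u) <= a p * exp (- (d * u)).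
Hypothesis a_summable : summable a.
Hypothesis g_sum : forall u, sums_to (fun p => f p u) (g u).

(** Partial sums converge uniformly relative to $e^{-du}$; this gives both the continuity of [g] and
    the exchange of sum and integral. *)
Lemma exchange_tail e : 0 < e -> exists F0, NoDup F0 /\ forall F, NoDup F -> incl F0 F ->
  forall u, Cmod (list_sum (fun p => f p u) F - g u)%C <= e * exp (- (d * u)).
Proof.
intros He. destruct (summable_tail a a_summable e He) as (F0 & N0 & HF0). exists F0. split; auto.
intros F N HI u. apply (dominated_tail (fun p => f p u) (fun p => exp (- (d * u)) * a p)); auto.
- intros p. rewrite Rmult_comm. apply f_bound.
- intros F' N' Hd'. rewrite rsum_scal, Rmult_comm. apply Rmult_le_compat_r; [apply Rlt_le, exp_pos|].
  apply HF0; auto. intros x Hx Hx'. apply (Hd' x Hx), HI, Hx'.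
Qed.

Lemma Rccont_list_sum F : Rccont (fun u => list_sum (fun p => f p u) F).
Proof.
induction F as [|p F IH].
- exact (Rccont_const (RtoC 0)).
- apply (Rccont_plus (f p) _ (f_cont p) IH).
Qed.

Lemma Rccont_sum : Rccont g.
Proof.
intros u. apply ccont_eps. intros e He.
set (E1 := exp (Rabs d * (Rabs u + 1))). assert (HE1 : 0 < E1) by apply exp_pos.
assert (Hexp : forall v, Rabs (v - u) < 1 -> exp (- (d * v)) <= E1).
{ intros v Hv. apply exp_le. eapply Rle_trans; [apply Rle_abs|]. rewrite Rabs_Ropp, Rabs_mult.
  apply Rmult_le_compat_l; [apply Rabs_pos|]. replace v with (v - u + u) by ring. eapply Rle_trans; [apply Rabs_triang|]. lra. }
destruct (exchange_tail (e / (4 * E1))) as (F0 & N0 & HF0); [apply Rdiv_lt_0_compat; lra|].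
specialize (HF0 F0 N0 (incl_refl _)).
pose proof (Rccont_list_sum F0 u) as Hc. rewrite ccont_eps in Hc. destruct (Hc (e / 4)) as (dl & Hdl & K); [lra|].
exists (Rmin dl 1). split; [apply Rmin_pos; lra|]. intros v Hv. pose proof (Rmin_l dl 1). pose proof (Rmin_r dl 1).
specialize (K v ltac:(lra)).
assert (HT : forall w, Rabs (w - u) < 1 -> Cmod (list_sum (fun p => f p w) F0 - g w)%C <= e / 4).
{ intros w Hw. eapply Rle_trans; [apply HF0|]. apply Rle_trans with (e / (4 * E1) * E1).
  - apply Rmult_le_compat_l; [apply Rlt_le, Rdiv_lt_0_compat; lra|auto].
  - apply Req_le. field. lra. }
pose proof (HT v ltac:(lra)) as T1. pose proof (HT u ltac:(rewrite Rminus_diag, Rabs_R0; lra)) as T2.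
set (sv := list_sum (fun p => f p v) F0) in *. set (su := list_sum (fun p => f p u) F0) in *.
replace (g v - g u)%C with (- (sv - g v) + ((sv - su) + (su - g u)))%C by ring.
eapply Rle_lt_trans; [apply Cmod_triangle|]. rewrite Cmod_opp. pose proof (Cmod_triangle (sv - su) (su - g u)). lra.
Qed.

Lemma Lint_list_sum (I : A -> C) F : (forall p, Lint (f p) (I p)) ->
  Lint (fun u => list_sum (fun p => f p u) F) (list_sum I F).
Proof.
intros HI. induction F as [|p F IH].
- intros e He. exists 0. intros T _.
  change (Cmod (CInt (fun _ => RtoC 0) 0 T - 0)%C < e). rewrite CInt_const.
  replace (RtoC (T - 0) * 0 - 0)%C with (RtoC 0) by ring. now rewrite Cmod_0.
- apply (Lint_plus (f p) _ (I p) _ (f_cont p) (Rccont_list_sum F) (HI p) IH).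
Qed.

Lemma Lint_sum (I : A -> C) G : 0 < d -> (forall p, Lint (f p) (I p)) -> Lint g G -> sums_to I G.
Proof.
intros Hd HI HG e He.
destruct (exchange_tail (e * d / 2)) as (F0 & N0 & HF0); [nra|].
exists F0. intros F N Hi. specialize (HF0 F N Hi).
pose proof (Lint_plus _ _ _ _ (Rccont_list_sum F) (Rccont_mult _ _ (Rccont_const (-1)%C) Rccont_sum)
  (Lint_list_sum I F HI) (Lint_scal (-1)%C _ _ Rccont_sum HG)) as L.
replace (list_sum I F - G)%C with (list_sum I F + -1 * G)%C by ring.
apply Rle_lt_trans with (e * d / 2 / d); [|unfold Rdiv; rewrite !Rmult_assoc, (Rmult_comm (/ 2)), <- (Rmult_assoc d), Rinv_r; lra].
refine (Lint_bound _ _ (e * d / 2) d Hd (Rccont_plus _ _ (Rccont_list_sum F) (Rccont_mult _ _ (Rccont_const (-1)%C) Rccont_sum)) _ L).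
intros u _. cbv beta.
replace (list_sum (fun p => f p u) F + -1 * g u)%C with (list_sum (fun p => f p u) F - g u)%C by ring. auto.
Qed.

End SumExchange.

(** * Mellin transforms of $e^{-Xt}$ *)

Definition gplus (X u : R) : C := RtoC (exp (- (X * exp u))).

(** [gplus X] reflected in the origin; the Mellin transform of [exp (- X t)]
    in the variable [t = exp u] is split at [u = 0] into two half-line integrals. *)
Definition gminus (X u : R) : C := RtoC (exp (- (X * exp (- u)))).

Lemma Rccont_gplus X : Rccont (gplus X).
Proof. apply Rccont_RtoC_derive. intros u. auto_derive. auto. Qed.

Lemma Rccont_gminus X : Rccont (gminus X).
Proof. apply Rccont_RtoC_derive. intros u. auto_derive. auto. Qed.

(** From the single term $y^J/J!$ of the exponential series. *)
Lemma exp_neg_pow J y : 0 < y -> exp (- y) <= INR (fact J) / y ^ J.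
Proof.
intros Hy. pose proof (exp_trunc_le_exp (S J) y ltac:(lra)) as H. simpl exp_trunc in H.
pose proof (exp_trunc_ge0 J y ltac:(lra)). pose proof (INR_fact_lt_0 J). pose proof (pow_lt y J Hy).
rewrite exp_Ropp. replace (INR (fact J) / y ^ J) with (/ (y ^ J / INR (fact J))) by (field; lra).
apply Rinv_le_contravar; [apply Rdiv_lt_0_compat; lra|lra].
Qed.

Lemma Cmod_gplus_le X J u : 0 < X -> Cmod (gplus X u) <= INR (fact J) / X ^ J * exp (- (INR J * u)).
Proof.
intros HX. unfold gplus. rewrite Cmod_exp. pose proof (exp_pos u).
eapply Rle_trans; [apply (exp_neg_pow J); nra|]. rewrite Rpow_mult_distr, exp_pow_INR, exp_Ropp.
apply Req_le. pose proof (pow_lt X J HX). pose proof (exp_pos (INR J * u)). field. lra.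
Qed.

Lemma gminus_gplus X u : gminus X u = gplus X (- u).
Proof. reflexivity. Qed.

Lemma Cmod_gminus_le1 X u : 0 <= X -> Cmod (gminus X u) <= 1.
Proof.
intros HX. unfold gminus. rewrite Cmod_exp, <- exp_0. apply exp_le. pose proof (exp_pos (- u)). nra.
Qed.

Lemma mellin_plus_ex X s : 0 < X -> exists I, Lint (fun u => gplus X u * cexp (s * RtoC u))%C I.
Proof.
intros HX. destruct (nfloor_ex (Rabs (Re s)) (Rabs_pos _)) as [J [_ HJ]].
pose proof (Rle_abs (Re s)).
apply (Lint_ex _ (INR (fact (S J)) / X ^ S J) (INR (S J) - Re s)).
- rewrite S_INR. lra.
- apply Rccont_mult; [apply Rccont_gplus|apply Rccont_cexp].
- intros u Hu. rewrite Cmod_mult, Cmod_cexp_RtoC.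
  apply Rle_trans with (INR (fact (S J)) / X ^ S J * exp (- (INR (S J) * u)) * exp (Re s * u)).
  + apply Rmult_le_compat_r; [apply Rlt_le, exp_pos|]. now apply Cmod_gplus_le.
  + rewrite Rmult_assoc, <- exp_plus. apply Req_le. do 2 f_equal. ring.
Qed.

Lemma mellin_minus_ex X s : 0 < X -> 0 < Re s -> exists I, Lint (fun u => gminus X u * cexp (- s * RtoC u))%C I.
Proof.
intros HX Hs. apply (Lint_ex _ 1 (Re s)); auto.
- apply Rccont_mult; [apply Rccont_gminus|apply Rccont_cexp].
- intros u Hu. rewrite Cmod_mult, Cmod_cexp_RtoC. change (Re (- s)%C) with (- Re s).
  replace (- Re s * u) with (- (Re s * u)) by ring.
  apply Rmult_le_compat_r; [apply Rlt_le, exp_pos|]. apply Cmod_gminus_le1. lra.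
Qed.

Lemma CInt_shift f L a b : a <= b -> Rccont f -> CInt (fun u => f (u + L)) a b = CInt f (a + L) (b + L).
Proof.
intros Hab Hf. destruct (Rccont_int f (a + L) (b + L) Hf ltac:(lra)) as [I1 I2].
unfold CInt. apply injective_projections; simpl.
- pose proof (RInt_comp_lin (V := R_CompleteNormedModule) (fun t => Re (f t)) 1 L a b) as H.
  rewrite !Rmult_1_l in H. rewrite <- H by exact I1. apply RInt_ext. intros x _. unfold scal; simpl; unfold mult; simpl.
  now rewrite !Rmult_1_l.
- pose proof (RInt_comp_lin (V := R_CompleteNormedModule) (fun t => Im (f t)) 1 L a b) as H.
  rewrite !Rmult_1_l in H. rewrite <- H by exact I2. apply RInt_ext. intros x _. unfold scal; simpl; unfold mult; simpl.
  now rewrite !Rmult_1_l.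
Qed.

Lemma CInt_reflect f a b : a <= b -> Rccont f -> CInt (fun u => f (- u)) a b = CInt f (- b) (- a).
Proof.
intros Hab Hf. destruct (Rccont_int f (- b) (- a) Hf ltac:(lra)) as [I1 I2].
assert (HR : forall h : R -> R, ex_RInt h (- b) (- a) -> RInt (fun u => h (- u)) a b = RInt h (- b) (- a)).
{ intros h Hh. pose proof (RInt_comp_lin (V := R_CompleteNormedModule) h (-1) 0 a b) as H.
  replace (-1 * a + 0) with (- a) in H by ring. replace (-1 * b + 0) with (- b) in H by ring.
  apply ex_RInt_swap in Hh. specialize (H Hh). rewrite <- (opp_RInt_swap (V := R_CompleteNormedModule) h) by exact Hh.
  rewrite <- H. rewrite <- (RInt_opp (V := R_CompleteNormedModule)).
  - apply RInt_ext. intros x _. unfold opp, scal; simpl; unfold mult; simpl. replace (-1 * x + 0) with (- x) by ring. ring.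
  - pose proof (ex_RInt_comp_lin (V := R_NormedModule) h (-1) 0 a b) as HE.
    replace (-1 * a + 0) with (- a) in HE by ring. replace (-1 * b + 0) with (- b) in HE by ring. now apply HE. }
unfold CInt. apply injective_projections; simpl.
- now apply (HR (fun t => Re (f t))).
- now apply (HR (fun t => Im (f t))).
Qed.

Lemma Lint_seq f I L : Lint f I -> Cseq_lim (fun n => CInt f 0 (INR n + L)) I.
Proof.
intros H e He. destruct (H e He) as [T0 K]. destruct (nfloor_ex (Rabs (T0 - L)) (Rabs_pos _)) as [N [_ HN]].
exists (S N). intros n Hn. apply K. apply le_INR in Hn. rewrite S_INR in Hn. pose proof (Rle_abs (T0 - L)). lra.
Qed.

Lemma Cseq_lim_plus u v a b : Cseq_lim u a -> Cseq_lim v b -> Cseq_lim (fun n => u n + v n)%C (a + b)%C.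
Proof.
intros H1 H2 e He. destruct (H1 (e / 2)) as [N1 K1]; [lra|]. destruct (H2 (e / 2)) as [N2 K2]; [lra|].
exists (N1 + N2)%nat. intros n Hn. specialize (K1 n ltac:(lia)). specialize (K2 n ltac:(lia)).
replace (u n + v n - (a + b))%C with ((u n - a) + (v n - b))%C by ring.
eapply Rle_lt_trans; [apply Cmod_triangle|]. lra.
Qed.

(** Translation of [u] by [ln lam]. A half-line integral alone does not scale, because the splitting
    point moves: the integral over [[0, ln lam]] passes from one half to the other, and only the
    total is homogeneous of degree $-s$. *)
Lemma mellin_scaling X lam s Gp Gm Ip Im : 0 < X -> 1 <= lam ->
  Lint (fun u => gplus X u * cexp (s * RtoC u))%C Gp -> Lint (fun u => gminus X u * cexp (- s * RtoC u))%C Gm ->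
  Lint (fun u => gplus (X * lam) u * cexp (s * RtoC u))%C Ip ->
  Lint (fun u => gminus (X * lam) u * cexp (- s * RtoC u))%C Im ->
  (Ip + Im = cexp (- s * RtoC (ln lam)) * (Gp + Gm))%C.
Proof.
intros HX Hlam HGp HGm HIp HIm. set (L := ln lam). set (w := cexp (- s * RtoC L)%C).
set (F := fun u => (gplus X u * cexp (s * RtoC u))%C).
set (F' := fun u => (gminus X u * cexp (- s * RtoC u))%C).
assert (HF : Rccont F) by (apply Rccont_mult; [apply Rccont_gplus|apply Rccont_cexp]).
assert (HF' : Rccont F') by (apply Rccont_mult; [apply Rccont_gminus|apply Rccont_cexp]).
assert (HL : 0 <= L) by (unfold L; rewrite <- ln_1; destruct Hlam as [Hl|<-]; [apply Rlt_le, ln_increasing; lra|lra]).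
assert (HeL : exp L = lam) by (apply exp_ln; lra).
assert (E1 : forall u, (gplus (X * lam) u * cexp (s * RtoC u))%C = (w * F (u + L)%R)%C).
{ intros u. unfold F, w, gplus. rewrite exp_plus, HeL, RtoC_plus.
  replace (X * (exp u * lam)) with (X * lam * exp u) by ring.
  replace (s * (RtoC u + RtoC L))%C with (s * RtoC u + s * RtoC L)%C by ring. rewrite cexp_plus.
  transitivity (RtoC (exp (- (X * lam * exp u))) * cexp (s * RtoC u) * (cexp (- s * RtoC L) * cexp (s * RtoC L)))%C; [|ring].
  rewrite <- cexp_plus. replace (- s * RtoC L + s * RtoC L)%C with (RtoC 0) by ring. rewrite cexp_0. ring. }
assert (E2 : forall u, (gminus (X * lam) u * cexp (- s * RtoC u))%C = (w * F' (u + - L)%R)%C).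
{ intros u. unfold F', w, gminus. replace (- (u + - L)) with (- u + L) by ring. rewrite exp_plus, HeL, RtoC_plus, RtoC_opp.
  replace (X * (exp (- u) * lam)) with (X * lam * exp (- u)) by ring.
  replace (- s * (RtoC u + - RtoC L))%C with (- s * RtoC u + s * RtoC L)%C by ring. rewrite cexp_plus.
  transitivity (RtoC (exp (- (X * lam * exp (- u)))) * cexp (- s * RtoC u) * (cexp (- s * RtoC L) * cexp (s * RtoC L)))%C; [|ring].
  rewrite <- cexp_plus. replace (- s * RtoC L + s * RtoC L)%C with (RtoC 0) by ring. rewrite cexp_0. ring. }
assert (HFL : forall M, Rccont (fun u => F (u + M))).
{ intros M. apply (Rccont_ext (fun u => gplus X (u + M)%R * cexp (s * RtoC M) * cexp (s * RtoC u))%C).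
  - intros u. unfold F. rewrite RtoC_plus. replace (s * (u + M))%C with (s * u + s * M)%C by ring. rewrite cexp_plus. ring.
  - apply Rccont_mult; [|apply Rccont_cexp]. apply Rccont_mult; [|apply Rccont_const].
    unfold gplus. apply Rccont_RtoC_derive. intros u. auto_derive. auto. }
assert (HFL' : forall M, Rccont (fun u => F' (u + M))).
{ intros M. apply (Rccont_ext (fun u => gminus X (u + M)%R * cexp (- s * RtoC M) * cexp (- s * RtoC u))%C).
  - intros u. unfold F'. rewrite RtoC_plus. replace (- s * (u + M))%C with (- s * u + - s * M)%C by ring. rewrite cexp_plus. ring.
  - apply Rccont_mult; [|apply Rccont_cexp]. apply Rccont_mult; [|apply Rccont_const].
    unfold gminus. apply Rccont_RtoC_derive. intros u. auto_derive. auto. }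
apply (Cseq_lim_unique (fun n => w * (CInt F 0 (INR n + L)%R + CInt F' 0 (INR n + - L)%R))%C).
2:{ apply Cseq_lim_scal, Cseq_lim_plus; now apply Lint_seq. }
pose proof (Cseq_lim_plus _ _ _ _ (Lint_seq _ _ 0 HIp) (Lint_seq _ _ 0 HIm)) as H.
revert H. apply Cseq_lim_ext. intros n. rewrite !Rplus_0_r. pose proof (pos_INR n) as Hn.
rewrite (CInt_ext _ (fun u => w * F (u + L)%R)%C), (CInt_ext (fun u => gminus (X * lam) u * cexp (- s * RtoC u))%C (fun u => w * F' (u + - L)%R)%C) by auto.
rewrite !CInt_scal by (apply Rccont_int; auto). rewrite !CInt_shift by auto.
rewrite !Rplus_0_l.
pose proof (CInt_Chasles F 0 L (INR n + L) (Rccont_int F 0 L HF ltac:(lra)) (Rccont_int F L (INR n + L) HF ltac:(lra))) as C1.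
assert (C2 : CInt F' (- L) (INR n + - L) = (CInt F 0 L + CInt F' 0 (INR n + - L)%R)%C).
{ assert (ER : CInt F' (- L) 0 = CInt F 0 L).
  { transitivity (CInt (fun u => F' (- u)) 0 L).
    - rewrite CInt_reflect by auto. now rewrite Ropp_0.
    - apply CInt_ext; auto. intros x _. unfold F, F', gminus, gplus. rewrite Ropp_involutive, RtoC_opp. f_equal. f_equal. ring. }
  (* For [n < L] the upper limit [n - L] is negative, and the last integral has to be reversed. *)
  rewrite <- ER. destruct (Rle_dec L (INR n)).
  - symmetry. apply CInt_Chasles; apply Rccont_int; auto; lra.
  - pose proof (CInt_Chasles F' (- L) (INR n + - L) 0 (Rccont_int F' (- L) (INR n + - L) HF' ltac:(lra)) (Rccont_int F' (INR n + - L) 0 HF' ltac:(lra))) as C3.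
    rewrite <- C3.
    assert (ES : CInt F' 0 (INR n + - L) = (- CInt F' (INR n + - L) 0)%C).
    { pose proof (Rccont_int F' (INR n + - L) 0 HF' ltac:(lra)) as [I1 I2].
      unfold CInt. apply injective_projections; simpl; symmetry; apply (opp_RInt_swap (V := R_CompleteNormedModule)); auto. }
    rewrite ES. ring. }
rewrite C2, <- C1. ring.
Qed.

Lemma CInt_RtoC h a b : CInt (fun u => RtoC (h u)) a b = RtoC (RInt h a b).
Proof.
unfold CInt. apply injective_projections; simpl; [reflexivity|].
rewrite RInt_const. unfold scal; simpl; unfold mult; simpl. ring.
Qed.

Lemma cexp_nat m u : cexp (RtoC (INR m) * RtoC u)%C = RtoC (exp u ^ m).
Proof. now rewrite <- RtoC_mult, cexp_RtoC, exp_pow_INR. Qed.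

Lemma gamma_tail_vanishes m e : 0 < e -> exists T0, forall y, 0 <= y -> T0 <= y -> gamma_tail m y < e.
Proof.
intros He. assert (Hp : 0 < (1 / 2) ^ m) by (apply pow_lt; lra).
destruct (exp_decay_small (1 / 2) (e * (1 / 2) ^ m)) as (T0 & HT0 & K); [lra|nra|].
exists T0. intros y Hy HyT. specialize (K y HyT).
pose proof (gamma_tail_chernoff m y (1 / 2) Hy ltac:(lra)) as H.
replace ((1 - 1 / 2) * y) with (1 / 2 * y) in H by field.
apply Rmult_lt_reg_r with ((1 / 2) ^ m); lra.
Qed.

Section IntegerMellin.

Variables (X : R) (mu : nat).
Hypothesis X_pos : 0 < X.

(** This is $\Gamma(\mu+1)/X^{\mu+1}$, the full Mellin integral at $s=\mu+1$; its two halves take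
    the shares [gamma_tail] and one minus [gamma_tail]. *)
Let scale := INR (fact mu) / X ^ S mu.

Lemma mellin_antiderivative u :
  is_derive (fun u => - scale * gamma_tail (S mu) (X * exp u)) u (exp (- (X * exp u)) * exp u ^ S mu).
Proof.
assert (H : is_derive (fun u => gamma_tail (S mu) (X * exp u)) u
  (scal (X * exp u) (- (exp (- (X * exp u)) * (X * exp u) ^ mu / INR (fact mu))))).
{ apply (is_derive_comp (K := R_AbsRing) (V := R_NormedModule) (gamma_tail (S mu)) (fun u => X * exp u)).
  - apply gamma_tail_derive.
  - auto_derive; auto. ring. }
apply (is_derive_scal _ _ (- scale)) in H.
replace (exp (- (X * exp u)) * exp u ^ S mu) with
  (- scale * scal (X * exp u) (- (exp (- (X * exp u)) * (X * exp u) ^ mu / INR (fact mu)))); [exact H|].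
unfold scal; simpl; unfold mult; simpl. unfold scale. rewrite Rpow_mult_distr. simpl.
pose proof (INR_fact_neq_0 mu). pose proof (pow_lt X mu X_pos). field. lra.
Qed.

Lemma mellin_RInt a b : a <= b ->
  RInt (fun u => exp (- (X * exp u)) * exp u ^ S mu) a b = scale * (gamma_tail (S mu) (X * exp a) - gamma_tail (S mu) (X * exp b)).
Proof.
intros Hab.
assert (H : is_RInt (fun u => exp (- (X * exp u)) * exp u ^ S mu) a b
  (minus (- scale * gamma_tail (S mu) (X * exp b)) (- scale * gamma_tail (S mu) (X * exp a)))).
{ apply (is_RInt_derive (fun u => - scale * gamma_tail (S mu) (X * exp u))).
  - intros x _. apply mellin_antiderivative.
  - intros x _. apply (ex_derive_continuous (K := R_AbsRing) (V := R_NormedModule)). auto_derive. auto. }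
rewrite (is_RInt_unique _ _ _ _ H). unfold minus, plus, opp; simpl. ring.
Qed.

Lemma scale_pos : 0 < scale.
Proof. apply Rdiv_lt_0_compat; [apply INR_fact_lt_0|now apply pow_lt]. Qed.

Lemma mellin_plus_integer :
  Lint (fun u => gplus X u * cexp (RtoC (INR (S mu)) * RtoC u))%C (RtoC (scale * gamma_tail (S mu) X)).
Proof.
intros e He. pose proof scale_pos as Hs.
destruct (gamma_tail_vanishes (S mu) (e / scale)) as [T0 K]; [now apply Rdiv_lt_0_compat|].
exists (Rmax 0 (T0 / X)). intros T HT. pose proof (Rmax_l 0 (T0 / X)). pose proof (Rmax_r 0 (T0 / X)).
rewrite (CInt_ext _ (fun u => RtoC (exp (- (X * exp u)) * exp u ^ S mu))); [|lra|].
2:{ intros u _. unfold gplus. now rewrite cexp_nat, RtoC_mult. }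
rewrite CInt_RtoC, mellin_RInt by lra. rewrite exp_0, Rmult_1_r, <- RtoC_minus, Cmod_R.
replace (scale * (gamma_tail (S mu) X - gamma_tail (S mu) (X * exp T)) - scale * gamma_tail (S mu) X)
  with (- (scale * gamma_tail (S mu) (X * exp T))) by ring.
assert (HXT : 0 <= X * exp T) by (pose proof (exp_pos T); nra).
pose proof (gamma_tail_ge0 (S mu) _ HXT).
rewrite Rabs_Ropp, Rabs_pos_eq by nra.
assert (T0 <= X * exp T).
{ assert (HTT : T0 / X <= T) by lra. apply Rle_div_l in HTT; auto. pose proof (exp_ineq1_le T). nra. }
specialize (K _ HXT H2). apply Rlt_div_r in K; auto. lra.
Qed.

Lemma mellin_minus_integer :
  Lint (fun u => gminus X u * cexp (- RtoC (INR (S mu)) * RtoC u))%C (RtoC (scale * (1 - gamma_tail (S mu) X))).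
Proof.
intros e He. pose proof scale_pos as Hs.
destruct (exp_decay_small 1 (e / (scale * X + 1))) as (T0 & HT0 & K); [lra|apply Rdiv_lt_0_compat; nra|].
exists T0. intros T HT. specialize (K T HT).
set (F := fun v => (gplus X v * cexp (RtoC (INR (S mu)) * RtoC v))%C).
assert (HC : Rccont F) by (apply Rccont_mult; [apply Rccont_gplus|apply Rccont_cexp]).
rewrite (CInt_ext _ (fun u => F (- u))); [|lra|].
2:{ intros u _. unfold F. rewrite gminus_gplus. do 2 f_equal. rewrite RtoC_opp. ring. }
rewrite (CInt_reflect F) by (auto; lra).
rewrite (CInt_ext _ (fun u => RtoC (exp (- (X * exp u)) * exp u ^ S mu))); [|lra|].
2:{ intros u _. unfold F, gplus. now rewrite cexp_nat, RtoC_mult. }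
rewrite CInt_RtoC, mellin_RInt by lra. rewrite Ropp_0, exp_0, Rmult_1_r, <- RtoC_minus, Cmod_R.
replace (scale * (gamma_tail (S mu) (X * exp (- T)) - gamma_tail (S mu) X) - scale * (1 - gamma_tail (S mu) X))
  with (- (scale * (1 - gamma_tail (S mu) (X * exp (- T))))) by ring.
pose proof (exp_pos (- T)) as HeT.
assert (HXT : 0 <= X * exp (- T)) by nra.
pose proof (gamma_tail_le1 (S mu) _ HXT). pose proof (gamma_tail_markov (S mu) _ HXT) as HM.
assert (H1 : 1 <= INR (S mu)) by (rewrite S_INR; pose proof (pos_INR mu); lra).
rewrite Rabs_Ropp, Rabs_pos_eq by nra.
replace (1 * T) with T in K by ring.
apply Rlt_div_r in K; [|nra].
assert (1 - gamma_tail (S mu) (X * exp (- T)) <= X * exp (- T)) by nra. nra.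
Qed.

End IntegerMellin.

(** * The central value as a lattice sum *)

(** The reciprocal of the constant $7/(2\pi)$ in the functional equation. *)
Definition c7 : R := 2 * PI / 7.

Lemma c7_pos : 0 < c7.
Proof. unfold c7. pose proof PI_RGT_0. lra. Qed.

Definition lam (p : Z * Z) : R := IZR (normZ (fst p) (snd p)).

(** Shifted index: [coef n] belongs to $\chi^{4(n+1)-3}$. By [eps_chi] the symbol $\epsilon_{a,b}$
    is [chi (2 a + b)]. *)
Definition coef (n : nat) (p : Z * Z) : C :=
  (IZR (chi (2 * fst p + snd p)) * Cpow (zelt p) (4 * n + 1))%C.

Lemma Lint_zero : Lint (fun _ => RtoC 0) (RtoC 0).
Proof.
intros e He. exists 0. intros T _. rewrite CInt_const. replace (RtoC (T - 0) * 0 - 0)%C with (RtoC 0) by ring. now rewrite Cmod_0.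
Qed.

Lemma lam_ge1 p : p <> (0, 0)%Z -> 1 <= lam p.
Proof.
destruct p as [a b]. intros H. unfold lam. cbn [fst snd]. apply IZR_le. unfold normZ.
assert (a <> 0 \/ b <> 0)%Z by (destruct (Z.eq_dec a 0); [right|left; auto]; intros ->; subst; now apply H).
nia.
Qed.

Lemma coef_0 n : coef n (0, 0)%Z = RtoC 0.
Proof. unfold coef. change (chi (2 * fst (0, 0)%Z + snd (0, 0)%Z)) with 0%Z. ring. Qed.

Lemma Cmod_zelt_sqr p : Cmod (zelt p) ^ 2 = lam p.
Proof. apply Cmod_elt_sqr. Qed.

Lemma Cmod_zelt_le_lam p : p <> (0, 0)%Z -> Cmod (zelt p) <= lam p.
Proof.
intros H. pose proof (lam_ge1 p H) as H1. rewrite <- Cmod_zelt_sqr in *. pose proof (Cmod_ge_0 (zelt p)). nra.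
Qed.

Lemma Cmod_coef_le n p : Cmod (coef n p) <= Cmod (zelt p) ^ (4 * n + 1).
Proof.
unfold coef. rewrite Cmod_mult, Cmod_R, Cmod_pow. pose proof (chi_abs_le (2 * fst p + snd p)).
pose proof (pow_le (Cmod (zelt p)) (4 * n + 1) (Cmod_ge_0 _)). pose proof (Rabs_pos (IZR (chi (2 * fst p + snd p)))). nra.
Qed.

Lemma inv_lam_sqr_le p : p <> (0, 0)%Z -> / lam p ^ 2 <= 9 * (pz (fst p) * pz (snd p)).
Proof.
intros H. pose proof (lam_ge1 p H) as H1. pose proof (normZ_lower (fst p) (snd p)) as H2. fold (lam p) in H2.
unfold pz. set (A := IZR (fst p) ^ 2) in *. set (B := IZR (snd p) ^ 2) in *.
assert (0 <= A) by apply pow2_ge_0. assert (0 <= B) by apply pow2_ge_0.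
rewrite <- Rinv_mult. replace (9 * / ((1 + A) * (1 + B))) with (/ ((1 + A) * (1 + B) / 9)) by (field; lra).
apply Rinv_le_contravar; [apply Rdiv_lt_0_compat; nra|].
assert ((1 + A) * (1 + B) <= (3 * lam p) * (3 * lam p)) by (apply Rmult_le_compat; lra). simpl. lra.
Qed.

(** As $|z|\le|z|^2=\lambda$, the coefficient is at most $\lambda^{4n+1}$, and $e^{-y}\le J!/y^J$
    leaves at most $\lambda^{-2}$, which is summable. The bound holds for every real [u], so it can
    also be applied at [- u]. *)
Lemma coef_gplus_bound n J p u : (4 * n + 3 <= J)%nat ->
  Cmod (coef n p * gplus (c7 * lam p) u)%C <= (INR (fact J) / c7 ^ J * 9 * (pz (fst p) * pz (snd p))) * exp (- (INR J * u)).
Proof.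
intros HJ. pose proof c7_pos as Hc. pose proof (pow_lt c7 J Hc) as HcJ. pose proof (INR_fact_lt_0 J) as Hf.
assert (HC : 0 < INR (fact J) / c7 ^ J) by (apply Rdiv_lt_0_compat; lra).
pose proof (pz_ge0 (fst p)). pose proof (pz_ge0 (snd p)). pose proof (exp_pos (- (INR J * u))) as He.
destruct (classic (p = (0, 0)%Z)) as [->|Hp].
- rewrite coef_0, Cmult_0_l, Cmod_0. apply Rmult_le_pos; [|lra]. apply Rmult_le_pos; [lra|]. apply Rmult_le_pos; lra.
- pose proof (lam_ge1 p Hp) as Hl. rewrite Cmod_mult.
  apply Rle_trans with (lam p ^ (4 * n + 1) * (INR (fact J) / (c7 * lam p) ^ J * exp (- (INR J * u)))).
  + apply Rmult_le_compat; try apply Cmod_ge_0.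
    * eapply Rle_trans; [apply Cmod_coef_le|]. apply pow_incr. split; [apply Cmod_ge_0|now apply Cmod_zelt_le_lam].
    * apply Cmod_gplus_le. nra.
  + replace (lam p ^ (4 * n + 1) * (INR (fact J) / (c7 * lam p) ^ J * exp (- (INR J * u))))
     with (INR (fact J) / c7 ^ J * (lam p ^ (4 * n + 1) / lam p ^ J) * exp (- (INR J * u))).
    2:{ rewrite Rpow_mult_distr. pose proof (pow_lt (lam p) J ltac:(lra)). field. lra. }
    apply Rmult_le_compat_r; [lra|]. rewrite Rmult_assoc. apply Rmult_le_compat_l; [lra|].
    eapply Rle_trans; [|now apply inv_lam_sqr_le].
    assert (EJ : lam p ^ J = lam p ^ (4 * n + 1) * (lam p ^ 2 * lam p ^ (J - (4 * n + 3)))).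
    { rewrite <- !pow_add. f_equal. lia. }
    assert (H2 : 1 <= lam p ^ (J - (4 * n + 3))) by (apply pow_R1_Rle; lra).
    assert (H3 : 0 < lam p ^ 2) by (apply pow_lt; lra).
    assert (H4 : 0 < lam p ^ (4 * n + 1)) by (apply pow_lt; lra).
    rewrite EJ. set (A := lam p ^ (4 * n + 1)) in *. set (B := lam p ^ (J - (4 * n + 3))) in *.
    replace (A / (A * (lam p ^ 2 * B))) with (/ (lam p ^ 2 * B)) by (field; repeat split; lra).
    apply Rinv_le_contravar; nra.
Qed.

Lemma summable_pz2_scal K : 0 <= K -> summable (fun p : Z * Z => K * (pz (fst p) * pz (snd p))).
Proof. intros HK. apply summable_scal; [easy|apply summable_pz2]. Qed.

Lemma gauss_const_ge0 J : 0 <= INR (fact J) / c7 ^ J * 9.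
Proof.
pose proof (INR_fact_lt_0 J). pose proof (pow_lt c7 J c7_pos).
assert (0 < INR (fact J) / c7 ^ J) by (apply Rdiv_lt_0_compat; lra). lra.
Qed.

Lemma lat_gauss_coef n u p :
  (lat_gauss (exp u) p * Cpow (zelt p) (4 * n + 1))%C = (coef n p * gplus (c7 * lam p) u)%C.
Proof.
unfold lat_gauss, coef, gplus. fold (lam p). fold c7.
replace (c7 * exp u * lam p) with (c7 * lam p * exp u) by ring. rewrite RtoC_mult. ring.
Qed.

Section CentralValue.

Variable n : nat.

(** The Mellin variable is $m+p$ when the argument of [L] is $1/2+p$, and the functional equation
    exchanges $s$ and $2m-s$. *)
Let m := (2 * n + 1)%nat.

Lemma theta_exists : exists th : R -> C, forall u, sums_to (fun p => coef n p * gplus (c7 * lam p) u)%C (th u).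
Proof.
apply (choice_fun (fun u S => sums_to (fun p => coef n p * gplus (c7 * lam p) u)%C S)). intros u.
apply (sums_to_ex _ (fun p => (INR (fact (4 * n + 3)) / c7 ^ (4 * n + 3) * 9 * exp (- (INR (4 * n + 3) * u))) * (pz (fst p) * pz (snd p)))).
- apply summable_pz2_scal. apply Rmult_le_pos; [apply gauss_const_ge0|apply Rlt_le, exp_pos].
- intros p. eapply Rle_trans; [apply (coef_gplus_bound n (4 * n + 3)); lia|]. apply Req_le. ring.
Qed.

Variable th : R -> C.
Hypothesis th_sum : forall u, sums_to (fun p => coef n p * gplus (c7 * lam p) u)%C (th u).

Lemma th_symmetry u : th (- u) = (RtoC (exp u ^ (2 * m)) * th u)%C.
Proof.
apply (sums_to_unique (fun p => coef n p * gplus (c7 * lam p) (- u))%C); [apply th_sum|].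
assert (H : sums_to (fun p => lat_gauss (exp u) p * Cpow (zelt p) (4 * n + 1))%C (th u)).
{ eapply sums_to_ext; [|apply (th_sum u)]. intros p. symmetry. apply lat_gauss_coef. }
apply theta_functional_equation in H; [|apply exp_pos].
replace (2 * m)%nat with (4 * n + 2)%nat by (unfold m; lia).
revert H. apply sums_to_ext. intros p. rewrite <- exp_Ropp. apply lat_gauss_coef.
Qed.

Lemma th_cont : Rccont th.
Proof.
apply (Rccont_sum _ (fun p u => coef n p * gplus (c7 * lam p) u)%C
  (fun p => INR (fact (4 * n + 3)) / c7 ^ (4 * n + 3) * 9 * (pz (fst p) * pz (snd p))) (INR (4 * n + 3))); auto.
- intros p. apply Rccont_mult; [apply Rccont_const|apply Rccont_gplus].
- intros p u. apply coef_gplus_bound. lia.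
- apply summable_pz2_scal, gauss_const_ge0.
Qed.

Lemma th_decay J : (4 * n + 3 <= J)%nat -> exists K, forall u, Cmod (th u) <= K * exp (- (INR J * u)).
Proof.
intros HJ. destruct summable_pz2 as [H0 [B HB]].
exists (INR (fact J) / c7 ^ J * 9 * B). intros u.
apply (sums_to_bound _ _ _ (th_sum u)). intros F N.
eapply Rle_trans; [apply (Cmod_list_sum_le _ (fun p => (INR (fact J) / c7 ^ J * 9 * exp (- (INR J * u))) * (pz (fst p) * pz (snd p))))|].
- intros p _. eapply Rle_trans; [now apply (coef_gplus_bound n J)|]. apply Req_le. ring.
- rewrite rsum_scal. specialize (HB F N). pose proof (gauss_const_ge0 J). pose proof (exp_pos (- (INR J * u))).
  apply Rle_trans with (INR (fact J) / c7 ^ J * 9 * exp (- (INR J * u)) * B); [|apply Req_le; ring].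
  apply Rmult_le_compat_l; [|easy]. apply Rmult_le_pos; lra.
Qed.

Lemma large_exponent x : exists J, (4 * n + 3 <= J)%nat /\ x < INR J.
Proof.
destruct (nfloor_ex (Rabs x) (Rabs_pos _)) as [N [_ HN]]. exists (S N + (4 * n + 3))%nat. split; [lia|].
rewrite plus_INR, S_INR. pose proof (Rle_abs x). pose proof (pos_INR (4 * n + 3)). lra.
Qed.

(** [Lam] is the Mellin integral of the theta series over $t\ge1$ only. It converges for every [s],
    since the exponent [J] in [th_decay] can be taken as large as desired. *)
Lemma theta_mellin_exists : exists Lam : C -> C, forall s, Lint (fun u => th u * cexp (s * RtoC u))%C (Lam s).
Proof.
apply (choice_fun (fun s I => Lint (fun u => th u * cexp (s * RtoC u))%C I)). intros s. destruct (large_exponent (Re s)) as (J & HJ & Hx).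
destruct (th_decay J HJ) as [K HK].
apply (Lint_ex _ K (INR J - Re s)); [lra| |].
- apply Rccont_mult; [apply th_cont|apply Rccont_cexp].
- intros u Hu. rewrite Cmod_mult, Cmod_cexp_RtoC.
  replace (- ((INR J - Re s) * u)) with (- (INR J * u) + Re s * u) by ring. rewrite exp_plus, <- Rmult_assoc.
  apply Rmult_le_compat_r; [apply Rlt_le, exp_pos|auto].
Qed.

Variable Lam : C -> C.
Hypothesis Lam_spec : forall s, Lint (fun u => th u * cexp (s * RtoC u))%C (Lam s).

Lemma Lam_diff s : cdiff Lam s.
Proof.
destruct (large_exponent (Re s)) as (J & HJ & Hx). destruct (th_decay J HJ) as [K HK].
apply (Lint_cdiff th K (INR J)); auto. apply th_cont.
Qed.

Lemma Lam_sum s (I : Z * Z -> C) :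
  (forall p, p <> (0, 0)%Z -> Lint (fun u => gplus (c7 * lam p) u * cexp (s * RtoC u))%C (I p)) -> sums_to (fun p => coef n p * I p)%C (Lam s).
Proof.
intros HI. destruct (large_exponent (Re s)) as (J & HJ & Hx).
apply (Lint_sum _ (fun p u => coef n p * gplus (c7 * lam p) u * cexp (s * RtoC u))%C
  (fun p => INR (fact J) / c7 ^ J * 9 * (pz (fst p) * pz (snd p))) (INR J - Re s) (fun u => th u * cexp (s * RtoC u))%C).
- intros p. apply Rccont_mult; [apply Rccont_mult; [apply Rccont_const|apply Rccont_gplus]|apply Rccont_cexp].
- intros p u. rewrite Cmod_mult, Cmod_cexp_RtoC.
  replace (- ((INR J - Re s) * u)) with (- (INR J * u) + Re s * u) by ring. rewrite exp_plus, <- Rmult_assoc.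
  apply Rmult_le_compat_r; [apply Rlt_le, exp_pos|now apply coef_gplus_bound].
- apply summable_pz2_scal, gauss_const_ge0.
- intros u. pose proof (sums_to_scal (cexp (s * RtoC u)%C) _ _ (th_sum u)) as H.
  rewrite (Cmult_comm (th u)). revert H. apply sums_to_ext. intros p. ring.
- lra.
- intros p. destruct (classic (p = (0, 0)%Z)) as [->|Hp].
  { rewrite coef_0, Cmult_0_l. eapply Lint_ext; [|exact Lint_zero]. intros u _. cbv beta. ring. }
  eapply Lint_ext; [|apply (Lint_scal (coef n p) _ _ (Rccont_mult _ _ (Rccont_gplus _) (Rccont_cexp s)) (HI p Hp))].
  intros u _. cbv beta. ring.
- apply Lam_spec.
Qed.

(** This is the part $0<t\le1$: by [th_symmetry], $th(-u)e^{-su}=th(u)e^{(2m-s)u}$. Termwise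
    integration is done for large [Re s], since the majorant from [coef_gplus_bound] at [- u] grows
    like $e^{Ju}$. *)
Lemma Lam_dual_sum s (I : Z * Z -> C) : INR (4 * n + 3) < Re s ->
  (forall p, p <> (0, 0)%Z -> Lint (fun u => gminus (c7 * lam p) u * cexp (- s * RtoC u))%C (I p)) ->
  sums_to (fun p => coef n p * I p)%C (Lam (RtoC (INR (2 * m)) - s)%C).
Proof.
intros Hs HI. set (J := (4 * n + 3)%nat) in *.
assert (Hg : Lint (fun u => th (- u) * cexp (- s * RtoC u))%C (Lam (RtoC (INR (2 * m)) - s)%C)).
{ eapply Lint_ext; [|apply Lam_spec]. intros u _. cbv beta. rewrite th_symmetry, <- cexp_nat.
  replace ((RtoC (INR (2 * m)) - s) * RtoC u)%C with (RtoC (INR (2 * m)) * RtoC u + - s * RtoC u)%C by ring.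
  rewrite cexp_plus. ring. }
apply (Lint_sum _ (fun p u => coef n p * gminus (c7 * lam p) u * cexp (- s * RtoC u))%C
  (fun p => INR (fact J) / c7 ^ J * 9 * (pz (fst p) * pz (snd p))) (Re s - INR J) (fun u => th (- u) * cexp (- s * RtoC u))%C).
- intros p. apply Rccont_mult; [apply Rccont_mult; [apply Rccont_const|apply Rccont_gminus]|apply Rccont_cexp].
- intros p u. rewrite Cmod_mult, Cmod_cexp_RtoC. change (Re (- s)%C) with (- Re s).
  replace (- ((Re s - INR J) * u)) with (- (INR J * - u) + - Re s * u) by ring. rewrite exp_plus, <- Rmult_assoc.
  apply Rmult_le_compat_r; [apply Rlt_le, exp_pos|]. rewrite gminus_gplus. apply coef_gplus_bound. unfold J; lia.
- apply summable_pz2_scal, gauss_const_ge0.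
- intros u. pose proof (sums_to_scal (cexp (- s * RtoC u)%C) _ _ (th_sum (- u))) as H.
  rewrite (Cmult_comm (th (- u))). revert H. apply sums_to_ext. intros p. rewrite gminus_gplus. ring.
- lra.
- intros p. destruct (classic (p = (0, 0)%Z)) as [->|Hp].
  { rewrite coef_0, Cmult_0_l. eapply Lint_ext; [|exact Lint_zero]. intros u _. cbv beta. ring. }
  eapply Lint_ext; [|apply (Lint_scal (coef n p) _ _ (Rccont_mult _ _ (Rccont_gminus _) (Rccont_cexp (- s)%C)) (HI p Hp))].
  intros u _. cbv beta. ring.
- exact Hg.
Qed.

Variables Gp Gm : C -> C.
Hypothesis Gp_spec : forall s, Lint (fun u => gplus c7 u * cexp (s * RtoC u))%C (Gp s).
Hypothesis Gm_spec : forall s, 0 < Re s -> Lint (fun u => gminus c7 u * cexp (- s * RtoC u))%C (Gm s).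

Lemma Gp_diff s : cdiff Gp s.
Proof.
destruct (large_exponent (Re s)) as (J & HJ & Hx).
apply (Lint_cdiff (gplus c7) (INR (fact J) / c7 ^ J) (INR J)); auto.
- apply Rccont_gplus.
- intros u _. apply Cmod_gplus_le, c7_pos.
Qed.

Lemma Gm_diff s : 0 < Re s -> cdiff Gm s.
Proof.
intros Hs.
assert (H : cdiff (fun z => Gm (- z)%C) (- s)%C).
{ apply (Lint_cdiff (gminus c7) 1 0).
  - apply Rccont_gminus.
  - intros u _. rewrite Rmult_0_l, Ropp_0, exp_0, Rmult_1_r. apply Cmod_gminus_le1, Rlt_le, c7_pos.
  - intros z Hz. assert (Hz' : 0 < Re (- z)%C) by (change (Re (- z)%C) with (- Re z); lra).
    specialize (Gm_spec _ Hz'). replace (- - z)%C with z in Gm_spec by ring. exact Gm_spec.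
  - change (Re (- s)%C) with (- Re s). lra. }
apply (cdiff_ext (fun z => (fun z => Gm (- z)%C) ((-1) * z)%C)).
- intros z. f_equal. ring.
- apply (cdiff_comp (fun z => Gm (- z)%C) (fun z => (-1) * z)%C).
  + apply cdiff_mult; [apply cdiff_const|apply cdiff_id].
  + replace (-1 * s)%C with (- s)%C by ring. exact H.
Qed.

(** [Gp s + Gm s] is $\Gamma(s)c_7^{-s}$ as a sum of two half-line integrals, and [mellin_scaling]
    extracts the factor $\lambda^{-s}$ at each lattice point. *)
Lemma dirichlet_series s : INR (4 * n + 3) < Re s ->
  sums_to (fun p => (Gp s + Gm s) * (coef n p * cexp (- s * RtoC (ln (lam p)))))%C (Lam s + Lam (RtoC (INR (2 * m)) - s))%C.
Proof.
intros Hs. pose proof (pos_INR (4 * n + 3)) as HJ.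
assert (Hl : forall p, p <> (0, 0)%Z -> 0 < c7 * lam p).
{ intros p Hp. pose proof (lam_ge1 p Hp). pose proof c7_pos. nra. }
destruct (choice_fun (fun p I => p <> (0, 0)%Z -> Lint (fun u => gplus (c7 * lam p) u * cexp (s * RtoC u))%C I)) as [Ip HIp].
{ intros p. destruct (classic (p = (0, 0)%Z)) as [|Hp]; [now exists (RtoC 0)|].
  destruct (mellin_plus_ex (c7 * lam p) s (Hl p Hp)) as [I HI]. now exists I. }
destruct (choice_fun (fun p I => p <> (0, 0)%Z -> Lint (fun u => gminus (c7 * lam p) u * cexp (- s * RtoC u))%C I)) as [Im HIm].
{ intros p. destruct (classic (p = (0, 0)%Z)) as [|Hp]; [now exists (RtoC 0)|].
  destruct (mellin_minus_ex (c7 * lam p) s (Hl p Hp) ltac:(lra)) as [I HI]. now exists I. }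
pose proof (sums_to_plus _ _ _ _ (Lam_sum s Ip HIp) (Lam_dual_sum s Im Hs HIm)) as H.
revert H. apply sums_to_ext. intros p.
destruct (classic (p = (0, 0)%Z)) as [->|Hp]; [rewrite coef_0; ring|].
rewrite <- Cmult_plus_distr_l.
rewrite (mellin_scaling c7 (lam p) s (Gp s) (Gm s) (Ip p) (Im p) c7_pos (lam_ge1 p Hp) (Gp_spec s) (Gm_spec s ltac:(lra)) (HIp p Hp) (HIm p Hp)).
ring.
Qed.

(** With [g = Gp + Gm] the Gamma factor, [g(m + p) L(1/2 + p)] is [(Lam(m + p) + Lam(m - p)) / 2]
    for large [Re p]. Both sides are differentiable for [0 <= Re p], so that
    [vanishing_at_origin] extends this to [p = 0]; the poles of the Gamma factor are never met. *)
Lemma completed_central_value (L : C -> C) :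
  (forall s, cdiff L s) ->
  (forall s, 1 < Re s -> sums_to (fun p => coef n p * cexp (- (s + RtoC (2 * INR n + 1 / 2)) * RtoC (ln (lam p))))%C (2 * L s)%C) ->
  ((Gp (RtoC (INR m)) + Gm (RtoC (INR m))) * L (RtoC (1 / 2)) = Lam (RtoC (INR m)))%C.
Proof.
intros HLd HLs.
assert (HmR : INR m = 2 * INR n + 1) by (unfold m; rewrite plus_INR, mult_INR; simpl; ring).
pose proof (pos_INR n) as Hn.
set (D := fun p => (2 * ((Gp (RtoC (INR m) + p) + Gm (RtoC (INR m) + p)) * L (p + RtoC (1 / 2)))
   + (-1) * (Lam (RtoC (INR m) + p) + Lam (RtoC (INR m) + (-1) * p)))%C).
assert (HD : D (RtoC 0) = RtoC 0).
{ apply (vanishing_at_origin D (INR (4 * n + 3) + 1)).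
  - pose proof (pos_INR (4 * n + 3)). lra.
  - intros p Hp.
    assert (Ha : cdiff (fun p => RtoC (INR m) + p)%C p) by (apply cdiff_plus; [apply cdiff_const|apply cdiff_id]).
    assert (Hb : cdiff (fun p => RtoC (INR m) + (-1) * p)%C p) by (apply cdiff_plus; [apply cdiff_const|apply cdiff_mult; [apply cdiff_const|apply cdiff_id]]).
    assert (Hc : cdiff (fun p => p + RtoC (1 / 2))%C p) by (apply cdiff_plus; [apply cdiff_id|apply cdiff_const]).
    assert (HRe : 0 < Re (RtoC (INR m) + p)%C) by (change (Re (RtoC (INR m) + p)%C) with (INR m + Re p); lra).
    apply cdiff_plus.
    + apply cdiff_mult; [apply cdiff_const|]. apply cdiff_mult.
      * apply cdiff_plus; [apply (cdiff_comp Gp _ p Ha), Gp_diff|apply (cdiff_comp Gm _ p Ha), Gm_diff, HRe].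
      * apply (cdiff_comp L _ p Hc), HLd.
    + apply cdiff_mult; [apply cdiff_const|]. apply cdiff_plus; [apply (cdiff_comp Lam _ p Ha), Lam_diff|apply (cdiff_comp Lam _ p Hb), Lam_diff].
  - intros p Hp. unfold D. set (s := (RtoC (INR m) + p)%C).
    assert (Hs : INR (4 * n + 3) < Re s) by (unfold s; change (Re (RtoC (INR m) + p)%C) with (INR m + Re p); lra).
    pose proof (pos_INR (4 * n + 3)).
    assert (Hs1 : 1 < Re (p + RtoC (1 / 2))%C) by (change (Re (p + RtoC (1 / 2))%C) with (Re p + 1 / 2); lra).
    pose proof (dirichlet_series s Hs) as H1. pose proof (HLs _ Hs1) as H2.
    apply (sums_to_scal (Gp s + Gm s)%C) in H2.
    replace (p + RtoC (1 / 2) + RtoC (2 * INR n + 1 / 2))%C with s in H2.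
    2:{ unfold s. rewrite HmR. apply injective_projections; simpl; field. }
    pose proof (sums_to_unique _ _ _ H1 H2) as E0.
    replace (RtoC (INR (2 * m)) - s)%C with (RtoC (INR m) + (-1) * p)%C in E0.
    2:{ unfold s. rewrite mult_INR. apply injective_projections; simpl; ring. }
    rewrite E0. ring. }
unfold D in HD. rewrite Cplus_0_r, Cplus_0_l in HD.
replace (RtoC (INR m) + -1 * 0)%C with (RtoC (INR m)) in HD by ring.
set (A := ((Gp (RtoC (INR m)) + Gm (RtoC (INR m))) * L (RtoC (1 / 2)))%C) in *. set (B := Lam (RtoC (INR m))) in *.
replace A with (/ 2 * (2 * A + -1 * (B + B)) + B)%C by field. rewrite HD. ring.
Qed.

End CentralValue.

(** At the integer point $s=m$ the integrals are explicit and $\Gamma(m)c_7^{-m}$ cancels. The two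
    equal halves at the centre make up for the factor 2 between the full lattice sum and [L], so no
    constant remains. *)
Lemma central_value_formula n (L : C -> C) :
  (forall s, cdiff L s) ->
  (forall s, 1 < Re s -> sums_to (fun p => coef n p * cexp (- (s + RtoC (2 * INR n + 1 / 2)) * RtoC (ln (lam p))))%C (2 * L s)%C) ->
  sums_to (fun p => coef n p * RtoC (gamma_tail (2 * n + 1) (c7 * lam p) / lam p ^ (2 * n + 1)))%C (L (RtoC (1 / 2))).
Proof.
intros HLd HLs.
destruct (theta_exists n) as [th Hth]. destruct (theta_mellin_exists n th Hth) as [Lam HLam].
destruct (choice_fun _ (fun s => mellin_plus_ex c7 s c7_pos)) as [Gp HGp].
destruct (choice_fun (fun s G => 0 < Re s -> Lint (fun u => gminus c7 u * cexp (- s * RtoC u))%C G)) as [Gm HGm].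
{ intros s. destruct (Rlt_dec 0 (Re s)) as [Hs|Hs]; [|exists (RtoC 0); lra].
  destruct (mellin_minus_ex c7 s c7_pos Hs) as [I HI]. now exists I. }
pose proof (completed_central_value n th Hth Lam HLam Gp Gm HGp HGm L HLd HLs) as E0.
set (m := (2 * n + 1)%nat) in *.
assert (Hm : m = S (2 * n)) by (unfold m; lia).
assert (EG : (Gp (RtoC (INR m)) + Gm (RtoC (INR m)))%C = RtoC (INR (fact (2 * n)) / c7 ^ m)).
{ rewrite Hm. rewrite (Lint_unique _ _ _ (HGp (RtoC (INR (S (2 * n))))) (mellin_plus_integer c7 (2 * n) c7_pos)).
  assert (Hre : 0 < Re (RtoC (INR (S (2 * n))))) by (apply (lt_INR 0); lia).
  rewrite (Lint_unique _ _ _ (HGm (RtoC (INR (S (2 * n)))) Hre) (mellin_minus_integer c7 (2 * n) c7_pos)).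
  rewrite <- RtoC_plus. f_equal. ring. }
assert (HS : sums_to (fun p => coef n p * RtoC (INR (fact (2 * n)) / (c7 * lam p) ^ m * gamma_tail m (c7 * lam p)))%C (Lam (RtoC (INR m)))).
{ apply (Lam_sum n th Hth Lam HLam). intros p Hp. rewrite Hm. apply mellin_plus_integer.
  pose proof (lam_ge1 p Hp). pose proof c7_pos. nra. }
rewrite <- E0, EG in HS.
pose proof (pow_lt c7 m c7_pos) as Hc. pose proof (INR_fact_lt_0 (2 * n)) as Hf.
assert (Hg : INR (fact (2 * n)) / c7 ^ m <> 0) by (apply Rgt_not_eq, Rdiv_lt_0_compat; lra).
apply (sums_to_scal (/ RtoC (INR (fact (2 * n)) / c7 ^ m))%C) in HS.
rewrite Cmult_assoc, Cinv_l, Cmult_1_l in HS by (now apply RtoC_neq).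
revert HS. apply sums_to_ext. intros p.
destruct (classic (p = (0, 0)%Z)) as [->|Hp]; [rewrite coef_0; ring|].
pose proof (lam_ge1 p Hp) as Hl. pose proof (pow_lt (lam p) m ltac:(lra)).
rewrite <- RtoC_inv by easy.
transitivity (coef n p * (RtoC (/ (INR (fact (2 * n)) / c7 ^ m)) * RtoC (INR (fact (2 * n)) / (c7 * lam p) ^ m * gamma_tail m (c7 * lam p))))%C; [ring|].
rewrite <- RtoC_mult. do 2 f_equal. rewrite Rpow_mult_distr. field. repeat split; lra.
Qed.

(** * The lattice points on the real axis *)

(** Partial sums of the Fourier series of $(\pi-x)/2$. *)
Definition sawtooth_sum (N : nat) (x : R) : R := rsum (fun n => sin (INR (S n) * x) / INR (S n)) (seq 0 N).

Lemma dirichlet_kernel N x :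
  2 * sin (x / 2) * (/ 2 + rsum (fun n => cos (INR (S n) * x)) (seq 0 N)) = sin ((INR N + / 2) * x).
Proof.
induction N as [|N IH].
- unfold rsum; simpl. replace ((0 + / 2) * x) with (x / 2) by field. field.
- rewrite rsum_seq_S, <- Rplus_assoc, Rmult_plus_distr_l, IH, !S_INR.
  replace ((INR N + / 2) * x) with ((INR N + 1) * x - x / 2) by field.
  replace ((INR N + 1 + / 2) * x) with ((INR N + 1) * x + x / 2) by field.
  rewrite sin_minus, sin_plus. ring.
Qed.

Lemma sawtooth_derive N x : is_derive (sawtooth_sum N) x (rsum (fun n => cos (INR (S n) * x)) (seq 0 N)).
Proof.
induction N as [|N IH].
- change (is_derive (fun _ : R => 0) x 0). auto_derive; auto.
- rewrite rsum_seq_S.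
  apply (is_derive_ext (fun y => sawtooth_sum N y + sin (INR (S N) * y) / INR (S N))).
  + intros y. unfold sawtooth_sum. now rewrite rsum_seq_S.
  + apply (is_derive_plus (K := R_AbsRing) (V := R_NormedModule) (sawtooth_sum N)); [exact IH|].
    assert (H : INR (S N) <> 0) by (apply not_0_INR; lia). set (q := INR (S N)) in *.
    auto_derive; auto. field. auto.
Qed.

(** Adding [cos ((N + 1/2) x) / ((2 N + 1) sin (x / 2))] cancels the main term of the
    derivative, so that the mean value theorem on [[x, PI]] gives the rate. *)
Lemma sawtooth_rate N x : 0 < x < PI ->
  Rabs (sawtooth_sum N x - (PI - x) / 2) <= (PI / (2 * sin (x / 2) ^ 2) + 1 / sin (x / 2)) / (2 * INR N + 1).
Proof.
intros Hx. pose proof (pos_INR N) as HN. set (q := 2 * INR N + 1). assert (Hq : 0 < q) by (unfold q; lra).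
set (s0 := sin (x / 2)). assert (Hs0 : 0 < s0) by (apply sin_gt_0; lra).
assert (Hs : forall t, x <= t <= PI -> s0 <= sin (t / 2)).
{ intros t Ht. destruct (Req_dec t x) as [->|]; [unfold s0; lra|]. apply Rlt_le, sin_increasing_1; lra. }
set (G := fun t => sawtooth_sum N t - (PI - t) / 2 + cos ((INR N + / 2) * t) / (q * sin (t / 2))).
set (dG := fun t => - (cos ((INR N + / 2) * t) * cos (t / 2)) / (2 * q * sin (t / 2) ^ 2)).
assert (HG : forall t, x <= t <= PI -> is_derive G t (dG t)).
{ intros t Ht. specialize (Hs t Ht). assert (Hst : 0 < sin (t / 2)) by lra.
  pose proof (dirichlet_kernel N t) as HD.
  replace (dG t) with ((rsum (fun n => cos (INR (S n) * t)) (seq 0 N) - (-1 / 2)) +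
    (- ((INR N + / 2) * sin ((INR N + / 2) * t)) * (q * sin (t / 2)) - cos ((INR N + / 2) * t) * (q * (cos (t / 2) / 2))) / (q * sin (t / 2)) ^ 2).
  - apply (is_derive_plus (K := R_AbsRing) (V := R_NormedModule)).
    + apply (is_derive_minus (K := R_AbsRing) (V := R_NormedModule) (sawtooth_sum N) (fun t => (PI - t) / 2)).
      * apply sawtooth_derive.
      * auto_derive; auto.
    + auto_derive; [apply Rgt_not_eq; nra|]. change (t * / 2) with (t / 2). field. split; lra.
  - unfold dG. rewrite <- HD. replace (INR N + / 2) with (q / 2) by (unfold q; field). field. split; lra. }
destruct (MVT_gen G x PI dG) as (c & Hc & E0).
- intros t Ht. rewrite Rmin_left, Rmax_right in Ht by lra. apply HG; lra.
- intros t Ht. rewrite Rmin_left, Rmax_right in Ht by lra. apply continuity_pt_filterlim.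
  apply (ex_derive_continuous (K := R_AbsRing) (V := R_NormedModule) G t). exists (dG t). apply HG; lra.
- rewrite Rmin_left, Rmax_right in Hc by lra.
  assert (HGP : G PI = 0).
  { unfold G. replace ((INR N + / 2) * PI) with (PI / 2 + INR N * PI) by field.
    assert (H0 : cos (PI / 2 + INR N * PI) = 0).
    { rewrite cos_plus, cos_PI2, sin_PI2.
      assert (HsN : sin (INR N * PI) = 0) by (apply sin_eq_0_1; exists (Z.of_nat N); now rewrite <- INR_IZR_INZ).
      rewrite HsN. ring. }
    rewrite H0. replace (PI - PI) with 0 by ring.
    assert (Hsaw : sawtooth_sum N PI = 0).
    { unfold sawtooth_sum. rewrite (rsum_ext _ (fun n => 0 * 0)); [rewrite rsum_scal; ring|].
      intros n _. assert (HsN : sin (INR (S n) * PI) = 0) by (apply sin_eq_0_1; exists (Z.of_nat (S n)); now rewrite <- INR_IZR_INZ).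
      rewrite HsN. unfold Rdiv. ring. }
    rewrite Hsaw. unfold Rdiv. ring. }
  rewrite HGP in E0. specialize (Hs c Hc).
  assert (HdG : Rabs (dG c) <= / (2 * q * s0 ^ 2)).
  { unfold dG, Rdiv. rewrite Rabs_mult, Rabs_Ropp, Rabs_mult.
    assert (H1 : 0 < 2 * q * s0 ^ 2) by (pose proof (pow_lt s0 2 Hs0); nra).
    assert (H2 : 2 * q * s0 ^ 2 <= 2 * q * sin (c / 2) ^ 2) by (apply Rmult_le_compat_l; [lra|apply pow_incr; lra]).
    rewrite (Rabs_pos_eq (/ _)) by (apply Rlt_le, Rinv_0_lt_compat; lra).
    rewrite <- (Rmult_1_l (/ (2 * q * s0 ^ 2))).
    apply Rmult_le_compat; [apply Rmult_le_pos; apply Rabs_pos|apply Rlt_le, Rinv_0_lt_compat; lra| |now apply Rinv_le_contravar].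
    pose proof (COS_bound ((INR N + / 2) * c)). pose proof (COS_bound (c / 2)).
    assert (A1 : Rabs (cos ((INR N + / 2) * c)) <= 1) by (apply Rabs_le; lra).
    assert (A2 : Rabs (cos (c / 2)) <= 1) by (apply Rabs_le; lra).
    pose proof (Rabs_pos (cos ((INR N + / 2) * c))). pose proof (Rabs_pos (cos (c / 2))). nra. }
  assert (HGx : Rabs (G x) <= PI / (2 * s0 ^ 2) / q).
  { replace (G x) with (- (dG c * (PI - x))) by lra. rewrite Rabs_Ropp, Rabs_mult, (Rabs_pos_eq (PI - x)) by lra.
    replace (PI / (2 * s0 ^ 2) / q) with (/ (2 * q * s0 ^ 2) * PI) by (field; lra).
    apply Rmult_le_compat; try apply Rabs_pos; lra. }
  assert (HC : Rabs (cos ((INR N + / 2) * x) / (q * sin (x / 2))) <= 1 / s0 / q).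
  { fold s0. unfold Rdiv. rewrite Rabs_mult, (Rabs_pos_eq (/ _)) by (apply Rlt_le, Rinv_0_lt_compat, Rmult_lt_0_compat; lra).
    pose proof (COS_bound ((INR N + / 2) * x)).
    replace (1 * / s0 * / q) with (1 * / (q * s0)) by (field; lra).
    apply Rmult_le_compat_r; [apply Rlt_le, Rinv_0_lt_compat, Rmult_lt_0_compat; lra|apply Rabs_le; lra]. }
  replace (sawtooth_sum N x - (PI - x) / 2) with (G x + - (cos ((INR N + / 2) * x) / (q * sin (x / 2)))) by (unfold G; ring).
  eapply Rle_trans; [apply Rabs_triang|]. rewrite Rabs_Ropp. replace ((PI / (2 * s0 ^ 2) + 1 / s0) / q) with (PI / (2 * s0 ^ 2) / q + 1 / s0 / q) by (field; lra). lra.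
Qed.

Lemma sawtooth_lim x : 0 < x < PI -> is_lim_seq (fun N => sawtooth_sum N x) (Finite ((PI - x) / 2)).
Proof.
intros Hx. apply is_lim_seq_spec. intros e.
set (K := PI / (2 * sin (x / 2) ^ 2) + 1 / sin (x / 2)).
destruct (nfloor_ex (Rabs (K / e)) (Rabs_pos _)) as [N [_ HN]].
exists N. intros n Hn. apply le_INR in Hn. pose proof (pos_INR n).
eapply Rle_lt_trans; [now apply sawtooth_rate|]. fold K.
pose proof (cond_pos e). apply Rlt_div_l; [lra|]. pose proof (Rle_abs (K / e)).
assert (H2 : K / e < 2 * INR n + 1) by lra. apply Rlt_div_l in H2; [|easy]. lra.
Qed.

(** The imaginary part of [gauss_sum], with the residues 4, 5, 6 folded onto 3, 2, 1. *)
Lemma chi_sines a : sqrt 7 * IZR (chi a) =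
  2 * (sin (IZR a * (2 * PI / 7)) + sin (IZR a * (4 * PI / 7)) - sin (IZR a * (6 * PI / 7))).
Proof.
pose proof (gauss_sum a) as H. unfold residues7 in H. rewrite !list_sum_cons in H. unfold list_sum, map, fold_right in H.
change (chi 0) with 0%Z in H. change (chi 1) with 1%Z in H. change (chi 2) with 1%Z in H. change (chi 3) with (-1)%Z in H.
change (chi 4) with 1%Z in H. change (chi 5) with (-1)%Z in H. change (chi 6) with (-1)%Z in H.
apply (f_equal snd) in H. unfold E in H. simpl in H.
assert (HR : forall r r' : R, r + r' = 7 -> sin (2 * PI * IZR a * r / 7) = - sin (IZR a * (2 * PI * r' / 7))).
{ intros r r' Hr. pose proof (E_periodic (- (IZR a * (2 * PI * r' / 7))) a) as HE. unfold E in HE. inversion HE as [[H1 H2]].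
  rewrite sin_neg in H2. rewrite <- H2. f_equal. replace r with (7 - r') by lra. field. }
rewrite (HR 4 3), (HR 5 2), (HR 6 1) in H by ring.
replace (2 * PI * IZR a * 1 / 7) with (IZR a * (2 * PI / 7)) in H by field.
replace (2 * PI * IZR a * 2 / 7) with (IZR a * (4 * PI / 7)) in H by field.
replace (2 * PI * IZR a * 3 / 7) with (IZR a * (6 * PI / 7)) in H by field.
replace (2 * PI * 3 / 7) with (6 * PI / 7) in H by field.
replace (2 * PI * 2 / 7) with (4 * PI / 7) in H by field.
replace (2 * PI * 1 / 7) with (2 * PI / 7) in H by field.
lra.
Qed.

(** By [chi_sines] the series combines the sawtooth series at $2\pi/7$, $4\pi/7$ and $6\pi/7$, with
    values $5\pi/14$, $3\pi/14$ and $\pi/14$; and $5+3-1=7$. *)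
Lemma L1_chi : is_lim_seq (fun N => rsum (fun n => IZR (chi (Z.of_nat (S n))) / INR (S n)) (seq 0 N)) (Finite (PI / sqrt 7)).
Proof.
pose proof PI_RGT_0 as HPI. assert (H7 : 0 < sqrt 7) by (apply sqrt_lt_R0; lra).
apply is_lim_seq_ext with (fun N => 2 / sqrt 7 * (sawtooth_sum N (2 * PI / 7) + sawtooth_sum N (4 * PI / 7) - sawtooth_sum N (6 * PI / 7))).
- intros N. unfold sawtooth_sum. unfold Rminus. rewrite <- rsum_plus.
  replace (- rsum (fun n => sin (INR (S n) * (6 * PI / 7)) / INR (S n)) (seq 0 N)) with
   (rsum (fun n => -1 * (sin (INR (S n) * (6 * PI / 7)) / INR (S n))) (seq 0 N)) by (rewrite rsum_scal; ring).
  rewrite <- rsum_plus, <- rsum_scal. apply rsum_ext. intros n _.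
  pose proof (chi_sines (Z.of_nat (S n))) as H. rewrite <- INR_IZR_INZ in H.
  assert (Hn : INR (S n) <> 0) by (apply not_0_INR; lia). set (q := INR (S n)) in *.
  replace (IZR (chi (Z.of_nat (S n)))) with (2 * (sin (q * (2 * PI / 7)) + sin (q * (4 * PI / 7)) - sin (q * (6 * PI / 7))) / sqrt 7) by (rewrite <- H; field; lra).
  field. lra.
- replace (PI / sqrt 7) with (2 / sqrt 7 * ((PI - 2 * PI / 7) / 2 + (PI - 4 * PI / 7) / 2 - (PI - 6 * PI / 7) / 2)) by (field; lra).
  apply is_lim_seq_mult'; [apply is_lim_seq_const|]. apply is_lim_seq_minus'; [apply is_lim_seq_plus'|]; apply sawtooth_lim; lra.
Qed.

Definition chi_partial (A : nat) : R := rsum (fun n => IZR (chi (Z.of_nat (S n)))) (seq 0 A).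

(** Over a period the partial sums are 1, 2, 1, 2, 1, 0, 0. *)
Lemma chi_partial_bound A : Rabs (chi_partial A) <= 2.
Proof.
set (tab := fun r : Z => if (r =? 1)%Z then 1 else if (r =? 2)%Z then 2 else if (r =? 3)%Z then 1
   else if (r =? 4)%Z then 2 else if (r =? 5)%Z then 1 else 0).
assert (H : chi_partial A = tab (Z.of_nat A mod 7)%Z).
{ unfold chi_partial. induction A as [|A IH]; [reflexivity|]. rewrite rsum_seq_S, IH.
  rewrite (chi_mod (Z.of_nat (S A)) (Z.of_nat A mod 7 + 1)) by (rewrite Nat2Z.inj_succ, Zplus_mod_idemp_l; f_equal; lia).
  replace (Z.of_nat (S A) mod 7)%Z with ((Z.of_nat A mod 7 + 1) mod 7)%Z by (rewrite Nat2Z.inj_succ, Zplus_mod_idemp_l; f_equal; lia).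
  pattern (Z.of_nat A mod 7)%Z. apply mod7_cases;
  repeat match goal with |- context [chi ?x] => let y := eval vm_compute in (chi x) in change (chi x) with y end;
  repeat match goal with |- context [(?x mod 7)%Z] => let y := eval vm_compute in (x mod 7)%Z in change (x mod 7)%Z with y end;
  unfold tab; simpl; lra. }
rewrite H. pattern (Z.of_nat A mod 7)%Z. apply mod7_cases; unfold tab; simpl; apply Rabs_le; lra.
Qed.

(** Summation by parts: the factor 2 bounds the partial sums of [chi], and only the variation of [h]
    enters. *)
Lemma chi_abel (h : nat -> R) A :
  Rabs (rsum (fun n => IZR (chi (Z.of_nat (S n))) * h (S n)) (seq 0 A) - chi_partial A * h A)
   <= 2 * rsum (fun n => Rabs (h n - h (S n))) (seq 0 A).
Proof.
induction A as [|A IH].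
- unfold chi_partial, rsum; simpl. rewrite Rmult_0_l, Rminus_0_r, Rabs_R0. lra.
- unfold chi_partial in *. rewrite !rsum_seq_S.
  set (X := rsum _ (seq 0 A)) in IH. set (Y := rsum _ (seq 0 A)) in IH at 1.
  fold X. change (rsum (fun n : nat => IZR (chi (Z.of_nat (S n)))) (seq 0 A)) with (chi_partial A) in *.
  replace (X + IZR (chi (Z.of_nat (S A))) * h (S A) - (chi_partial A + IZR (chi (Z.of_nat (S A)))) * h (S A))
   with (X - chi_partial A * h A + chi_partial A * (h A - h (S A))) by ring.
  eapply Rle_trans; [apply Rabs_triang|]. rewrite Rabs_mult. pose proof (chi_partial_bound A).
  pose proof (Rabs_pos (h A - h (S A))). rewrite Rmult_plus_distr_l. apply Rplus_le_compat; [exact IH|].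
  apply Rmult_le_compat_r; lra.
Qed.

Section AxisTerms.

Variable m : nat.

Let M := INR (S m).
Let P (a : nat) : R := 1 - gamma_tail (S m) (c7 * INR a ^ 2).
(** Replacing the weight [gamma_tail] by 1 changes the series by the sum of [chi a * h a]. As [h] is
    at most $a/q^2$ and at most $1/a$, with [q] the cutoff length, a total variation of order $1/q$
    can be expected. *)
Let h (a : nat) : R := P a / INR a.
Let q : R := sqrt (M / c7).

Lemma M_pos : 0 < M.
Proof. apply lt_0_INR. lia. Qed.

Lemma q_pos : 0 < q.
Proof. apply sqrt_lt_R0, Rdiv_lt_0_compat; [apply M_pos|apply c7_pos]. Qed.

Lemma q_sqr : q ^ 2 = M / c7.
Proof.
unfold q. rewrite pow2_sqrt; [easy|]. apply Rlt_le, Rdiv_lt_0_compat; [apply M_pos|apply c7_pos].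
Qed.

Lemma P_range a : 0 <= P a <= 1 /\ P a <= INR a ^ 2 / q ^ 2.
Proof.
pose proof c7_pos as Hc. pose proof M_pos as HM.
assert (Hx : 0 <= c7 * INR a ^ 2) by (pose proof (pow2_ge_0 (INR a)); nra).
pose proof (gamma_tail_le1 (S m) _ Hx). pose proof (gamma_tail_ge0 (S m) _ Hx). pose proof (gamma_tail_markov (S m) _ Hx) as H1.
fold M in H1. fold (P a) in H1. unfold P at 1 2. split; [lra|]. rewrite q_sqr.
apply Rmult_le_reg_l with M; auto. replace (M * (INR a ^ 2 / (M / c7))) with (c7 * INR a ^ 2) by (field; lra). exact H1.
Qed.

Lemma P_increasing a b : (a <= b)%nat -> P a <= P b.
Proof.
intros H. unfold P. pose proof c7_pos. apply le_INR in H. pose proof (pos_INR a).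
assert (gamma_tail (S m) (c7 * INR b ^ 2) <= gamma_tail (S m) (c7 * INR a ^ 2)); [|lra].
apply gamma_tail_decreasing. assert (INR a ^ 2 <= INR b ^ 2) by (apply pow_incr; lra). pose proof (pow2_ge_0 (INR a)). nra.
Qed.

(** Since [P] increases, [h] falls in one step by at most $P(a)/(a(a+1))$. The signed increment plus
    twice this fall bounds the absolute value, and both parts telescope. *)
Lemma h_variation_step a : (0 < a)%nat ->
  Rabs (h a - h (S a)) <= h (S a) - h a + 8 * (/ (q + INR a - 1) - / (q + INR a)).
Proof.
intros Ha. apply le_INR in Ha. simpl in Ha. set (x := INR a) in *.
pose proof (P_range a) as [[P0 P1] P2]. pose proof (P_increasing a (S a) ltac:(lia)) as Hinc. pose proof q_pos as Hq.
fold x in P2. unfold h. rewrite S_INR. fold x.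
assert (Hw : P a / (x * (x + 1)) <= 4 * (/ (q + x - 1) - / (q + x))).
{ (* [min (1, y) <= 2 y / (1 + y)] and [(q + x)^2 <= 2 (q^2 + x^2)] *)
  assert (HP : P a <= 2 * x ^ 2 / (q ^ 2 + x ^ 2)).
  { assert (0 < q ^ 2) by (apply pow_lt; lra). assert (0 < x ^ 2) by (apply pow_lt; lra).
    apply (proj1 (Rle_div_r _ _ (q ^ 2 + x ^ 2) ltac:(lra))).
    apply (proj2 (Rle_div_r _ _ (q ^ 2) ltac:(lra))) in P2. nra. }
  apply Rle_trans with (2 / (q ^ 2 + x ^ 2)).
  - assert (0 < q ^ 2 + x ^ 2) by (assert (0 < q ^ 2) by (apply pow_lt; lra); nra).
    apply Rle_div_l; [nra|]. eapply Rle_trans; [apply HP|].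
    replace (2 / (q ^ 2 + x ^ 2) * (x * (x + 1))) with (2 * (x * (x + 1)) / (q ^ 2 + x ^ 2)) by (field; lra).
    apply Rmult_le_compat_r; [apply Rlt_le, Rinv_0_lt_compat; lra|]. nra.
  - replace (4 * (/ (q + x - 1) - / (q + x))) with (2 / ((q + x - 1) * (q + x) / 2)) by (field; lra).
    apply Rmult_le_compat_l; [lra|]. apply Rinv_le_contravar; [nra|]. pose proof (pow2_ge_0 (q - x)). nra. }
assert (Hid : P (S a) / (x + 1) - P a / x = (P (S a) - P a) / (x + 1) - P a / (x * (x + 1))) by (field; lra).
assert (Hd : 0 <= (P (S a) - P a) / (x + 1)) by (apply Rdiv_le_0_compat; lra).
assert (Hpa : 0 <= P a / (x * (x + 1))) by (apply Rdiv_le_0_compat; [lra|nra]).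
replace (P a / x - P (S a) / (x + 1)) with (P a / (x * (x + 1)) - (P (S a) - P a) / (x + 1)) by lra.
apply Rle_trans with (P a / (x * (x + 1)) + (P (S a) - P a) / (x + 1)).
- apply Rabs_le. lra.
- lra.
Qed.

Lemma h_nonneg a : 0 <= h a.
Proof.
unfold h. destruct a; [unfold Rdiv; simpl; rewrite Rinv_0; lra|].
apply Rdiv_le_0_compat; [apply P_range|apply lt_0_INR; lia].
Qed.

Lemma h_le_inv a : (0 < a)%nat -> h a <= / INR a.
Proof.
intros Ha. apply lt_0_INR in Ha. unfold h, Rdiv. rewrite <- (Rmult_1_l (/ INR a)) at 2.
apply Rmult_le_compat_r; [apply Rlt_le, Rinv_0_lt_compat; lra|apply P_range].
Qed.

Lemma h_0 : h 0 = 0.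
Proof. unfold h, Rdiv. simpl. rewrite Rinv_0. ring. Qed.

Lemma h_variation A : rsum (fun n => Rabs (h n - h (S n))) (seq 0 (S A)) <= h (S A) + 8 * (/ q - / (q + INR A)).
Proof.
pose proof q_pos. induction A as [|A IH].
- unfold rsum; simpl. rewrite h_0. pose proof (h_nonneg 1). rewrite Rabs_left1 by lra. rewrite !Rplus_0_r. lra.
- rewrite rsum_seq_S. pose proof (h_variation_step (S A) ltac:(lia)) as H1.
  replace (q + INR (S A) - 1) with (q + INR A) in H1 by (rewrite S_INR; ring). lra.
Qed.

(** The boundary term of [chi_abel] gives at most $2/A$, and twice the variation gives at most
    $2/A+16/q$. *)
Lemma axis_partial_sum A : (0 < A)%nat ->
  Rabs (rsum (fun n => IZR (chi (Z.of_nat (S n))) / INR (S n) * gamma_tail (S m) (c7 * INR (S n) ^ 2)) (seq 0 A)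
    - rsum (fun n => IZR (chi (Z.of_nat (S n))) / INR (S n)) (seq 0 A)) <= 4 / INR A + 16 / q.
Proof.
intros HA.
replace (rsum (fun n => IZR (chi (Z.of_nat (S n))) / INR (S n) * gamma_tail (S m) (c7 * INR (S n) ^ 2)) (seq 0 A)
    - rsum (fun n => IZR (chi (Z.of_nat (S n))) / INR (S n)) (seq 0 A))
  with (- rsum (fun n => IZR (chi (Z.of_nat (S n))) * h (S n)) (seq 0 A)).
2:{ unfold Rminus. replace (- rsum (fun n => IZR (chi (Z.of_nat (S n))) / INR (S n)) (seq 0 A)) with
     (rsum (fun n => -1 * (IZR (chi (Z.of_nat (S n))) / INR (S n))) (seq 0 A)) by (rewrite rsum_scal; ring).
    rewrite <- rsum_plus. replace (- rsum (fun n => IZR (chi (Z.of_nat (S n))) * h (S n)) (seq 0 A)) with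
     (rsum (fun n => -1 * (IZR (chi (Z.of_nat (S n))) * h (S n))) (seq 0 A)) by (rewrite rsum_scal; ring).
    apply rsum_ext. intros n _. unfold h, P. field. apply not_0_INR; lia. }
rewrite Rabs_Ropp. pose proof (chi_abel h A) as H1. pose proof (chi_partial_bound A) as H2.
destruct A as [|A]; [lia|]. pose proof (h_variation A) as H3. pose proof (h_le_inv (S A) HA) as H4. pose proof (h_nonneg (S A)) as H5.
pose proof q_pos as Hq. pose proof (pos_INR A).
assert (0 < / (q + INR A)) by (apply Rinv_0_lt_compat; lra).
set (X := rsum _ _) in *.
replace X with (X - chi_partial (S A) * h (S A) + chi_partial (S A) * h (S A)) by ring.
eapply Rle_trans; [apply Rabs_triang|]. rewrite Rabs_mult, (Rabs_pos_eq (h (S A))) by easy.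
assert (Rabs (chi_partial (S A)) * h (S A) <= 2 * h (S A)) by (apply Rmult_le_compat_r; easy).
unfold Rdiv. lra.
Qed.

(** At [a = 0] the numerator [chi 0] is zero, so the term is zero in spite of the division by
    zero. *)
Definition axis_term (a : Z) : C := RtoC (IZR (chi a) / IZR a * gamma_tail (S m) (c7 * IZR a ^ 2)).

Lemma axis_term_ex : exists S, sums_to axis_term S.
Proof.
pose proof c7_pos as Hc. set (k := c7 / INR (S (S m))).
assert (Hk : 0 < k) by (apply Rdiv_lt_0_compat; [easy|apply lt_0_INR; lia]).
apply (sums_to_ex _ (fun a => (exp 2 * (1 + / k)) * pz a)).
- apply summable_scal; [|apply summable_pz]. pose proof (exp_pos 2). pose proof (Rinv_0_lt_compat _ Hk). nra.
- intros a. unfold axis_term. rewrite Cmod_R, Rabs_mult.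
  assert (Hx : 0 <= c7 * IZR a ^ 2) by (pose proof (pow2_ge_0 (IZR a)); nra).
  pose proof (gamma_tail_ge0 (S m) _ Hx). rewrite (Rabs_pos_eq (gamma_tail _ _)) by easy.
  assert (H1 : Rabs (IZR (chi a) / IZR a) <= 1).
  { unfold Rdiv. rewrite Rabs_mult. pose proof (chi_abs_le a). destruct (Z.eq_dec a 0) as [->|Ha].
    - rewrite Rinv_0, Rabs_R0. lra.
    - rewrite Rabs_inv. assert (1 <= Rabs (IZR a)) by (rewrite <- abs_IZR; apply IZR_le; lia).
      assert (/ Rabs (IZR a) <= 1) by (rewrite <- Rinv_1; apply Rinv_le_contravar; lra).
      assert (0 < / Rabs (IZR a)) by (apply Rinv_0_lt_compat; lra). pose proof (Rabs_pos (IZR (chi a))). nra. }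
  assert (H2 : gamma_tail (S m) (c7 * IZR a ^ 2) <= exp 2 * ((1 + / k) * pz a)).
  (* One step up in the index, because [gamma_tail_exp_bound] asks for at least 2 and [m] may be
     0. *)
  { eapply Rle_trans; [now apply gamma_tail_le_S|]. eapply Rle_trans; [apply gamma_tail_exp_bound; [lia|easy]|].
    apply Rmult_le_compat_l; [apply Rlt_le, exp_pos|].
    replace (c7 * IZR a ^ 2 / INR (S (S m))) with (k * IZR a ^ 2) by (unfold k; field; apply not_0_INR; lia).
    now apply gauss_le_pz. }
  pose proof (Rabs_pos (IZR (chi a) / IZR a)). rewrite Rmult_assoc. nra.
Qed.

Lemma sym_range_S A : Permutation (sym_range (S A)) (Z.of_nat (S A) :: (- Z.of_nat (S A))%Z :: sym_range A).
Proof.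
apply NoDup_Permutation.
- apply NoDup_sym_range.
- constructor; [|constructor; [|apply NoDup_sym_range]].
  + intros [H|H]; [lia|]. apply in_sym_range in H. lia.
  + intros H. apply in_sym_range in H. lia.
- intros z. cbn [In]. rewrite !in_sym_range. lia.
Qed.

Lemma sums_to_sym_range (f : Z -> C) S : sums_to f S -> Cseq_lim (fun A => list_sum f (sym_range A)) S.
Proof.
intros H e He. destruct (H e He) as [F0 HF0].
assert (exists N, forall z, In z F0 -> (Z.abs z <= Z.of_nat N)%Z) as [N HN].
{ clear. induction F0 as [|a F [N HN]]; [exists 0%nat; intros z []|].
  exists (N + Z.to_nat (Z.abs a))%nat. intros z [<-|Hz]; [lia|]. specialize (HN z Hz). lia. }
exists N. intros A HA. apply HF0; [apply NoDup_sym_range|]. intros z Hz. apply in_sym_range. specialize (HN z Hz). lia.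
Qed.

Lemma axis_sum_sym A : list_sum axis_term (sym_range A) =
  RtoC (2 * rsum (fun n => IZR (chi (Z.of_nat (S n))) / INR (S n) * gamma_tail (S m) (c7 * INR (S n) ^ 2)) (seq 0 A)).
Proof.
induction A as [|A IH].
- unfold sym_range. simpl. unfold list_sum, rsum; simpl. unfold axis_term. change (chi 0) with 0%Z.
  unfold Rdiv. rewrite !Rmult_0_l, Rmult_0_r. ring.
- rewrite (list_sum_perm _ _ _ (sym_range_S A)), !list_sum_cons, IH, rsum_seq_S.
  unfold axis_term. rewrite chi_opp, !opp_IZR, <- INR_IZR_INZ.
  assert (HS : INR (S A) <> 0) by (apply not_0_INR; lia).
  rewrite <- !RtoC_plus. f_equal.
  replace ((- INR (S A)) ^ 2) with (INR (S A) ^ 2) by ring. field. exact HS.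
Qed.

(** [chi] and $1/a$ are both odd, so symmetric sums are twice the sums over positive [a]; this
    doubles the value in [L1_chi] and the error $16/q$. *)
Lemma axis_value R0 : sums_to axis_term R0 -> Cmod (R0 - RtoC (2 * PI / sqrt 7))%C <= 32 / q.
Proof.
intros H. apply sums_to_sym_range in H. apply le_epsilon. intros e He.
destruct (H (e / 4)) as [N1 K1]; [lra|].
pose proof L1_chi as HL. apply is_lim_seq_spec in HL. destruct (HL (mkposreal (e / 8) ltac:(lra))) as [N2 K2]. cbn [pos] in K2.
destruct (nfloor_ex (32 / e)) as [N3 [_ HN3]]; [apply Rdiv_le_0_compat; lra|].
set (A := (N1 + N2 + S N3)%nat). specialize (K1 A ltac:(lia)). specialize (K2 A ltac:(lia)).
pose proof (axis_partial_sum A ltac:(lia)) as K3. rewrite axis_sum_sym in K1.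
assert (HA : 4 / INR A <= e / 8).
{ assert (32 / e < INR A) by (unfold A; rewrite !plus_INR, S_INR; pose proof (pos_INR N1); pose proof (pos_INR N2); lra).
  assert (0 < 32 / e) by (apply Rdiv_lt_0_compat; lra).
  apply Rle_div_l; [lra|]. apply Rlt_div_l in H0; [|easy]. lra. }
set (X := rsum (fun n => _ * gamma_tail _ _) _) in *.
set (Y := rsum (fun n => IZR (chi (Z.of_nat (S n))) / INR (S n)) (seq 0 A)) in *.
replace (R0 - RtoC (2 * PI / sqrt 7))%C with (- (RtoC (2 * X) - R0) + (RtoC (2 * (X - Y)) + RtoC (2 * (Y - PI / sqrt 7))))%C.
2:{ replace (2 * PI / sqrt 7) with (2 * (PI / sqrt 7)) by (unfold Rdiv; ring). rewrite !RtoC_mult, !RtoC_minus. ring. }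
eapply Rle_trans; [apply Cmod_triangle|]. rewrite Cmod_opp.
pose proof (Cmod_triangle (RtoC (2 * (X - Y))) (RtoC (2 * (Y - PI / sqrt 7)))) as T.
rewrite !Cmod_R, !Rabs_mult, !(Rabs_pos_eq 2) in T by lra. unfold Rdiv in *. lra.
Qed.

End AxisTerms.

(** * The lattice points off the real axis *)

(** $(1-w)\sum_{j\le N}w^jQ_j+Q_Nw^{N+1}$ is $Q_0$ plus the increments of $Q$ times powers of $w$,
    hence at most $Q_N$ in modulus. *)
Lemma geometric_abel (w : C) (Q : nat -> R) N : Cmod w = 1 ->
  (forall j, 0 <= Q j) -> (forall j, Q j <= Q (S j)) ->
  Cmod (1 - w) * Cmod (list_sum (fun j => Cpow w j * Q j)%C (seq 0 (S N))) <= 2 * Q N.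
Proof.
intros Hw H0 Hm. rewrite <- Cmod_mult.
assert (Hp : forall j, Cmod (Cpow w j) = 1) by (intros j; rewrite Cmod_pow, Hw; apply pow1).
assert (H : Cmod ((1 - w) * list_sum (fun j => Cpow w j * Q j) (seq 0 (S N)) + Q N * Cpow w (S N))%C <= Q N).
{ induction N as [|N IH].
  - unfold list_sum; simpl. replace ((1 - w) * (1 * Q 0%nat + 0) + Q 0%nat * (w * 1))%C with (RtoC (Q 0%nat)) by ring.
    rewrite Cmod_R, Rabs_pos_eq by auto. lra.
  - rewrite seq_S, list_sum_app, list_sum_cons. unfold list_sum at 2; simpl fold_right. rewrite Nat.add_0_l.
    replace ((1 - w) * (list_sum (fun j => Cpow w j * Q j) (seq 0 (S N)) + (Cpow w (S N) * Q (S N) + 0)) + Q (S N) * Cpow w (S (S N)))%C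
      with (((1 - w) * list_sum (fun j => Cpow w j * Q j) (seq 0 (S N)) + Q N * Cpow w (S N)) + RtoC (Q (S N) - Q N) * Cpow w (S N))%C.
    + eapply Rle_trans; [apply Cmod_triangle|]. rewrite Cmod_mult, Hp, Cmod_R, Rabs_pos_eq by (specialize (Hm N); lra). lra.
    + rewrite (Cpow_S w (S N)), RtoC_minus. ring. }
set (X := ((1 - w) * list_sum _ _)%C) in *.
pose proof (Cmod_triangle (X + Q N * Cpow w (S N)) (- (Q N * Cpow w (S N))))%C as T.
replace (X + Q N * Cpow w (S N) + - (Q N * Cpow w (S N)))%C with X in T by ring.
rewrite Cmod_opp, Cmod_mult, Hp, Cmod_R, Rabs_pos_eq in T by auto. lra.
Qed.

Definition central_term (j : nat) (p : Z * Z) : C :=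
  (coef j p * RtoC (gamma_tail (2 * j + 1) (c7 * lam p) / lam p ^ (2 * j + 1)))%C.

Lemma zelt_parts p : zelt p = (IZR (2 * fst p + snd p) / 2, sqrt 7 * IZR (snd p) / 2).
Proof.
unfold zelt. rewrite elt_parts, plus_IZR, mult_IZR. apply injective_projections; simpl; field.
Qed.

Lemma lam_squares p : lam p = (IZR (2 * fst p + snd p) ^ 2 + 7 * IZR (snd p) ^ 2) / 4.
Proof. unfold lam. rewrite normZ_IZR, plus_IZR, mult_IZR. field. Qed.

(** As $\lambda^2=|z|^4$, each step in [j] multiplies by $z^4/\lambda^2$, a number of modulus 1; the
    only other dependence on [j] is through [gamma_tail]. *)
Lemma central_sum_geometric N p : p <> (0, 0)%Z ->
  list_sum (fun j => central_term j p) (seq 0 N) =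
  (IZR (chi (2 * fst p + snd p)) * (zelt p / lam p) *
   list_sum (fun j => Cpow (Cpow (zelt p) 4 / RtoC (lam p ^ 2)) j * RtoC (gamma_tail (2 * j + 1) (c7 * lam p))) (seq 0 N))%C.
Proof.
intros Hp. pose proof (lam_ge1 p Hp) as Hl. rewrite <- list_sum_scal. apply list_sum_ext. intros j _.
unfold central_term, coef.
assert (Hl0 : RtoC (lam p) <> RtoC 0) by (apply RtoC_neq; lra).
unfold Cdiv at 2. rewrite Cpow_mult_l, <- Cpow_mult_r, Cpow_add_r, Cpow_1_r, RtoC_div by (apply pow_nonzero; lra).
rewrite <- RtoC_inv by (apply pow_nonzero; lra). rewrite <- RtoC_pow.
rewrite pow_inv, <- pow_mult. rewrite RtoC_inv by (apply pow_nonzero; lra).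
rewrite pow_add, pow_1, RtoC_mult.
assert (Hlj : RtoC (lam p ^ (2 * j)) <> RtoC 0) by (apply RtoC_neq, pow_nonzero; lra).
field. auto.
Qed.

Lemma sqrt7_bounds : 1 <= sqrt 7 <= 3.
Proof.
split.
- rewrite <- sqrt_1 at 1. apply sqrt_le_1_alt. lra.
- replace 3 with (sqrt (3 * 3)) by (apply sqrt_square; lra). apply sqrt_le_1_alt. lra.
Qed.

(** The argument of [zelt p ^ 4] stays away from [0] unless [p] is close to one of the axes:
    with [u = Re z] and [v = Im z], [|1 - (z / |z|) ^ 4| = 4 |u v| / |z| ^ 2]. *)
Lemma off_axis_pointwise N p : snd p <> 0%Z -> (2 * fst p + snd p)%Z <> 0%Z ->
  Cmod (list_sum (fun j => central_term j p) (seq 0 (S N))) <=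
  3 * (/ Rabs (IZR (snd p)) + / Rabs (IZR (2 * fst p + snd p))) * gamma_tail (2 * N + 1) (c7 * lam p).
Proof.
intros Hb Hc.
assert (Hp : p <> (0, 0)%Z) by (intros ->; now apply Hb).
pose proof (lam_ge1 p Hp) as Hl. pose proof c7_pos as Hc7. assert (Hx : 0 <= c7 * lam p) by nra.
rewrite (central_sum_geometric (S N) p Hp).
set (w := (Cpow (zelt p) 4 / RtoC (lam p ^ 2))%C).
set (b := IZR (snd p)) in *. set (c := IZR (2 * fst p + snd p)) in *.
assert (Hb0 : b <> 0) by (apply not_0_IZR; auto). assert (Hc0 : c <> 0) by (apply not_0_IZR; auto).
assert (Hl2 : lam p ^ 2 <> 0) by (apply pow_nonzero; lra).
assert (HCl : RtoC (lam p ^ 2) <> RtoC 0) by now apply RtoC_neq.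
pose proof (Cmod_zelt_sqr p) as Hz. pose proof (lam_squares p) as Hlq. fold b c in Hlq.
assert (Hw : Cmod w = 1).
{ unfold w. rewrite Cmod_div, Cmod_pow, Cmod_R by easy. rewrite Rabs_pos_eq by (apply pow_le; lra).
  replace (Cmod (zelt p) ^ 4) with ((Cmod (zelt p) ^ 2) ^ 2) by ring. rewrite Hz. field. lra. }
assert (H1w : Cmod (1 - w)%C = sqrt 7 * Rabs b * Rabs c / lam p).
{ assert (E1 : (1 - w)%C = (- (Cpow (zelt p) 2 * (RtoC (sqrt 7 * b * c) * Ci)) / RtoC (lam p ^ 2))%C).
  { unfold w. replace (1 - Cpow (zelt p) 4 / RtoC (lam p ^ 2))%C with ((RtoC (lam p ^ 2) - Cpow (zelt p) 4) / RtoC (lam p ^ 2))%C by (field; auto).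
    f_equal. pose proof sqrt7_sqr as H7.
    replace (RtoC (lam p ^ 2)) with (Cpow (zelt p) 2 * Cpow (Cconj (zelt p)) 2)%C.
    - transitivity (Cpow (zelt p) 2 * (Cpow (Cconj (zelt p)) 2 - Cpow (zelt p) 2))%C; [ring|].
      replace (Cpow (Cconj (zelt p)) 2 - Cpow (zelt p) 2)%C with (- (RtoC (sqrt 7 * b * c) * Ci))%C; [ring|].
      rewrite zelt_parts. fold b c. apply injective_projections; simpl; field.
    - rewrite <- Cpow_mult_l, <- Cmod2_conj, Hz, <- RtoC_pow. reflexivity. }
  rewrite E1, Cmod_div, Cmod_opp, !Cmod_mult, Cmod_pow, Hz, Cmod_Ci, !Cmod_R by easy.
  rewrite (Rabs_pos_eq (lam p ^ 2)) by (apply pow_le; lra). rewrite !Rabs_mult, (Rabs_pos_eq (sqrt 7)) by apply sqrt_pos.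
  field. lra. }
pose proof (geometric_abel w (fun j => gamma_tail (2 * j + 1) (c7 * lam p)) N Hw) as HA.
assert (HQ : forall j, 0 <= gamma_tail (2 * j + 1) (c7 * lam p)) by (intros; now apply gamma_tail_ge0).
specialize (HA HQ ltac:(intros j; apply gamma_tail_le; [lia|easy])). rewrite H1w in HA. cbv beta in HA.
set (G := list_sum _ _) in *. set (Q := gamma_tail (2 * N + 1) (c7 * lam p)) in *.
assert (HQ0 : 0 <= Q) by apply HQ.
destruct sqrt7_bounds as [S1 S2]. pose proof (Rabs_pos_lt _ Hb0) as Pb. pose proof (Rabs_pos_lt _ Hc0) as Pc.
assert (HG : Cmod G <= 2 * Q * lam p / (sqrt 7 * Rabs b * Rabs c)).
{ assert (Hpos : 0 < sqrt 7 * Rabs b * Rabs c) by (repeat apply Rmult_lt_0_compat; lra).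
  apply Rle_div_r; [easy|]. apply Rmult_le_reg_r with (/ lam p); [apply Rinv_0_lt_compat; lra|].
  replace (2 * Q * lam p * / lam p) with (2 * Q) by (field; lra). unfold Rdiv in HA. lra. }
assert (Hzb : Cmod (zelt p) <= (Rabs c + 3 * Rabs b) / 2).
{ rewrite zelt_parts. fold b c. eapply Rle_trans; [apply Cmod_le_parts|]. simpl. unfold Rdiv.
  rewrite !Rabs_mult, (Rabs_pos_eq (/ 2)), (Rabs_pos_eq (sqrt 7)) by lra. nra. }
rewrite !Cmod_mult, Cmod_R, Cmod_div, Cmod_R, (Rabs_pos_eq (lam p)) by (try apply RtoC_neq; lra).
pose proof (chi_abs_le (2 * fst p + snd p)) as Hchi. pose proof (Rabs_pos (IZR (chi (2 * fst p + snd p)))).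
pose proof (Cmod_ge_0 (zelt p)) as Hz0. pose proof (Cmod_ge_0 G) as HG0.
apply Rle_trans with (1 * (((Rabs c + 3 * Rabs b) / 2) / lam p) * (2 * Q * lam p / (1 * Rabs b * Rabs c))).
- assert (Hi : 0 < / lam p) by (apply Rinv_0_lt_compat; lra).
  apply Rmult_le_compat; auto.
  + apply Rmult_le_pos; [easy|]. apply Rmult_le_pos; lra.
  + apply Rmult_le_compat; auto; [apply Rmult_le_pos; lra|]. apply Rmult_le_compat_r; lra.
  + eapply Rle_trans; [apply HG|]. apply Rmult_le_compat_l; [nra|]. apply Rinv_le_contravar; [repeat apply Rmult_lt_0_compat; lra|].
    apply Rmult_le_compat_r; [lra|]. apply Rmult_le_compat_r; lra.
- replace (1 * ((Rabs c + 3 * Rabs b) / 2 / lam p) * (2 * Q * lam p / (1 * Rabs b * Rabs c))) with ((/ Rabs b + 3 * / Rabs c) * Q) by (field; lra).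
  apply Rmult_le_compat_r; [easy|]. pose proof (Rinv_0_lt_compat _ Pb). lra.
Qed.

(** [gauss0] and [gauss1] are Gaussians on the nonzero integers with weights 1 and $1/|c|$. The
    value 0 at the origin reflects that the lines [b = 0] and [2 a + b = 0] are excluded. *)
Definition gauss0 (k : R) (c : Z) : R := if Z.eq_dec c 0 then 0 else exp (- (k * IZR c ^ 2)).

Definition gauss1 (k : R) (c : Z) : R := if Z.eq_dec c 0 then 0 else exp (- (k * IZR c ^ 2)) / Rabs (IZR c).

Lemma gauss0_ge0 k c : 0 <= gauss0 k c.
Proof. unfold gauss0. destruct (Z.eq_dec c 0); [lra|apply Rlt_le, exp_pos]. Qed.

Lemma gauss1_ge0 k c : 0 <= gauss1 k c.
Proof.
unfold gauss1. destruct (Z.eq_dec c 0); [lra|]. apply Rdiv_le_0_compat; [apply Rlt_le, exp_pos|].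
apply Rabs_pos_lt, not_0_IZR. auto.
Qed.

Lemma rsum_even_Z_le (g : Z -> R) B : (forall z, 0 <= g z) -> g 0%Z = 0 -> (forall z, g (- z)%Z = g z) ->
  (forall M, rsum (fun k => g (Z.of_nat (S k))) (seq 0 M) <= B) ->
  forall F, NoDup F -> rsum g F <= 2 * B.
Proof.
intros H0 Hz Hev HB F N. replace (2 * B) with (B + B) by ring.
apply (rsum_Z_le g (fun k => g (Z.of_nat k)) (fun k => g (Z.of_nat (S k)))); auto.
- intros k. lra.
- intros k. rewrite <- Hev. apply Req_le. f_equal. lia.
- intros [|M]; [specialize (HB 0%nat); exact HB|].
  specialize (HB M). simpl seq. rewrite rsum_cons. change (Z.of_nat 0) with 0%Z. rewrite Hz, Rplus_0_l.
  rewrite <- seq_shift, rsum_map. exact HB.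
Qed.

(** $e^{-x^2/q^2}\le q^2/(q^2+x^2)\le2q^2/(q+x)^2$, and the last quantity is below a telescoping
    difference. *)
Lemma gauss_step q x : 0 < q -> 1 <= x -> exp (- (/ q ^ 2 * x ^ 2)) <= 2 * q ^ 2 * (/ (q + x - 1) - / (q + x)).
Proof.
intros Hq Hx. assert (Hq2 : 0 < q ^ 2) by (apply pow_lt; lra).
assert (Hy : 0 <= / q ^ 2 * x ^ 2) by (apply Rmult_le_pos; [apply Rlt_le, Rinv_0_lt_compat; lra|apply pow2_ge_0]).
eapply Rle_trans; [apply exp_neg_le, Hy|].
replace (2 * q ^ 2 * (/ (q + x - 1) - / (q + x))) with (/ ((q + x - 1) * (q + x) / (2 * q ^ 2))) by (field; lra).
apply Rinv_le_contravar; [apply Rdiv_lt_0_compat; nra|].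
apply Rle_div_l; [lra|]. replace ((1 + / q ^ 2 * x ^ 2) * (2 * q ^ 2)) with (2 * (q ^ 2 + x ^ 2)) by (field; lra).
pose proof (pow2_ge_0 (q - x)). nra.
Qed.

Lemma gauss0_sum q : 0 < q -> forall F, NoDup F -> rsum (gauss0 (/ q ^ 2)) F <= 2 * (2 * q).
Proof.
intros Hq. apply rsum_even_Z_le.
- apply gauss0_ge0.
- reflexivity.
- intros z. unfold gauss0. destruct (Z.eq_dec (- z) 0), (Z.eq_dec z 0); try lia; auto. rewrite opp_IZR. do 3 f_equal. ring.
- intros M.
  assert (H : rsum (fun k => gauss0 (/ q ^ 2) (Z.of_nat (S k))) (seq 0 M) <= 2 * q ^ 2 * (/ q - / (q + INR M))).
  { induction M as [|M IH]; [unfold rsum; simpl; rewrite Rplus_0_r; lra|].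
    rewrite rsum_seq_S. unfold gauss0 at 2. destruct (Z.eq_dec (Z.of_nat (S M)) 0); [lia|].
    rewrite <- INR_IZR_INZ. pose proof (pos_INR M).
    pose proof (gauss_step q (INR (S M)) Hq ltac:(rewrite S_INR; lra)) as H1.
    replace (q + INR (S M) - 1) with (q + INR M) in H1 by (rewrite S_INR; ring). lra. }
  eapply Rle_trans; [apply H|]. pose proof (pos_INR M).
  assert (0 < / (q + INR M)) by (apply Rinv_0_lt_compat; lra).
  replace (2 * q) with (2 * q ^ 2 * / q) by (field; lra). apply Rmult_le_compat_l; [nra|lra].
Qed.

Definition harmonic (n : nat) : R := rsum (fun k => / INR (S k)) (seq 0 n).

Lemma harmonic_le_log n : harmonic (S n) <= 1 + ln (INR (S n)).
Proof.
induction n as [|n IH].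
- unfold harmonic, rsum; simpl. rewrite ln_1, Rinv_1. lra.
- unfold harmonic in *. rewrite rsum_seq_S.
  assert (H1 : 1 <= INR (S n)) by (rewrite S_INR; pose proof (pos_INR n); lra).
  rewrite (S_INR (S n)). set (x := INR (S n)) in *.
  assert (H : / (x + 1) <= ln (x + 1) - ln x); [|lra].
  assert (Hi : 0 < / (x + 1)) by (apply Rinv_0_lt_compat; lra).
  replace x with ((x + 1) * (1 - / (x + 1))) at 3 by (field; lra).
  assert (Hlt : 0 < 1 - / (x + 1)) by (assert (/ (x + 1) < / 1) by (apply Rinv_lt_contravar; lra); lra).
  rewrite ln_mult by lra.
  assert (ln (1 - / (x + 1)) <= - / (x + 1)); [|lra].
  rewrite <- (ln_exp (- / (x + 1))). apply ln_le; [easy|]. pose proof (exp_ineq1_le (- / (x + 1))). lra.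
Qed.

(** Bounding each term by $2(1/x-1/(x+q))$ with an integer [q] makes the sum telescope in harmonic
    numbers, to at most $2H_q$ for each sign. *)
Lemma gauss1_sum (q : nat) : (0 < q)%nat -> forall F, NoDup F ->
  rsum (gauss1 (/ INR q ^ 2)) F <= 2 * (2 * (1 + ln (INR q))).
Proof.
intros Hq. assert (Hq0 : 0 < INR q) by now apply lt_0_INR.
apply rsum_even_Z_le.
- apply gauss1_ge0.
- reflexivity.
- intros z. unfold gauss1. destruct (Z.eq_dec (- z) 0), (Z.eq_dec z 0); try lia; auto. rewrite opp_IZR, Rabs_Ropp. do 4 f_equal. ring.
- intros M.
  assert (H : rsum (fun k => gauss1 (/ INR q ^ 2) (Z.of_nat (S k))) (seq 0 M) <= 2 * (harmonic q + harmonic M - harmonic (M + q))).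
  { induction M as [|M IH]; [unfold harmonic at 2, rsum; simpl; lra|].
    unfold harmonic in *. simpl (S M + q)%nat. rewrite !rsum_seq_S.
    unfold gauss1 at 2. destruct (Z.eq_dec (Z.of_nat (S M)) 0); [lia|].
    rewrite <- INR_IZR_INZ. set (x := INR (S M)). pose proof (pos_INR M). assert (Hx : 1 <= x) by (unfold x; rewrite S_INR; lra).
    replace (INR (S (M + q))) with (x + INR q) by (unfold x; rewrite !S_INR, plus_INR; ring).
    rewrite (Rabs_pos_eq x) by lra.
    assert (H1 : exp (- (/ INR q ^ 2 * x ^ 2)) / x <= 2 * (/ x - / (x + INR q))); [|lra].
    assert (Hq2 : 0 < INR q ^ 2) by (apply pow_lt; lra).
    assert (Hy : 0 <= / INR q ^ 2 * x ^ 2) by (apply Rmult_le_pos; [apply Rlt_le, Rinv_0_lt_compat; lra|apply pow2_ge_0]).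
    pose proof (exp_neg_le _ Hy) as He.
    replace (2 * (/ x - / (x + INR q))) with (2 * INR q / (x + INR q) / x) by (field; lra).
    apply Rmult_le_compat_r; [apply Rlt_le, Rinv_0_lt_compat; lra|]. eapply Rle_trans; [apply He|].
    replace (2 * INR q / (x + INR q)) with (/ ((x + INR q) / (2 * INR q))) by (field; lra).
    apply Rinv_le_contravar; [apply Rdiv_lt_0_compat; lra|]. apply Rle_div_l; [lra|].
    replace ((1 + / INR q ^ 2 * x ^ 2) * (2 * INR q)) with (2 * INR q + 2 * x ^ 2 / INR q) by (field; lra).
    set (u := INR q) in *. assert (x <= u + x ^ 2 / u).
    { apply Rmult_le_reg_r with u; [easy|]. replace ((u + x ^ 2 / u) * u) with (u ^ 2 + x ^ 2) by (field; lra).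
      pose proof (pow2_ge_0 (u - x)). nra. }
    assert (0 <= x ^ 2 / u) by (apply Rdiv_le_0_compat; [apply pow2_ge_0|easy]). unfold Rdiv in *. lra. }
  eapply Rle_trans; [apply H|]. apply Rmult_le_compat_l; [lra|].
  assert (Hmono : harmonic M <= harmonic (M + q)).
  { unfold harmonic. clear. induction q as [|q IH]; [rewrite Nat.add_0_r; lra|]. rewrite Nat.add_succ_r, rsum_seq_S.
    assert (0 < / INR (S (M + q))) by (apply Rinv_0_lt_compat, lt_0_INR; lia). lra. }
  destruct q as [|q]; [lia|]. pose proof (harmonic_le_log q). lra.
Qed.

Lemma gauss_monotone k k' c : k' <= k -> gauss0 k c <= gauss0 k' c /\ gauss1 k c <= gauss1 k' c.
Proof.
intros Hk. unfold gauss0, gauss1. destruct (Z.eq_dec c 0); [lra|].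
assert (exp (- (k * IZR c ^ 2)) <= exp (- (k' * IZR c ^ 2))) by (apply exp_le; pose proof (pow2_ge_0 (IZR c)); nra).
split; [easy|]. apply Rmult_le_compat_r; [|easy]. apply Rlt_le, Rinv_0_lt_compat, Rabs_pos_lt, not_0_IZR. auto.
Qed.

(** * The mean of the central values *)

Lemma has_sum_sums_to {A} (f : A -> C) (p0 : A) S :
  f p0 = RtoC 0 -> has_sum (fun p => p <> p0) f S -> sums_to f S.
Proof.
intros H0 H e He. destruct (H e He) as (F0 & HP & HF). exists F0. intros F N I.
set (F' := filter (fun p => if classic_eq_dec p p0 then false else true) F).
assert (Hin : forall p, In p F' <-> In p F /\ p <> p0).
{ intros p. unfold F'. rewrite filter_In. destruct (classic_eq_dec p p0); intuition congruence. }
replace (list_sum f F) with (list_sum f F').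
- apply HF.
  + now apply NoDup_filter.
  + apply Forall_forall. intros p Hp. now apply Hin.
  + intros p Hp. apply Hin. split; [now apply I|]. rewrite Forall_forall in HP. now apply HP.
- unfold F'. clear - H0. induction F as [|p F IH]; [reflexivity|]. simpl filter.
  destruct (classic_eq_dec p p0) as [->|]; rewrite ?list_sum_cons, IH; [rewrite H0; ring|reflexivity].
Qed.

(** For the index [S n] the exponent is $4n+1$ and the shift is $2(n+1)-3/2=2n+1/2$, which are those
    of [central_value_formula]. *)
Lemma hecke_L_central n L : is_hecke_L (S n) L -> sums_to (central_term n) (L (RtoC (1 / 2))).
Proof.
intros [He Hs]. apply central_value_formula.
- intros s. apply cdiff_of_ex_derive, He.
- intros s Hs1. destruct (Hs s Hs1) as (S0 & HS & HL).
  replace (2 * L s)%C with S0 by (rewrite HL, RtoC_div by lra; field).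
  apply (has_sum_sums_to _ (0, 0)%Z) in HS.
  + revert HS. apply sums_to_ext. intros [a b]. unfold hecke_term, coef, zelt, lam. cbn [fst snd].
    rewrite eps_chi, Rcpow_cexp. replace (4 * S n - 3)%nat with (4 * n + 1)%nat by lia.
    replace (2 * INR (S n) - 3 / 2) with (2 * INR n + 1 / 2) by (rewrite S_INR; field).
    unfold Cdiv. f_equal. set (z := ((s + RtoC (2 * INR n + 1 / 2)) * RtoC (ln (IZR (normZ a b))))%C).
    replace (- (s + RtoC (2 * INR n + 1 / 2)) * RtoC (ln (IZR (normZ a b))))%C with (- z)%C by (unfold z; ring).
    assert (E1 : (cexp z * cexp (- z))%C = RtoC 1) by (rewrite <- cexp_plus, Cplus_opp_r; apply cexp_0).
    transitivity (/ cexp z * (cexp z * cexp (- z)))%C; [rewrite E1; ring|].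
    rewrite Cmult_assoc, Cinv_l by apply cexp_neq_0. ring.
  + unfold hecke_term. change (eps 0 0) with 0%Z. unfold Cdiv. rewrite !Cmult_0_l. reflexivity.
Qed.

Definition axis_ext (j : nat) (p : Z * Z) : C :=
  if Z.eq_dec (snd p) 0 then axis_term (2 * j) (fst p) else RtoC 0.

Lemma axis_ext_sum j R0 : sums_to (axis_term (2 * j)) R0 -> sums_to (axis_ext j) R0.
Proof.
intros H. apply (sums_to_push (axis_ext j) (fun a : Z => (a, 0%Z))).
- intros x y E0. congruence.
- intros [a b] Hab. unfold axis_ext. cbn [fst snd]. destruct (Z.eq_dec b 0) as [->|]; [|reflexivity].
  exfalso. now apply (Hab a).
- revert H. apply sums_to_ext. intros a. reflexivity.
Qed.

(** For real $z=a$ the powers reduce to $a^{4j+1}/a^{4j+2}=1/a$, and [chi (2 a)] is [chi a]: on the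
    axis there is no oscillation in [j]. *)
Lemma central_term_axis j a : central_term j (a, 0%Z) = axis_term (2 * j) a.
Proof.
unfold axis_term. destruct (Z.eq_dec a 0) as [->|Ha].
- unfold central_term. rewrite coef_0. change (chi 0) with 0%Z. unfold Rdiv. rewrite !Rmult_0_l. ring.
- assert (Ha0 : IZR a <> 0) by now apply not_0_IZR.
  unfold central_term, coef. rewrite lam_squares, zelt_parts. cbn [fst snd]. rewrite Z.add_0_r, chi_2, mult_IZR.
  replace ((2 * IZR a / 2)%R, (sqrt 7 * 0 / 2)%R) with (RtoC (IZR a)) by (apply injective_projections; simpl; field).
  rewrite <- RtoC_pow, <- !RtoC_mult. f_equal.
  replace (((2 * IZR a) ^ 2 + 7 * 0 ^ 2) / 4) with (IZR a ^ 2) by field.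
  replace (2 * j + 1)%nat with (S (2 * j)) by lia. rewrite <- pow_mult.
  replace (2 * S (2 * j))%nat with (S (4 * j + 1)) by lia.
  change (IZR a ^ S (4 * j + 1)) with (IZR a * IZR a ^ (4 * j + 1)).
  field. repeat split; try easy; now apply pow_nonzero.
Qed.

Section OffAxis.

Variable N : nat.

(** The decay rate from [gamma_tail_exp_bound] at the index $2(N+1)$: with $c=2a+b$ one has
    $c_7\lambda/(2(N+1))=k(c^2+7b^2)$. *)
Let k := c7 / (8 * INR (S N)).

Let dom (q : Z * Z) : R := 3 * exp 2 * (gauss1 k (fst q) * gauss0 k (snd q) + gauss0 k (fst q) * gauss1 k (snd q)).

Lemma k_pos : 0 < k.
Proof.
apply Rdiv_lt_0_compat; [apply c7_pos|]. assert (0 < INR (S N)) by (apply lt_0_INR; lia). lra.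
Qed.

(** For [b = 0] the two terms cancel, and for [2 a + b = 0] the character vanishes. Elsewhere
    [off_axis_pointwise] applies, and the exponential bound for the weight factors over the
    coordinates [b] and [2 a + b]. *)
Lemma off_axis_dominated p :
  Cmod (list_sum (fun j => central_term j p + (-1) * axis_ext j p)%C (seq 0 (S N))) <= dom (snd p, (2 * fst p + snd p)%Z).
Proof.
destruct p as [a b]. unfold dom. cbn [fst snd].
pose proof (gauss0_ge0 k b) as G1. pose proof (gauss1_ge0 k b) as G2.
pose proof (gauss0_ge0 k (2 * a + b)) as G3. pose proof (gauss1_ge0 k (2 * a + b)) as G4.
pose proof (exp_pos 2) as He2.
assert (Hdom : 0 <= 3 * exp 2 * (gauss1 k b * gauss0 k (2 * a + b) + gauss0 k b * gauss1 k (2 * a + b))).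
{ apply Rmult_le_pos; [lra|]. pose proof (Rmult_le_pos _ _ G2 G3). pose proof (Rmult_le_pos _ _ G1 G4). lra. }
destruct (Z.eq_dec b 0) as [->|Hb].
{ rewrite (list_sum_ext _ (fun _ => RtoC 0 * RtoC 0)%C), list_sum_scal.
  - rewrite Cmult_0_l, Cmod_0. exact Hdom.
  - intros j _. rewrite central_term_axis. unfold axis_ext. cbn [fst snd]. destruct (Z.eq_dec 0 0); [ring|lia]. }
rewrite (list_sum_ext _ (fun j => central_term j (a, b))).
2:{ intros j _. unfold axis_ext. cbn [fst snd]. destruct (Z.eq_dec b 0); [lia|ring]. }
destruct (Z.eq_dec (2 * a + b) 0) as [Hc|Hc].
{ rewrite (list_sum_ext _ (fun _ => RtoC 0 * RtoC 0)%C), list_sum_scal.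
  - rewrite Cmult_0_l, Cmod_0. exact Hdom.
  - intros j _. unfold central_term, coef. cbn [fst snd]. rewrite Hc. change (chi 0) with 0%Z. ring. }
pose proof (off_axis_pointwise N (a, b) Hb Hc) as H. cbn [fst snd] in H.
eapply Rle_trans; [apply H|].
assert (Hl : lam (a, b) = (IZR (2 * a + b) ^ 2 + 7 * IZR b ^ 2) / 4) by apply lam_squares.
unfold gauss0, gauss1 in *. destruct (Z.eq_dec b 0) as [|_]; [lia|]. destruct (Z.eq_dec (2 * a + b) 0) as [|_]; [lia|].
set (c := IZR (2 * a + b)) in *. set (b' := IZR b) in *.
assert (Hx : 0 <= c7 * lam (a, b)).
{ rewrite Hl. pose proof c7_pos. pose proof (pow2_ge_0 c). pose proof (pow2_ge_0 b'). apply Rmult_le_pos; lra. }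
assert (HS : 0 < INR (S N)) by (apply lt_0_INR; lia).
assert (HQ : gamma_tail (2 * N + 1) (c7 * lam (a, b)) <= exp 2 * (exp (- (k * b' ^ 2)) * exp (- (k * c ^ 2)))).
{ eapply Rle_trans; [now apply gamma_tail_le_S|].
  replace (S (2 * N + 1)) with (2 * S N)%nat by lia.
  eapply Rle_trans; [apply gamma_tail_exp_bound; [lia|easy]|].
  apply Rmult_le_compat_l; [lra|]. rewrite <- exp_plus. apply exp_le.
  rewrite mult_INR, Hl. simpl (INR 2).
  replace (c7 * ((c ^ 2 + 7 * b' ^ 2) / 4) / ((1 + 1) * INR (S N))) with (k * (c ^ 2 + 7 * b' ^ 2)) by (unfold k; field; lra).
  pose proof k_pos. pose proof (pow2_ge_0 b'). assert (0 <= k * b' ^ 2) by (apply Rmult_le_pos; lra). lra. }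
assert (Hb0 : 0 < / Rabs b') by (apply Rinv_0_lt_compat, Rabs_pos_lt, not_0_IZR; auto).
assert (Hc0 : 0 < / Rabs c) by (apply Rinv_0_lt_compat, Rabs_pos_lt, not_0_IZR; auto).
eapply Rle_trans; [apply Rmult_le_compat_l; [lra|exact HQ]|]. apply Req_le. unfold Rdiv. ring.
Qed.

(** The map to [(b, 2 a + b)] is injective, so the lattice sum is at most a sum over all pairs, that
    is, a product of one-dimensional sums bounded by $4q_0$ and $4(1+\ln q_1)$; the constant is
    $96=3\cdot2\cdot16$. *)
Lemma off_axis_bound (M0 : nat) D : 8 / c7 <= INR M0 -> (0 < M0)%nat ->
  sums_to (fun p => list_sum (fun j => central_term j p + (-1) * axis_ext j p)%C (seq 0 (S N))) D ->
  Cmod D <= 96 * exp 2 * (sqrt (8 / c7) * sqrt (INR (S N))) * (1 + ln (INR (M0 * S N))).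
Proof.
intros HM HM0 HD.
assert (HS : 1 <= INR (S N)) by (rewrite S_INR; pose proof (pos_INR N); lra).
pose proof c7_pos as Hc7. pose proof k_pos as Hk. pose proof (exp_pos 2).
set (q0 := sqrt (8 / c7) * sqrt (INR (S N))).
assert (H8 : 0 < 8 / c7) by (apply Rdiv_lt_0_compat; lra).
assert (Hq0 : 0 < q0) by (apply Rmult_lt_0_compat; apply sqrt_lt_R0; lra).
assert (Eq0 : / q0 ^ 2 = k).
{ unfold q0. rewrite Rpow_mult_distr, !pow2_sqrt by lra. unfold k. field. lra. }
pose proof (gauss0_sum q0 Hq0) as B0. rewrite Eq0 in B0.
(* [gauss1_sum] asks for an integer. A size of order [N] instead of $\sqrt N$ is harmless, because
   [q1] enters only through its logarithm. *)
set (q1 := (M0 * S N)%nat) in *.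
assert (Hq1 : 1 <= INR q1) by (apply (le_INR 1); unfold q1; lia).
assert (Eq1 : / INR q1 ^ 2 <= k).
{ unfold q1. rewrite mult_INR. apply (le_INR 1) in HM0. simpl in HM0. set (u := INR M0) in *. set (v := INR (S N)) in *.
  replace k with (/ (8 / c7 * v)) by (unfold k; fold v; field; lra).
  apply Rinv_le_contravar; [nra|]. apply Rle_trans with (u * v); [apply Rmult_le_compat_r; lra|].
  assert (1 <= u * v) by nra. nra. }
assert (B1 : forall F, NoDup F -> rsum (gauss1 k) F <= 2 * (2 * (1 + ln (INR q1)))).
{ intros F NF. eapply Rle_trans; [|apply (gauss1_sum q1 ltac:(unfold q1; lia) F NF)].
  apply rsum_le. intros c _. now apply gauss_monotone. }
assert (HlnQ : 0 <= ln (INR q1)).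
{ rewrite <- ln_1. apply ln_le; lra. }
apply (sums_to_bound _ _ _ HD). intros F NF.
eapply Rle_trans; [apply (Cmod_list_sum_le _ (fun p => dom (snd p, (2 * fst p + snd p)%Z)))|].
{ intros p _. apply off_axis_dominated. }
rewrite <- (rsum_map dom (fun p : Z * Z => (snd p, (2 * fst p + snd p)%Z))).
set (F' := map _ F).
assert (NF' : NoDup F').
{ apply FinFun.Injective_map_NoDup; auto. intros [a b] [a' b'] E0. pose proof (f_equal fst E0) as E1. pose proof (f_equal snd E0) as E2. cbn [fst snd] in E1, E2. f_equal; lia. }
unfold dom. rewrite rsum_scal, rsum_plus.
pose proof (rsum_prod_le (gauss1 k) (gauss0 k) _ _ (gauss1_ge0 k) (gauss0_ge0 k) B1 B0 F' NF') as R1.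
pose proof (rsum_prod_le (gauss0 k) (gauss1 k) _ _ (gauss0_ge0 k) (gauss1_ge0 k) B0 B1 F' NF') as R2.
apply Rle_trans with (3 * exp 2 * (2 * (2 * (1 + ln (INR q1))) * (2 * (2 * q0)) + 2 * (2 * q0) * (2 * (2 * (1 + ln (INR q1)))))).
- apply Rmult_le_compat_l; lra.
- apply Req_le. ring.
Qed.

End OffAxis.

Lemma sum_inv_sqrt N : rsum (fun j => / sqrt (INR (S j))) (seq 0 N) <= 2 * sqrt (INR N).
Proof.
induction N as [|N IH].
- unfold rsum; simpl. rewrite sqrt_0. lra.
- rewrite rsum_seq_S. rewrite S_INR in *. pose proof (pos_INR N) as HN.
  assert (Hs : 0 < sqrt (INR N + 1)) by (apply sqrt_lt_R0; lra). pose proof (sqrt_pos (INR N)) as Hs0.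
  assert (H1 : sqrt (INR N + 1) * sqrt (INR N + 1) = INR N + 1) by (apply sqrt_sqrt; lra).
  assert (H2 : sqrt (INR N) * sqrt (INR N) = INR N) by (apply sqrt_sqrt; lra).
  set (s := sqrt (INR N + 1)) in *. set (r := sqrt (INR N)) in *.
  assert (/ s <= 2 * (s - r)); [|lra].
  apply Rmult_le_reg_l with s; [easy|]. rewrite Rinv_r by lra. pose proof (pow2_ge_0 (s - r)). nra.
Qed.

(** In [axis_value] the cutoff length is $\sqrt{(2j+1)/c_7}\ge\sqrt{(j+1)/c_7}$, and the resulting
    errors add up by [sum_inv_sqrt]. *)
Lemma axis_total (Rv : nat -> C) N : (forall j, sums_to (axis_term (2 * j)) (Rv j)) ->
  Cmod (list_sum (fun j => Rv j + (-1) * RtoC (2 * PI / sqrt 7))%C (seq 0 N)) <= 64 * sqrt c7 * sqrt (INR N).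
Proof.
intros H. pose proof c7_pos as Hc.
eapply Rle_trans; [apply (Cmod_list_sum_le _ (fun j => 32 * sqrt c7 * / sqrt (INR (S j))))|].
- intros j _. replace (Rv j + -1 * RtoC (2 * PI / sqrt 7))%C with (Rv j - RtoC (2 * PI / sqrt 7))%C by ring.
  eapply Rle_trans; [apply axis_value, H|].
  assert (Hj : 0 < INR (S j)) by (apply lt_0_INR; lia).
  assert (Hjm : INR (S j) <= INR (S (2 * j))) by (apply le_INR; lia).
  rewrite sqrt_div_alt by easy.
  pose proof (sqrt_lt_R0 _ Hc). pose proof (sqrt_lt_R0 _ Hj). pose proof (sqrt_le_1_alt _ _ Hjm).
  replace (32 / (sqrt (INR (S (2 * j))) / sqrt c7)) with (32 * sqrt c7 * / sqrt (INR (S (2 * j)))) by (field; lra).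
  apply Rmult_le_compat_l; [lra|]. now apply Rinv_le_contravar.
- rewrite rsum_scal. pose proof (sum_inv_sqrt N). pose proof (sqrt_pos c7). pose proof (sqrt_pos (INR N)). nra.
Qed.

Lemma sum_n_m_list_sum (f : nat -> C) N : sum_n_m f 1 N = list_sum (fun j => f (S j)) (seq 0 N).
Proof.
induction N as [|N IH].
- rewrite sum_n_m_zero by lia. reflexivity.
- rewrite sum_n_Sm by lia. rewrite IH, seq_S, list_sum_app. unfold list_sum at 3. simpl.
  unfold plus; simpl. f_equal. symmetry. apply Cplus_0_r.
Qed.

Theorem theorem2p1 :
  forall L : nat -> C -> C,
    (forall n : nat, (1 <= n)%nat -> is_hecke_L n (L n)) ->
    exists (K : R) (N0 : nat),
      forall N : nat, (1 <= N)%nat -> (N0 <= N)%nat ->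
        (Cmod (RtoC (1 / INR N)
                 * sum_n_m (fun n : nat => L n (RtoC (1 / 2))) 1 N
               - RtoC (2 * PI / sqrt 7))%C
         <= K * (ln (INR N) / sqrt (INR N)))%R.
Proof.
intros L HL. pose proof c7_pos as Hc.
assert (H8 : 0 < 8 / c7) by (apply Rdiv_lt_0_compat; lra).
destruct (nfloor_ex (8 / c7)) as [M [_ HM]]; [lra|]. rewrite <- S_INR in HM.
set (A := 96 * exp 2 * sqrt (8 / c7)). set (B := 64 * sqrt c7). set (M0 := S M) in *.
assert (HlM : 0 <= ln (INR M0)) by (rewrite <- ln_1; apply ln_le; [lra|apply (le_INR 1); unfold M0; lia]).
assert (HA : 0 <= A).
{ unfold A. pose proof (exp_pos 2). pose proof (sqrt_pos (8 / c7)). apply Rmult_le_pos; lra. }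
assert (HB : 0 <= B) by (unfold B; pose proof (sqrt_pos c7); lra).
(* From $N=3$ on $\ln N\ge1$. Hence $1+\ln(M_0N)\le(2+\ln M_0)\ln N$, and the axis error, which has
   no logarithm, fits under the same bound. *)
exists (A * (2 + ln (INR M0)) + B), 3%nat. intros N HN1 HN3.
destruct (choice_fun _ (fun j => axis_term_ex (2 * j))) as [Rv HRv].
destruct N as [|N]; [lia|]. set (NN := S N) in *.
assert (HNN : 3 <= INR NN) by (replace 3 with (INR 3) by (simpl; lra); now apply le_INR).
pose proof (sums_to_list_sum (fun j p => central_term j p + (-1) * axis_ext j p)%C
  (fun j => L (S j) (RtoC (1 / 2)) + (-1) * Rv j)%C (seq 0 NN)) as HD.
assert (HDj : forall j, sums_to (fun p => central_term j p + (-1) * axis_ext j p)%C (L (S j) (RtoC (1 / 2)) + (-1) * Rv j)%C).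
{ intros j. apply sums_to_plus; [apply hecke_L_central, HL; lia|]. apply sums_to_scal, axis_ext_sum, HRv. }
specialize (HD HDj).
pose proof (off_axis_bound N M0 _ ltac:(unfold M0 in *; lra) ltac:(unfold M0; lia) HD) as HO.
pose proof (axis_total Rv NN HRv) as HX. fold NN in HO.
rewrite sum_n_m_list_sum.
assert (Hs : 0 < sqrt (INR NN)) by (apply sqrt_lt_R0; lra).
assert (Hss : sqrt (INR NN) * sqrt (INR NN) = INR NN) by (apply sqrt_sqrt; lra).
set (D := list_sum (fun j => L (S j) (RtoC (1 / 2)) + (-1) * Rv j)%C (seq 0 NN)) in *.
set (X := list_sum (fun j => Rv j + (-1) * RtoC (2 * PI / sqrt 7))%C (seq 0 NN)) in *.
set (S0 := list_sum (fun j => L (S j) (RtoC (1 / 2))) (seq 0 NN)).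
assert (Hcount : forall z : C, list_sum (fun _ : nat => z) (seq 0 NN) = (RtoC (INR NN) * z)%C).
{ intros z. generalize NN. intros k. induction k as [|k IH]; [simpl; unfold list_sum; simpl; ring|].
  rewrite seq_S, list_sum_app, IH, S_INR, RtoC_plus. unfold list_sum; simpl. ring. }
(* [D] collects the points off the axis, [X] the deviation of the axis values from $2\pi/\sqrt7$;
   the last summand is the main term. *)
assert (ES : S0 = (D + X + RtoC (INR NN) * RtoC (2 * PI / sqrt 7))%C).
{ rewrite <- Hcount. unfold S0, D, X. rewrite <- !list_sum_plus. apply list_sum_ext. intros j _. ring. }
assert (HNC : RtoC (INR NN) <> RtoC 0) by (apply RtoC_neq; lra).
replace (RtoC (1 / INR NN) * S0 - RtoC (2 * PI / sqrt 7))%C with (RtoC (1 / INR NN) * (D + X))%C.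
2:{ rewrite ES, RtoC_div by lra. field. auto. }
rewrite Cmod_mult, Cmod_R, Rabs_pos_eq by (apply Rdiv_le_0_compat; lra).
assert (Hln : 1 <= ln (INR NN)).
{ rewrite <- (ln_exp 1). apply ln_le; [apply exp_pos|]. pose proof exp_le_3. lra. }
assert (HlnM : ln (INR (M0 * NN)) = ln (INR M0) + ln (INR NN)).
{ rewrite mult_INR. apply ln_mult; [apply lt_0_INR; unfold M0; lia|lra]. }
rewrite HlnM in HO. set (l := ln (INR NN)) in *. set (lM := ln (INR M0)) in *. set (s := sqrt (INR NN)) in *.
assert (HO' : Cmod D <= A * (2 + lM) * (s * l)).
{ eapply Rle_trans; [apply HO|].
  replace (96 * exp 2 * (sqrt (8 / c7) * s) * (1 + (lM + l))) with (A * s * (1 + (lM + l))) by (unfold A; ring).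
  replace (A * (2 + lM) * (s * l)) with (A * s * ((2 + lM) * l)) by ring.
  apply Rmult_le_compat_l; [apply Rmult_le_pos; lra|]. nra. }
assert (HX' : Cmod X <= B * (s * l)).
{ eapply Rle_trans; [apply HX|]. fold B. apply Rmult_le_compat_l; [easy|]. nra. }
apply Rle_trans with (1 / INR NN * ((A * (2 + lM) + B) * (s * l))).
- apply Rmult_le_compat_l; [apply Rdiv_le_0_compat; lra|].
  eapply Rle_trans; [apply Cmod_triangle|]. lra.
- apply Req_le. rewrite <- Hss. field. lra.
Qed.
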